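(* Let $\nu$ be a complex number with $\operatorname{Re}(\nu)>-1$ and let $0<\theta<\pi/2$. Put $\beta=\sin(\theta)\exp(i\theta)$ and $$\psi_\nu(\theta)=P_\nu(\cos\theta)-\frac{2}{\pi}\,i\,Q_\nu(\cos\theta),$$ where $P_\nu$ and $Q_\nu$ are the Legendre functions of the first and second kinds of degree $\nu$. Then $$\psi_\nu(\theta)=-\frac{2}{\pi}\,i\,\exp\bigl(i(\nu+1)\theta\bigr)\int_0^\infty\frac{1}{\sqrt{x^2-2ix}\,\left(1+\beta x\right)^{\nu+1}}\,dx.$$
   Context: Principal branches of the square root and of complex powers are used throughout. Gauss' hypergeometric function is ${}_2F_1(a,b;c;z)=\sum_{n=0}^\infty\frac{(a)_n(b)_n}{(c)_n}\frac{z^n}{n!}$ for $|z|<1$, where $c\neq 0,-1,-2,\ldots$ and $(z)_n=z(z+1)\cdots(z+n-1)$. The Legendre function of the first kind of degree $\nu$ is $P_\nu(z)={}_2F_1\left(-\nu,\nu+1;1;\frac{1-z}{2}\right)$ near $z=1$, analytically continued to $\mathbb{C}\setminus(-\infty,-1]$. The Legendre function of the second kind of degree $\nu$ is $$Q_\nu(z)=(2z)^{-\nu-1}\sqrt{\pi}\,\frac{\Gamma(\nu+1)}{\Gamma(\nu+3/2)}\;{}_2F_1\left(\frac{\nu}{2}+1,\frac{\nu}{2}+\frac12;\nu+\frac32;\frac{1}{z^2}\right)$$ for $|z|>1$, analytically continued to $\mathbb{C}\setminus(-\infty,1]$. For $x\in(-1,1)$, $Q_\nu(x)$ is defined by $$Q_\nu(x)=\lim_{y\to0^+}\frac{Q_\nu(x+iy)+Q_\nu(x-iy)}{2}.$$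 *)

(* Defs.v *)
From Stdlib Require Export Reals Factorial.
From Coquelicot Require Export Coquelicot.

Local Open Scope R_scope.
Local Open Scope C_scope.

(** * Exponential and principal branches *)

Definition Cexp (z : C) : C := RtoC (exp (Re z)) * (cos (Im z), sin (Im z)).

(* Principal argument, with values in (-PI, PI]; only meaningful for z <> 0. *)
Definition Carg (z : C) : R :=
  if Rle_dec 0 (Im z) then acos (Re z / Cmod z) else (- acos (Re z / Cmod z))%R.

Definition Clog (z : C) : C := (ln (Cmod z), Carg z).

(* Principal power z ^ a, only meaningful for z <> 0. *)
Definition Cpower (z a : C) : C := Cexp (a * Clog z).

Definition Csqrt (z : C) : C :=
  RtoC (sqrt (Cmod z)) * Cexp (Ci * RtoC (Carg z / 2)).

(** * Total limit, series and integral operators on C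

    As for the library's [RInt], each is the limiting value when it exists and
    an unspecified number otherwise. *)

Definition Clim {T : Type} (f : T -> C) (F : (T -> Prop) -> Prop) : C :=
  iota (T := C_R_CompleteNormedModule)
    (fun l : C => filterlim f F (locally (T := C_UniformSpace) l)).

Definition CSeries (a : nat -> C) : C :=
  Clim (sum_n (G := C_AbelianMonoid) a) eventually.

(* Improper Riemann integral over (0, +oo) of a complex-valued function; both
   endpoints are treated as limits. *)
Definition ex_CInt_0_infty (f : R -> C) : Prop :=
  ex_RInt_gen (V := C_R_NormedModule) f (at_right 0) (Rbar_locally p_infty).

Definition CInt_0_infty (f : R -> C) : C :=
  RInt_gen (V := C_R_CompleteNormedModule) f
    (at_right 0) (Rbar_locally p_infty).

(** * Gamma and Gauss' hypergeometric function *)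

(* Euler's integral, which represents Gamma on the half-plane 0 < Re z. *)
Definition CGamma (z : C) : C :=
  CInt_0_infty (fun t : R => Cpower (RtoC t) (z - 1) * Cexp (- RtoC t)).

Fixpoint pochhammer (z : C) (n : nat) : C :=
  match n with
  | O => 1
  | S m => pochhammer z m * (z + RtoC (INR m))
  end.

(* For Cmod z < 1 and c not in {0, -1, -2, ...}. *)
Definition hyp2F1 (a b c z : C) : C :=
  CSeries (fun n : nat =>
    (pochhammer a n * pochhammer b n) / pochhammer c n
      * (Cpow z n / RtoC (INR (fact n)))).

(** * Legendre functions *)

Definition analytic_at (f : C -> C) (z0 : C) : Prop :=
  exists a : nat -> C,
    locally (T := C_UniformSpace) z0 (fun z : C =>
      is_pseries (K := C_AbsRing) (V := C_NormedModule) a (z - z0) (f z)).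

Definition analytic_on (D : C -> Prop) (f : C -> C) : Prop :=
  forall z : C, D z -> analytic_at f z.

(* The complement of the half-line (-oo, r] of the real axis. *)
Definition cut_plane (r : R) (z : C) : Prop := ~ (Im z = 0%R /\ (Re z <= r)%R).

(* [P] is the Legendre function of the first kind of degree [nu].  The cut
   plane is connected, so this determines [P] on it; the values of [P] on the
   cut are left arbitrary. *)
Definition is_LegendreP (nu : C) (P : C -> C) : Prop :=
  analytic_on (cut_plane (-1)) P /\
  locally (T := C_UniformSpace) (RtoC 1)
    (fun z : C => P z = hyp2F1 (- nu) (nu + 1) 1 ((1 - z) / 2)).

(* [Q] is the Legendre function of the second kind of degree [nu], off the cut
   (-oo, 1].  The use of Euler's integral in [CGamma] requires -1 < Re nu. *)
Definition is_LegendreQ (nu : C) (Q : C -> C) : Prop :=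
  analytic_on (cut_plane 1) Q /\
  forall z : C, cut_plane 1 z -> (1 < Cmod z)%R ->
    Q z = Cpower (2 * z) (- nu - 1) * RtoC (sqrt PI)
          * (CGamma (nu + 1) / CGamma (nu + 3 / 2))
          * hyp2F1 (nu / 2 + 1) (nu / 2 + 1 / 2) (nu + 3 / 2) (1 / (z * z)).

(* The value at x in (-1, 1) of the Legendre function of the second kind, [Q]
   being the function off the cut. *)
Definition LegendreQ_cut (Q : C -> C) (x : R) : C :=
  Clim (fun y : R =>
          (Q (RtoC x + Ci * RtoC y) + Q (RtoC x - Ci * RtoC y)) / 2)
    (at_right 0).

Definition legendre_psi (P Q : C -> C) (theta : R) : C :=
  P (RtoC (cos theta)) - RtoC (2 / PI) * Ci * LegendreQ_cut Q (cos theta).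

Definition legendre_beta (theta : R) : C :=
  RtoC (sin theta) * Cexp (Ci * RtoC theta).

Definition psi_integrand (nu : C) (theta : R) (x : R) : C :=
  1 / (Csqrt (RtoC x * RtoC x - 2 * Ci * RtoC x)
       * Cpower (1 + legendre_beta theta * RtoC x) (nu + 1)).

(* Main.v *)
From Stdlib Require Import Ranalysis5 Lra Lia Classical FunctionalExtensionality.
Require Import Defs.

(** Write mu = - nu - 1 and z = cosh w. The Laplace-Heine integral

      Qc mu w = int_0^oo (cosh w + sinh w cosh t) ^ mu dt

    represents Q_nu (cosh w) for Re w > 0 and |Im w| < pi/2, and it still converges on the segment Re w = 0,
    0 < |Im w| < pi/2, that is, on both sides of the part 0 < z < 1 of the cut. Every term of
    the theorem can be expressed by it.

    - Second kind. Legendre's operator applied to the kernel is a derivative with respect to t, so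
      Qc solves Legendre's equation ([Qc_equation]). For z = cosh s real and T = tanh s, the
      variable of the hypergeometric series is 1 / z ^ 2 = 1 - T ^ 2. Up to a power of z, both Qc and
      the series are regular at T = 1, hence proportional by a Wronskian argument ([M_proportional]),
      and the factor is a quotient of Gamma functions ([gamma_quotient]). This gives Q = Qc for large real z
      ([Q_on_real_axis]). The identity theorem then extends Legendre's equation to Q off the cut, and
      uniqueness for a linear differential equation along segments extends the equality
      ([Q_off_cut]). In elliptic coordinates Qc is continuous up to the cut, so that Q_nu (cos theta)
      is the mean of Qc at i theta and - i theta ([LegendreQ_cut_value]).

    - First kind. The kernels of Qc (- i theta) and Qc (i theta) are the values of one holomorphic
      function on the lines Im t = 0 and Im t = pi. By Cauchy's theorem on the half-strip between them,
      the difference Qc (- i theta) - Qc (i theta) is i times an integral over the edge from 0 to i pi,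
      namely Laplace's integral ([connection]). That integral therefore solves Legendre's equation, it
      is regular at theta = 0 with value pi, and so it equals pi P_nu (cos theta) ([P_Laplace]).

    Together, P_nu - (2 i / pi) Q_nu at cos theta collapses to - (2 i / pi) Qc (- i theta): only one
    boundary value survives.

    - Rotation. With cosh t = 1 + u this boundary value becomes the integral over u > 0 of
      (exp (- i theta) - i sin theta u) ^ mu / sqrt (u (u + 2)). Turning the path to u = i x
      ([rotation]) makes the base exp (- i theta) (1 + beta x), which is the integral of the theorem up to
      the constant exp (- i (nu + 1) theta) ([psi_integral]). *)

Local Open Scope R_scope.
Local Open Scope C_scope.

(** * Calculus of complex-valued functions of a real variable *)

Definition cder (f : R -> C) (s : R) (l : C) : Prop :=
  is_derive (fun x => Re (f x)) s (Re l) /\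
  is_derive (fun x => Im (f x)) s (Im l).

Definition ccont (f : R -> C) (s : R) : Prop :=
  continuity_pt (fun x => Re (f x)) s /\ continuity_pt (fun x => Im (f x)) s.

Definition ccont2 (f : R -> R -> C) (s t : R) : Prop :=
  continuity_2d_pt (fun x y => Re (f x y)) s t /\
  continuity_2d_pt (fun x y => Im (f x y)) s t.

(** The complex derivative is tested along differentiable curves. This follows from the usual
    notion ([Cdiff_hol]), and makes the chain rule, and hence every computation of a derivative,
    a statement about functions of a real variable. *)
Definition hol (F : C -> C) (z l : C) : Prop :=
  forall (g : R -> C) (s : R) (g' : C),
    g s = z -> cder g s g' -> cder (fun x => F (g x)) s (l * g').

Lemma C_ext (a b : C) : Re a = Re b -> Im a = Im b -> a = b.
Proof. destruct a, b; simpl; intros; subst; reflexivity. Qed.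

Lemma is_derive_eq (f : R -> R) (x l l' : R) :
  is_derive f x l -> l = l' -> is_derive f x l'.
Proof. intros H e; now rewrite <- e. Qed.

Lemma is_derive_Rplus (f g : R -> R) (x a b : R) :
  is_derive f x a -> is_derive g x b -> is_derive (fun y => f y + g y)%R x (a + b)%R.
Proof. apply @is_derive_plus. Qed.

Lemma is_derive_Rminus (f g : R -> R) (x a b : R) :
  is_derive f x a -> is_derive g x b -> is_derive (fun y => f y - g y)%R x (a - b)%R.
Proof. apply @is_derive_minus. Qed.

Lemma is_derive_Rmult (f g : R -> R) (x a b : R) :
  is_derive f x a -> is_derive g x b -> is_derive (fun y => f y * g y)%R x (a * g x + f x * b)%R.
Proof. intros; apply (is_derive_mult f g x a b); trivial; intros; apply Rmult_comm. Qed.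

Lemma is_derive_Rcomp (f g : R -> R) (x a b : R) :
  is_derive f (g x) a -> is_derive g x b -> is_derive (fun y => f (g y)) x (b * a)%R.
Proof. apply (is_derive_comp f g). Qed.

Lemma cder_eq f s l l' : cder f s l -> l = l' -> cder f s l'.
Proof. intros H e; now rewrite <- e. Qed.

Lemma cder_ext_loc (f g : R -> C) s l :
  locally s (fun x => f x = g x) -> cder f s l -> cder g s l.
Proof.
  intros E [H1 H2]; split; [eapply is_derive_ext_loc; [|exact H1]|
    eapply is_derive_ext_loc; [|exact H2]]; simpl; revert E; apply filter_imp; intros x ->; reflexivity.
Qed.

Lemma cder_ext (f g : R -> C) s l :
  (forall x, f x = g x) -> cder f s l -> cder g s l.
Proof. intros E; apply cder_ext_loc; now apply filter_forall. Qed.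

Lemma cder_unique f s l l' : cder f s l -> cder f s l' -> l = l'.
Proof.
  intros [H1 H2] [H3 H4]; apply C_ext.
  - rewrite <- (is_derive_unique _ _ _ H1); now apply is_derive_unique.
  - rewrite <- (is_derive_unique _ _ _ H2); now apply is_derive_unique.
Qed.

Lemma cder_ccont f s l : cder f s l -> ccont f s.
Proof.
  intros [H1 H2]; split; apply continuity_pt_filterlim; apply @ex_derive_continuous;
    eexists; eassumption.
Qed.

Lemma cder_const c s : cder (fun _ => c) s 0.
Proof. split; apply @is_derive_const. Qed.

Lemma cder_plus f g s a b :
  cder f s a -> cder g s b -> cder (fun x => f x + g x) s (a + b).
Proof. intros [H1 H2] [H3 H4]; split; simpl; now apply @is_derive_plus. Qed.

Lemma cder_opp f s a : cder f s a -> cder (fun x => - f x) s (- a).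
Proof. intros [H1 H2]; split; simpl; now apply @is_derive_opp. Qed.

Lemma cder_minus f g s a b :
  cder f s a -> cder g s b -> cder (fun x => f x - g x) s (a - b).
Proof. intros; apply cder_plus; trivial; now apply cder_opp. Qed.

Lemma cder_mult f g s a b :
  cder f s a -> cder g s b -> cder (fun x => f x * g x) s (a * g s + f s * b).
Proof.
  intros [H1 H2] [H3 H4]; split; simpl.
  - apply is_derive_eq with
      ((Re a * Re (g s) + Re (f s) * Re b) - (Im a * Im (g s) + Im (f s) * Im b))%R.
    + now apply is_derive_Rminus; apply is_derive_Rmult.
    + unfold Re, Im; simpl; ring.
  - apply is_derive_eq with
      ((Re a * Im (g s) + Re (f s) * Im b) + (Im a * Re (g s) + Im (f s) * Re b))%R.
    + now apply is_derive_Rplus; apply is_derive_Rmult.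
    + unfold Re, Im; simpl; ring.
Qed.

Lemma cder_RtoC (f : R -> R) s a : is_derive f s a -> cder (fun x => RtoC (f x)) s (RtoC a).
Proof. intros H; split; simpl; trivial; apply @is_derive_const. Qed.

Lemma cder_id s : cder (fun x => RtoC x) s 1.
Proof. apply cder_RtoC; apply @is_derive_id. Qed.

Lemma cder_scal (c : C) f s a : cder f s a -> cder (fun x => c * f x) s (c * a).
Proof.
  intros H; eapply cder_eq; [apply cder_mult; [apply cder_const|exact H]|]; cbv beta; ring.
Qed.

Lemma cder_comp (f : R -> C) (g : R -> R) s a b :
  cder f (g s) a -> is_derive g s b -> cder (fun x => f (g x)) s (RtoC b * a).
Proof.
  intros [H1 H2] H3; split.
  - eapply is_derive_eq; [eapply (is_derive_Rcomp (fun x => Re (f x)) g); eauto|].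
    destruct a; simpl; ring.
  - eapply is_derive_eq; [eapply (is_derive_Rcomp (fun x => Im (f x)) g); eauto|].
    destruct a; simpl; ring.
Qed.

Lemma cder_line (p d : C) s : cder (fun x => p + RtoC x * d) s d.
Proof.
  eapply cder_eq; [apply cder_plus; [apply cder_const|apply cder_mult;
    [apply cder_id|apply cder_const]]|]; cbv beta; ring.
Qed.

Lemma hol_eq F z l l' : hol F z l -> l = l' -> hol F z l'.
Proof. intros H e; now rewrite <- e. Qed.

Lemma hol_unique F z l l' : hol F z l -> hol F z l' -> l = l'.
Proof.
  intros H H'.
  assert (e : z + RtoC 0 * 1 = z) by ring.
  pose proof (H _ 0 _ e (cder_line z 1 0)) as A.
  pose proof (H' _ 0 _ e (cder_line z 1 0)) as B.
  pose proof (cder_unique _ _ _ _ A B) as U.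
  replace l with (l * 1) by ring; rewrite U; ring.
Qed.

Lemma hol_const c z : hol (fun _ => c) z 0.
Proof. intros g s g' e H; eapply cder_eq; [apply cder_const|ring]. Qed.

Lemma hol_id z : hol (fun x => x) z 1.
Proof. intros g s g' e H; eapply cder_eq; [exact H|ring]. Qed.

Lemma hol_plus F G z a b : hol F z a -> hol G z b -> hol (fun x => F x + G x) z (a + b).
Proof.
  intros HF HG g s g' e H; eapply cder_eq; [apply cder_plus; [apply HF|apply HG]; eauto|ring].
Qed.

Lemma hol_opp F z a : hol F z a -> hol (fun x => - F x) z (- a).
Proof. intros HF g s g' e H; eapply cder_eq; [apply cder_opp; apply HF; eauto|ring]. Qed.

Lemma hol_minus F G z a b : hol F z a -> hol G z b -> hol (fun x => F x - G x) z (a - b).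
Proof. intros; apply hol_plus; trivial; now apply hol_opp. Qed.

Lemma hol_mult F G z a b :
  hol F z a -> hol G z b -> hol (fun x => F x * G x) z (a * G z + F z * b).
Proof.
  intros HF HG g s g' e H; eapply cder_eq; [apply cder_mult; [apply HF|apply HG]; eauto|].
  cbv beta; rewrite e; ring.
Qed.

Lemma hol_scal c F z a : hol F z a -> hol (fun x => c * F x) z (c * a).
Proof.
  intros HF; eapply hol_eq; [apply hol_mult; [apply hol_const|exact HF]|]; cbv beta; ring.
Qed.

Lemma hol_comp F G z a b : hol F (G z) a -> hol G z b -> hol (fun x => F (G x)) z (a * b).
Proof.
  intros HF HG g s g' e H.
  eapply cder_eq; [apply (HF (fun x => G (g x)) s (b * g')); [now rewrite e|now apply HG]|ring].
Qed.

Lemma hol_ext F G z a : (forall x, F x = G x) -> hol F z a -> hol G z a.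
Proof.
  intros E HF g s g' e H; eapply cder_ext; [|apply HF; eauto]; intros; simpl; apply E.
Qed.

Lemma ccont2_const c s t : ccont2 (fun _ _ => c) s t.
Proof. split; apply continuity_2d_pt_const. Qed.

Lemma ccont2_plus f g s t : ccont2 f s t -> ccont2 g s t -> ccont2 (fun x y => f x y + g x y) s t.
Proof. intros [] []; split; simpl; now apply continuity_2d_pt_plus. Qed.

Lemma ccont2_opp f s t : ccont2 f s t -> ccont2 (fun x y => - f x y) s t.
Proof. intros []; split; simpl; now apply continuity_2d_pt_opp. Qed.

Lemma ccont2_minus f g s t : ccont2 f s t -> ccont2 g s t -> ccont2 (fun x y => f x y - g x y) s t.
Proof. intros; apply ccont2_plus; trivial; now apply ccont2_opp. Qed.

Lemma ccont2_mult f g s t : ccont2 f s t -> ccont2 g s t -> ccont2 (fun x y => f x y * g x y) s t.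
Proof.
  intros [] []; split; simpl; unfold Re, Im in *; [apply continuity_2d_pt_minus|apply continuity_2d_pt_plus];
    now apply continuity_2d_pt_mult.
Qed.

Lemma ccont2_ext f g s t : (forall x y, f x y = g x y) -> ccont2 f s t -> ccont2 g s t.
Proof.
  intros E [H1 H2]; split; eapply continuity_2d_pt_ext.
  2: exact H1. 3: exact H2. all: intros; simpl; now rewrite E.
Qed.

Lemma ccont2_1 f s t : ccont f s -> ccont2 (fun x _ => f x) s t.
Proof.
  intros [H1 H2]; split.
  - apply (continuity_1d_2d_pt_comp (fun x => Re (f x)) (fun x _ => x)); trivial.
    apply continuity_2d_pt_id1.
  - apply (continuity_1d_2d_pt_comp (fun x => Im (f x)) (fun x _ => x)); trivial.
    apply continuity_2d_pt_id1.
Qed.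

Lemma ccont2_2 f s t : ccont f t -> ccont2 (fun _ y => f y) s t.
Proof.
  intros [H1 H2]; split.
  - apply (continuity_1d_2d_pt_comp (fun x => Re (f x)) (fun _ x => x)); trivial.
    apply continuity_2d_pt_id2.
  - apply (continuity_1d_2d_pt_comp (fun x => Im (f x)) (fun _ x => x)); trivial.
    apply continuity_2d_pt_id2.
Qed.

Lemma continuity_2d_slice f s t : continuity_2d_pt f s t -> continuity_pt (f s) t.
Proof.
  intros H; apply continuity_pt_locally; intros eps; destruct (H eps) as [d Hd].
  exists d; intros y Hy; apply Hd; trivial.
  rewrite Rminus_eq_0, Rabs_R0; apply cond_pos.
Qed.

Lemma ccont2_slice f s t : ccont2 f s t -> ccont (f s) t.
Proof.
  intros [H1 H2]; split.
  - apply (continuity_2d_slice _ _ _ H1).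
  - apply (continuity_2d_slice _ _ _ H2).
Qed.

Lemma continuity_2d_slice1 f s t : continuity_2d_pt f s t -> continuity_pt (fun x => f x t) s.
Proof.
  intros H; apply continuity_pt_locally; intros eps; destruct (H eps) as [d Hd].
  exists d; intros y Hy; apply Hd; trivial.
  rewrite Rminus_eq_0, Rabs_R0; apply cond_pos.
Qed.

Lemma ccont2_slice1 f s t : ccont2 f s t -> ccont (fun x => f x t) s.
Proof.
  intros [H1 H2]; split.
  - apply (continuity_2d_slice1 _ _ _ H1).
  - apply (continuity_2d_slice1 _ _ _ H2).
Qed.

Lemma ccont_RtoC (f : R -> R) s : continuity_pt f s -> ccont (fun x => RtoC (f x)) s.
Proof. intros H; split; simpl; trivial; apply continuity_pt_const; now intros x y. Qed.

Lemma ccont_of_c2 f s : ccont2 (fun x _ => f x) s 0 -> ccont f s.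
Proof. apply (ccont2_slice1 (fun x _ => f x)). Qed.

(** * The exponential and powers on the right half-plane *)

Lemma Cexp_add (a b : C) : Cexp (a + b) = Cexp a * Cexp b.
Proof.
  unfold Cexp; destruct a as [x y], b as [u v]; unfold Re, Im; simpl.
  rewrite exp_plus, cos_plus, sin_plus; apply C_ext; simpl; ring.
Qed.

Lemma Cexp_0 : Cexp 0 = 1.
Proof. unfold Cexp; simpl; rewrite exp_0, cos_0, sin_0; apply C_ext; simpl; ring. Qed.

Lemma Cexp_opp_r (a : C) : Cexp a * Cexp (- a) = 1.
Proof. rewrite <- Cexp_add; replace (a + - a) with (RtoC 0) by ring; apply Cexp_0. Qed.

Lemma Cmod_Cexp (a : C) : Cmod (Cexp a) = exp (Re a).
Proof.
  unfold Cexp; rewrite Cmod_mult, Cmod_R, Rabs_pos_eq by (left; apply exp_pos).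
  unfold Cmod; simpl.
  replace (_ + _)%R with 1%R; [rewrite sqrt_1; ring|].
  pose proof (sin2_cos2 (Im a)); unfold Rsqr in *; lra.
Qed.

Lemma Cexp_neq_0 (a : C) : Cexp a <> 0.
Proof. apply Cmod_gt_0; rewrite Cmod_Cexp; apply exp_pos. Qed.

Lemma Cexp_RtoC (x : R) : Cexp (RtoC x) = RtoC (exp x).
Proof. unfold Cexp; simpl; rewrite cos_0, sin_0; apply C_ext; simpl; ring. Qed.

Lemma Cexp_i (x : R) : Cexp (Ci * RtoC x) = (cos x, sin x).
Proof.
  unfold Cexp; simpl.
  replace (0 * x - 1 * 0)%R with 0%R by ring; replace (0 * 0 + 1 * x)%R with x by ring.
  rewrite exp_0; apply C_ext; simpl; ring.
Qed.

Lemma hol_Cexp z : hol Cexp z (Cexp z).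
Proof.
  intros g s g' e [H1 H2]; unfold Cexp; split; simpl.
  - eapply is_derive_ext with (f := fun x => (exp (Re (g x)) * cos (Im (g x)))%R).
    { intros; simpl; ring. }
    evar_last.
    + apply is_derive_Rmult.
      * apply (is_derive_Rcomp exp (fun x => Re (g x))); [apply is_derive_exp|exact H1].
      * apply (is_derive_Rcomp cos (fun x => Im (g x))); [apply is_derive_cos|exact H2].
    + cbv beta; rewrite e; destruct z, g'; simpl; ring.
  - eapply is_derive_ext with (f := fun x => (exp (Re (g x)) * sin (Im (g x)))%R).
    { intros; simpl; ring. }
    evar_last.
    + apply is_derive_Rmult.
      * apply (is_derive_Rcomp exp (fun x => Re (g x))); [apply is_derive_exp|exact H1].
      * apply (is_derive_Rcomp sin (fun x => Im (g x))); [apply is_derive_sin|exact H2].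
    + cbv beta; rewrite e; destruct z, g'; simpl; ring.
Qed.

Lemma ccont2_Cexp f s t : ccont2 f s t -> ccont2 (fun x y => Cexp (f x y)) s t.
Proof.
  intros [H1 H2]; unfold Cexp; split; simpl.
  - eapply continuity_2d_pt_ext with (f := fun x y => (exp (Re (f x y)) * cos (Im (f x y)))%R).
    { intros; simpl; ring. }
    apply continuity_2d_pt_mult.
    + apply (continuity_1d_2d_pt_comp exp); trivial; apply derivable_continuous, derivable_exp.
    + apply (continuity_1d_2d_pt_comp cos); trivial; apply continuity_cos.
  - eapply continuity_2d_pt_ext with (f := fun x y => (exp (Re (f x y)) * sin (Im (f x y)))%R).
    { intros; simpl; ring. }
    apply continuity_2d_pt_mult.
    + apply (continuity_1d_2d_pt_comp exp); trivial; apply derivable_continuous, derivable_exp.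
    + apply (continuity_1d_2d_pt_comp sin); trivial; apply continuity_sin.
Qed.

(** The principal logarithm on the right half-plane; the argument is given by [atan], which is
    differentiable without the case distinction of [Carg]. *)
Definition Clr (z : C) : C := (ln (Cmod z), atan (Im z / Re z)).

Lemma Re_pos_neq_0 z : (0 < Re z)%R -> z <> 0.
Proof. intros H e; rewrite e in H; simpl in H; lra. Qed.

Lemma Cmod_sqr z : (Cmod z * Cmod z = Re z * Re z + Im z * Im z)%R.
Proof.
  unfold Cmod, Re, Im; rewrite sqrt_sqrt; [ring|].
  apply Rplus_le_le_0_compat; apply pow2_ge_0.
Qed.

Lemma Re_pos_Cmod z : (0 < Re z)%R -> (0 < Cmod z)%R.
Proof. intros H; apply Cmod_gt_0; now apply Re_pos_neq_0. Qed.

Lemma sqrt_1_tan z : (0 < Re z)%R -> sqrt (1 + (Im z / Re z)^2) = (Cmod z / Re z)%R.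
Proof.
  intros H; pose proof (Re_pos_Cmod _ H); pose proof (Cmod_sqr z) as E.
  apply sqrt_lem_1.
  - pose proof (pow2_ge_0 (Im z / Re z)); lra.
  - left; now apply Rdiv_lt_0_compat.
  - replace (Cmod z / Re z * (Cmod z / Re z))%R with ((Cmod z * Cmod z) / (Re z * Re z))%R by (field; lra).
    rewrite E; field; lra.
Qed.

Lemma Cexp_Clr z : (0 < Re z)%R -> Cexp (Clr z) = z.
Proof.
  intros H; pose proof (Re_pos_Cmod _ H) as Hm; pose proof (sqrt_1_tan _ H) as E.
  unfold Cexp, Clr; simpl; rewrite exp_ln, cos_atan, sin_atan by trivial.
  unfold Rsqr; replace (Im z / Re z * (Im z / Re z))%R with ((Im z / Re z)^2)%R by ring.
  rewrite E; apply C_ext; simpl; field; lra.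
Qed.

Lemma Clr_Im z : (Rabs (Im (Clr z)) < PI / 2)%R.
Proof. simpl; pose proof (atan_bound (Im z / Re z)); apply Rabs_def1; lra. Qed.

Lemma hol_Clr z : (0 < Re z)%R -> hol Clr z (/ z).
Proof.
  intros H g s g' e [H1 H2].
  assert (Hm : (0 < Re z ^ 2 + Im z ^ 2)%R) by (pose proof (pow2_ge_0 (Im z)); nra).
  split; unfold Clr; simpl.
  - apply is_derive_ext_loc with (f := fun x => (/ 2 * ln (Re (g x) * Re (g x) + Im (g x) * Im (g x)))%R).
    { assert (L : locally s (fun x => 0 < Re (g x))%R).
      { pose proof (ex_derive_continuous _ _ (ex_intro _ _ H1)) as K.
        apply (K (fun y => 0 < y)%R); rewrite e; now apply (open_gt 0). }
      revert L; apply filter_imp; intros x Hx; unfold Cmod.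
      change (fst (g x)) with (Re (g x)); change (snd (g x)) with (Im (g x)).
      assert (0 < Re (g x) ^ 2 + Im (g x) ^ 2)%R by (pose proof (pow2_ge_0 (Im (g x))); nra).
      rewrite <- Rpower_sqrt by trivial; unfold Rpower; rewrite ln_exp; f_equal; f_equal; ring. }
    eapply is_derive_eq.
    + apply @is_derive_scal; apply (is_derive_Rcomp ln).
      * apply is_derive_Reals, derivable_pt_lim_ln; rewrite e; nra.
      * apply is_derive_Rplus; apply is_derive_Rmult; eassumption.
    + cbv beta; rewrite e; clear - Hm; destruct z as [u v], g' as [p q]; simpl in *; field; nra.
  - eapply is_derive_eq.
    + apply (is_derive_Rcomp atan); [apply is_derive_atan|].
      apply is_derive_div; [exact H2|exact H1|rewrite e; lra].
    + cbv beta; rewrite e; clear - Hm H; unfold Rsqr; destruct z as [u v], g' as [p q]; simpl in *; field; repeat split; try lra; nra.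
Qed.

Lemma ccont2_Clr f s t : ccont2 f s t -> (0 < Re (f s t))%R -> ccont2 (fun x y => Clr (f x y)) s t.
Proof.
  intros [H1 H2] H; unfold Clr; split; simpl.
  - apply (continuity_1d_2d_pt_comp ln).
    { apply derivable_continuous_pt; exists (/ Cmod (f s t))%R; apply derivable_pt_lim_ln.
      now apply Re_pos_Cmod. }
    unfold Cmod; apply (continuity_1d_2d_pt_comp sqrt).
    { apply continuity_pt_sqrt; apply Rplus_le_le_0_compat; apply pow2_ge_0. }
    apply continuity_2d_pt_plus;
      apply (continuity_1d_2d_pt_comp (fun x => x ^ 2)%R); trivial;
      apply derivable_continuous, derivable_pow.
  - apply (continuity_1d_2d_pt_comp atan).
    { apply derivable_continuous_pt, derivable_pt_atan. }
    apply continuity_2d_pt_mult; trivial; apply continuity_2d_pt_inv; trivial; lra.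
Qed.

(** The principal power; every base that occurs below lies in the right half-plane. *)
Definition pw (a z : C) : C := Cexp (a * Clr z).

Lemma pw_add a b z : pw (a + b) z = pw a z * pw b z.
Proof. unfold pw; rewrite <- Cexp_add; f_equal; ring. Qed.

Lemma pw_1 z : (0 < Re z)%R -> pw 1 z = z.
Proof. intros H; unfold pw; replace (1 * Clr z) with (Clr z) by ring; now apply Cexp_Clr. Qed.

Lemma pw_pred a z : (0 < Re z)%R -> pw (a - 1) z * z = pw a z.
Proof.
  intros H; transitivity (pw (a - 1) z * pw 1 z); [now rewrite pw_1|].
  rewrite <- pw_add; f_equal; ring.
Qed.

Lemma hol_pw a z : (0 < Re z)%R -> hol (pw a) z (a * pw (a - 1) z).
Proof.
  intros H; unfold pw at 1; eapply hol_eq.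
  - apply (hol_comp Cexp (fun z => a * Clr z)); [apply hol_Cexp|].
    apply hol_scal; now apply hol_Clr.
  - change (Cexp (a * Clr z)) with (pw a z); rewrite <- (pw_pred a z H).
    field; now apply Re_pos_neq_0.
Qed.

Lemma ccont2_pw a f s t : ccont2 f s t -> (0 < Re (f s t))%R -> ccont2 (fun x y => pw a (f x y)) s t.
Proof.
  intros H1 H2; apply ccont2_Cexp, ccont2_mult; [apply ccont2_const|now apply ccont2_Clr].
Qed.

Lemma Clr_Cexp (L : C) : (Rabs (Im L) < PI / 2)%R -> Clr (Cexp L) = L.
Proof.
  intros H; apply Rabs_def2 in H.
  assert (Hc : (0 < cos (Im L))%R) by (apply cos_gt_0; lra).
  pose proof (exp_pos (Re L)) as He.
  unfold Clr; rewrite Cmod_Cexp, ln_exp; destruct L as [x y]; unfold Cexp; simpl in *; f_equal.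
  match goal with |- atan ?u = _ => replace u with (tan y) end; [apply atan_tan; lra|].
  unfold tan; field; lra.
Qed.

Lemma pw_Cexp a L : (Rabs (Im L) < PI / 2)%R -> pw a (Cexp L) = Cexp (a * L).
Proof. intros H; unfold pw; now rewrite Clr_Cexp. Qed.

Lemma Clog_Cexp (L : C) : (Rabs (Im L) < PI)%R -> Clog (Cexp L) = L.
Proof.
  intros H; apply Rabs_def2 in H.
  pose proof (exp_pos (Re L)) as He.
  assert (E : forall c, (exp (Re L) * c / exp (Re L) = c)%R) by (intros; field; lra).
  unfold Clog, Carg; rewrite Cmod_Cexp, ln_exp; destruct L as [x y]; unfold Cexp; simpl in *; f_equal.
  replace (exp x * cos y - 0 * sin y)%R with (exp x * cos y)%R by ring.
  replace (exp x * sin y + 0 * cos y)%R with (exp x * sin y)%R by ring.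
  rewrite E.
  destruct (Rle_dec _ _) as [l|n].
  - apply acos_cos; split; [|lra].
    destruct (Rle_or_lt 0 y) as [|Hy]; trivial.
    assert (0 < sin (- y))%R by (apply sin_gt_0; lra); rewrite sin_neg in *; nra.
  - destruct (Rle_or_lt 0 y) as [Hy|Hy].
    + exfalso; apply n; apply Rmult_le_pos; [lra|apply sin_ge_0; lra].
    + rewrite <- cos_neg, acos_cos by lra; ring.
Qed.

Lemma Clog_Clr z : (0 < Re z)%R -> Clog z = Clr z.
Proof.
  intros H; rewrite <- (Cexp_Clr z H) at 1; apply Clog_Cexp.
  pose proof (Clr_Im z); pose proof PI_RGT_0; lra.
Qed.

Lemma Cpower_pw z a : (0 < Re z)%R -> Cpower z a = pw a z.
Proof. intros H; unfold Cpower, pw; now rewrite Clog_Clr. Qed.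

(** The three arguments are below pi/2 in modulus, so those of the factors add up to less than pi
    and no multiple of 2 pi is lost. *)
Lemma pw_mult a z w :
  (0 < Re z)%R -> (0 < Re w)%R -> (0 < Re (z * w))%R -> pw a (z * w) = pw a z * pw a w.
Proof.
  intros Hz Hw Hzw; unfold pw; rewrite <- Cexp_add, <- Cmult_plus_distr_l; f_equal; f_equal.
  rewrite <- Clog_Clr by trivial.
  rewrite <- (Cexp_Clr z Hz) at 1; rewrite <- (Cexp_Clr w Hw) at 1; rewrite <- Cexp_add.
  apply Clog_Cexp.
  pose proof (Clr_Im z); pose proof (Clr_Im w); simpl in *.
  eapply Rle_lt_trans; [apply Rabs_triang|lra].
Qed.

Lemma Clr_RtoC x : (0 < x)%R -> Clr (RtoC x) = RtoC (ln x).
Proof.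
  intros H; unfold Clr; rewrite Cmod_R, Rabs_pos_eq by lra; simpl.
  replace (0 / x)%R with 0%R by (field; lra); now rewrite atan_0.
Qed.

Lemma exp_mono x y : (x <= y)%R -> (exp x <= exp y)%R.
Proof. intros [H|H]; [left; now apply exp_increasing|right; now rewrite H]. Qed.

Lemma Cmod_pw a z :
  (0 < Re z)%R -> (Cmod (pw a z) <= exp (Rabs (Im a) * PI) * exp (Re a * ln (Cmod z)))%R.
Proof.
  intros H; unfold pw; rewrite Cmod_Cexp, <- exp_plus; apply exp_mono; simpl.
  pose proof (Clr_Im z) as B; simpl in B; pose proof PI_RGT_0.
  change (fst a) with (Re a); change (snd a) with (Im a).
  assert (- (Im a * atan (Im z / Re z)) <= Rabs (Im a) * PI)%R; [|lra].
  eapply Rle_trans; [apply Rle_abs|]; rewrite Rabs_Ropp, Rabs_mult.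
  apply Rmult_le_compat_l; [apply Rabs_pos|lra].
Qed.

(** A base growing like [exp t] makes a power with negative real exponent decay exponentially;
    the imaginary part of the exponent only costs a constant factor, the argument being bounded. *)
Lemma pw_decay a z k t :
  (0 < Re z)%R -> (0 < k)%R -> (k * exp t <= Cmod z)%R -> (Re a <= 0)%R ->
  (Cmod (pw a z) <= exp (Rabs (Im a) * PI) * exp (Re a * ln k) * exp (Re a * t))%R.
Proof.
  intros H1 H2 H3 H4; eapply Rle_trans; [now apply Cmod_pw|].
  rewrite Rmult_assoc, <- (exp_plus (Re a * ln k)); apply Rmult_le_compat_l; [left; apply exp_pos|].
  apply exp_mono; pose proof (exp_pos t).
  assert (ln k + t <= ln (Cmod z))%R; [|nra].
  rewrite <- (ln_exp t), <- ln_mult by trivial.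
  apply ln_le; trivial; nra.
Qed.

(** * Integrals over compact intervals and over the half-line *)

Definition CRInt (f : R -> C) (a b : R) : C :=
  (RInt (fun t => Re (f t)) a b, RInt (fun t => Im (f t)) a b).

Definition clim (F : R -> C) (l : C) : Prop :=
  is_lim (fun T => Re (F T)) p_infty (Re l) /\ is_lim (fun T => Im (F T)) p_infty (Im l).

Definition RHint (f : R -> R) : R := real (Lim (fun T => RInt f 0 T) p_infty).

Definition HInt (f : R -> C) : C := (RHint (fun t => Re (f t)), RHint (fun t => Im (f t))).

(** Continuous with exponential decay: a class closed under the operations needed, on which the
    integral over the half-line converges with an explicit remainder. *)
Definition hgood (f : R -> C) : Prop :=
  (forall t, ccont f t) /\
  exists M d, (0 < d)%R /\ forall t, (0 <= t)%R -> (Cmod (f t) <= M * exp (- d * t))%R.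

Lemma im_le_Cmod z : (Rabs (Im z) <= Cmod z)%R.
Proof. eapply Rle_trans; [apply Rmax_r|apply Rmax_Cmod]. Qed.

Lemma Cmod_le_ReIm z : (Cmod z <= Rabs (Re z) + Rabs (Im z))%R.
Proof.
  replace z with (RtoC (Re z) + Ci * RtoC (Im z)) at 1 by (apply C_ext; simpl; ring).
  eapply Rle_trans; [apply Cmod_triangle|].
  rewrite Cmod_mult, Cmod_Ci, !Cmod_R; lra.
Qed.

Lemma ex_RInt_cont (f : R -> R) a b : (forall t, continuity_pt f t) -> ex_RInt f a b.
Proof.
  intros H; apply @ex_RInt_continuous; intros; apply continuity_pt_filterlim; apply H.
Qed.

Lemma RInt_dominated (f : R -> R) M d a b :
  (forall t, continuity_pt f t) -> (0 < d)%R -> (0 <= a <= b)%R ->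
  (forall t, (0 <= t)%R -> (Rabs (f t) <= M * exp (- d * t))%R) ->
  (Rabs (RInt f a b) <= M / d * exp (- d * a))%R.
Proof.
  intros Hc Hd Hab Hf.
  assert (HM : (0 <= M)%R).
  { pose proof (Hf 0%R (Rle_refl _)) as H; replace (- d * 0)%R with 0%R in H by ring.
    rewrite exp_0 in H; pose proof (Rabs_pos (f 0%R)); lra. }
  assert (I : is_RInt (fun t => M * exp (- d * t))%R a b
      (minus (- (M / d) * exp (- d * b))%R (- (M / d) * exp (- d * a))%R)).
  { apply (is_RInt_derive (fun t => - (M / d) * exp (- d * t))%R).
    - intros; auto_derive; trivial; field; lra.
    - intros; apply @ex_derive_continuous; auto_derive; trivial. }
  eapply Rle_trans.
  - apply (abs_RInt_le f a b); [lra|now apply ex_RInt_cont].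
  - eapply Rle_trans.
    + apply RInt_le with (g := fun t => (M * exp (- d * t))%R); [lra| |eexists; exact I|].
      * apply ex_RInt_cont; intros; apply (continuity_pt_comp f Rabs); trivial; apply Rcontinuity_abs.
      * intros; apply Hf; lra.
    + rewrite (is_RInt_unique _ _ _ _ I); unfold minus, plus, opp; simpl.
      assert (0 <= M / d)%R by (apply Rmult_le_pos; [lra|left; now apply Rinv_0_lt_compat]).
      pose proof (exp_pos (- d * b)); nra.
Qed.

Lemma exp_decay_lim k d : (0 < d)%R -> is_lim (fun T => k * exp (- d * T))%R p_infty 0.
Proof.
  intros Hd; replace 0%R with (k * 0)%R by ring.
  apply (is_lim_scal_l (fun T => exp (- d * T))%R k p_infty 0).
  apply (is_lim_comp exp (fun T => - d * T)%R p_infty 0 m_infty).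
  - apply is_lim_exp_m.
  - replace m_infty with (Rbar_mult (- d)%R p_infty).
    + apply (is_lim_scal_l (fun T => T) (- d)%R p_infty p_infty), is_lim_id.
    + simpl; destruct (Rle_dec 0 (- d)); [exfalso; lra|trivial].
  - now exists 0%R.
Qed.

(** The tail between [a] and [b] is at most [M / d * exp (- d * a)], so the partial integrals are
    Cauchy, and the same bound passes to the limit. *)
Lemma RHint_spec (f : R -> R) M d :
  (forall t, continuity_pt f t) -> (0 < d)%R ->
  (forall t, (0 <= t)%R -> (Rabs (f t) <= M * exp (- d * t))%R) ->
  is_lim (fun T => RInt f 0 T) p_infty (RHint f) /\
  (forall T, (0 <= T)%R -> (Rabs (RHint f - RInt f 0 T) <= M / d * exp (- d * T))%R).
Proof.
  intros Hc Hd Hf.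
  assert (D : forall a b, (0 <= a <= b)%R ->
      (Rabs (RInt f 0 b - RInt f 0 a) <= M / d * exp (- d * a))%R).
  { intros a b Hab.
    rewrite <- (RInt_Chasles f 0 a b) by now apply ex_RInt_cont.
    assert (E : forall x y : R, (x + y - x = y)%R) by (intros; ring).
    unfold plus; simpl; rewrite E; now apply RInt_dominated. }
  assert (L : exists l : R, is_lim (fun T => RInt f 0 T) p_infty l).
  { apply (Hierarchy.filterlim_locally_cauchy (U := R_CompleteSpace) (F := Rbar_locally p_infty)).
    intros eps.
    pose proof (exp_decay_lim (M / d) d Hd) as E.
    apply is_lim_spec in E; specialize (E eps); destruct E as [N HN].
    set (N1 := Rmax 0 N).
    assert (K : forall u v, (N1 < u)%R -> (u <= v)%R -> (Rabs (RInt f 0 v - RInt f 0 u) < eps)%R).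
    { intros u v Hu Huv.
      assert (0 < u /\ N < u)%R as [] by (unfold N1 in Hu; pose proof (Rmax_l 0 N); pose proof (Rmax_r 0 N); lra).
      eapply Rle_lt_trans; [apply D; lra|].
      specialize (HN u ltac:(trivial)); rewrite Rminus_0_r in HN.
      eapply Rle_lt_trans; [apply Rle_abs|exact HN]. }
    exists (fun T => (N1 < T)%R); split; [now exists N1|].
    intros u v Hu Hv; change (Rabs (RInt f 0 v - RInt f 0 u) < eps)%R.
    destruct (Rle_dec u v); [apply K; trivial|].
    rewrite Rabs_minus_sym; apply K; trivial; lra. }
  destruct L as [l Hl].
  assert (E : RHint f = l) by (unfold RHint; now rewrite (is_lim_unique _ _ _ Hl)).
  rewrite E; split; trivial.
  intros T HT.
  assert (A : is_lim (fun S => Rabs (RInt f 0 S - RInt f 0 T)) p_infty (Rabs (l - RInt f 0 T))).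
  { apply (is_lim_comp_continuous (fun S => RInt f 0 S - RInt f 0 T)%R Rabs p_infty (l - RInt f 0 T)%R).
    - apply is_lim_minus'; trivial; apply is_lim_const.
    - apply continuous_Rabs. }
  apply (is_lim_le_loc (fun S => Rabs (RInt f 0 S - RInt f 0 T)) (fun _ => M / d * exp (- d * T))%R
    p_infty (Rabs (l - RInt f 0 T)) (M / d * exp (- d * T))%R); trivial.
  - exists T; intros S HS; apply D; lra.
  - apply is_lim_const.
Qed.

Lemma hgood_re f : hgood f -> exists M d, (forall t, continuity_pt (fun t => Re (f t)) t) /\ (0 < d)%R /\
  (forall t, (0 <= t)%R -> (Rabs (Re (f t)) <= M * exp (- d * t))%R).
Proof.
  intros [H1 [M [d [H2 H3]]]]; exists M, d; repeat split; trivial.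
  - intros; apply H1.
  - intros; eapply Rle_trans; [apply re_le_Cmod|auto].
Qed.

Lemma hgood_im f : hgood f -> exists M d, (forall t, continuity_pt (fun t => Im (f t)) t) /\ (0 < d)%R /\
  (forall t, (0 <= t)%R -> (Rabs (Im (f t)) <= M * exp (- d * t))%R).
Proof.
  intros [H1 [M [d [H2 H3]]]]; exists M, d; repeat split; trivial.
  - intros; apply H1.
  - intros; eapply Rle_trans; [apply im_le_Cmod|auto].
Qed.

Lemma HInt_lim f : hgood f -> clim (fun T => CRInt f 0 T) (HInt f).
Proof.
  intros H; destruct (hgood_re f H) as (M & d & A & B & D), (hgood_im f H) as (M' & d' & A' & B' & D').
  split; simpl.
  - apply (RHint_spec _ M d A B D).
  - apply (RHint_spec _ M' d' A' B' D').
Qed.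

Lemma clim_unique F l l' : clim F l -> clim F l' -> l = l'.
Proof.
  intros [H1 H2] [H3 H4]; apply C_ext.
  - apply is_lim_unique in H1, H3; rewrite H1 in H3; now injection H3.
  - apply is_lim_unique in H2, H4; rewrite H2 in H4; now injection H4.
Qed.

Lemma clim_const l : clim (fun _ => l) l.
Proof. split; apply is_lim_const. Qed.

Lemma clim_plus F G a b : clim F a -> clim G b -> clim (fun T => F T + G T) (a + b).
Proof. intros [] []; split; simpl; now apply is_lim_plus'. Qed.

Lemma clim_scal c F a : clim F a -> clim (fun T => c * F T) (c * a).
Proof.
  intros [H1 H2]; split; simpl.
  - apply is_lim_minus'; apply (is_lim_scal_l _ _ _ (Finite _)); trivial.
  - apply is_lim_plus'; apply (is_lim_scal_l _ _ _ (Finite _)); trivial.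
Qed.

Lemma clim_opp F a : clim F a -> clim (fun T => - F T) (- a).
Proof. intros [H1 H2]; split; simpl; apply (is_lim_opp _ _ (Finite _)); trivial. Qed.

Lemma clim_ext F G l : (forall T, (0 < T)%R -> F T = G T) -> clim F l -> clim G l.
Proof.
  intros E [H1 H2]; split; eapply is_lim_ext_loc.
  2: exact H1. 3: exact H2.
  all: exists 0%R; intros x Hx; now rewrite E.
Qed.

Lemma clim_dominated F l g T0 :
  (forall T, (T0 < T)%R -> (Cmod (F T - l) <= g T)%R) -> is_lim g p_infty 0 -> clim F l.
Proof.
  intros H G.
  assert (K : forall u : R -> R, (forall T, (T0 < T)%R -> (Rabs (u T) <= g T)%R) -> is_lim u p_infty 0).
  { intros u Hu; apply (is_lim_le_le_loc (fun T => - g T)%R g); trivial.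
    - exists T0; intros x Hx; specialize (Hu x Hx); apply Rabs_le_between in Hu; lra.
    - replace 0%R with (- 0)%R by ring; apply (is_lim_opp _ _ (Finite _)); trivial. }
  split.
  - apply is_lim_ext with (f := fun T => (Re (F T - l) + Re l)%R); [intros; unfold Re, Im; simpl; ring|].
    replace (Re l) with (0 + Re l)%R by ring.
    apply is_lim_plus'; [|replace (0 + Re l)%R with (Re l) by ring; apply is_lim_const].
    apply K; intros T HT; eapply Rle_trans; [apply re_le_Cmod|auto].
  - apply is_lim_ext with (f := fun T => (Im (F T - l) + Im l)%R); [intros; unfold Re, Im; simpl; ring|].
    replace (Im l) with (0 + Im l)%R by ring.
    apply is_lim_plus'; [|replace (0 + Im l)%R with (Im l) by ring; apply is_lim_const].
    apply K; intros T HT; eapply Rle_trans; [apply im_le_Cmod|auto].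
Qed.

Lemma clim_exp_eventually F l M d T0 :
  (0 < d)%R -> (forall T, (T0 < T)%R -> (Cmod (F T - l) <= M * exp (- d * T))%R) -> clim F l.
Proof. intros Hd H; eapply clim_dominated; [exact H|now apply exp_decay_lim]. Qed.

Lemma clim_exp_dominated F l M d :
  (0 < d)%R -> (forall T, (0 < T)%R -> (Cmod (F T - l) <= M * exp (- d * T))%R) -> clim F l.
Proof. apply clim_exp_eventually. Qed.

Lemma HInt_ext f g : (forall t, (0 <= t)%R -> f t = g t) -> hgood f -> hgood g -> HInt f = HInt g.
Proof.
  intros E Hf Hg; apply (clim_unique (fun T => CRInt f 0 T)); [now apply HInt_lim|].
  apply (clim_ext (fun T => CRInt g 0 T)); [|now apply HInt_lim].
  intros T HT; apply C_ext; simpl; apply RInt_ext; intros x;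
    rewrite Rmin_left, Rmax_right by lra; intros Hx; rewrite E by lra; reflexivity.
Qed.

Lemma ccont_plus f g s : ccont f s -> ccont g s -> ccont (fun x => f x + g x) s.
Proof. intros [] []; split; simpl; now apply (continuity_pt_plus _ _ s). Qed.

Lemma ccont_mult f g s : ccont f s -> ccont g s -> ccont (fun x => f x * g x) s.
Proof.
  intros H1 H2; apply ccont_of_c2, (ccont2_mult (fun x _ => f x) (fun x _ => g x)); now apply ccont2_1.
Qed.

Lemma ccont_const c s : ccont (fun _ => c) s.
Proof. split; apply continuity_pt_const; now intros x y. Qed.

Lemma hgood_scal c f : hgood f -> hgood (fun t => c * f t).
Proof.
  intros [H [M [d [H1 H2]]]]; split.
  - intros; apply ccont_mult; trivial; apply ccont_const.
  - exists (Cmod c * M)%R, d; split; trivial; intros; rewrite Cmod_mult, Rmult_assoc.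
    apply Rmult_le_compat_l; [apply Cmod_ge_0|auto].
Qed.

Lemma bound_nonneg f M d :
  (forall t, (0 <= t)%R -> (Cmod (f t) <= M * exp (- d * t))%R) -> (0 <= M)%R.
Proof.
  intros H; pose proof (H 0%R (Rle_refl _)) as K; replace (- d * 0)%R with 0%R in K by ring.
  rewrite exp_0 in K; pose proof (Cmod_ge_0 (f 0%R)); lra.
Qed.

Lemma exp_weaken M d e t : (0 <= M)%R -> (e <= d)%R -> (0 <= t)%R ->
  (M * exp (- d * t) <= M * exp (- e * t))%R.
Proof. intros; apply Rmult_le_compat_l; trivial; apply exp_mono; nra. Qed.

Lemma hgood_plus f g : hgood f -> hgood g -> hgood (fun t => f t + g t).
Proof.
  intros [H [M [d [H1 H2]]]] [H' [M' [d' [H1' H2']]]]; split.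
  - intros; now apply ccont_plus.
  - exists (M + M')%R, (Rmin d d'); split; [now apply Rmin_glb_lt|].
    intros t Ht; eapply Rle_trans; [apply Cmod_triangle|].
    rewrite Rmult_plus_distr_r.
    pose proof (exp_weaken M d (Rmin d d') t (bound_nonneg _ _ _ H2) (Rmin_l _ _) Ht).
    pose proof (exp_weaken M' d' (Rmin d d') t (bound_nonneg _ _ _ H2') (Rmin_r _ _) Ht).
    specialize (H2 t Ht); specialize (H2' t Ht); lra.
Qed.

Lemma CRInt_plus f g a b : (forall t, ccont f t) -> (forall t, ccont g t) ->
  CRInt (fun t => f t + g t) a b = CRInt f a b + CRInt g a b.
Proof.
  intros Hf Hg; apply C_ext; simpl.
  - apply (RInt_plus (fun t => Re (f t)) (fun t => Re (g t))); apply ex_RInt_cont; intros; (apply Hf || apply Hg).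
  - apply (RInt_plus (fun t => Im (f t)) (fun t => Im (g t))); apply ex_RInt_cont; intros; (apply Hf || apply Hg).
Qed.

Lemma CRInt_scal c f a b : (forall t, ccont f t) ->
  CRInt (fun t => c * f t) a b = c * CRInt f a b.
Proof.
  intros Hf.
  assert (E1 : ex_RInt (fun t => Re (f t)) a b) by (apply ex_RInt_cont; intros; apply Hf).
  assert (E2 : ex_RInt (fun t => Im (f t)) a b) by (apply ex_RInt_cont; intros; apply Hf).
  pose proof (RInt_correct _ _ _ E1) as I1; pose proof (RInt_correct _ _ _ E2) as I2.
  apply C_ext; simpl; apply is_RInt_unique.
  - apply @is_RInt_minus; apply @is_RInt_scal; trivial.
  - apply @is_RInt_plus; apply @is_RInt_scal; trivial.
Qed.

Lemma HInt_plus f g : hgood f -> hgood g -> HInt (fun t => f t + g t) = HInt f + HInt g.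
Proof.
  intros Hf Hg; apply (clim_unique (fun T => CRInt (fun t => f t + g t) 0 T)).
  - now apply HInt_lim, hgood_plus.
  - apply (clim_ext (fun T => CRInt f 0 T + CRInt g 0 T)).
    + intros; symmetry; apply CRInt_plus; [apply Hf|apply Hg].
    + now apply clim_plus; apply HInt_lim.
Qed.

Lemma HInt_scal c f : hgood f -> HInt (fun t => c * f t) = c * HInt f.
Proof.
  intros Hf; apply (clim_unique (fun T => CRInt (fun t => c * f t) 0 T)).
  - now apply HInt_lim, hgood_scal.
  - apply (clim_ext (fun T => c * CRInt f 0 T)).
    + intros; symmetry; apply CRInt_scal; apply Hf.
    + now apply clim_scal; apply HInt_lim.
Qed.

Lemma CRInt_derive F f a b :
  (forall t, (Rmin a b <= t <= Rmax a b)%R -> cder F t (f t) /\ ccont f t) ->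
  CRInt f a b = F b - F a.
Proof.
  intros H; apply C_ext; simpl; apply is_RInt_unique.
  - apply (is_RInt_derive (fun t => Re (F t))); intros t Ht; destruct (H t Ht) as [[] []]; trivial.
    now apply continuity_pt_filterlim.
  - apply (is_RInt_derive (fun t => Im (F t))); intros t Ht; destruct (H t Ht) as [[] []]; trivial.
    now apply continuity_pt_filterlim.
Qed.

Lemma HInt_derive F f l :
  (forall t, cder F t (f t)) -> hgood f -> clim F l -> HInt f = l - F 0%R.
Proof.
  intros H Hf HF; apply (clim_unique (fun T => CRInt f 0 T)); [now apply HInt_lim|].
  apply (clim_ext (fun T => F T + - F 0%R)).
  - intros; symmetry; apply CRInt_derive; intros; split; [apply H|apply Hf].
  - apply clim_plus; trivial; apply clim_const.
Qed.

(** ** Dependence on a parameter *)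

(** Tube lemma. The auxiliary function [g] describes an open set as [g > 0], which is how the domain
    of a parameter-dependent integrand is given below. *)
Lemma tube (g : R -> R -> R) (s a b : R) :
  (a <= b)%R -> (forall x y, continuity_2d_pt g x y) -> (forall t, (a <= t <= b)%R -> (0 < g s t)%R) ->
  locally s (fun x => forall t, (a <= t <= b)%R -> (0 < g x t)%R).
Proof.
  intros Hab Hg Hp.
  destruct (continuity_ab_min (g s) a b Hab) as [m [Hm1 Hm2]].
  { intros c _; apply continuity_2d_slice; apply Hg. }
  assert (P : (0 < g s m)%R) by (apply Hp; trivial).
  destruct (uniform_continuity_2d_1d' g a b s (fun x _ => Hg s x) (mkposreal _ P)) as [d Hd].
  exists d; intros x Hx t Ht.
  assert (Hx' : (Rabs (x - s) < d)%R) by exact Hx; apply Rabs_def2 in Hx'.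
  assert (K : (Rabs (g x t - g s t) < g s m)%R).
  { apply Hd; trivial; try lra; pose proof (cond_pos d); try lra; rewrite Rminus_eq_0, Rabs_R0; apply cond_pos. }
  apply Rabs_def2 in K; specialize (Hm1 t Ht); lra.
Qed.

Lemma RInt_param_derive (g f f' : R -> R -> R) (s a b : R) :
  (a <= b)%R -> (forall x y, continuity_2d_pt g x y) ->
  (forall t, (a <= t <= b)%R -> (0 < g s t)%R) ->
  (forall x t, (0 < g x t)%R -> is_derive (fun u => f u t) x (f' x t)) ->
  (forall x t, (0 < g x t)%R -> continuity_2d_pt f' x t) ->
  (forall x t, (0 < g x t)%R -> continuity_pt (f x) t) ->
  is_derive (fun x => RInt (f x) a b) s (RInt (f' s) a b).
Proof.
  intros Hab Hg Hp Hd Hc Hf.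
  pose proof (tube g s a b Hab Hg Hp) as T.
  evar_last.
  - apply (is_derive_RInt_param f a b s).
    + revert T; apply filter_imp; intros x Hx t; rewrite Rmin_left, Rmax_right by trivial.
      intros Ht; eexists; apply Hd; now apply Hx.
    + intros t; rewrite Rmin_left, Rmax_right by trivial; intros Ht.
      apply continuity_2d_pt_ext_loc with f'; [|now apply Hc, Hp].
      destruct (Hg s t (mkposreal _ (Hp t Ht))) as [d Hd']; exists d; intros u v Hu Hv.
      symmetry; apply is_derive_unique, Hd.
      specialize (Hd' u v Hu Hv); simpl in Hd'; apply Rabs_def2 in Hd'; lra.
    + revert T; apply filter_imp; intros x Hx; apply @ex_RInt_continuous; intros z.
      rewrite Rmin_left, Rmax_right by trivial; intros Hz; apply continuity_pt_filterlim; apply Hf, Hx; trivial.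
  - apply RInt_ext; intros x; rewrite Rmin_left, Rmax_right by trivial; intros Hx.
    apply is_derive_unique, Hd, Hp; lra.
Qed.

Lemma CRInt_param_derive (g : R -> R -> R) (f f' : R -> R -> C) (s a b : R) :
  (a <= b)%R -> (forall x y, continuity_2d_pt g x y) ->
  (forall t, (a <= t <= b)%R -> (0 < g s t)%R) ->
  (forall x t, (0 < g x t)%R -> cder (fun u => f u t) x (f' x t)) ->
  (forall x t, (0 < g x t)%R -> ccont2 f' x t) ->
  (forall x t, (0 < g x t)%R -> ccont (f x) t) ->
  cder (fun x => CRInt (f x) a b) s (CRInt (f' s) a b).
Proof.
  intros Hab Hg Hp Hd Hc Hf; split; simpl.
  - apply (RInt_param_derive g (fun x t => Re (f x t)) (fun x t => Re (f' x t))); trivial;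
      intros; (apply Hd || apply Hc || apply Hf); trivial.
  - apply (RInt_param_derive g (fun x t => Im (f x t)) (fun x t => Im (f' x t))); trivial;
      intros; (apply Hd || apply Hc || apply Hf); trivial.
Qed.

Lemma RInt_param_cont (f : R -> R -> R) (s a b : R) :
  (a <= b)%R -> (forall t, continuity_2d_pt f s t) ->
  locally s (fun x => ex_RInt (f x) a b) -> continuity_pt (fun x => RInt (f x) a b) s.
Proof.
  intros Hab Hc Hl.
  assert (Hs : ex_RInt (f s) a b) by (apply locally_singleton in Hl; exact Hl).
  apply continuity_pt_locally; intros eps.
  assert (P : (0 < eps / (b - a + 1))%R) by (apply Rdiv_lt_0_compat; [apply cond_pos|lra]).
  destruct (uniform_continuity_2d_1d' f a b s (fun x _ => Hc x) (mkposreal _ P)) as [d Hd].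
  assert (Ld : locally s (fun x => Rabs (x - s) < d)%R) by (exists d; now intros).
  generalize (filter_and _ _ Hl Ld); apply filter_imp; intros x [Hx Hx'].
  apply Rabs_def2 in Hx'.
  change (RInt (f x) a b - RInt (f s) a b)%R with (minus (RInt (f x) a b) (RInt (f s) a b)).
  rewrite <- RInt_minus by trivial.
  eapply Rle_lt_trans.
  - apply (abs_RInt_le_const (fun t => minus (f x t) (f s t)) a b (eps / (b - a + 1))); trivial.
    + now apply @ex_RInt_minus.
    + intros t Ht; left; apply (Hd t s t x); trivial; pose proof (cond_pos d); try lra.
      rewrite Rminus_eq_0, Rabs_R0; lra.
  - pose proof (cond_pos eps); apply Rmult_lt_reg_r with (b - a + 1)%R; [lra|].
    replace ((b - a) * (eps / (b - a + 1)) * (b - a + 1))%R with ((b - a) * eps)%R by (field; lra); nra.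
Qed.

(** Locally uniform version of [hgood]: the bound does not depend on the parameter. *)
Definition dfam (f : R -> R -> C) (s r : R) : Prop :=
  (forall x t, (Rabs (x - s) < r)%R -> ccont2 f x t) /\
  exists M d, (0 < d)%R /\ forall x t, (Rabs (x - s) < r)%R -> (0 <= t)%R ->
    (Cmod (f x t) <= M * exp (- d * t))%R.

Lemma dfam_hgood f s r x : dfam f s r -> (Rabs (x - s) < r)%R -> hgood (f x).
Proof.
  intros [H1 [M [d [H2 H3]]]] Hx; split; [intros; now apply ccont2_slice, H1|].
  exists M, d; split; auto.
Qed.

(** The exponential tail bound makes the truncated integrals converge uniformly in the parameter,
    so that continuity and differentiability are inherited from compact intervals. *)
Lemma RHint_CVU (f : R -> R -> R) (s M d : R) (r : posreal) :
  (forall x t, (Rabs (x - s) < r)%R -> continuity_pt (f x) t) ->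
  (0 < d)%R ->
  (forall x t, (Rabs (x - s) < r)%R -> (0 <= t)%R -> (Rabs (f x t) <= M * exp (- d * t))%R) ->
  CVU (fun n x => RInt (f x) 0 (INR n)) (fun x => RHint (f x)) s r.
Proof.
  intros Hc Hd Hf eps He.
  pose proof (exp_decay_lim (M / d) d Hd) as E; apply is_lim_spec in E.
  destruct (E (mkposreal _ He)) as [N HN].
  destruct (INR_unbounded (Rmax 0 N)) as [n0 Hn0].
  exists n0; intros n y Hn Hy.
  assert (Hy' : (Rabs (y - s) < r)%R) by exact Hy.
  apply le_INR in Hn; pose proof (Rmax_l 0 N); pose proof (Rmax_r 0 N).
  destruct (RHint_spec (f y) M d (fun t => Hc y t Hy') Hd (fun t => Hf y t Hy')) as [_ K].
  eapply Rle_lt_trans; [apply K; lra|].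
  specialize (HN (INR n)); rewrite Rminus_0_r in HN; simpl in HN.
  eapply Rle_lt_trans; [apply Rle_abs|apply HN; lra].
Qed.

Lemma RHint_param_cont (f : R -> R -> R) (s M d : R) (r : posreal) :
  (forall x t, (Rabs (x - s) < r)%R -> continuity_2d_pt f x t) ->
  (0 < d)%R ->
  (forall x t, (Rabs (x - s) < r)%R -> (0 <= t)%R -> (Rabs (f x t) <= M * exp (- d * t))%R) ->
  forall x, (Rabs (x - s) < r)%R -> continuity_pt (fun x => RHint (f x)) x.
Proof.
  intros Hc Hd Hf x Hx.
  apply (CVU_continuity (fun n x => RInt (f x) 0 (INR n)) _ s r); trivial.
  - apply RHint_CVU with M d; trivial; intros; now apply continuity_2d_slice, Hc.
  - intros n y Hy; assert (Hy' : (Rabs (y - s) < r)%R) by exact Hy.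
    apply RInt_param_cont; [apply pos_INR|intros; now apply Hc|].
    assert (P : (0 < r - Rabs (y - s))%R) by lra.
    exists (mkposreal _ P); intros z Hz; assert (Hz' : (Rabs (z - y) < r - Rabs (y - s))%R) by exact Hz.
    apply ex_RInt_cont; intros t; apply continuity_2d_slice, Hc.
    replace (z - s)%R with ((z - y) + (y - s))%R by ring.
    eapply Rle_lt_trans; [apply Rabs_triang|lra].
Qed.

Lemma HInt_param_cont f s r x :
  dfam f s r -> (Rabs (x - s) < r)%R -> ccont (fun x => HInt (f x)) x.
Proof.
  intros [H1 [M [d [H2 H3]]]] Hx.
  assert (P : (0 < r)%R) by (pose proof (Rabs_pos (x - s)); lra).
  split; simpl.
  - apply (RHint_param_cont (fun x t => Re (f x t)) s M d (mkposreal _ P)); trivial.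
    + intros; now apply H1.
    + intros; eapply Rle_trans; [apply re_le_Cmod|auto].
  - apply (RHint_param_cont (fun x t => Im (f x t)) s M d (mkposreal _ P)); trivial.
    + intros; now apply H1.
    + intros; eapply Rle_trans; [apply im_le_Cmod|auto].
Qed.

Lemma RHint_param_derive (f f' : R -> R -> R) (s M d M' d' : R) (r : posreal) :
  (forall x t, (Rabs (x - s) < r)%R -> continuity_pt (f x) t) -> (0 < d)%R ->
  (forall x t, (Rabs (x - s) < r)%R -> (0 <= t)%R -> (Rabs (f x t) <= M * exp (- d * t))%R) ->
  (forall x t, (Rabs (x - s) < r)%R -> continuity_2d_pt f' x t) -> (0 < d')%R ->
  (forall x t, (Rabs (x - s) < r)%R -> (0 <= t)%R -> (Rabs (f' x t) <= M' * exp (- d' * t))%R) ->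
  (forall x t, (Rabs (x - s) < r)%R -> is_derive (fun u => f u t) x (f' x t)) ->
  forall x, (Rabs (x - s) < r)%R -> is_derive (fun x => RHint (f x)) x (RHint (f' x)).
Proof.
  intros Hc Hd Hf Hc' Hd' Hf' Hder x Hx; apply is_derive_Reals.
  apply (derivable_pt_lim_CVU (fun n x => RInt (f x) 0 (INR n)) (fun n x => RInt (f' x) 0 (INR n))
    (fun x => RHint (f x)) (fun x => RHint (f' x)) x s r); trivial.
  - intros y n Hy; assert (Hy' : (Rabs (y - s) < r)%R) by exact Hy.
    apply is_derive_Reals.
    apply (RInt_param_derive (fun x _ => r - Rabs (x - s))%R f f'); try apply pos_INR.
    + intros; apply (continuity_1d_2d_pt_comp (fun x => r - Rabs (x - s))%R (fun x _ => x)); [|apply continuity_2d_pt_id1].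
      apply (continuity_pt_minus (fun _ => pos r) (fun x => Rabs (x - s))); [apply continuity_pt_const; now intros ? ?|].
      apply (continuity_pt_comp (fun x => x - s)%R Rabs); [|apply Rcontinuity_abs].
      apply derivable_continuous_pt; apply derivable_pt_minus; [apply derivable_pt_id|apply derivable_pt_const].
    + intros; lra.
    + intros; apply Hder; lra.
    + intros; apply Hc'; lra.
    + intros; apply Hc; lra.
  - intros y Hy; assert (Hy' : (Rabs (y - s) < r)%R) by exact Hy.
    apply (CVU_cv _ _ s r (RHint_CVU f s M d r Hc Hd Hf)); trivial.
  - apply RHint_CVU with M' d'; trivial; intros; now apply continuity_2d_slice, Hc'.
  - intros y Hy; apply (RHint_param_cont f' s M' d' r); trivial.
Qed.

Lemma HInt_param_derive f f' s r x :
  dfam f s r -> dfam f' s r ->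
  (forall x t, (Rabs (x - s) < r)%R -> cder (fun u => f u t) x (f' x t)) ->
  (Rabs (x - s) < r)%R -> cder (fun x => HInt (f x)) x (HInt (f' x)).
Proof.
  intros [H1 [M [d [H2 H3]]]] [H1' [M' [d' [H2' H3']]]] Hd Hx.
  assert (P : (0 < r)%R) by (pose proof (Rabs_pos (x - s)); lra).
  split; simpl.
  - apply (RHint_param_derive (fun x t => Re (f x t)) (fun x t => Re (f' x t)) s M d M' d' (mkposreal _ P)); trivial.
    + intros; apply (ccont2_slice f); now apply H1.
    + intros; eapply Rle_trans; [apply re_le_Cmod|auto].
    + intros; now apply H1'.
    + intros; eapply Rle_trans; [apply re_le_Cmod|auto].
    + intros; now apply Hd.
  - apply (RHint_param_derive (fun x t => Im (f x t)) (fun x t => Im (f' x t)) s M d M' d' (mkposreal _ P)); trivial.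
    + intros; apply (ccont2_slice f); now apply H1.
    + intros; eapply Rle_trans; [apply im_le_Cmod|auto].
    + intros; now apply H1'.
    + intros; eapply Rle_trans; [apply im_le_Cmod|auto].
    + intros; now apply Hd.
Qed.

(** ** Cauchy's theorem on a rectangle *)

(** Both sides are functions of [q] vanishing at [q = p]. By the Cauchy-Riemann equations the integral
    along a horizontal side has derivative [Ci * (F (b, y) - F (a, y))] in the height [y]. *)
Lemma rectangle (g : R -> R -> R) (F F' : C -> C) (a b p q : R) :
  (a <= b)%R -> (p <= q)%R ->
  (forall x y, continuity_2d_pt g x y) ->
  (forall y t, (p <= y <= q)%R -> (a <= t <= b)%R -> (0 < g y t)%R) ->
  (forall y t, (0 < g y t)%R -> hol F (t, y) (F' (t, y))) ->
  (forall y t, (0 < g y t)%R -> ccont2 (fun y t => F' (t, y)) y t) ->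
  CRInt (fun t => F (t, q)) a b - CRInt (fun t => F (t, p)) a b =
  Ci * (CRInt (fun y => F (b, y)) p q - CRInt (fun y => F (a, y)) p q).
Proof.
  intros Hab Hpq Hg Hp HF HF'.
  assert (line1 : forall y t, cder (fun t => (t, y)) t 1).
  { intros; apply (cder_ext (fun t => (0, y) + RtoC t * 1)); [intros; apply C_ext; simpl; ring|apply cder_line]. }
  assert (line2 : forall y t, cder (fun y => (t, y)) y Ci).
  { intros; apply (cder_ext (fun y => RtoC t + RtoC y * Ci)); [intros; apply C_ext; simpl; ring|apply cder_line]. }
  assert (D1 : forall y t, (0 < g y t)%R -> cder (fun t => F (t, y)) t (F' (t, y))).
  { intros y t H; eapply cder_eq; [apply (HF y t H (fun t => (t, y)) t 1); trivial|ring]. }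
  assert (D2 : forall y t, (0 < g y t)%R -> cder (fun y => F (t, y)) y (Ci * F' (t, y))).
  { intros y t H; eapply cder_eq; [apply (HF y t H (fun y => (t, y)) y Ci); trivial|ring]. }
  assert (Cb : forall t, (a <= t <= b)%R -> forall y, (p <= y <= q)%R -> ccont (fun y => F (t, y)) y).
  { intros t Ht y Hy; eapply cder_ccont, D2; now apply Hp. }
  rewrite <- (CRInt_derive (fun y => CRInt (fun t => F (t, y)) a b)
     (fun y => Ci * (F (b, y) - F (a, y))) p q).
  - assert (E : forall t, (a <= t <= b)%R -> ex_RInt (fun y => Re (F (t, y))) p q /\ ex_RInt (fun y => Im (F (t, y))) p q).
    { intros t Ht; split; apply @ex_RInt_continuous; intros y; rewrite Rmin_left, Rmax_right by trivial;
        intros Hy; apply continuity_pt_filterlim; apply Cb; trivial. }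
    destruct (E a) as [Ea Ea'], (E b) as [Eb Eb']; try lra.
    assert (M : forall u v : R -> R, ex_RInt u p q -> ex_RInt v p q ->
      RInt (fun y => u y - v y)%R p q = (RInt u p q - RInt v p q)%R).
    { intros u v Hu Hv; apply is_RInt_unique, @is_RInt_minus;
        apply (RInt_correct (V := R_CompleteNormedModule)); trivial. }
    apply C_ext; simpl.
    + rewrite (RInt_ext _ (fun y => Im (F (a, y)) - Im (F (b, y)))%R).
      * rewrite M by trivial; unfold Im; ring.
      * intros; unfold Re, Im; simpl; ring.
    + rewrite (RInt_ext _ (fun y => Re (F (b, y)) - Re (F (a, y)))%R).
      * rewrite M by trivial; unfold Re; ring.
      * intros; unfold Re, Im; simpl; ring.
  - intros y; rewrite Rmin_left, Rmax_right by trivial; intros Hy; split.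
    + eapply cder_eq.
      * apply (CRInt_param_derive g (fun y t => F (t, y)) (fun y t => Ci * F' (t, y))); trivial.
        -- intros; apply Hp; trivial.
        -- intros; apply ccont2_mult; [apply ccont2_const|now apply HF'].
        -- intros; eapply cder_ccont; now apply D1.
      * rewrite (CRInt_derive (fun t => Ci * F (t, y))); [ring|].
        intros t; rewrite Rmin_left, Rmax_right by trivial; intros Ht; split.
        -- apply cder_scal, D1; now apply Hp.
        -- apply ccont_mult; [apply ccont_const|apply (ccont2_slice (fun y t => F' (t, y))), HF', Hp; trivial].
    + apply ccont_mult; [apply ccont_const|].
      apply ccont_plus; [apply Cb; trivial; lra|].
      destruct (Cb a ltac:(lra) y Hy) as [K1 K2]; split; simpl; now apply (continuity_pt_opp _ y).
Qed.

(** * Power series and analytic functions *)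

Definition Cdiff (F : C -> C) (z l : C) : Prop :=
  forall eps, (0 < eps)%R -> exists d, (0 < d)%R /\
    forall h, (Cmod h < d)%R -> (Cmod (F (z + h)%C - F z - l * h) <= eps * Cmod h)%R.

Lemma is_derive_eps (f : R -> R) s l :
  is_derive f s l <-> forall eps, (0 < eps)%R -> exists d, (0 < d)%R /\
    forall h, (Rabs h < d)%R -> (Rabs (f (s + h)%R - f s - h * l) <= eps * Rabs h)%R.
Proof.
  rewrite is_derive_Reals; split; intros H eps He.
  - destruct (H eps He) as [d Hd]; exists d; split; [apply cond_pos|]; intros h Hh.
    destruct (Req_dec h 0) as [->|Hn].
    + rewrite Rplus_0_r, Rabs_R0; replace (_ - _ - _)%R with 0%R by ring; rewrite Rabs_R0; lra.
    + specialize (Hd h Hn Hh).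
      replace (f (s + h)%R - f s - h * l)%R with (((f (s + h)%R - f s) / h - l) * h)%R by (field; trivial).
      rewrite Rabs_mult; apply Rmult_le_compat_r; [apply Rabs_pos|lra].
  - destruct (H (eps / 2)%R ltac:(lra)) as [d [Hd Hd']]; exists (mkposreal _ Hd); intros h Hn Hh.
    specialize (Hd' h Hh).
    replace ((f (s + h)%R - f s) / h - l)%R with ((f (s + h)%R - f s - h * l) * / h)%R by (field; trivial).
    rewrite Rabs_mult, Rabs_inv.
    pose proof (Rabs_pos_lt h Hn) as P.
    apply Rmult_lt_reg_r with (Rabs h); trivial.
    replace (Rabs (f (s + h)%R - f s - h * l) * / Rabs h * Rabs h)%R with (Rabs (f (s + h)%R - f s - h * l)) by (field; lra).
    nra.
Qed.

Lemma cder_eps (f : R -> C) s l :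
  cder f s l <-> forall eps, (0 < eps)%R -> exists d, (0 < d)%R /\
    forall h, (Rabs h < d)%R -> (Cmod (f (s + h)%R - f s - RtoC h * l) <= eps * Rabs h)%R.
Proof.
  unfold cder; rewrite !is_derive_eps; split.
  - intros [H1 H2] eps He.
    destruct (H1 (eps / 2)%R ltac:(lra)) as [d1 [P1 Q1]], (H2 (eps / 2)%R ltac:(lra)) as [d2 [P2 Q2]].
    exists (Rmin d1 d2); split; [now apply Rmin_glb_lt|]; intros h Hh.
    pose proof (Rmin_l d1 d2); pose proof (Rmin_r d1 d2).
    specialize (Q1 h ltac:(lra)); specialize (Q2 h ltac:(lra)).
    eapply Rle_trans; [apply Cmod_le_ReIm|].
    replace (Re (f (s + h)%R - f s - RtoC h * l)) with (Re (f (s + h)%R) - Re (f s) - h * Re l)%R by (unfold Re; simpl; ring).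
    replace (Im (f (s + h)%R - f s - RtoC h * l)) with (Im (f (s + h)%R) - Im (f s) - h * Im l)%R by (unfold Im; simpl; ring).
    lra.
  - intros H; split; intros eps He; destruct (H eps He) as [d [P Q]]; exists d; split; trivial; intros h Hh;
      eapply Rle_trans; [|exact (Q h Hh)| |exact (Q h Hh)].
    + eapply Rle_trans; [|apply re_le_Cmod]; right; f_equal; unfold Re; simpl; ring.
    + eapply Rle_trans; [|apply im_le_Cmod]; right; f_equal; unfold Im; simpl; ring.
Qed.

Lemma Cdiff_hol F z l : Cdiff F z l -> hol F z l.
Proof.
  intros HF g s g' e Hg; apply cder_eps; intros eps He.
  pose proof (proj1 (cder_eps g s g') Hg) as Hg'.
  pose proof (Cmod_ge_0 g') as G0; pose proof (Cmod_ge_0 l) as L0.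
  destruct (HF (eps / 2 / (Cmod g' + 1))%R) as [d1 [P1 Q1]].
  { apply Rdiv_lt_0_compat; lra. }
  set (e2 := Rmin 1 (eps / 2 / (Cmod l + 1))).
  assert (He2 : (0 < e2)%R) by (apply Rmin_glb_lt; [lra|apply Rdiv_lt_0_compat; lra]).
  destruct (Hg' e2 He2) as [d2 [P2 Q2]].
  exists (Rmin d2 (d1 / (Cmod g' + 1))); split.
  { apply Rmin_glb_lt; trivial; apply Rdiv_lt_0_compat; lra. }
  intros h Hh; pose proof (Rmin_l d2 (d1 / (Cmod g' + 1))); pose proof (Rmin_r d2 (d1 / (Cmod g' + 1))).
  specialize (Q2 h ltac:(lra)).
  set (k := g (s + h)%R - g s) in *.
  pose proof (Rabs_pos h) as HA.
  assert (Hk : (Cmod k <= (Cmod g' + 1) * Rabs h)%R).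
  { replace k with ((k - RtoC h * g') + RtoC h * g') by ring.
    eapply Rle_trans; [apply Cmod_triangle|]; rewrite Cmod_mult, Cmod_R.
    assert (e2 <= 1)%R by apply Rmin_l; nra. }
  assert (Hkd : (Cmod k < d1)%R).
  { eapply Rle_lt_trans; [exact Hk|].
    assert (Rabs h < d1 / (Cmod g' + 1))%R by lra.
    apply Rmult_lt_reg_r with (/ (Cmod g' + 1))%R; [apply Rinv_0_lt_compat; lra|].
    replace ((Cmod g' + 1) * Rabs h * / (Cmod g' + 1))%R with (Rabs h) by (field; lra); exact H1. }
  specialize (Q1 k Hkd).
  replace (g (s + h)%R) with (z + k) by (unfold k; rewrite e; ring).
  rewrite e.
  replace (F (z + k)%C - F z - RtoC h * (l * g')) with
    ((F (z + k)%C - F z - l * k) + l * (k - RtoC h * g')) by ring.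
  eapply Rle_trans; [apply Cmod_triangle|]; rewrite (Cmod_mult l).
  assert (A : (eps / 2 / (Cmod g' + 1) * Cmod k <= eps / 2 * Rabs h)%R).
  { replace (eps / 2 * Rabs h)%R with (eps / 2 / (Cmod g' + 1) * ((Cmod g' + 1) * Rabs h))%R by (field; lra).
    apply Rmult_le_compat_l; trivial; left; apply Rdiv_lt_0_compat; lra. }
  assert (B : (Cmod l * Cmod (k - RtoC h * g') <= eps / 2 * Rabs h)%R).
  { apply Rle_trans with (Cmod l * (eps / 2 / (Cmod l + 1) * Rabs h))%R.
    - apply Rmult_le_compat_l; trivial; eapply Rle_trans; [exact Q2|].
      apply Rmult_le_compat_r; trivial; apply Rmin_r.
    - replace (Cmod l * (eps / 2 / (Cmod l + 1) * Rabs h))%R with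
        (eps / 2 * Rabs h * (Cmod l / (Cmod l + 1)))%R by (field; lra).
      rewrite <- (Rmult_1_r (eps / 2 * Rabs h)) at 2; apply Rmult_le_compat_l; [nra|].
      apply Rmult_le_reg_r with (Cmod l + 1)%R; [lra|].
      unfold Rdiv; rewrite Rmult_assoc, Rinv_l by lra; lra. }
  lra.
Qed.

Lemma Cdiff_ext_loc F G z l r : (0 < r)%R ->
  (forall w, (Cmod (w - z) < r)%R -> F w = G w) -> Cdiff F z l -> Cdiff G z l.
Proof.
  intros Hr E H eps He; destruct (H eps He) as [d [P Q]]; exists (Rmin d r); split; [now apply Rmin_glb_lt|].
  intros h Hh; pose proof (Rmin_l d r); pose proof (Rmin_r d r).
  rewrite <- !E; [apply Q; lra| |].
  - replace (z - z) with (RtoC 0) by ring; now rewrite Cmod_0.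
  - replace (z + h - z) with h by ring; lra.
Qed.

Lemma Cdiff_cont F z l eps : Cdiff F z l -> (0 < eps)%R ->
  exists d, (0 < d)%R /\ forall h, (Cmod h < d)%R -> (Cmod (F (z + h)%C - F z) < eps)%R.
Proof.
  intros H He; destruct (H 1%R ltac:(lra)) as [d [P Q]].
  pose proof (Cmod_ge_0 l).
  exists (Rmin d (eps / (Cmod l + 1))); split.
  { apply Rmin_glb_lt; trivial; apply Rdiv_lt_0_compat; lra. }
  intros h Hh; pose proof (Rmin_l d (eps / (Cmod l + 1))); pose proof (Rmin_r d (eps / (Cmod l + 1))).
  replace (F (z + h)%C - F z) with ((F (z + h)%C - F z - l * h) + l * h) by ring.
  eapply Rle_lt_trans; [apply Cmod_triangle|]; rewrite (Cmod_mult l).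
  specialize (Q h ltac:(lra)).
  assert (Cmod h * (Cmod l + 1) < eps)%R; [|lra].
  apply Rmult_lt_reg_r with (/ (Cmod l + 1))%R; [apply Rinv_0_lt_compat; lra|].
  rewrite Rmult_assoc, Rinv_r by lra; unfold Rdiv in *; lra.
Qed.

(** ** Absolutely convergent complex series *)

(** Summation by components: it is total, and agrees with [CSeries] on absolutely convergent
    series ([CSeries_csum]). *)
Definition csum (u : nat -> C) : C :=
  (Series (fun n => Re (u n)), Series (fun n => Im (u n))).

Definition cser (u : nat -> C) : Prop := ex_series (fun n => Cmod (u n)).

Lemma cser_re u : cser u -> ex_series (fun n => Re (u n)).
Proof.
  intros H; apply @ex_series_le with (b := fun n => Cmod (u n)); trivial.
  intros n; apply re_le_Cmod.
Qed.

Lemma cser_im u : cser u -> ex_series (fun n => Im (u n)).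
Proof.
  intros H; apply @ex_series_le with (b := fun n => Cmod (u n)); trivial.
  intros n; apply im_le_Cmod.
Qed.

Lemma cser_le u b : (forall n, (Cmod (u n) <= b n)%R) -> ex_series b -> cser u.
Proof.
  intros H Hb; apply @ex_series_le with (b := b); trivial.
  intros n; unfold norm; simpl; unfold abs; simpl; rewrite Rabs_pos_eq by apply Cmod_ge_0; apply H.
Qed.

Lemma cser_scal c u : cser u -> cser (fun n => c * u n).
Proof.
  intros H; apply (ex_series_ext (fun n => Cmod c * Cmod (u n))%R).
  - intros; now rewrite Cmod_mult.
  - apply (ex_series_scal_l (V := R_NormedModule) (Cmod c)); exact H.
Qed.

Lemma cser_plus u v : cser u -> cser v -> cser (fun n => u n + v n).
Proof.
  intros Hu Hv; apply (cser_le _ (fun n => Cmod (u n) + Cmod (v n))%R).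
  - intros; apply Cmod_triangle.
  - apply (ex_series_plus (V := R_NormedModule)); trivial.
Qed.

Lemma csum_ext u v : (forall n, u n = v n) -> csum u = csum v.
Proof. intros E; apply C_ext; simpl; apply Series_ext; intros; now rewrite E. Qed.

Lemma csum_plus u v : cser u -> cser v -> csum (fun n => u n + v n) = csum u + csum v.
Proof.
  intros Hu Hv; apply C_ext; simpl; apply Series_plus; (apply cser_re || apply cser_im); trivial.
Qed.

Lemma csum_scal c u : cser u -> csum (fun n => c * u n) = c * csum u.
Proof.
  intros Hu; pose proof (cser_re u Hu) as H1; pose proof (cser_im u Hu) as H2.
  assert (K : forall (x : R) w, ex_series w -> ex_series (fun n => x * w n)%R).
  { intros x w Hw; apply (ex_series_scal_l (V := R_NormedModule) x w Hw). }
  apply C_ext; simpl.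
  - rewrite (Series_minus (fun n => fst c * fst (u n))%R (fun n => snd c * snd (u n))%R)
      by (apply K; trivial); now rewrite !Series_scal_l.
  - rewrite (Series_plus (fun n => fst c * snd (u n))%R (fun n => snd c * fst (u n))%R)
      by (apply K; trivial); now rewrite !Series_scal_l.
Qed.

Lemma csum_bound u b : (forall n, (Cmod (u n) <= b n)%R) -> ex_series b -> (Cmod (csum u) <= 2 * Series b)%R.
Proof.
  intros H Hb; pose proof (cser_le u b H Hb) as Hu.
  assert (K : forall w : nat -> R, (forall n, (Rabs (w n) <= Cmod (u n))%R) -> (Rabs (Series w) <= Series b)%R).
  { intros w Hw; eapply Rle_trans; [apply Series_Rabs|].
    - apply @ex_series_le with (b := fun n => Cmod (u n)); trivial.
      intros n; unfold norm; simpl; unfold abs; simpl; rewrite Rabs_Rabsolu; apply Hw.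
    - apply Series_le; trivial; intros n; split; [apply Rabs_pos|].
      eapply Rle_trans; [apply Hw|apply H]. }
  eapply Rle_trans; [apply Cmod_le_ReIm|]; simpl.
  pose proof (K (fun n => Re (u n)) (fun n => re_le_Cmod _)).
  pose proof (K (fun n => Im (u n)) (fun n => im_le_Cmod _)); lra.
Qed.

Lemma cser_incr u : cser (fun n => u (S n)) <-> cser u.
Proof. symmetry; apply (ex_series_incr_1 (V := R_NormedModule) (fun n => Cmod (u n))). Qed.

Lemma csum_incr u : cser u -> csum u = u 0%nat + csum (fun n => u (S n)).
Proof.
  intros H; apply C_ext; simpl; apply Series_incr_1; [now apply cser_re|now apply cser_im].
Qed.

Definition pterm (a : nat -> C) (z : C) (n : nat) : C := a n * Cpow z n.
Definition psum (a : nat -> C) (z : C) : C := csum (pterm a z).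
(** The radius of absolute convergence is at least [R]. *)
Definition PSok (a : nat -> C) (R : R) : Prop :=
  forall r, (0 <= r < R)%R -> ex_series (fun n => Cmod (a n) * r ^ n)%R.

Lemma PSok_cser a R z : PSok a R -> (Cmod z < R)%R -> cser (pterm a z).
Proof.
  intros H Hz; eapply ex_series_ext; [|apply (H (Cmod z)); split; [apply Cmod_ge_0|exact Hz]].
  intros n; unfold pterm; now rewrite Cmod_mult, Cmod_pow.
Qed.

Lemma PSok_radius a R r : PSok a R -> (0 <= r < R)%R -> Rbar_lt (Rabs r) (CV_radius (fun n => Cmod (a n))).
Proof.
  intros H Hr; rewrite Rabs_pos_eq by lra.
  apply Rbar_lt_le_trans with ((r + R) / 2)%R; [simpl; lra|].
  assert (D : CV_disk (fun n => Cmod (a n)) ((r + R) / 2)).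
  { eapply ex_series_ext; [|apply (H ((r + R) / 2)%R); lra].
    intros n; simpl; rewrite Rabs_pos_eq; trivial.
    apply Rmult_le_pos; [apply Cmod_ge_0|apply pow_le; lra]. }
  unfold CV_radius; apply (Lub_Rbar_correct (CV_disk (fun n => Cmod (a n)))); exact D.
Qed.

Lemma radius_ex_series (A : nat -> R) r : (0 <= r)%R -> (forall n, (0 <= A n)%R) ->
  Rbar_lt (Rabs r) (CV_radius A) -> ex_series (fun n => A n * r ^ n)%R.
Proof.
  intros Hr HA H; apply CV_disk_inside in H.
  eapply ex_series_ext; [|exact H]; intros n; simpl; apply Rabs_pos_eq.
  apply Rmult_le_pos; [apply HA|now apply pow_le].
Qed.

Definition pder (a : nat -> C) (n : nat) : C := RtoC (INR (S n)) * a (S n).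

Lemma Cmod_pder a n : Cmod (pder a n) = PS_derive (fun n => Cmod (a n)) n.
Proof. unfold pder, PS_derive; rewrite Cmod_mult, Cmod_R, Rabs_pos_eq; trivial; apply pos_INR. Qed.

Lemma PSok_pder a R : PSok a R -> PSok (pder a) R.
Proof.
  intros H r Hr; apply (ex_series_ext (fun n => PS_derive (fun n => Cmod (a n)) n * r ^ n)%R).
  - intros n; now rewrite Cmod_pder.
  - apply radius_ex_series; [lra| |].
    + intros; rewrite <- Cmod_pder; apply Cmod_ge_0.
    + rewrite CV_radius_derive; now apply PSok_radius with R.
Qed.

(** Second-order remainder of a power, with a constant whose series in [n] is that of a second
    derivative; it is what differentiates a power series term by term. *)
Lemma power_taylor (z h : C) (r : R) (n : nat) :
  (Cmod z <= r)%R -> (Cmod (z + h) <= r)%R ->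
  (Cmod (Cpow (z + h) (S (S n)) - Cpow z (S (S n)) - RtoC (INR (S (S n))) * h * Cpow z (S n))
   <= Cmod h * Cmod h * (INR (S (S n)) * INR (S n) * r ^ n))%R.
Proof.
  intros Hz Hzh; pose proof (Cmod_ge_0 z); pose proof (Cmod_ge_0 h); pose proof (Cmod_ge_0 (z + h)).
  induction n as [|n IH].
  - simpl INR; replace (_ - _ - _) with (h * h) by (rewrite !Cpow_S; simpl; unfold RtoC; apply C_ext; simpl; ring).
    rewrite Cmod_mult; simpl; nra.
  - set (T := Cpow (z + h) (S (S n)) - Cpow z (S (S n)) - RtoC (INR (S (S n))) * h * Cpow z (S n)) in *.
    replace (Cpow (z + h) (S (S (S n))) - Cpow z (S (S (S n))) - RtoC (INR (S (S (S n)))) * h * Cpow z (S (S n)))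
      with ((z + h) * T + RtoC (INR (S (S n))) * (h * h) * Cpow z (S n)).
    2:{ unfold T; rewrite (S_INR (S (S n))), RtoC_plus, (Cpow_S (z + h) (S (S n))), (Cpow_S z (S (S n))), (Cpow_S z (S n)).
        ring. }
    eapply Rle_trans; [apply Cmod_triangle|].
    rewrite !Cmod_mult, Cmod_R, Cmod_pow, (Rabs_pos_eq (INR _)) by apply pos_INR.
    assert (Hp : (Cmod z ^ S n <= r ^ S n)%R) by (apply pow_incr; lra).
    assert (Hr : (0 <= r)%R) by lra.
    pose proof (pow_le r n Hr) as Hrn; pose proof (pow_le r (S n) Hr) as HrSn.
    rewrite (S_INR (S (S n))).
    pose proof (pos_INR (S (S n))) as N2.
    apply Rle_trans with (r * (Cmod h * Cmod h * (INR (S (S n)) * INR (S n) * r ^ n))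
       + INR (S (S n)) * (Cmod h * Cmod h) * r ^ S n)%R.
    + apply Rplus_le_compat.
      * apply Rmult_le_compat; trivial; apply Cmod_ge_0.
      * apply Rmult_le_compat_l; trivial; apply Rmult_le_pos; trivial; nra.
    + rewrite (S_INR (S n)) in *.
      assert (E : (r * (Cmod h * Cmod h * ((INR (S n) + 1) * INR (S n) * r ^ n))
       + (INR (S n) + 1) * (Cmod h * Cmod h) * r ^ S n
       = Cmod h * Cmod h * ((INR (S n) + 1) * (INR (S n) + 1) * r ^ S n))%R) by (simpl pow; ring).
      rewrite E; apply Rmult_le_compat_l; [nra|].
      apply Rmult_le_compat_r; trivial; nra.
Qed.

(** Summing [power_taylor] bounds the remainder by a constant times the square of the increment. *)
Lemma psum_Cdiff a R z : PSok a R -> (Cmod z < R)%R -> Cdiff (psum a) z (psum (pder a) z).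
Proof.
  intros H Hz.
  set (r := ((Cmod z + R) / 2)%R).
  assert (Hr : (Cmod z < r < R)%R) by (unfold r; lra).
  pose proof (Cmod_ge_0 z) as Z0.
  pose proof (PSok_pder _ _ (PSok_pder _ _ H)) as H2.
  assert (Sm : ex_series (fun n => Cmod (pder (pder a) n) * r ^ n)%R) by (apply H2; lra).
  set (S2 := Series (fun n => Cmod (pder (pder a) n) * r ^ n)%R) in *.
  assert (S0 : (0 <= S2)%R).
  { rewrite <- (Rmult_0_l S2); unfold S2; rewrite <- Series_scal_l.
    apply Series_le; trivial; intros n; rewrite Rmult_0_l; split; [lra|].
    apply Rmult_le_pos; [apply Cmod_ge_0|apply pow_le; lra]. }
  assert (K : forall h, (Cmod h < r - Cmod z)%R ->
    (Cmod (psum a (z + h) - psum a z - psum (pder a) z * h) <= 2 * (Cmod h * Cmod h * S2))%R).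
  { intros h Hh.
    assert (Hzh : (Cmod (z + h) <= r)%R) by (eapply Rle_trans; [apply Cmod_triangle|lra]).
    assert (C1 : cser (pterm a (z + h))) by (apply PSok_cser with R; trivial; lra).
    assert (C2 : cser (pterm a z)) by (apply PSok_cser with R; trivial; lra).
    assert (C3 : cser (pterm (pder a) z)) by (apply PSok_cser with R; trivial; now apply PSok_pder).
    unfold psum.
    rewrite (csum_incr _ C1), (csum_incr _ C2).
    rewrite <- cser_incr in C1, C2.
    pose (v := fun n => pterm a (z + h) (S n) + (- (1)) * pterm a z (S n) + (- h) * pterm (pder a) z n).
    assert (C4 : cser (fun n => (- (1)) * pterm a z (S n))) by exact (cser_scal _ _ C2).
    assert (C5 : cser (fun n => (- h) * pterm (pder a) z n)) by exact (cser_scal _ _ C3).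
    assert (C6 : cser (fun n => pterm a (z + h) (S n) + (- (1)) * pterm a z (S n))) by exact (cser_plus _ _ C1 C4).
    assert (Cv : cser v) by exact (cser_plus _ _ C6 C5).
    assert (E : csum v = csum (fun n => pterm a (z + h) (S n)) + (- (1)) * csum (fun n => pterm a z (S n))
       + (- h) * csum (pterm (pder a) z)).
    { unfold v; now rewrite (csum_plus _ _ C6 C5), (csum_plus _ _ C1 C4), (csum_scal _ _ C2), (csum_scal _ _ C3). }
    replace (_ - _ - _) with (csum v).
    2:{ rewrite E; unfold pterm; simpl; ring. }
    rewrite (csum_incr _ Cv).
    replace (v 0%nat) with (RtoC 0).
    2:{ unfold v, pterm, pder; rewrite !Cpow_S; simpl; ring. }
    rewrite Cplus_0_l.
    unfold S2; rewrite <- (Series_scal_l (Cmod h * Cmod h)).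
    apply csum_bound.
    - intros n; unfold v, pterm.
      replace (_ + _ + _) with (a (S (S n)) * (Cpow (z + h) (S (S n)) - Cpow z (S (S n)) - RtoC (INR (S (S n))) * h * Cpow z (S n))).
      2:{ unfold pder; ring. }
      rewrite Cmod_mult.
      eapply Rle_trans; [apply Rmult_le_compat_l; [apply Cmod_ge_0|apply power_taylor with (r := r); lra]|].
      unfold pder; rewrite !Cmod_mult, !Cmod_R, !Rabs_pos_eq by apply pos_INR.
      right; ring.
    - apply (ex_series_scal_l (V := R_NormedModule)); exact Sm. }
  intros eps He; exists (Rmin (r - Cmod z) (eps / (2 * S2 + 1))); split.
  { apply Rmin_glb_lt; [lra|apply Rdiv_lt_0_compat; lra]. }
  intros h Hh; pose proof (Rmin_l (r - Cmod z) (eps / (2 * S2 + 1))); pose proof (Rmin_r (r - Cmod z) (eps / (2 * S2 + 1))).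
  eapply Rle_trans; [apply K; lra|].
  pose proof (Cmod_ge_0 h).
  assert (Cmod h * (2 * S2 + 1) <= eps)%R.
  { apply Rmult_le_reg_r with (/ (2 * S2 + 1))%R; [apply Rinv_0_lt_compat; lra|].
    rewrite Rmult_assoc, Rinv_r by lra; unfold Rdiv in *; lra. }
  nra.
Qed.

Lemma PSok_scal c a R : PSok a R -> PSok (fun n => c * a n) R.
Proof.
  intros H r Hr; apply (ex_series_ext (fun n => Cmod c * (Cmod (a n) * r ^ n))%R).
  - intros; rewrite Cmod_mult; simpl; ring.
  - apply (ex_series_scal_l (V := R_NormedModule)); now apply H.
Qed.

Lemma ex_series_le_R (a b : nat -> R) :
  (forall n, (0 <= a n <= b n)%R) -> ex_series b -> ex_series a.
Proof.
  intros H Hb; apply @ex_series_le with (b := b); trivial.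
  intros n; unfold norm; simpl; unfold abs; simpl; rewrite Rabs_pos_eq; apply H.
Qed.

Lemma PSok_le a (B : nat -> R) R :
  (forall n, (Cmod (a n) <= B n)%R) ->
  (forall r, (0 <= r < R)%R -> ex_series (fun n => B n * r ^ n)%R) -> PSok a R.
Proof.
  intros H HB r Hr; apply ex_series_le_R with (b := fun n => (B n * r ^ n)%R); [|now apply HB].
  intros n; assert (0 <= r ^ n)%R by (apply pow_le; lra).
  split; [apply Rmult_le_pos; trivial; apply Cmod_ge_0|now apply Rmult_le_compat_r].
Qed.

Lemma PSok_plus a b R : PSok a R -> PSok b R -> PSok (fun n => a n + b n) R.
Proof.
  intros Ha Hb; apply PSok_le with (fun n => Cmod (a n) + Cmod (b n))%R; [intros; apply Cmod_triangle|].
  intros r Hr; apply (ex_series_ext (fun n => Cmod (a n) * r ^ n + Cmod (b n) * r ^ n)%R).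
  - intros; simpl; ring.
  - apply (ex_series_plus (V := R_NormedModule)); [now apply Ha|now apply Hb].
Qed.

Definition pshift (a : nat -> C) (n : nat) : C := match n with O => 0 | S m => a m end.

Lemma PSok_pshift a R : PSok a R -> PSok (pshift a) R.
Proof.
  intros H r Hr; apply (ex_series_incr_1 (V := R_NormedModule)).
  apply (ex_series_ext (fun n => r * (Cmod (a n) * r ^ n))%R).
  - intros; simpl; ring.
  - apply (ex_series_scal_l (V := R_NormedModule)); now apply H.
Qed.

Lemma PSok_weaken a R R' : (R' <= R)%R -> PSok a R -> PSok a R'.
Proof. intros Hle H r Hr; apply H; lra. Qed.

Lemma psum_plus a b R z : PSok a R -> PSok b R -> (Cmod z < R)%R ->
  psum (fun n => a n + b n) z = psum a z + psum b z.
Proof.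
  intros Ha Hb Hz; unfold psum; rewrite <- csum_plus by (eapply PSok_cser; eassumption).
  apply csum_ext; intros; unfold pterm; ring.
Qed.

Lemma psum_scal c a R z : PSok a R -> (Cmod z < R)%R -> psum (fun n => c * a n) z = c * psum a z.
Proof.
  intros Ha Hz; unfold psum; rewrite <- csum_scal by (eapply PSok_cser; eassumption).
  apply csum_ext; intros; unfold pterm; ring.
Qed.

Lemma psum_pshift a R z : PSok a R -> (Cmod z < R)%R -> psum (pshift a) z = z * psum a z.
Proof.
  intros Ha Hz; unfold psum.
  rewrite csum_incr by (eapply PSok_cser; [apply PSok_pshift|]; eassumption).
  rewrite <- csum_scal by (eapply PSok_cser; eassumption).
  replace (pterm (pshift a) z 0) with (RtoC 0) by (unfold pterm; simpl; ring).
  rewrite Cplus_0_l; apply csum_ext; intros; unfold pterm; simpl; ring.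
Qed.

Lemma psum_ext a b z : (forall n, a n = b n) -> psum a z = psum b z.
Proof. intros E; apply csum_ext; intros; unfold pterm; now rewrite E. Qed.

Lemma psum_0 a : psum a 0 = a 0%nat.
Proof.
  unfold psum; rewrite csum_incr.
  - rewrite (csum_ext _ (fun _ => 0 * 0)).
    + rewrite csum_scal; [unfold pterm; simpl; ring|].
      apply cser_le with (fun n => (0 * (/ 2) ^ n)%R); [intros; rewrite Cmod_0; lra|].
      apply (ex_series_scal_l (V := R_NormedModule)), ex_series_geom; rewrite Rabs_pos_eq; lra.
    + intros; unfold pterm; rewrite Cpow_S; ring.
  - apply cser_incr, cser_le with (fun n => (0 * (/ 2) ^ n)%R).
    + intros; unfold pterm; rewrite Cpow_S, !Cmod_mult, Cmod_0; lra.
    + apply (ex_series_scal_l (V := R_NormedModule)), ex_series_geom; rewrite Rabs_pos_eq; lra.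
Qed.

(** Analyticity with absolute convergence built in; see [analytic_at_an]. *)
Definition an (f : C -> C) (z0 : C) : Prop :=
  exists a r, (0 < r)%R /\ PSok a r /\ forall z, (Cmod (z - z0) < r)%R -> f z = psum a (z - z0).

Lemma an_ext_loc f g z0 r : (0 < r)%R -> (forall z, (Cmod (z - z0) < r)%R -> f z = g z) -> an f z0 -> an g z0.
Proof.
  intros Hr E (a & r' & H1 & H2 & H3); exists a, (Rmin r r'); split; [now apply Rmin_glb_lt|]; split.
  - eapply PSok_weaken; [|exact H2]; apply Rmin_r.
  - intros z Hz; pose proof (Rmin_l r r'); pose proof (Rmin_r r r').
    rewrite <- E by lra; apply H3; lra.
Qed.

Lemma an_plus f g z0 : an f z0 -> an g z0 -> an (fun z => f z + g z) z0.
Proof.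
  intros (a & r & H1 & H2 & H3) (a' & r' & H1' & H2' & H3').
  pose proof (Rmin_l r r'); pose proof (Rmin_r r r').
  exists (fun n => a n + a' n), (Rmin r r'); split; [now apply Rmin_glb_lt|].
  apply (PSok_weaken _ _ (Rmin r r')) in H2; trivial; apply (PSok_weaken _ _ (Rmin r r')) in H2'; trivial.
  split; [now apply PSok_plus|]; intros z Hz.
  rewrite (psum_plus _ _ (Rmin r r')), H3, H3'; trivial; lra.
Qed.

Lemma an_scal c f z0 : an f z0 -> an (fun z => c * f z) z0.
Proof.
  intros (a & r & H1 & H2 & H3); exists (fun n => c * a n), r; repeat split; trivial.
  - now apply PSok_scal.
  - intros z Hz; rewrite (psum_scal c a r), H3; trivial.
Qed.

Lemma an_mulX f z0 : an f z0 -> an (fun z => z * f z) z0.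
Proof.
  intros (a & r & H1 & H2 & H3); exists (fun n => z0 * a n + pshift a n), r; repeat split; trivial.
  - apply PSok_plus; [now apply PSok_scal|now apply PSok_pshift].
  - intros z Hz.
    rewrite (psum_plus _ _ r), (psum_scal _ _ r), (psum_pshift _ r), H3; trivial.
    + ring.
    + now apply PSok_scal.
    + now apply PSok_pshift.
Qed.

Lemma Cdiff_shift F z0 z l : Cdiff F (z - z0) l -> Cdiff (fun z => F (z - z0)) z l.
Proof.
  intros H eps He; destruct (H eps He) as [d [P Q]]; exists d; split; trivial; intros h Hh.
  replace (z + h - z0) with (z - z0 + h) by ring; now apply Q.
Qed.

(** The derivative along the real direction, as a total operator; it is the complex derivative wherever
    that exists ([hol_Cder]). *)
Definition Cder (f : C -> C) (z : C) : C :=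
  (Derive (fun x => Re (f (z + RtoC x)%C)) 0, Derive (fun x => Im (f (z + RtoC x)%C)) 0).

Lemma hol_Cder f z l : hol f z l -> Cder f z = l.
Proof.
  intros H.
  destruct (H (fun x => z + RtoC x) 0%R 1) as [H1 H2]; [ring| |].
  - apply (cder_ext (fun x => z + RtoC x * 1)); [intros; ring|apply cder_line].
  - apply C_ext; unfold Cder.
    + etransitivity; [apply (is_derive_unique _ _ _ H1)|f_equal; ring].
    + etransitivity; [apply (is_derive_unique _ _ _ H2)|f_equal; ring].
Qed.

Lemma an_Cder f z0 : an f z0 ->
  exists r, (0 < r)%R /\ (forall z, (Cmod (z - z0) < r)%R -> Cdiff f z (Cder f z)) /\ an (Cder f) z0.
Proof.
  intros (a & r & H1 & H2 & H3).
  assert (D : forall z, (Cmod (z - z0) < r)%R -> Cdiff f z (psum (pder a) (z - z0))).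
  { intros z Hz; apply Cdiff_ext_loc with (fun z => psum a (z - z0)) (r - Cmod (z - z0))%R; [lra| |].
    - intros w Hw; symmetry; apply H3.
      replace (w - z0) with ((w - z) + (z - z0)) by ring; eapply Rle_lt_trans; [apply Cmod_triangle|lra].
    - apply Cdiff_shift, psum_Cdiff with r; trivial. }
  exists r; repeat split; trivial.
  - intros z Hz; rewrite (hol_Cder f z _ (Cdiff_hol _ _ _ (D z Hz))); now apply D.
  - exists (pder a), r; repeat split; trivial; [now apply PSok_pder|].
    intros z Hz; apply hol_Cder, Cdiff_hol, D; trivial.
Qed.

Lemma an_hol f z0 : an f z0 -> hol f z0 (Cder f z0).
Proof.
  intros H; destruct (an_Cder f z0 H) as (r & Hr & D & _); apply Cdiff_hol, D.
  replace (z0 - z0) with (RtoC 0) by ring; now rewrite Cmod_0.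
Qed.

Lemma an_der f z0 : an f z0 -> an (Cder f) z0.
Proof. intros H; now destruct (an_Cder f z0 H) as (r & Hr & D & K). Qed.

(** Splitting off the power that corresponds to the leading zero coefficients. *)
Lemma psum_factor a r N z : PSok a r -> (Cmod z < r)%R ->
  (forall n, (n < N)%nat -> a n = 0) ->
  psum a z = Cpow z N * psum (fun n => a (N + n)%nat) z /\ PSok (fun n => a (N + n)%nat) r.
Proof.
  revert a; induction N as [|N IH]; intros a Ha Hz H0.
  - split; [change (fun n => a (0 + n)%nat) with (fun n => a n); simpl; rewrite Cmult_1_l; apply psum_ext; reflexivity|exact Ha].
  - assert (Hs : PSok (fun n => a (S n)) r).
    { apply PSok_le with (fun n => Cmod (pder a n)).
      - intros n; unfold pder; rewrite Cmod_mult, Cmod_R, Rabs_pos_eq by apply pos_INR.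
        rewrite S_INR; pose proof (pos_INR n); pose proof (Cmod_ge_0 (a (S n))); nra.
      - apply (PSok_pder _ _ Ha). }
    destruct (IH (fun n => a (S n)) Hs Hz) as [E K]; [intros; apply H0; lia|].
    split; [|exact K].
    rewrite Cpow_S, <- Cmult_assoc.
    change (fun n => a (S N + n)%nat) with (fun n => a (S (N + n))); rewrite <- E.
    rewrite <- (psum_pshift _ r) by trivial; apply psum_ext.
    intros [|n]; simpl; trivial; apply H0; lia.
Qed.

Lemma Cmult_zero (z w : C) : z * w = 0 -> z = 0 \/ w = 0.
Proof.
  intros H; apply (f_equal Cmod) in H; rewrite Cmod_mult, Cmod_0 in H.
  apply Rmult_integral in H; destruct H; [left|right]; now apply Cmod_eq_0.
Qed.

(** The first nonzero coefficient dominates near the centre, so zeros cannot accumulate. *)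
Lemma an_zero f z0 : an f z0 ->
  (forall eps, (0 < eps)%R -> exists z, (0 < Cmod (z - z0) < eps)%R /\ f z = 0) ->
  exists r, (0 < r)%R /\ forall z, (Cmod (z - z0) < r)%R -> f z = 0.
Proof.
  intros (a & r & H1 & H2 & H3) Hz.
  assert (A : forall N n, (n < N)%nat -> a n = 0).
  { induction N as [|N IH]; [lia|].
    assert (HN : a N = 0).
    { destruct (Ceq_dec (a N) 0) as [|Hne]; trivial; exfalso.
      assert (Ok : PSok (fun n => a (N + n)%nat) r).
      { apply (psum_factor a r N 0); trivial; now rewrite Cmod_0. }
      assert (Dz : Cdiff (psum (fun n => a (N + n)%nat)) 0 (psum (pder (fun n => a (N + n)%nat)) 0)).
      { apply psum_Cdiff with r; trivial; now rewrite Cmod_0. }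
      apply Cmod_gt_0 in Hne.
      destruct (Cdiff_cont _ _ _ _ Dz Hne) as [d [Hd Hd']].
      destruct (Hz (Rmin r d)) as [z [[Z1 Z2] Z3]]; [now apply Rmin_glb_lt|].
      pose proof (Rmin_l r d); pose proof (Rmin_r r d).
      specialize (Hd' (z - z0) ltac:(lra)).
      rewrite psum_0, Cplus_0_l in Hd'; replace (N + 0)%nat with N in Hd' by lia.
      rewrite (H3 z ltac:(lra)) in Z3.
      rewrite (proj1 (psum_factor a r N (z - z0) H2 ltac:(lra) IH)) in Z3.
      apply Cmult_zero in Z3; destruct Z3 as [Z3|Z3].
      - revert Z3; apply Cpow_nz, Cmod_gt_0; lra.
      - rewrite Z3 in Hd'; replace (0 - a N) with (- a N) in Hd' by ring; rewrite Cmod_opp in Hd'; lra. }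
    intros n Hn; destruct (Nat.eq_dec n N) as [->|]; trivial; apply IH; lia. }
  exists r; split; trivial; intros z Hz'; rewrite H3 by trivial.
  rewrite (psum_ext a (fun n => 0 * a n)), (psum_scal 0 a r); trivial; [ring|].
  intros n; rewrite (A (S n) n) by lia; ring.
Qed.

Definition vanishes_near (f : C -> C) (z0 : C) : Prop :=
  exists r, (0 < r)%R /\ forall z, (Cmod (z - z0) < r)%R -> f z = 0.

Lemma cder_moves g s g' eps : cder g s g' -> g' <> 0 -> (0 < eps)%R ->
  exists d, (0 < d)%R /\ forall h, (0 < Rabs h < d)%R -> (0 < Cmod (g (s + h)%R - g s) < eps)%R.
Proof.
  intros H Hn He; apply Cmod_gt_0 in Hn; rewrite cder_eps in H.
  destruct (H (Cmod g' / 2)%R ltac:(lra)) as [d [P Q]].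
  exists (Rmin d (eps / (2 * Cmod g'))); split; [apply Rmin_glb_lt; trivial; apply Rdiv_lt_0_compat; lra|].
  intros h Hh; pose proof (Rmin_l d (eps / (2 * Cmod g'))); pose proof (Rmin_r d (eps / (2 * Cmod g'))).
  specialize (Q h ltac:(lra)).
  assert (Hhe : (2 * Cmod g' * Rabs h < eps)%R).
  { apply Rmult_lt_reg_r with (/ (2 * Cmod g'))%R; [apply Rinv_0_lt_compat; lra|].
    replace (2 * Cmod g' * Rabs h * / (2 * Cmod g'))%R with (Rabs h) by (field; lra); unfold Rdiv in *; lra. }
  set (k := g (s + h)%R - g s) in *.
  assert (U : (Cmod k <= Cmod (k - RtoC h * g') + Cmod (RtoC h * g'))%R).
  { replace k with ((k - RtoC h * g') + RtoC h * g') at 1 by ring; apply Cmod_triangle. }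
  assert (V : (Cmod (RtoC h * g') <= Cmod k + Cmod (k - RtoC h * g'))%R).
  { replace (RtoC h * g') with (k + - (k - RtoC h * g')) at 1 by ring.
    eapply Rle_trans; [apply Cmod_triangle|]; rewrite Cmod_opp; lra. }
  rewrite Cmod_mult, Cmod_R in U, V; nra.
Qed.

Lemma ccont_eps g s eps : ccont g s -> (0 < eps)%R ->
  exists d, (0 < d)%R /\ forall h, (Rabs h < d)%R -> (Cmod (g (s + h)%R - g s) < eps)%R.
Proof.
  intros [H1 H2] He.
  pose proof (proj1 (continuity_pt_locally _ _) H1 (mkposreal (eps / 2) ltac:(lra))) as [d1 K1].
  pose proof (proj1 (continuity_pt_locally _ _) H2 (mkposreal (eps / 2) ltac:(lra))) as [d2 K2].
  exists (Rmin d1 d2); split; [apply Rmin_glb_lt; apply cond_pos|]; intros h Hh.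
  pose proof (Rmin_l d1 d2); pose proof (Rmin_r d1 d2).
  eapply Rle_lt_trans; [apply Cmod_le_ReIm|].
  assert (A1 : (Rabs (s + h - s) < d1)%R) by (replace (s + h - s)%R with h by ring; lra).
  assert (A2 : (Rabs (s + h - s) < d2)%R) by (replace (s + h - s)%R with h by ring; lra).
  specialize (K1 _ A1); specialize (K2 _ A2); simpl in *.
  unfold Re, Im in *; simpl; unfold Rminus in *; lra.
Qed.

(** The parameters up to which [f] vanishes form an open set by definition and a closed one by [an_zero]; the
    derivative of the curve is nonzero so that the earlier zeros are distinct from the limiting point. *)
Lemma zero_propagation f (g : R -> C) (a b : R) :
  (forall s, (a <= s <= b)%R -> an f (g s) /\ exists g' : C, g' <> 0 /\ cder g s g') ->
  vanishes_near f (g a) -> forall s, (a <= s <= b)%R -> vanishes_near f (g s).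
Proof.
  intros H Ha s0 Hs0.
  set (E := fun s => (a <= s <= s0)%R /\ forall s', (a <= s' <= s)%R -> vanishes_near f (g s')).
  assert (Ea : E a).
  { split; [lra|]; intros s' Hs'; now replace s' with a by lra. }
  destruct (completeness E) as [m [Hm1 Hm2]].
  { exists s0; intros x [Hx _]; lra. }
  { now exists a. }
  assert (Hma : (a <= m)%R) by now apply Hm1.
  assert (Hms : (m <= s0)%R) by (apply Hm2; intros x [Hx _]; lra).
  assert (Below : forall s, (a <= s < m)%R -> vanishes_near f (g s)).
  { intros s Hs; destruct (classic (exists x, E x /\ (s < x)%R)) as [[x [[_ Hx] Hsx]]|N].
    - apply Hx; lra.
    - exfalso; assert (m <= s)%R; [|lra].
      apply Hm2; intros x Hx; destruct (Rle_or_lt x s); trivial; exfalso; apply N; now exists x. }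
  assert (At : vanishes_near f (g m)).
  { destruct (Req_dec m a) as [->|Hne]; trivial.
    destruct (H m ltac:(lra)) as [Han [g' [Hg' Hd]]].
    apply an_zero; trivial; intros eps He.
    destruct (cder_moves g m g' eps Hd Hg' He) as [d [Pd Qd]].
    set (h := Rmin (d / 2) (m - a)).
    assert (Hh : (0 < h)%R) by (apply Rmin_glb_lt; lra).
    assert (h <= d / 2 /\ h <= m - a)%R as [] by (split; [apply Rmin_l|apply Rmin_r]).
    exists (g (m + - h)%R); split.
    - apply Qd; rewrite Rabs_Ropp, Rabs_pos_eq by lra; lra.
    - destruct (Below (m + - h)%R ltac:(lra)) as [r [Hr Hr']]; apply Hr'.
      replace (_ - _) with (RtoC 0) by ring; now rewrite Cmod_0. }
  destruct (Req_dec m s0) as [<-|Hne]; trivial; exfalso.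
  destruct At as [r [Hr Hr']].
  destruct (H m ltac:(lra)) as [_ [g' [_ Hd]]]; apply cder_ccont in Hd.
  destruct (ccont_eps g m r Hd Hr) as [d [Pd Qd]].
  set (h := Rmin (d / 2) (s0 - m)).
  assert (Hh : (0 < h)%R) by (apply Rmin_glb_lt; lra).
  assert (h <= d / 2 /\ h <= s0 - m)%R as [] by (split; [apply Rmin_l|apply Rmin_r]).
  assert (E (m + h)%R); [|specialize (Hm1 _ H2); lra].
  split; [lra|]; intros s' Hs'; destruct (Rlt_or_le s' m); [apply Below; lra|].
  specialize (Qd (s' - m)%R ltac:(rewrite Rabs_pos_eq; lra)).
  replace (m + (s' - m))%R with s' in Qd by ring.
  exists (r - Cmod (g s' - g m))%R; split; [lra|]; intros z Hz; apply Hr'.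
  replace (z - g m) with ((z - g s') + (g s' - g m)) by ring.
  eapply Rle_lt_trans; [apply Cmod_triangle|lra].
Qed.

(** ** Comparison with limits along filters *)

Lemma is_series_components (u : nat -> C) (l : C) :
  is_series (K := C_AbsRing) (V := C_NormedModule) u l ->
  is_series (fun n => Re (u n)) (Re l) /\ is_series (fun n => Im (u n)) (Im l).
Proof.
  intros H.
  assert (H0 : filterlim (sum_n (G := C_AbelianMonoid) u) eventually (locally (T := C_UniformSpace) l)) by exact H.
  split; unfold is_series.
  - apply filterlim_ext with (fun n => Re (sum_n (G := C_AbelianMonoid) u n)).
    + induction x; [now rewrite !sum_O|]; rewrite !sum_Sn, <- IHx; reflexivity.
    + eapply filterlim_comp; [exact H0|]; intros P [e He]; exists e; intros y Hy; apply He; apply Hy.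
  - apply filterlim_ext with (fun n => Im (sum_n (G := C_AbelianMonoid) u n)).
    + induction x; [now rewrite !sum_O|]; rewrite !sum_Sn, <- IHx; reflexivity.
    + eapply filterlim_comp; [exact H0|]; intros P [e He]; exists e; intros y Hy; apply He; apply Hy.
Qed.

Lemma pow_n_Cpow (z : C) n : pow_n (K := C_Ring) z n = Cpow z n.
Proof. induction n; simpl; [reflexivity|rewrite IHn; reflexivity]. Qed.

(** Convergence at one point bounds the terms there, which is what gives absolute convergence on
    every smaller disk in [analytic_at_an]. *)
Lemma is_pseries_psum (a : nat -> C) (z l : C) :
  is_pseries (K := C_AbsRing) (V := C_NormedModule) a z l ->
  psum a z = l /\ exists B, forall n, (Cmod (pterm a z n) <= B)%R.
Proof.
  intros H; apply is_series_components in H.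
  assert (E : forall n, scal (pow_n (K := C_AbsRing) z n) (a n) = pterm a z n).
  { intros; unfold pterm; rewrite Cmult_comm, <- pow_n_Cpow; reflexivity. }
  destruct H as [H1 H2].
  apply is_series_ext with (b := fun n => Re (pterm a z n)) in H1; [|intros; now rewrite E].
  apply is_series_ext with (b := fun n => Im (pterm a z n)) in H2; [|intros; now rewrite E].
  split.
  - apply C_ext; now apply is_series_unique.
  - assert (K : forall w : nat -> R, ex_series w -> exists B, forall n, (Rabs (w n) <= B)%R).
    { intros w Hw; apply ex_series_lim_0 in Hw; apply is_lim_seq_Reals in Hw.
      destruct (maj_by_pos w) as [B [_ HB]]; [now exists 0%R|now exists B]. }
    destruct (K _ (ex_intro _ _ H1)) as [B1 K1], (K _ (ex_intro _ _ H2)) as [B2 K2].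
    exists (B1 + B2)%R; intros n; eapply Rle_trans; [apply Cmod_le_ReIm|].
    specialize (K1 n); specialize (K2 n); lra.
Qed.

Lemma ball_Cmod (z0 z : C) (eps : posreal) :
  (Cmod (z - z0) < eps)%R -> ball (M := C_UniformSpace) z0 eps z.
Proof. intros H; apply C_NormedModule_mixin_compat1; exact H. Qed.

Lemma analytic_at_an f z0 : analytic_at f z0 -> an f z0.
Proof.
  intros [a [eps Ha]]; exists a, (pos eps); split; [apply cond_pos|].
  assert (Ha' : forall z, (Cmod (z - z0) < eps)%R -> psum a (z - z0) = f z /\
     exists B, forall n, (Cmod (pterm a (z - z0) n) <= B)%R).
  { intros z Hz; apply is_pseries_psum, Ha, ball_Cmod, Hz. }
  split.
  - intros r Hr; set (q := ((r + eps) / 2)%R).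
    assert (Hq : (r < q < eps)%R) by (unfold q; lra).
    destruct (Ha' (z0 + RtoC q)) as [_ [B HB]].
    { replace (z0 + RtoC q - z0) with (RtoC q) by ring; rewrite Cmod_R, Rabs_pos_eq; lra. }
    assert (HB' : forall n, (Cmod (a n) * q ^ n <= B)%R).
    { intros n; specialize (HB n); unfold pterm in HB.
      replace (z0 + RtoC q - z0) with (RtoC q) in HB by ring.
      rewrite Cmod_mult, Cmod_pow, Cmod_R, Rabs_pos_eq in HB; lra. }
    assert (Hrq : (0 <= r / q < 1)%R).
    { split; [apply Rmult_le_pos; [lra|left; apply Rinv_0_lt_compat; lra]|].
      apply Rmult_lt_reg_r with q; [lra|]; unfold Rdiv; rewrite Rmult_assoc, Rinv_l; lra. }
    apply ex_series_le_R with (b := fun n => (B * (r / q) ^ n)%R).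
    + intros n; split; [apply Rmult_le_pos; [apply Cmod_ge_0|apply pow_le; lra]|].
      replace (r ^ n)%R with (q ^ n * (r / q) ^ n)%R.
      2:{ rewrite <- Rpow_mult_distr; f_equal; field; lra. }
      rewrite <- Rmult_assoc; apply Rmult_le_compat_r; [apply pow_le; lra|apply HB'].
    + apply (ex_series_scal_l (V := R_NormedModule)), ex_series_geom; rewrite Rabs_pos_eq; lra.
  - intros z Hz; symmetry; now apply Ha'.
Qed.

Lemma Clim_unique {T : Type} (f : T -> C) (F : (T -> Prop) -> Prop) {FF : ProperFilter F} (l : C) :
  filterlim f F (locally (T := C_UniformSpace) l) -> Clim f F = l.
Proof.
  intros H; unfold Clim; apply (iota_unique (V := C_R_CompleteNormedModule)); trivial.
  intros y Hy; apply (filterlim_locally_unique (V := C_R_NormedModule) (F := F) f); trivial.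
Qed.

Lemma filterlim_C {T : Type} (f : T -> C) (F : (T -> Prop) -> Prop) {FF : Filter F} (l : C) :
  filterlim (fun x => Re (f x)) F (locally (Re l)) -> filterlim (fun x => Im (f x)) F (locally (Im l)) ->
  filterlim f F (locally (T := C_UniformSpace) l).
Proof.
  intros H1 H2 P [e He].
  assert (K1 : F (fun x => ball (Re l) e (Re (f x)))) by (apply H1; exists e; trivial).
  assert (K2 : F (fun x => ball (Im l) e (Im (f x)))) by (apply H2; exists e; trivial).
  unfold filtermap; generalize (filter_and _ _ K1 K2); apply filter_imp; intros x [Hx Hy].
  apply He; split; trivial.
Qed.

Lemma CSeries_csum u : cser u -> CSeries u = csum u.
Proof.
  intros H; apply Clim_unique; [apply eventually_filter|].
  pose proof (Series_correct _ (cser_re u H)) as S1; pose proof (Series_correct _ (cser_im u H)) as S2.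
  apply filterlim_C; [apply eventually_filter| |].
  - eapply filterlim_ext; [|exact S1].
    induction x; [now rewrite !sum_O|]; rewrite !sum_Sn, IHx; reflexivity.
  - eapply filterlim_ext; [|exact S2].
    induction x; [now rewrite !sum_O|]; rewrite !sum_Sn, IHx; reflexivity.
Qed.

(** * Gauss' hypergeometric equation *)

Definition gcoef (a b c : C) (n : nat) : C :=
  pochhammer a n * pochhammer b n / pochhammer c n / RtoC (INR (fact n)).

Definition nonpole (c : C) : Prop := forall n, c + RtoC (INR n) <> 0.

Lemma Re_pos_nonpole c : (0 < Re c)%R -> nonpole c.
Proof.
  intros H n E; apply (f_equal Re) in E; simpl in E; pose proof (pos_INR n); unfold Re in *; lra.
Qed.

Lemma pochhammer_nz c n : nonpole c -> pochhammer c n <> 0.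
Proof.
  intros H; induction n as [|n IH]; simpl.
  - intros E; apply (f_equal Re) in E; simpl in E; lra.
  - intros E; apply Cmult_zero in E; destruct E as [E|E]; [tauto|now apply (H n)].
Qed.

Lemma RtoC_nz x : (x <> 0)%R -> RtoC x <> 0.
Proof. intros H E; apply H; now apply RtoC_inj. Qed.

Lemma gcoef_S a b c n : nonpole c ->
  gcoef a b c (S n) * ((c + RtoC (INR n)) * RtoC (INR (S n))) =
  gcoef a b c n * ((a + RtoC (INR n)) * (b + RtoC (INR n))).
Proof.
  intros H; unfold gcoef; pose proof (pochhammer_nz c n H); pose proof (H n).
  simpl pochhammer.
  assert (RtoC (INR (fact n)) <> 0) by apply RtoC_nz, INR_fact_neq_0.
  assert (RtoC (INR (S n)) <> 0) by apply RtoC_nz, not_0_INR, Nat.neq_succ_0.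
  change (fact (S n)) with (S n * fact n)%nat; rewrite mult_INR, RtoC_mult.
  field; repeat split; trivial.
Qed.

Lemma ratio_summable (u : nat -> R) (q : R) (N : nat) :
  (0 <= q < 1)%R -> (forall n, (0 <= u n)%R) -> (forall n, (N <= n)%nat -> (u (S n) <= q * u n)%R) ->
  ex_series u.
Proof.
  intros Hq Hu H; apply (ex_series_incr_n (V := R_NormedModule) u N).
  apply ex_series_le_R with (b := fun k => (u N * q ^ k)%R).
  - intros k; split; [apply Hu|]; induction k as [|k IH].
    + rewrite Nat.add_0_r; simpl; lra.
    + replace (N + S k)%nat with (S (N + k)) by lia.
      eapply Rle_trans; [apply H; lia|]; simpl.
      apply Rle_trans with (q * (u N * q ^ k))%R; [apply Rmult_le_compat_l; lra|right; ring].
  - apply (ex_series_scal_l (V := R_NormedModule)), ex_series_geom; rewrite Rabs_pos_eq; lra.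
Qed.

(** The quotient of consecutive coefficients tends to 1; [e] is chosen so that
    [(1 + e) ^ 2 * r < 1]. *)
Lemma gcoef_PSok a b c : nonpole c -> PSok (gcoef a b c) 1.
Proof.
  intros H r Hr.
  set (e := ((1 - r) / 4)%R).
  assert (He : (0 < e <= 1 / 4)%R) by (unfold e; lra).
  pose proof (Cmod_ge_0 a) as A0; pose proof (Cmod_ge_0 b) as B0; pose proof (Cmod_ge_0 c) as C0.
  destruct (INR_unbounded ((Cmod a + Cmod b + 2 * Cmod c + 1) / e)) as [N HN].
  assert (HN' : (Cmod a + Cmod b + 2 * Cmod c + 1 < INR N * e)%R).
  { apply Rmult_lt_reg_r with (/ e)%R; [apply Rinv_0_lt_compat; lra|].
    replace (INR N * e * / e)%R with (INR N) by (field; lra); exact HN. }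
  apply (ratio_summable _ ((1 + e) * (1 + e) * r) N).
  - unfold e in *; split; nra.
  - intros; apply Rmult_le_pos; [apply Cmod_ge_0|apply pow_le; lra].
  - intros n Hn; apply le_INR in Hn.
    pose proof (gcoef_S a b c n H) as E; apply (f_equal Cmod) in E; rewrite !Cmod_mult in E.
    rewrite Cmod_R, Rabs_pos_eq in E by apply pos_INR.
    set (G := Cmod (gcoef a b c n)) in *; set (G1 := Cmod (gcoef a b c (S n))) in *.
    assert (G0 : (0 <= G)%R) by apply Cmod_ge_0; assert (G10 : (0 <= G1)%R) by apply Cmod_ge_0.
    assert (Ka : (Cmod (a + RtoC (INR n)) <= Cmod a + INR n)%R).
    { eapply Rle_trans; [apply Cmod_triangle|]; rewrite Cmod_R, Rabs_pos_eq; [lra|apply pos_INR]. }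
    assert (Kb : (Cmod (b + RtoC (INR n)) <= Cmod b + INR n)%R).
    { eapply Rle_trans; [apply Cmod_triangle|]; rewrite Cmod_R, Rabs_pos_eq; [lra|apply pos_INR]. }
    assert (Kc : (INR n - Cmod c <= Cmod (c + RtoC (INR n)))%R).
    { assert (Cmod (RtoC (INR n)) <= Cmod (c + RtoC (INR n)) + Cmod c)%R.
      { replace (RtoC (INR n)) with ((c + RtoC (INR n)) + - c) at 1 by ring.
        eapply Rle_trans; [apply Cmod_triangle|]; rewrite Cmod_opp; lra. }
      rewrite Cmod_R, Rabs_pos_eq in H0 by apply pos_INR; lra. }
    rewrite S_INR in E.
    assert (Hne : (INR N * e <= INR n * e)%R) by nra.
    assert (P1 : (Cmod a + INR n <= (1 + e) * (INR n - Cmod c))%R) by nra.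
    assert (P2 : (Cmod b + INR n <= (1 + e) * (INR n + 1))%R) by nra.
    assert (P3 : (0 < INR n - Cmod c)%R) by nra.
    pose proof (Cmod_ge_0 (a + RtoC (INR n))); pose proof (Cmod_ge_0 (b + RtoC (INR n))).
    assert (Q : (G1 <= (1 + e) * (1 + e) * G)%R).
    { apply Rmult_le_reg_r with ((INR n - Cmod c) * (INR n + 1))%R; [apply Rmult_lt_0_compat; lra|].
      apply Rle_trans with (G1 * (Cmod (c + RtoC (INR n)) * (INR n + 1)))%R.
      - apply Rmult_le_compat_l; trivial; apply Rmult_le_compat_r; lra.
      - rewrite E.
        apply Rle_trans with (G * (((1 + e) * (INR n - Cmod c)) * ((1 + e) * (INR n + 1))))%R; [|right; ring].
        apply Rmult_le_compat_l; trivial; apply Rmult_le_compat; lra. }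
    simpl pow; assert (0 <= r ^ n)%R by (apply pow_le; lra).
    apply Rle_trans with ((1 + e) * (1 + e) * G * (r * r ^ n))%R; [|right; ring].
    apply Rmult_le_compat_r; trivial; nra.
Qed.

Lemma hyp2F1_psum a b c z : nonpole c -> (Cmod z < 1)%R -> hyp2F1 a b c z = psum (gcoef a b c) z.
Proof.
  intros H Hz; pose proof (PSok_cser _ _ _ (gcoef_PSok a b c H) Hz) as K.
  unfold hyp2F1, psum; rewrite <- CSeries_csum by trivial.
  f_equal; apply functional_extensionality; intros n.
  unfold pterm, gcoef; field; split; (now apply pochhammer_nz) || apply RtoC_nz, INR_fact_neq_0.
Qed.

Lemma hyp2F1_0 a b c : nonpole c -> hyp2F1 a b c 0 = 1.
Proof.
  intros H; rewrite hyp2F1_psum by (trivial; rewrite Cmod_0; lra); rewrite psum_0.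
  unfold gcoef; simpl; field; apply RtoC_nz; lra.
Qed.

(** Coefficients of [z f']. *)
Definition ptheta (a : nat -> C) (n : nat) : C := RtoC (INR n) * a n.

Lemma ptheta_pder a n : pshift (pder a) n = ptheta a n.
Proof. destruct n; unfold ptheta; simpl; [ring|reflexivity]. Qed.

Lemma PSok_ext a b R : (forall n, a n = b n) -> PSok a R -> PSok b R.
Proof. intros E H r Hr; eapply ex_series_ext; [|apply (H r Hr)]; intros; simpl; now rewrite E. Qed.

Lemma PSok_ptheta a R : PSok a R -> PSok (ptheta a) R.
Proof.
  intros H; apply (PSok_ext (pshift (pder a))); [apply ptheta_pder|].
  now apply PSok_pshift, PSok_pder.
Qed.

Lemma psum_ptheta a R z : PSok a R -> (Cmod z < R)%R -> z * psum (pder a) z = psum (ptheta a) z.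
Proof.
  intros H Hz; rewrite <- (psum_pshift _ R) by (trivial; now apply PSok_pder).
  apply psum_ext, ptheta_pder.
Qed.

(** Multiplying coefficients by the index is the Euler operator, and in these terms the equation is the
    recurrence [gcoef_S]. *)
Lemma gauss_equation a b c z : nonpole c -> (Cmod z < 1)%R ->
  exists G1 G2, (forall w, (Cmod w < 1)%R -> Cdiff (hyp2F1 a b c) w (G1 w) /\ Cdiff G1 w (G2 w)) /\
  z * (1 - z) * G2 z + (c - (a + b + 1) * z) * G1 z - a * b * hyp2F1 a b c z = 0.
Proof.
  intros Hc Hz; pose proof (gcoef_PSok a b c Hc) as Ok; set (g := gcoef a b c) in *.
  pose proof (PSok_pder _ _ Ok) as Ok1; pose proof (PSok_pder _ _ Ok1) as Ok2.
  exists (psum (pder g)), (psum (pder (pder g))); split.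
  - intros w Hw; split; [|now apply psum_Cdiff with 1%R].
    apply Cdiff_ext_loc with (psum g) (1 - Cmod w)%R; [lra| |now apply psum_Cdiff with 1%R].
    intros v Hv; symmetry; apply hyp2F1_psum; trivial.
    replace v with ((v - w) + w) by ring; eapply Rle_lt_trans; [apply Cmod_triangle|lra].
  - rewrite hyp2F1_psum by trivial; fold g.
    pose (h := fun n => ptheta g n + (- (1)) * g n).
    assert (Okh : PSok h 1) by (apply PSok_plus; [now apply PSok_ptheta|now apply PSok_scal]).
    assert (E1 : z * psum (pder (pder g)) z = psum (ptheta (pder g)) z) by (apply psum_ptheta with 1%R; trivial).
    assert (E2 : z * psum (pder g) z = psum (ptheta g) z) by (apply psum_ptheta with 1%R; trivial).
    assert (E3 : z * psum (ptheta (pder g)) z = psum (ptheta h) z).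
    { rewrite <- (psum_ptheta h 1) by trivial; f_equal; apply psum_ext; intros n.
      unfold ptheta, pder, h, ptheta; rewrite S_INR, RtoC_plus; ring. }
    transitivity (psum (ptheta (pder g)) z + (- (1)) * psum (ptheta h) z + c * psum (pder g) z
      + (- (a + b + 1)) * psum (ptheta g) z + (- (a * b)) * psum g z).
    { rewrite <- E3, <- E1, <- E2; ring. }
    pose proof (PSok_ptheta _ _ Ok) as T0; pose proof (PSok_ptheta _ _ Ok1) as T1; pose proof (PSok_ptheta _ _ Okh) as Th.
    pose proof (PSok_scal (- (1)) _ _ Th) as S1; pose proof (PSok_scal c _ _ Ok1) as S2.
    pose proof (PSok_scal (- (a + b + 1)) _ _ T0) as S3; pose proof (PSok_scal (- (a * b)) _ _ Ok) as S4.
    pose proof (PSok_plus _ _ _ T1 S1) as A1; pose proof (PSok_plus _ _ _ A1 S2) as A2; pose proof (PSok_plus _ _ _ A2 S3) as A3.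
    rewrite <- (psum_scal _ _ _ z Th Hz), <- (psum_scal c _ _ z Ok1 Hz), <- (psum_scal _ _ _ z T0 Hz), <- (psum_scal (- (a * b)) _ _ z Ok Hz).
    rewrite <- (psum_plus _ _ _ z T1 S1 Hz), <- (psum_plus _ _ _ z A1 S2 Hz), <- (psum_plus _ _ _ z A2 S3 Hz), <- (psum_plus _ _ _ z A3 S4 Hz).
    rewrite (psum_ext _ (fun n => 0 * g n)); [rewrite (psum_scal 0 _ _ z Ok Hz); ring|].
    intros n; unfold ptheta, h, pder, ptheta.
    pose proof (gcoef_S a b c n Hc) as R; fold g in R.
    transitivity (g (S n) * ((c + RtoC (INR n)) * RtoC (INR (S n))) - g n * ((a + RtoC (INR n)) * (b + RtoC (INR n)))).
    + ring.
    + rewrite R; ring.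
Qed.

(** * Uniqueness for linear equations of the second order *)

Lemma is_derive_mono (f f' : R -> R) (a b : R) : (a <= b)%R ->
  (forall x, (a <= x <= b)%R -> is_derive f x (f' x)) ->
  (forall x, (a <= x <= b)%R -> (f' x <= 0)%R) -> (f b <= f a)%R.
Proof.
  intros Hab Hd Hn.
  destruct (Req_dec a b) as [<-|Hne]; [lra|].
  destruct (MVT_gen f a b f') as [c [Hc E]].
  - intros x; rewrite Rmin_left, Rmax_right by lra; intros; apply Hd; lra.
  - intros x; rewrite Rmin_left, Rmax_right by lra; intros; apply continuity_pt_filterlim.
    apply @ex_derive_continuous; eexists; apply Hd; lra.
  - rewrite Rmin_left, Rmax_right in Hc by lra; specialize (Hn c Hc); nra.
Qed.

(** [exp (- k x) * N x] is nonincreasing. *)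
Lemma gronwall (N N' : R -> R) (k a b : R) : (a <= b)%R ->
  (forall x, (a <= x <= b)%R -> is_derive N x (N' x)) ->
  (forall x, (a <= x <= b)%R -> (0 <= N x)%R) ->
  (forall x, (a <= x <= b)%R -> (N' x <= k * N x)%R) -> N a = 0%R -> N b = 0%R.
Proof.
  intros Hab Hd Hp Hk H0.
  assert (L : (N b * exp (- k * b) <= N a * exp (- k * a))%R).
  { apply (is_derive_mono (fun x => N x * exp (- k * x))%R (fun x => (N' x * exp (- k * x) + N x * (- k * exp (- k * x)))%R)); trivial.
    - intros x Hx; apply (is_derive_Rmult N (fun x => exp (- k * x))); [now apply Hd|auto_derive; trivial; ring].
    - intros x Hx; specialize (Hk x Hx); pose proof (exp_pos (- k * x)); nra. }
  rewrite H0, Rmult_0_l in L; pose proof (exp_pos (- k * b)); specialize (Hp b ltac:(lra)); nra.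
Qed.

(** The squared norm of [(y, y1)] satisfies the hypothesis of [gronwall], the coefficients being
    bounded on the segment. *)
Lemma linear_ode_unique (A B y y1 : R -> C) (a b : R) : (a <= b)%R ->
  (forall s, (a <= s <= b)%R -> ccont A s) -> (forall s, (a <= s <= b)%R -> ccont B s) ->
  (forall s, (a <= s <= b)%R -> cder y s (y1 s)) ->
  (forall s, (a <= s <= b)%R -> cder y1 s (A s * y1 s + B s * y s)) ->
  y a = 0 -> y1 a = 0 -> y b = 0.
Proof.
  intros Hab HA HB Hy Hy1 Y0 Y10.
  assert (Bd : forall F : R -> C, (forall s, (a <= s <= b)%R -> ccont F s) ->
     exists K, forall s, (a <= s <= b)%R -> (Rabs (Re (F s)) <= K /\ Rabs (Im (F s)) <= K)%R).
  { intros F HF.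
    destruct (continuity_ab_maj (fun s => Rabs (Re (F s))) a b Hab) as [m1 [M1 _]].
    { intros c Hc; apply (continuity_pt_comp (fun s => Re (F s)) Rabs); [now apply HF|apply Rcontinuity_abs]. }
    destruct (continuity_ab_maj (fun s => Rabs (Im (F s))) a b Hab) as [m2 [M2 _]].
    { intros c Hc; apply (continuity_pt_comp (fun s => Im (F s)) Rabs); [now apply HF|apply Rcontinuity_abs]. }
    exists (Rabs (Re (F m1)) + Rabs (Im (F m2)))%R; intros s Hs; specialize (M1 s Hs); specialize (M2 s Hs).
    pose proof (Rabs_pos (Re (F m1))); pose proof (Rabs_pos (Im (F m2))); lra. }
  destruct (Bd A HA) as [KA BA], (Bd B HB) as [KB BB].
  pose (N := fun s => (Re (y s) * Re (y s) + Im (y s) * Im (y s) + (Re (y1 s) * Re (y1 s) + Im (y1 s) * Im (y1 s)))%R).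
  pose (y2 := fun s => A s * y1 s + B s * y s).
  assert (Z : N b = 0%R).
  { apply (gronwall N (fun s => (2 * (Re (y s) * Re (y1 s)) + 2 * (Im (y s) * Im (y1 s))
      + 2 * (Re (y1 s) * Re (y2 s)) + 2 * (Im (y1 s) * Im (y2 s)))%R) (2 + 4 * KA + 4 * KB) a b); trivial.
    - intros s Hs; destruct (Hy s Hs) as [D1 D2], (Hy1 s Hs) as [D3 D4].
      unfold N; eapply is_derive_eq.
      + apply is_derive_Rplus; apply is_derive_Rplus; apply is_derive_Rmult; eassumption.
      + unfold y2; ring.
    - intros s Hs; unfold N; nra.
    - intros s Hs; unfold N, y2.
      destruct (BA s Hs) as [BA1 BA2], (BB s Hs) as [BB1 BB2].
      generalize dependent (A s); generalize dependent (B s); generalize (y s), (y1 s).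
      intros [p q] [u v] [b1 b2] BB1 BB2 [a1 a2] BA1 BA2; unfold Re, Im in *; simpl in *.
      apply Rabs_le_between in BA1; apply Rabs_le_between in BA2; apply Rabs_le_between in BB1; apply Rabs_le_between in BB2.
      assert (E : (2 * (p * u) + 2 * (q * v) + 2 * (u * (a1 * u - a2 * v + (b1 * p - b2 * q))) +
        2 * (v * (a1 * v + a2 * u + (b1 * q + b2 * p))) =
        2 * (p * u) + 2 * (q * v) + 2 * a1 * (u * u + v * v) + 2 * b1 * (u * p + v * q) + 2 * b2 * (v * p - u * q))%R) by ring.
      rewrite E.
      assert (I1 : (2 * (p * u) + 2 * (q * v) <= p * p + q * q + (u * u + v * v))%R)
        by (pose proof (pow2_ge_0 (p - u)); pose proof (pow2_ge_0 (q - v)); lra).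
      assert (I2 : (2 * a1 * (u * u + v * v) <= 2 * KA * (u * u + v * v))%R)
        by (apply Rmult_le_compat_r; [pose proof (Rle_0_sqr u); pose proof (Rle_0_sqr v); unfold Rsqr in *; lra|lra]).
      assert (aux : forall k K x n, (- K <= k <= K)%R -> (- n <= 2 * x <= n)%R -> (2 * k * x <= K * n)%R).
      { intros k K x n Hk Hx; assert (0 <= K)%R by lra; assert (0 <= n)%R by lra; nra. }
      assert (I3 : (2 * b1 * (u * p + v * q) <= KB * (p * p + q * q + (u * u + v * v)))%R).
      { apply aux; [lra|]; pose proof (pow2_ge_0 (u + p)); pose proof (pow2_ge_0 (v + q));
        pose proof (pow2_ge_0 (u - p)); pose proof (pow2_ge_0 (v - q)); nra. }
      assert (I4 : (2 * b2 * (v * p - u * q) <= KB * (p * p + q * q + (u * u + v * v)))%R).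
      { apply aux; [lra|]; pose proof (pow2_ge_0 (v + p)); pose proof (pow2_ge_0 (u + q));
        pose proof (pow2_ge_0 (v - p)); pose proof (pow2_ge_0 (u - q)); nra. }
      assert (0 <= KA)%R by lra; assert (0 <= KB)%R by lra.
      nra.
    - unfold N; rewrite Y0, Y10; simpl; ring. }
  unfold N in Z; apply C_ext; simpl.
  - change (Re (y b) = 0)%R; nra.
  - change (Im (y b) = 0)%R; nra.
Qed.

(** * The hyperbolic parametrisation *)

Definition Ccosh (z : C) : C := (Cexp z + Cexp (- z)) / 2.
Definition Csinh (z : C) : C := (Cexp z - Cexp (- z)) / 2.

Lemma two_nz : RtoC 2 <> 0.
Proof. apply RtoC_nz; lra. Qed.

Lemma Ccosh_eq z : Ccosh z = (cosh (Re z) * cos (Im z), sinh (Re z) * sin (Im z))%R.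
Proof.
  unfold Ccosh, Cexp, cosh, sinh; destruct z as [x y]; simpl; rewrite cos_neg, sin_neg.
  apply C_ext; simpl; field.
Qed.

Lemma Csinh_eq z : Csinh z = (sinh (Re z) * cos (Im z), cosh (Re z) * sin (Im z))%R.
Proof.
  unfold Csinh, Cexp, cosh, sinh; destruct z as [x y]; simpl; rewrite cos_neg, sin_neg.
  apply C_ext; simpl; field.
Qed.

Lemma Ccosh_sqr z : Ccosh z * Ccosh z = 1 + Csinh z * Csinh z.
Proof.
  transitivity (Csinh z * Csinh z + Cexp z * Cexp (- z)).
  - unfold Ccosh, Csinh; field; apply two_nz.
  - rewrite Cexp_opp_r; ring.
Qed.

Lemma Ccosh_Csinh z : Ccosh z + Csinh z = Cexp z.
Proof. unfold Ccosh, Csinh; field; apply two_nz. Qed.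

Lemma hol_Cexp_opp z : hol (fun z => Cexp (- z)) z (- Cexp (- z)).
Proof.
  eapply hol_eq; [apply (hol_comp Cexp (fun z => - z)); [apply hol_Cexp|apply hol_opp, hol_id]|ring].
Qed.

Lemma hol_Ccosh z : hol Ccosh z (Csinh z).
Proof.
  apply (hol_ext (fun z => / 2 * (Cexp z + Cexp (- z)))); [intros; unfold Ccosh, Cdiv; ring|].
  eapply hol_eq; [apply hol_scal, hol_plus; [apply hol_Cexp|apply hol_Cexp_opp]|].
  unfold Csinh, Cdiv; ring.
Qed.

Lemma hol_Csinh z : hol Csinh z (Ccosh z).
Proof.
  apply (hol_ext (fun z => / 2 * (Cexp z - Cexp (- z)))); [intros; unfold Csinh, Cdiv; ring|].
  eapply hol_eq; [apply hol_scal, hol_minus; [apply hol_Cexp|apply hol_Cexp_opp]|].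
  unfold Ccosh, Cdiv; ring.
Qed.

Lemma cosh_ge_1 t : (1 <= cosh t)%R.
Proof.
  unfold cosh; pose proof (exp_pos t); pose proof (exp_pos (- t)).
  assert (exp t * exp (- t) = 1)%R by (rewrite <- exp_plus, Rplus_opp_r; apply exp_0).
  pose proof (pow2_ge_0 (exp t - exp (- t))); nra.
Qed.

Lemma cosh_sinh_sqr t : (cosh t * cosh t = 1 + sinh t * sinh t)%R.
Proof.
  unfold cosh, sinh; assert (exp t * exp (- t) = 1)%R by (rewrite <- exp_plus, Rplus_opp_r; apply exp_0).
  nra.
Qed.

Lemma cosh_lower t : (exp t / 2 <= cosh t)%R.
Proof. unfold cosh; pose proof (exp_pos (- t)); lra. Qed.

Lemma exp_neg_le t : (0 <= t)%R -> (exp (- t) <= exp t)%R.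
Proof. intros; apply exp_mono; lra. Qed.

Lemma cosh_upper t : (0 <= t)%R -> (cosh t <= exp t)%R.
Proof. intros H; unfold cosh; pose proof (exp_neg_le t H); lra. Qed.

Lemma sinh_pos t : (0 < t)%R -> (0 < sinh t)%R.
Proof. intros H; unfold sinh; assert (exp (- t) < exp t)%R by (apply exp_increasing; lra); lra. Qed.

Lemma sinh_nonneg t : (0 <= t)%R -> (0 <= sinh t)%R.
Proof. intros [H|<-]; [left; now apply sinh_pos|unfold sinh; rewrite Ropp_0; lra]. Qed.

Lemma sinh_upper t : (0 <= t)%R -> (Rabs (sinh t) <= exp t)%R.
Proof.
  intros H; rewrite Rabs_pos_eq by now apply sinh_nonneg.
  unfold sinh; pose proof (exp_pos (- t)); pose proof (exp_pos t); lra.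
Qed.

(** The values of [w] for which the integral [Qc] is used: the half-strip over the right half-plane cut
    along (0, 1], together with its edge on the imaginary axis, which is mapped to the two sides of the cut.
    The point 0 is the branch point z = 1. *)
Definition Reg (w : C) : Prop := (0 <= Re w /\ Rabs (Im w) < PI / 2)%R /\ w <> 0.

Lemma Reg_cos w : Reg w -> (0 < cos (Im w))%R.
Proof. intros [[_ H] _]; apply Rabs_def2 in H; apply cos_gt_0; lra. Qed.

Lemma Reg_Csinh_nz w : Reg w -> Csinh w <> 0.
Proof.
  intros H E; pose proof (Reg_cos w H) as Hc; rewrite Csinh_eq in E.
  destruct H as [[H1 H2] H3]; apply H3.
  assert (E1 : (sinh (Re w) * cos (Im w) = 0)%R) by exact (f_equal Re E).
  assert (E2 : (cosh (Re w) * sin (Im w) = 0)%R) by exact (f_equal Im E).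
  pose proof (cosh_ge_1 (Re w)).
  assert (R0 : Re w = 0%R).
  { destruct H1 as [H1|H1]; [|now symmetry]; apply sinh_pos in H1; nra. }
  assert (S0 : sin (Im w) = 0%R) by nra.
  apply C_ext; simpl; trivial; apply Rabs_def2 in H2.
  destruct (Rtotal_order (Im w) 0) as [L|[L|L]]; trivial; exfalso.
  - assert (0 < sin (- Im w))%R by (apply sin_gt_0; lra); rewrite sin_neg in *; lra.
  - assert (0 < sin (Im w))%R by (apply sin_gt_0; lra); lra.
Qed.

(** * The Laplace-Heine kernel *)

(** [kB] is the derivative of [kA] with respect to [w], and conversely. *)
Definition kA (w : C) (t : R) : C := Ccosh w + Csinh w * RtoC (cosh t).
Definition kB (w : C) (t : R) : C := Csinh w + Ccosh w * RtoC (cosh t).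
Definition k0 (mu w : C) (t : R) : C := pw mu (kA w t).
(** [k1] and [k2] are the first two derivatives of [k0] in [w]; the base [kA] being its own second derivative is
    used in [k2]. *)
Definition k1 (mu w : C) (t : R) : C := mu * (pw (mu - 1) (kA w t) * kB w t).
Definition k2 (mu w : C) (t : R) : C :=
  mu * ((mu - 1) * (pw (mu - 2) (kA w t) * (kB w t * kB w t)) + pw mu (kA w t)).

(** The real part is [cos (Im w)] times [cosh (Re w) + sinh (Re w) * cosh t]. *)
Lemma kA_pos w t : Reg w -> (0 < Re (kA w t))%R.
Proof.
  intros H; pose proof (Reg_cos w H); destruct H as [[H1 _] _].
  unfold kA; rewrite Ccosh_eq, Csinh_eq; simpl.
  pose proof (cosh_ge_1 (Re w)); pose proof (cosh_ge_1 t); pose proof (sinh_nonneg _ H1).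
  assert (0 <= sinh (Re w) * cos (Im w) * cosh t)%R by (apply Rmult_le_pos; nra).
  nra.
Qed.

(** The modulus grows like [exp t] as long as [Csinh w] stays away from 0. *)
Lemma kA_lower w t m : Reg w -> (0 < m <= 1)%R -> (m <= Cmod (Csinh w))%R ->
  (m / 4 * exp t <= Cmod (kA w t))%R.
Proof.
  intros H Hm Hw; destruct H as [[H1 _] _].
  pose proof (cosh_ge_1 t) as Hc; pose proof (cosh_lower t) as Hc'; pose proof (exp_pos t).
  assert (Sq : (1 + m * m * ((cosh t - 1) * (cosh t - 1)) <= Cmod (kA w t) * Cmod (kA w t))%R).
  { assert (E : kA w t = Cexp w + Csinh w * RtoC (cosh t - 1)).
    { unfold kA; rewrite <- Ccosh_Csinh, RtoC_minus; ring. }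
    assert (W2 : (m * m <= Re (Csinh w) * Re (Csinh w) + Im (Csinh w) * Im (Csinh w))%R).
    { rewrite <- Cmod_sqr; apply Rmult_le_compat; lra. }
    assert (I : (0 <= Re (Cexp w) * Re (Csinh w) + Im (Cexp w) * Im (Csinh w))%R).
    { rewrite Csinh_eq; unfold Cexp; simpl.
      pose proof (exp_pos (Re w)); pose proof (sinh_nonneg _ H1); pose proof (cosh_ge_1 (Re w)).
      match goal with |- (_ <= ?r)%R => replace r with (exp (Re w) * (sinh (Re w) * (cos (Im w) * cos (Im w)) + cosh (Re w) * (sin (Im w) * sin (Im w))))%R by ring end.
      apply Rmult_le_pos; [lra|]; apply Rplus_le_le_0_compat; apply Rmult_le_pos; try lra; apply Rle_0_sqr. }
    assert (O : (1 <= Re (Cexp w) * Re (Cexp w) + Im (Cexp w) * Im (Cexp w))%R).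
    { rewrite <- Cmod_sqr, Cmod_Cexp; rewrite <- exp_plus, <- exp_0; apply exp_mono; lra. }
    rewrite Cmod_sqr, E; revert W2 I O; generalize (Csinh w), (Cexp w); intros [a b] [x y]; simpl; intros W2 I O.
    set (c := (cosh t - 1)%R) in *; assert (C0 : (0 <= c)%R) by (unfold c; lra).
    match goal with |- (_ <= ?r)%R => replace r with ((x * x + y * y) + 2 * c * (x * a + y * b) + (a * a + b * b) * (c * c))%R by ring end.
    assert (0 <= c * (x * a + y * b))%R by (apply Rmult_le_pos; trivial).
    assert (m * m * (c * c) <= (a * a + b * b) * (c * c))%R by (apply Rmult_le_compat_r; trivial; nra).
    lra. }
  apply Rsqr_incr_0_var; [|apply Cmod_ge_0]; unfold Rsqr.
  eapply Rle_trans; [|exact Sq].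
  assert (m * m <= 1)%R by nra.
  assert (exp t * exp t <= 4 * (cosh t * cosh t))%R by nra.
  assert (0 <= m * m)%R by nra.
  apply Rle_trans with (m * m * (1 + (cosh t - 1) * (cosh t - 1)))%R; [|nra].
  replace (m / 4 * exp t * (m / 4 * exp t))%R with (m * m * (exp t * exp t / 16))%R by field.
  apply Rmult_le_compat_l; trivial; (pose proof (pow2_ge_0 (3 * cosh t - 4)); nra).
Qed.

Lemma kB_upper w t Z : (0 <= t)%R -> (Cmod (Csinh w) <= Z)%R -> (Cmod (Ccosh w) <= Z)%R ->
  (Cmod (kB w t) <= 2 * Z * exp t)%R.
Proof.
  intros Ht H1 H2; unfold kB; eapply Rle_trans; [apply Cmod_triangle|].
  pose proof (cosh_ge_1 t); pose proof (cosh_upper t Ht).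
  rewrite Cmod_mult, Cmod_R, Rabs_pos_eq by lra.
  pose proof (Cmod_ge_0 (Csinh w)); pose proof (Cmod_ge_0 (Ccosh w)).
  nra.
Qed.

Lemma exp_shift2 a t : (exp ((a - 2) * t) * (exp t * exp t) = exp (a * t))%R.
Proof. rewrite <- !exp_plus; f_equal; ring. Qed.

Lemma exp_shift1 a t : (exp ((a - 1) * t) * exp t = exp (a * t))%R.
Proof. rewrite <- !exp_plus; f_equal; ring. Qed.

Lemma kernel_bounds mu m Z : (Re mu < 0)%R -> (0 < m <= 1)%R ->
  exists K, forall w t, Reg w -> (m <= Cmod (Csinh w))%R -> (Cmod (Csinh w) <= Z)%R -> (Cmod (Ccosh w) <= Z)%R ->
    (0 <= t)%R ->
    (Cmod (k0 mu w t) <= K * exp (Re mu * t) /\ Cmod (k1 mu w t) <= K * exp (Re mu * t) /\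
     Cmod (k2 mu w t) <= K * exp (Re mu * t) /\
     Cmod (pw (mu - 1) (kA w t)) <= K * exp ((Re mu - 1) * t))%R.
Proof.
  intros Hmu Hm.
  pose (D := fun a : C => (exp (Rabs (Im a) * PI) * exp (Re a * ln (m / 4)))%R).
  assert (DP : forall a, (0 < D a)%R) by (intros; apply Rmult_lt_0_compat; apply exp_pos).
  assert (HD : forall a w t, Reg w -> (m <= Cmod (Csinh w))%R -> (Re a <= 0)%R ->
    (Cmod (pw a (kA w t)) <= D a * exp (Re a * t))%R).
  { intros a w t Hr Hw Ha; apply pw_decay; trivial; [now apply kA_pos|lra|now apply kA_lower]. }
  pose (Z' := Rmax Z 0); assert (HZ' : (Z <= Z' /\ 0 <= Z')%R) by (split; [apply Rmax_l|apply Rmax_r]).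
  exists (D mu + D (mu - 1)%C + Cmod mu * (D (mu - 1)%C * (2 * Z')) +
    Cmod mu * (Cmod (mu - 1) * (D (mu - 2)%C * (2 * Z' * (2 * Z'))) + D mu))%R.
  intros w t Hr Hw HZ1 HZ2 Ht.
  pose proof (kB_upper w t Z' Ht ltac:(lra) ltac:(lra)) as HB.
  pose proof (HD mu w t Hr Hw ltac:(lra)) as B0.
  pose proof (HD (mu - 1)%C w t Hr Hw ltac:(simpl; unfold Re in *; lra)) as B1.
  pose proof (HD (mu - 2)%C w t Hr Hw ltac:(simpl; unfold Re in *; lra)) as B2.
  replace (Re (mu - 1)) with (Re mu - 1)%R in B1 by (simpl; unfold Re; ring).
  replace (Re (mu - 2)) with (Re mu - 2)%R in B2 by (simpl; unfold Re; ring).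
  pose proof (Cmod_ge_0 mu) as M0; pose proof (Cmod_ge_0 (mu - 1)) as M1.
  pose proof (DP mu) as P0; pose proof (DP (mu - 1)) as P1; pose proof (DP (mu - 2)) as P2.
  pose proof (exp_pos (Re mu * t)) as Ep; pose proof (exp_pos ((Re mu - 1) * t)) as Ep1.
  pose proof (exp_pos ((Re mu - 2) * t)) as Ep2; pose proof (exp_pos t) as Et.
  pose proof (Cmod_ge_0 (kB w t)) as KB0.
  assert (U1 : (Cmod (k1 mu w t) <= Cmod mu * (D (mu - 1)%C * (2 * Z')) * exp (Re mu * t))%R).
  { unfold k1; rewrite !Cmod_mult, <- (exp_shift1 (Re mu) t).
    replace (Cmod mu * (D (mu - 1)%C * (2 * Z')) * (exp ((Re mu - 1) * t) * exp t))%R with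
      (Cmod mu * ((D (mu - 1)%C * exp ((Re mu - 1) * t)) * (2 * Z' * exp t)))%R by ring.
    apply Rmult_le_compat_l; trivial; apply Rmult_le_compat; trivial; apply Cmod_ge_0. }
  assert (U2 : (Cmod (k2 mu w t) <= Cmod mu * (Cmod (mu - 1)%C * (D (mu - 2)%C * (2 * Z' * (2 * Z'))) + D mu) * exp (Re mu * t))%R).
  { unfold k2; rewrite Cmod_mult, Rmult_assoc; apply Rmult_le_compat_l; trivial.
    eapply Rle_trans; [apply Cmod_triangle|]; rewrite Rmult_plus_distr_r; apply Rplus_le_compat; trivial.
    rewrite !Cmod_mult, <- (exp_shift2 (Re mu) t), !Rmult_assoc; apply Rmult_le_compat_l; trivial.
    replace (D (mu - 2)%C * (2 * (Z' * (2 * (Z' * (exp ((Re mu - 2) * t) * (exp t * exp t)))))))%R with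
      ((D (mu - 2)%C * exp ((Re mu - 2) * t)) * ((2 * Z' * exp t) * (2 * Z' * exp t)))%R by ring.
    apply Rmult_le_compat; trivial; [apply Cmod_ge_0|apply Rmult_le_pos; trivial|].
    apply Rmult_le_compat; trivial. }
  assert (N1 : (0 <= Cmod mu * (D (mu - 1)%C * (2 * Z')))%R) by (apply Rmult_le_pos; trivial; apply Rmult_le_pos; lra).
  assert (N2 : (0 <= Cmod mu * (Cmod (mu - 1)%C * (D (mu - 2)%C * (2 * Z' * (2 * Z'))) + D mu))%R).
  { apply Rmult_le_pos; trivial; apply Rplus_le_le_0_compat; [|lra].
    apply Rmult_le_pos; trivial; apply Rmult_le_pos; [lra|]; apply Rmult_le_pos; lra. }
  repeat split; (eapply Rle_trans; [first [exact B0|exact U1|exact U2|exact B1]|]); apply Rmult_le_compat_r; lra.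
Qed.

Lemma hol_kA w t : hol (fun w => kA w t) w (kB w t).
Proof.
  unfold kA; eapply hol_eq; [apply hol_plus; [apply hol_Ccosh|apply hol_mult; [apply hol_Csinh|apply hol_const]]|].
  unfold kB; ring.
Qed.

Lemma hol_kB w t : hol (fun w => kB w t) w (kA w t).
Proof.
  unfold kB; eapply hol_eq; [apply hol_plus; [apply hol_Csinh|apply hol_mult; [apply hol_Ccosh|apply hol_const]]|].
  unfold kA; ring.
Qed.

Lemma hol_k0 mu w t : (0 < Re (kA w t))%R -> hol (fun w => k0 mu w t) w (k1 mu w t).
Proof.
  intros H; eapply hol_eq; [apply (hol_comp (pw mu) (fun w => kA w t)); [now apply hol_pw|apply hol_kA]|].
  unfold k1; ring.
Qed.

Lemma hol_k1 mu w t : (0 < Re (kA w t))%R -> hol (fun w => k1 mu w t) w (k2 mu w t).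
Proof.
  intros H; unfold k1; eapply hol_eq.
  - apply hol_scal, hol_mult; [|apply hol_kB].
    apply (hol_comp (pw (mu - 1)) (fun w => kA w t)); [now apply hol_pw|apply hol_kA].
  - unfold k2; rewrite <- (pw_pred mu) by trivial; replace (mu - 1 - 1) with (mu - 2) by (unfold RtoC; apply C_ext; simpl; ring).
    ring.
Qed.

Lemma ccont_cosh t : ccont (fun t => RtoC (cosh t)) t.
Proof. apply ccont_RtoC, derivable_continuous, derivable_cosh. Qed.

Lemma ccont2_kA g s t : ccont2 (fun x _ => Ccosh (g x)) s t -> ccont2 (fun x _ => Csinh (g x)) s t ->
  ccont2 (fun x y => kA (g x) y) s t.
Proof.
  intros H1 H2; apply ccont2_plus; trivial; apply ccont2_mult; trivial.
  apply (ccont2_2 (fun t => RtoC (cosh t))), ccont_cosh.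
Qed.

Lemma ccont2_kB g s t : ccont2 (fun x _ => Ccosh (g x)) s t -> ccont2 (fun x _ => Csinh (g x)) s t ->
  ccont2 (fun x y => kB (g x) y) s t.
Proof.
  intros H1 H2; apply ccont2_plus; trivial; apply ccont2_mult; trivial.
  apply (ccont2_2 (fun t => RtoC (cosh t))), ccont_cosh.
Qed.

Lemma ccont2_Ccosh f s t : ccont2 f s t -> ccont2 (fun x y => Ccosh (f x y)) s t.
Proof.
  intros H; unfold Ccosh, Cdiv; apply ccont2_mult; [|apply ccont2_const].
  apply ccont2_plus; apply ccont2_Cexp; trivial; now apply ccont2_opp.
Qed.

Lemma ccont2_Csinh f s t : ccont2 f s t -> ccont2 (fun x y => Csinh (f x y)) s t.
Proof.
  intros H; unfold Csinh, Cdiv; apply ccont2_mult; [|apply ccont2_const].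
  apply ccont2_minus; apply ccont2_Cexp; trivial; now apply ccont2_opp.
Qed.

Lemma ccont2_kernels mu g s t : ccont g s -> Reg (g s) ->
  ccont2 (fun x y => k0 mu (g x) y) s t /\ ccont2 (fun x y => k1 mu (g x) y) s t /\ ccont2 (fun x y => k2 mu (g x) y) s t.
Proof.
  intros Hg HR; pose proof (kA_pos _ t HR) as P.
  pose proof (ccont2_1 g s t Hg) as G.
  pose proof (ccont2_kA g s t (ccont2_Ccosh _ _ _ G) (ccont2_Csinh _ _ _ G)) as CA.
  pose proof (ccont2_kB g s t (ccont2_Ccosh _ _ _ G) (ccont2_Csinh _ _ _ G)) as CB.
  assert (CP : forall a, ccont2 (fun x y => pw a (kA (g x) y)) s t) by (intros a; now apply ccont2_pw).
  split; [apply CP|split].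
  - apply (ccont2_mult (fun _ _ => mu)); [apply ccont2_const|now apply ccont2_mult].
  - apply (ccont2_mult (fun _ _ => mu)); [apply ccont2_const|].
    apply (ccont2_plus (fun x y => (mu - 1) * (pw (mu - 2) (kA (g x) y) * (kB (g x) y * kB (g x) y)))); [|apply CP].
    apply (ccont2_mult (fun _ _ => mu - 1)); [apply ccont2_const|].
    apply ccont2_mult; [apply CP|now apply ccont2_mult].
Qed.

Lemma kernels_good mu w : (Re mu < 0)%R -> Reg w -> hgood (k0 mu w) /\ hgood (k1 mu w) /\ hgood (k2 mu w).
Proof.
  intros Hmu HR.
  pose proof (proj1 (Cmod_gt_0 _) (Reg_Csinh_nz w HR)) as Hw.
  set (m := Rmin 1 (Cmod (Csinh w))).
  assert (Hm : (0 < m <= 1)%R) by (split; [apply Rmin_glb_lt; lra|apply Rmin_l]).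
  destruct (kernel_bounds mu m (Cmod (Csinh w) + Cmod (Ccosh w)) Hmu Hm) as [K HK].
  pose proof (Cmod_ge_0 (Ccosh w)).
  assert (HK' := fun t => HK w t HR (Rmin_r _ _) ltac:(lra) ltac:(lra)).
  assert (Cc := fun t => ccont2_kernels mu (fun _ => w) 0 t (ccont_const _ _) HR).
  split; [|split].
  - split; [intros t; apply (ccont2_slice (fun _ => k0 mu w) 0), (Cc t)|].
    exists K, (- Re mu)%R; split; [lra|]; intros t Ht; rewrite Ropp_involutive; apply (HK' t Ht).
  - split; [intros t; apply (ccont2_slice (fun _ => k1 mu w) 0), (Cc t)|].
    exists K, (- Re mu)%R; split; [lra|]; intros t Ht; rewrite Ropp_involutive; apply (HK' t Ht).
  - split; [intros t; apply (ccont2_slice (fun _ => k2 mu w) 0), (Cc t)|].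
    exists K, (- Re mu)%R; split; [lra|]; intros t Ht; rewrite Ropp_involutive; apply (HK' t Ht).
Qed.

Lemma kernels_dfam mu g s r : (Re mu < 0)%R -> (0 < r)%R ->
  (forall x, (Rabs (x - s) < r)%R -> ccont g x /\ Reg (g x)) ->
  exists r', (0 < r')%R /\ dfam (fun x => k0 mu (g x)) s r' /\ dfam (fun x => k1 mu (g x)) s r' /\
    dfam (fun x => k2 mu (g x)) s r' /\ forall x, (Rabs (x - s) < r')%R -> (Rabs (x - s) < r)%R.
Proof.
  intros Hmu Hr Hg.
  destruct (Hg s) as [Cs Rs]; [rewrite Rminus_eq_0, Rabs_R0; lra|].
  pose proof (proj1 (Cmod_gt_0 _) (Reg_Csinh_nz _ Rs)) as Hw.
  set (m := Rmin 1 (Cmod (Csinh (g s)) / 2)).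
  assert (Hm : (0 < m <= 1)%R) by (split; [apply Rmin_glb_lt; lra|apply Rmin_l]).
  assert (Hm' : (m <= Cmod (Csinh (g s)) / 2)%R) by apply Rmin_r.
  assert (Gs : ccont (fun x => Csinh (g x)) s) by (apply ccont_of_c2, ccont2_Csinh, ccont2_1; trivial).
  assert (Gc : ccont (fun x => Ccosh (g x)) s) by (apply ccont_of_c2, ccont2_Ccosh, ccont2_1; trivial).
  destruct (ccont_eps _ _ m Gs ltac:(lra)) as [d1 [P1 Q1]].
  destruct (ccont_eps _ _ m Gc ltac:(lra)) as [d2 [P2 Q2]].
  set (Z := (Cmod (Csinh (g s)) + Cmod (Ccosh (g s)) + 1)%R).
  destruct (kernel_bounds mu m Z Hmu Hm) as [K HK].
  set (r' := Rmin r (Rmin d1 d2)).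
  assert (Hr' : (0 < r')%R) by (repeat apply Rmin_glb_lt; trivial).
  assert (Sub : forall x, (Rabs (x - s) < r')%R -> (Rabs (x - s) < r /\ Rabs (x - s) < d1 /\ Rabs (x - s) < d2)%R).
  { intros x Hx; unfold r' in Hx; pose proof (Rmin_l r (Rmin d1 d2)); pose proof (Rmin_r r (Rmin d1 d2));
    pose proof (Rmin_l d1 d2); pose proof (Rmin_r d1 d2); lra. }
  assert (Bd : forall x t, (Rabs (x - s) < r')%R -> (0 <= t)%R ->
    (Cmod (k0 mu (g x) t) <= K * exp (- - Re mu * t) /\ Cmod (k1 mu (g x) t) <= K * exp (- - Re mu * t) /\
     Cmod (k2 mu (g x) t) <= K * exp (- - Re mu * t))%R).
  { intros x t Hx Ht; rewrite Ropp_involutive; destruct (Sub x Hx) as (S1 & S2 & S3).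
    specialize (Q1 _ S2); specialize (Q2 _ S3); replace (s + (x - s))%R with x in Q1, Q2 by ring.
    assert (T : forall u v : C, (Cmod u <= Cmod (v - u) + Cmod v /\ Cmod v <= Cmod (v - u) + Cmod u)%R).
    { intros u v; split.
      - replace u with (- (v - u) + v) at 1 by ring; eapply Rle_trans; [apply Cmod_triangle|]; rewrite Cmod_opp; lra.
      - replace v with ((v - u) + u) at 1 by ring; apply Cmod_triangle. }
    destruct (T (Csinh (g s)) (Csinh (g x))); destruct (T (Ccosh (g s)) (Ccosh (g x))).
    pose proof (Cmod_ge_0 (Csinh (g s))); pose proof (Cmod_ge_0 (Ccosh (g s))).
    destruct (HK (g x) t) as (A1 & A2 & A3 & _); trivial; unfold Z; try lra; now apply Hg. }
  exists r'; split; [exact Hr'|].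
  assert (Cx : forall x t, (Rabs (x - s) < r')%R -> ccont2 (fun x y => k0 mu (g x) y) x t /\
    ccont2 (fun x y => k1 mu (g x) y) x t /\ ccont2 (fun x y => k2 mu (g x) y) x t).
  { intros x t Hx; destruct (Hg x (proj1 (Sub x Hx))); now apply ccont2_kernels. }
  split; [|split; [|split]].
  - split; [intros x t Hx; apply (Cx x t Hx)|].
    exists K, (- Re mu)%R; split; [lra|]; intros x t Hx Ht; apply (Bd x t Hx Ht).
  - split; [intros x t Hx; apply (Cx x t Hx)|].
    exists K, (- Re mu)%R; split; [lra|]; intros x t Hx Ht; apply (Bd x t Hx Ht).
  - split; [intros x t Hx; apply (Cx x t Hx)|].
    exists K, (- Re mu)%R; split; [lra|]; intros x t Hx Ht; apply (Bd x t Hx Ht).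
  - intros x Hx; apply (Sub x Hx).
Qed.

Definition Qc (mu w : C) : C := HInt (k0 mu w).
Definition Qc1 (mu w : C) : C := HInt (k1 mu w).
Definition Qc2 (mu w : C) : C := HInt (k2 mu w).

Lemma ccont_line p d x : ccont (fun s => p + RtoC s * d) x.
Proof. eapply cder_ccont, cder_line. Qed.

Lemma Qc_cont mu g s r : (Re mu < 0)%R -> (0 < r)%R ->
  (forall x, (Rabs (x - s) < r)%R -> ccont g x /\ Reg (g x)) -> ccont (fun x => Qc mu (g x)) s.
Proof.
  intros Hmu Hr Hg; destruct (kernels_dfam mu g s r Hmu Hr Hg) as (r' & Hr' & D0 & _).
  apply (HInt_param_cont _ s r' s D0); rewrite Rminus_eq_0, Rabs_R0; lra.
Qed.

Lemma Qc_line mu p d s r : (Re mu < 0)%R -> (0 < r)%R ->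
  (forall x, (Rabs (x - s) < r)%R -> Reg (p + RtoC x * d)) ->
  cder (fun x => Qc mu (p + RtoC x * d)) s (d * Qc1 mu (p + RtoC s * d)) /\
  cder (fun x => Qc1 mu (p + RtoC x * d)) s (d * Qc2 mu (p + RtoC s * d)).
Proof.
  intros Hmu Hr HR.
  set (g := fun x => p + RtoC x * d).
  assert (Hg : forall x, (Rabs (x - s) < r)%R -> ccont g x /\ Reg (g x)).
  { intros x Hx; split; [apply ccont_line|now apply HR]. }
  destruct (kernels_dfam mu g s r Hmu Hr Hg) as (r' & Hr' & D0 & D1 & D2 & Sub).
  assert (S0 : (Rabs (s - s) < r')%R) by (rewrite Rminus_eq_0, Rabs_R0; lra).
  assert (Sc : forall k, dfam (fun x => k (g x)) s r' -> dfam (fun x t => d * k (g x) t) s r').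
  { intros k [H1 [M [e [H2 H3]]]]; split.
    - intros; apply ccont2_mult; [apply ccont2_const|now apply H1].
    - exists (Cmod d * M)%R, e; split; trivial; intros; rewrite Cmod_mult, Rmult_assoc.
      apply Rmult_le_compat_l; [apply Cmod_ge_0|now apply H3]. }
  split.
  - unfold Qc1; rewrite <- HInt_scal by (now apply (dfam_hgood _ s r' s D1)).
    apply (HInt_param_derive (fun x => k0 mu (g x)) (fun x t => d * k1 mu (g x) t) s r'); trivial; [now apply Sc|].
    intros x t Hx; eapply cder_eq; [apply (hol_k0 mu (g x) t); [apply kA_pos, HR, Sub, Hx|reflexivity|apply cder_line]|ring].
  - unfold Qc2; rewrite <- HInt_scal by (now apply (dfam_hgood _ s r' s D2)).
    apply (HInt_param_derive (fun x => k1 mu (g x)) (fun x t => d * k2 mu (g x) t) s r'); trivial; [now apply Sc|].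
    intros x t Hx; eapply cder_eq; [apply (hol_k1 mu (g x) t); [apply kA_pos, HR, Sub, Hx|reflexivity|apply cder_line]|ring].
Qed.

Lemma cder_cosh t : cder (fun t => RtoC (cosh t)) t (RtoC (sinh t)).
Proof. apply cder_RtoC, is_derive_Reals, derivable_pt_lim_cosh. Qed.

Lemma cder_sinh t : cder (fun t => RtoC (sinh t)) t (RtoC (cosh t)).
Proof. apply cder_RtoC, is_derive_Reals, derivable_pt_lim_sinh. Qed.

(** Legendre's operator in the variable [w] maps the kernel to the derivative in [t] of
    [mu * pw (mu - 1) (kA w t) * sinh t], which vanishes at both ends. *)
Lemma Qc_equation mu w : (Re mu < 0)%R -> Reg w ->
  Csinh w * Qc2 mu w + Ccosh w * Qc1 mu w - mu * (mu + 1) * Csinh w * Qc mu w = 0.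
Proof.
  intros Hmu HR; destruct (kernels_good mu w Hmu HR) as (G0 & G1 & G2).
  pose (F := fun t => mu * (pw (mu - 1) (kA w t) * RtoC (sinh t))).
  pose (f := fun t => Csinh w * k2 mu w t + Ccosh w * k1 mu w t + (- (mu * (mu + 1) * Csinh w)) * k0 mu w t).
  assert (Gf : hgood f) by (unfold f; repeat apply hgood_plus; now apply hgood_scal).
  assert (E : HInt f = 0 - F 0%R).
  { apply HInt_derive; trivial.
    - intros t; pose proof (kA_pos w t HR) as P.
      eapply cder_eq.
      + apply cder_scal, cder_mult; [|apply cder_sinh].
        apply (hol_pw (mu - 1) _ P (fun t => kA w t) t (Csinh w * RtoC (sinh t))); [reflexivity|].
        unfold kA; eapply cder_eq; [apply cder_plus; [apply cder_const|apply cder_scal, cder_cosh]|ring].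
      + unfold f, k0, k1, k2; replace (mu - 1 - 1) with (mu - 2) by (unfold RtoC; apply C_ext; simpl; ring).
        rewrite <- (pw_pred mu), <- (pw_pred (mu - 1)) by trivial.
        replace (mu - 1 - 1) with (mu - 2) by (unfold RtoC; apply C_ext; simpl; ring).
        set (P2 := pw (mu - 2) (kA w t)).
        assert (S2 : RtoC (sinh t) * RtoC (sinh t) = RtoC (cosh t) * RtoC (cosh t) - 1).
        { rewrite <- !RtoC_mult, cosh_sinh_sqr, RtoC_plus; ring. }
        pose proof (Ccosh_sqr w) as Z2.
        assert (B2 : kB w t * kB w t = kA w t * kA w t + RtoC (sinh t) * RtoC (sinh t)).
        { rewrite S2; unfold kA, kB.
          transitivity ((Ccosh w + Csinh w * RtoC (cosh t)) * (Ccosh w + Csinh w * RtoC (cosh t)) +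
            (Ccosh w * Ccosh w - Csinh w * Csinh w) * (RtoC (cosh t) * RtoC (cosh t) - 1)); [ring|].
          rewrite Z2; ring. }
        rewrite B2.
        assert (AB : Ccosh w * kB w t = Csinh w * kA w t + RtoC (cosh t)).
        { unfold kA, kB; transitivity (Ccosh w * Csinh w + (Ccosh w * Ccosh w) * RtoC (cosh t)); [ring|]; rewrite Z2; ring. }
        transitivity (mu * (mu - 1) * P2 * (kA w t * kA w t + RtoC (sinh t) * RtoC (sinh t)) * Csinh w
          + mu * P2 * kA w t * kA w t * Csinh w + mu * P2 * kA w t * (Ccosh w * kB w t)
          - mu * (mu + 1) * Csinh w * P2 * kA w t * kA w t); [rewrite AB; ring|ring].
    - pose proof (proj1 (Cmod_gt_0 _) (Reg_Csinh_nz w HR)) as Hw.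
      set (m := Rmin 1 (Cmod (Csinh w))).
      assert (Hm : (0 < m <= 1)%R) by (split; [apply Rmin_glb_lt; lra|apply Rmin_l]).
      pose proof (Cmod_ge_0 (Ccosh w)).
      destruct (kernel_bounds mu m (Cmod (Csinh w) + Cmod (Ccosh w)) Hmu Hm) as [K HK].
      apply (clim_exp_dominated _ _ (Cmod mu * K) (- Re mu)); [lra|].
      intros T HT; destruct (HK w T HR (Rmin_r _ _) ltac:(lra) ltac:(lra) ltac:(lra)) as (_ & _ & _ & B).
      replace (F T - 0) with (F T) by ring; unfold F; rewrite !Cmod_mult, Cmod_R, Ropp_involutive, Rmult_assoc.
      apply Rmult_le_compat_l; [apply Cmod_ge_0|].
      rewrite <- (exp_shift1 (Re mu) T), <- Rmult_assoc.
      apply Rmult_le_compat; trivial; [apply Cmod_ge_0|apply Rabs_pos|apply sinh_upper; lra]. }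
  replace (F 0%R) with (RtoC 0) in E.
  2:{ unfold F; unfold sinh; rewrite Ropp_0, Rminus_eq_0; replace (0 / 2)%R with 0%R by field; ring. }
  unfold f in E; rewrite !HInt_plus, !HInt_scal in E; trivial; try (repeat apply hgood_plus; now apply hgood_scal).
  unfold Qc, Qc1, Qc2.
  transitivity (RtoC 0 - 0); [rewrite <- E; ring|ring].
Qed.

(** * The function of the second kind on the half-line z > 1 *)

(** For [w = s > 0] and [T = tanh s] the base of the kernel is [2 * cosh s * tB T t]. Unlike the kernel in
    [w], this one is regular at [T = 1], the point at infinity of the z-axis. *)
Definition tB (T t : R) : C := RtoC ((1 + T * cosh t) / 2).
Definition m0 (mu : C) (T t : R) : C := pw mu (tB T t).
Definition m1 (mu : C) (T t : R) : C := mu * (pw (mu - 1) (tB T t) * RtoC (cosh t / 2)).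
Definition m2 (mu : C) (T t : R) : C :=
  mu * ((mu - 1) * (pw (mu - 2) (tB T t) * (RtoC (cosh t / 2) * RtoC (cosh t / 2)))).

Lemma tB_pos T t : (0 <= T)%R -> (0 < Re (tB T t))%R.
Proof. intros H; simpl; pose proof (cosh_ge_1 t); nra. Qed.

Lemma tB_lower T0 T t : (0 < T0 <= T)%R -> (T0 / 4 * exp t <= Cmod (tB T t))%R.
Proof.
  intros H; unfold tB; pose proof (cosh_ge_1 t); pose proof (cosh_lower t); pose proof (exp_pos t).
  rewrite Cmod_R, Rabs_pos_eq by nra.
  assert (T0 * (exp t / 2) <= T * cosh t)%R by (apply Rmult_le_compat; lra); lra.
Qed.

Lemma tkernel_bounds mu T0 : (Re mu < 0)%R -> (0 < T0)%R ->
  exists K, forall T t, (T0 <= T)%R -> (0 <= t)%R ->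
    (Cmod (m0 mu T t) <= K * exp (- - Re mu * t) /\ Cmod (m1 mu T t) <= K * exp (- - Re mu * t) /\
     Cmod (m2 mu T t) <= K * exp (- - Re mu * t) /\
     Cmod (pw (mu - 1) (tB T t)) <= K * exp ((Re mu - 1) * t))%R.
Proof.
  intros Hmu HT0.
  pose (D := fun a : C => (exp (Rabs (Im a) * PI) * exp (Re a * ln (T0 / 4)))%R).
  assert (DP : forall a, (0 < D a)%R) by (intros; apply Rmult_lt_0_compat; apply exp_pos).
  assert (HD : forall a T t, (T0 <= T)%R -> (Re a <= 0)%R ->
    (Cmod (pw a (tB T t)) <= D a * exp (Re a * t))%R).
  { intros a T t HT Ha; apply pw_decay; trivial; [apply tB_pos; lra|lra|apply tB_lower; lra]. }
  pose proof (Cmod_ge_0 mu) as M0; pose proof (Cmod_ge_0 (mu - 1)) as M1.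
  pose proof (DP mu) as P0; pose proof (DP (mu - 1)) as P1; pose proof (DP (mu - 2)) as P2.
  exists (D mu + D (mu - 1)%C + Cmod mu * D (mu - 1)%C + Cmod mu * (Cmod (mu - 1)%C * D (mu - 2)%C))%R.
  intros T t HT Ht; rewrite Ropp_involutive.
  pose proof (HD mu T t HT ltac:(lra)) as B0.
  pose proof (HD (mu - 1) T t HT ltac:(simpl; unfold Re in *; lra)) as B1.
  pose proof (HD (mu - 2) T t HT ltac:(simpl; unfold Re in *; lra)) as B2.
  replace (Re (mu - 1)) with (Re mu - 1)%R in B1 by (simpl; unfold Re; ring).
  replace (Re (mu - 2)) with (Re mu - 2)%R in B2 by (simpl; unfold Re; ring).
  pose proof (exp_pos (Re mu * t)) as Ep; pose proof (exp_pos ((Re mu - 1) * t)) as Ep1.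
  pose proof (exp_pos ((Re mu - 2) * t)) as Ep2; pose proof (exp_pos t) as Et.
  assert (Hc : (Cmod (RtoC (cosh t / 2)) <= exp t)%R).
  { pose proof (cosh_ge_1 t); pose proof (cosh_upper t Ht); rewrite Cmod_R, Rabs_pos_eq; lra. }
  pose proof (Cmod_ge_0 (RtoC (cosh t / 2))) as C0.
  assert (U1 : (Cmod (m1 mu T t) <= Cmod mu * D (mu - 1)%C * exp (Re mu * t))%R).
  { unfold m1; rewrite !(Cmod_mult mu), (Cmod_mult (pw _ _)), <- (exp_shift1 (Re mu) t), Rmult_assoc.
    apply Rmult_le_compat_l; trivial; rewrite <- (Rmult_assoc (D (mu - 1)%C)); apply Rmult_le_compat; trivial; apply Cmod_ge_0. }
  assert (U2 : (Cmod (m2 mu T t) <= Cmod mu * (Cmod (mu - 1)%C * D (mu - 2)%C) * exp (Re mu * t))%R).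
  { unfold m2; rewrite !(Cmod_mult mu), (Cmod_mult (mu - 1)), (Cmod_mult (pw _ _)), (Cmod_mult (RtoC _)).
    rewrite <- (exp_shift2 (Re mu) t), !Rmult_assoc.
    apply Rmult_le_compat_l; trivial; apply Rmult_le_compat_l; trivial.
    rewrite <- (Rmult_assoc (D (mu - 2)%C)).
    apply Rmult_le_compat; trivial; [apply Cmod_ge_0|apply Rmult_le_pos; trivial|].
    apply Rmult_le_compat; trivial. }
  assert (N1 : (0 <= Cmod mu * D (mu - 1)%C)%R) by (apply Rmult_le_pos; lra).
  assert (N2 : (0 <= Cmod mu * (Cmod (mu - 1)%C * D (mu - 2)%C))%R).
  { apply Rmult_le_pos; trivial; apply Rmult_le_pos; lra. }
  repeat split; (eapply Rle_trans; [first [exact B0|exact U1|exact U2|exact B1]|]); apply Rmult_le_compat_r; lra.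
Qed.

Lemma cder_tB T t : cder (fun T => tB T t) T (RtoC (cosh t / 2)).
Proof. apply cder_RtoC; auto_derive; trivial; field. Qed.

Lemma ccont2_tB T t : ccont2 tB T t.
Proof.
  apply (ccont2_ext (fun T t => / 2 * (1 + RtoC T * RtoC (cosh t)))).
  - intros; unfold tB; rewrite RtoC_div, RtoC_plus, RtoC_mult by lra; unfold Cdiv; ring.
  - apply ccont2_mult; [apply ccont2_const|]; apply ccont2_plus; [apply ccont2_const|]; apply ccont2_mult.
    + apply (ccont2_1 (fun x => RtoC x)); eapply cder_ccont, cder_id.
    + apply (ccont2_2 (fun t => RtoC (cosh t))), ccont_cosh.
Qed.

Lemma ccont2_half_cosh T t : ccont2 (fun _ t => RtoC (cosh t / 2)) T t.
Proof.
  apply (ccont2_ext (fun _ t => / 2 * RtoC (cosh t))).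
  - intros; rewrite RtoC_div by lra; unfold Cdiv; ring.
  - apply ccont2_mult; [apply ccont2_const|]; apply (ccont2_2 (fun t => RtoC (cosh t))), ccont_cosh.
Qed.

Lemma tkernels_dfam mu T : (Re mu < 0)%R -> (0 < T)%R ->
  dfam (m0 mu) T (T / 2) /\ dfam (m1 mu) T (T / 2) /\ dfam (m2 mu) T (T / 2).
Proof.
  intros Hmu HT; destruct (tkernel_bounds mu (T / 2) Hmu ltac:(lra)) as [K HK].
  assert (S : forall x, (Rabs (x - T) < T / 2)%R -> (T / 2 <= x)%R) by (intros x Hx; apply Rabs_def2 in Hx; lra).
  assert (Cp : forall a x t, (Rabs (x - T) < T / 2)%R -> ccont2 (fun x t => pw a (tB x t)) x t).
  { intros a x t Hx; apply ccont2_pw; [apply ccont2_tB|apply tB_pos; specialize (S x Hx); lra]. }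
  split; [|split].
  - split; [intros x t Hx; now apply Cp|].
    exists K, (- Re mu)%R; split; [lra|]; intros x t Hx Ht; apply (HK x t (S x Hx) Ht).
  - split; [intros x t Hx|].
    + apply (ccont2_mult (fun _ _ => mu)); [apply ccont2_const|apply ccont2_mult; [now apply Cp|apply ccont2_half_cosh]].
    + exists K, (- Re mu)%R; split; [lra|]; intros x t Hx Ht; apply (HK x t (S x Hx) Ht).
  - split; [intros x t Hx|].
    + apply (ccont2_mult (fun _ _ => mu)); [apply ccont2_const|apply ccont2_mult; [apply ccont2_const|]].
      apply ccont2_mult; [now apply Cp|apply ccont2_mult; apply ccont2_half_cosh].
    + exists K, (- Re mu)%R; split; [lra|]; intros x t Hx Ht; apply (HK x t (S x Hx) Ht).
Qed.

Lemma HInt_der_at f f' s r : (0 < r)%R -> dfam f s r -> dfam f' s r ->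
  (forall x t, (Rabs (x - s) < r)%R -> cder (fun u => f u t) x (f' x t)) ->
  cder (fun x => HInt (f x)) s (HInt (f' s)).
Proof.
  intros Hr H H' Hd; apply (HInt_param_derive f f' s r); trivial; rewrite Rminus_eq_0, Rabs_R0; lra.
Qed.

Definition M0 (mu : C) (T : R) : C := HInt (m0 mu T).
Definition M1 (mu : C) (T : R) : C := HInt (m1 mu T).
Definition M2 (mu : C) (T : R) : C := HInt (m2 mu T).

Lemma mu_pred2 (mu : C) : mu - 1 - 1 = mu - 2.
Proof. unfold RtoC; apply C_ext; simpl; ring. Qed.

Lemma M_derivatives mu T : (Re mu < 0)%R -> (0 < T)%R ->
  cder (M0 mu) T (M1 mu T) /\ cder (M1 mu) T (M2 mu T).
Proof.
  intros Hmu HT; destruct (tkernels_dfam mu T Hmu HT) as (D0 & D1 & D2).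
  assert (S : forall x t, (Rabs (x - T) < T / 2)%R -> (0 < Re (tB x t))%R).
  { intros x t Hx; apply tB_pos; apply Rabs_def2 in Hx; lra. }
  split.
  - apply (HInt_der_at (m0 mu) (m1 mu) T (T / 2)); trivial; [lra|].
    intros x t Hx; eapply cder_eq.
    + apply (hol_pw mu (tB x t) (S x t Hx) (fun T => tB T t)); [reflexivity|apply cder_tB].
    + unfold m1; ring.
  - apply (HInt_der_at (m1 mu) (m2 mu) T (T / 2)); trivial; [lra|].
    intros x t Hx; unfold m1; eapply cder_eq.
    + apply cder_scal, cder_mult; [|apply cder_const].
      apply (hol_pw (mu - 1) (tB x t) (S x t Hx) (fun T => tB T t)); [reflexivity|apply cder_tB].
    + unfold m2; rewrite mu_pred2; ring.
Qed.

(** As for [Qc_equation], the operator turns the kernel into a derivative in [t]. *)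
Lemma M_equation mu T : (Re mu < 0)%R -> (0 < T)%R ->
  RtoC T * (1 - RtoC T * RtoC T) * M2 mu T
  + ((1 - RtoC T * RtoC T) - (1 - 2 * mu) * (RtoC T * RtoC T)) * M1 mu T - mu * (mu - 1) * RtoC T * M0 mu T = 0.
Proof.
  intros Hmu HT; destruct (tkernels_dfam mu T Hmu HT) as (D0 & D1 & D2).
  assert (S0 : (Rabs (T - T) < T / 2)%R) by (rewrite Rminus_eq_0, Rabs_R0; lra).
  apply (dfam_hgood _ _ _ T) in D0, D1, D2; trivial.
  pose (F := fun t => mu / 2 * (pw (mu - 1) (tB T t) * RtoC (sinh t))).
  pose (f := fun t => (RtoC T * (1 - RtoC T * RtoC T)) * m2 mu T t
    + ((1 - RtoC T * RtoC T) - (1 - 2 * mu) * (RtoC T * RtoC T)) * m1 mu T t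
    + (- (mu * (mu - 1) * RtoC T)) * m0 mu T t).
  assert (Gf : hgood f) by (unfold f; repeat apply hgood_plus; now apply hgood_scal).
  assert (E : HInt f = 0 - F 0%R).
  { apply HInt_derive; trivial.
    - intros t; pose proof (tB_pos T t ltac:(lra)) as P.
      eapply cder_eq.
      + apply cder_scal, cder_mult; [|apply cder_sinh].
        apply (hol_pw (mu - 1) _ P (fun t => tB T t) t (RtoC (T * sinh t / 2))); [reflexivity|].
        apply cder_RtoC; eapply is_derive_eq.
        * apply (is_derive_Rmult (fun t => 1 + T * cosh t)%R (fun _ => / 2)%R); [|apply @is_derive_const].
          apply is_derive_Rplus; [apply @is_derive_const|apply @is_derive_scal, is_derive_Reals, derivable_pt_lim_cosh].
        * unfold zero; simpl; field.
      + unfold f, m0, m1, m2; rewrite mu_pred2.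
        rewrite <- (pw_pred mu), <- (pw_pred (mu - 1)), mu_pred2 by trivial.
        set (P2 := pw (mu - 2) (tB T t)).
        unfold tB; rewrite !RtoC_div, !RtoC_plus, !RtoC_mult by lra.
        assert (S2 : RtoC (cosh t) * RtoC (cosh t) = 1 + RtoC (sinh t) * RtoC (sinh t)).
        { rewrite <- !RtoC_mult, cosh_sinh_sqr, RtoC_plus; ring. }
        set (s := RtoC (sinh t)) in *; set (c := RtoC (cosh t)) in *; set (x := RtoC T).
        transitivity (mu / 2 * P2 * ((mu - 1) * x * (c * c - 1) / 2 + (1 + x * c) / 2 * c));
          [rewrite S2|]; field; apply two_nz.
    - destruct (tkernel_bounds mu T Hmu HT) as [K HK].
      apply (clim_exp_dominated _ _ (Cmod (mu / 2) * K) (- Re mu)); [lra|].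
      intros u Hu; destruct (HK T u ltac:(lra) ltac:(lra)) as (_ & _ & _ & B).
      replace (F u - 0) with (F u) by ring; unfold F; rewrite (Cmod_mult (mu / 2)), (Cmod_mult (pw _ _)), Cmod_R, Ropp_involutive, Rmult_assoc.
      apply Rmult_le_compat_l; [apply Cmod_ge_0|].
      rewrite <- (exp_shift1 (Re mu) u), <- Rmult_assoc.
      apply Rmult_le_compat; trivial; [apply Cmod_ge_0|apply Rabs_pos|apply sinh_upper; lra]. }
  replace (F 0%R) with (RtoC 0) in E.
  2:{ unfold F; unfold sinh; rewrite Ropp_0, Rminus_eq_0; replace (0 / 2)%R with 0%R by field; ring. }
  unfold f in E; rewrite !HInt_plus, !HInt_scal in E; trivial; try (repeat apply hgood_plus; now apply hgood_scal).
  unfold M0, M1, M2.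
  transitivity (RtoC 0 - 0); [rewrite <- E; ring|ring].
Qed.

Lemma cder_zero_const f a b : (a <= b)%R -> (forall s, (a <= s <= b)%R -> cder f s 0) -> f a = f b.
Proof.
  intros Hab H.
  assert (E : CRInt (fun _ => 0) a b = f b - f a).
  { apply CRInt_derive; intros t; rewrite Rmin_left, Rmax_right by trivial; intros Ht; split; [now apply H|apply ccont_const]. }
  assert (E0 : CRInt (fun _ => 0) a b = 0).
  { apply C_ext; simpl; rewrite RInt_const; unfold scal; simpl; unfold mult; simpl; ring. }
  rewrite E0 in E; transitivity (f b - (f b - f a)); [ring|rewrite <- E; ring].
Qed.

Lemma ccont_left_zero f a b : (a < b)%R -> ccont f b -> (forall s, (a < s < b)%R -> f s = 0) -> f b = 0.
Proof.
  intros Hab Hc H0; destruct (Ceq_dec (f b) 0) as [|Hne]; trivial; exfalso.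
  apply Cmod_gt_0 in Hne; destruct (ccont_eps f b _ Hc Hne) as [d [P Q]].
  set (h := Rmin (d / 2) ((b - a) / 2)).
  assert (0 < h)%R by (apply Rmin_glb_lt; lra).
  assert (h <= d / 2 /\ h <= (b - a) / 2)%R as [] by (split; [apply Rmin_l|apply Rmin_r]).
  specialize (Q (- h)%R ltac:(rewrite Rabs_Ropp, Rabs_pos_eq; lra)).
  rewrite H0 in Q by lra; replace (0 - f b) with (- f b) in Q by ring; rewrite Cmod_opp in Q; lra.
Qed.

(** Put [Y T = hyp2F1 a b c (1 - T * T)]. By the relations between the parameters, [Y] satisfies
    [M_equation]. The Wronskian of [Y] and [M0], multiplied by [T * (1 - T * T) ^ c], is constant on
    (0, 1); the Wronskian itself is continuous at [T = 1] and [Re c > 0], so the constant is 0.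
    Hence the quotient of [M0] by [Y] is constant where [Y] does not vanish, in particular near [T = 1],
    where [Y] is 1. *)
Lemma M_proportional (mu a b c : C) : (Re mu < 0)%R ->
  2 * c = 1 - 2 * mu -> a + b = c -> 4 * (a * b) = mu * (mu - 1) ->
  exists T0, (0 < T0 < 1)%R /\ forall T, (T0 <= T <= 1)%R ->
    M0 mu T = M0 mu 1 * hyp2F1 a b c (RtoC (1 - T * T)).
Proof.
  intros Hmu Ec Eab Epr.
  assert (Hc : (1 / 2 < Re c)%R).
  { apply (f_equal Re) in Ec; simpl in Ec; unfold Re in *; lra. }
  assert (Np : nonpole c) by (apply Re_pos_nonpole; lra).
  destruct (gauss_equation a b c 0 Np ltac:(rewrite Cmod_0; lra)) as (G1 & G2 & HG & _).
  assert (GE : forall z, (Cmod z < 1)%R -> z * (1 - z) * G2 z + (c - (c + 1) * z) * G1 z - a * b * hyp2F1 a b c z = 0).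
  { intros z Hz; destruct (gauss_equation a b c z Np Hz) as (G1' & G2' & HG' & E).
    assert (E1 : forall w, (Cmod w < 1)%R -> G1' w = G1 w).
    { intros w Hw; apply (hol_unique (hyp2F1 a b c) w); apply Cdiff_hol; [now apply HG'|now apply HG]. }
    assert (E2 : G2' z = G2 z).
    { apply (hol_unique G1 z); apply Cdiff_hol; [|now apply HG].
      apply Cdiff_ext_loc with G1' (1 - Cmod z)%R; [lra| |now apply HG'].
      intros w Hw; apply E1; replace w with ((w - z) + z) by ring; eapply Rle_lt_trans; [apply Cmod_triangle|lra]. }
    rewrite E1, E2, Eab in E by trivial; exact E. }
  pose (v := fun T : R => RtoC (1 - T * T)).
  assert (Dv : forall T, cder v T (RtoC (- (2 * T)))).
  { intros T; apply cder_RtoC; auto_derive; trivial; ring. }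
  assert (Hv : forall T, (0 < T <= 1)%R -> (Cmod (v T) < 1)%R).
  { intros T HT; unfold v; rewrite Cmod_R, Rabs_pos_eq; nra. }
  pose (Y := fun T => hyp2F1 a b c (v T)).
  pose (Y1 := fun T => RtoC (- (2 * T)) * G1 (v T)).
  assert (DY : forall T, (0 < T <= 1)%R -> cder Y T (Y1 T)).
  { intros T HT; eapply cder_eq.
    - apply (Cdiff_hol _ _ _ (proj1 (HG _ (Hv T HT))) v T); [reflexivity|apply Dv].
    - unfold Y1; ring. }
  pose (Y2 := fun T => RtoC (- 2) * G1 (v T) + RtoC (- (2 * T)) * (G2 (v T) * RtoC (- (2 * T)))).
  assert (DY1 : forall T, (0 < T <= 1)%R -> cder Y1 T (Y2 T)).
  { intros T HT; unfold Y1, Y2; apply (cder_mult (fun T => RtoC (- (2 * T))) (fun T => G1 (v T))).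
    - apply cder_RtoC; auto_derive; trivial; ring.
    - apply (Cdiff_hol _ _ _ (proj2 (HG _ (Hv T HT))) v T); [reflexivity|apply Dv]. }
  assert (YE : forall T, (0 < T <= 1)%R -> RtoC T * (1 - RtoC T * RtoC T) * Y2 T
     + ((1 - RtoC T * RtoC T) - (1 - 2 * mu) * (RtoC T * RtoC T)) * Y1 T - mu * (mu - 1) * RtoC T * Y T = 0).
  { intros T HT; specialize (GE _ (Hv T HT)); unfold Y, Y1, Y2.
    assert (Ev : v T = 1 - RtoC T * RtoC T) by (unfold v; now rewrite RtoC_minus, RtoC_mult).
    rewrite <- Epr, <- Ec; rewrite !RtoC_opp, !RtoC_mult; set (x := RtoC T) in *.
    transitivity (4 * x * (v T * (1 - v T) * G2 (v T) + (c - (c + 1) * v T) * G1 (v T) - a * b * hyp2F1 a b c (v T))).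
    - generalize (hyp2F1 a b c (v T)), (G1 (v T)), (G2 (v T)); intros g0 g1 g2; rewrite Ev; ring.
    - rewrite GE; ring. }
  pose (W := fun T => Y T * M1 mu T - Y1 T * M0 mu T).
  assert (DW : forall T, (0 < T <= 1)%R -> cder W T (Y T * M2 mu T - Y2 T * M0 mu T)).
  { intros T HT; destruct (M_derivatives mu T Hmu ltac:(lra)) as [DM DM1].
    eapply cder_eq; [apply cder_minus; apply cder_mult; [now apply DY|exact DM1|now apply DY1|exact DM]|ring]. }
  (* T (1 - T^2)^c is the integrating factor of the equation for the Wronskian, since 2 c = 1 - 2 mu *)
  pose (phi := fun T => Cexp (c * RtoC (ln (1 - T * T)))).
  pose (N := fun T => RtoC T * (phi T * W T)).
  assert (DN : forall T, (0 < T < 1)%R -> cder N T 0).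
  { intros T HT; assert (HT1 : (0 < 1 - T * T)%R) by nra.
    eapply cder_eq.
    - apply cder_mult; [apply cder_id|apply cder_mult; [|apply DW; lra]].
      apply (hol_Cexp (c * RtoC (ln (1 - T * T))) (fun T => c * RtoC (ln (1 - T * T))) T (c * RtoC (- (2 * T) / (1 - T * T)))); [reflexivity|].
      apply cder_scal, cder_RtoC; auto_derive; [lra|field; lra].
    - fold (phi T); set (p := phi T); rewrite RtoC_div by lra.
      pose proof (YE T ltac:(lra)) as A1; pose proof (M_equation mu T Hmu ltac:(lra)) as A2.
      rewrite RtoC_opp, RtoC_mult, RtoC_minus, RtoC_mult.
      assert (Nz : 1 - RtoC T * RtoC T <> 0).
      { rewrite <- RtoC_mult, <- RtoC_minus; apply RtoC_nz; lra. }
      unfold W; set (x := RtoC T) in *.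
      transitivity (p / (1 - x * x) * (
         Y T * (x * (1 - x * x) * M2 mu T + ((1 - x * x) - (1 - 2 * mu) * (x * x)) * M1 mu T - mu * (mu - 1) * x * M0 mu T)
         - M0 mu T * (x * (1 - x * x) * Y2 T + ((1 - x * x) - (1 - 2 * mu) * (x * x)) * Y1 T - mu * (mu - 1) * x * Y T))).
      + change (phi T) with p; rewrite <- Ec; field; exact Nz.
      + rewrite A1, A2; field; exact Nz. }
  assert (W0 : forall T, (0 < T < 1)%R -> W T = 0).
  { intros T HT.
    assert (CW : ccont W 1) by (eapply cder_ccont, DW; lra).
    destruct (ccont_eps W 1 1 CW ltac:(lra)) as [d [Pd Qd]].
    set (B := (Cmod (W 1%R) + 1)%R).
    assert (BW : forall s, (1 - d < s < 1)%R -> (Cmod (W s) <= B)%R).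
    { intros s Hs; specialize (Qd (s - 1)%R ltac:(rewrite Rabs_left; lra)); replace (1 + (s - 1))%R with s in Qd by ring.
      replace (W s) with ((W s - W 1%R) + W 1%R) by ring; eapply Rle_trans; [apply Cmod_triangle|]; unfold B; lra. }
    assert (NT : N T = 0).
    { destruct (Ceq_dec (N T) 0) as [|Hne]; trivial; exfalso; apply Cmod_gt_0 in Hne.
      pose proof (Cmod_ge_0 (W 1%R)) as W10.
      (* 1 - s^2 <= y makes the factor (1 - s^2)^c of N smaller than |N T| / B *)
      set (y := exp (ln (Cmod (N T) / (2 * B)) / Re c)).
      assert (Hy : (0 < y)%R) by apply exp_pos.
      set (h := Rmin (Rmin (d / 2) ((1 - T) / 2)) (y / 2)).
      assert (Hh : (0 < h)%R) by (repeat apply Rmin_glb_lt; lra).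
      assert (h <= Rmin (d / 2) ((1 - T) / 2) /\ h <= y / 2)%R as [h1 h2] by (split; [apply Rmin_l|apply Rmin_r]).
      assert (h <= d / 2 /\ h <= (1 - T) / 2)%R as [h3 h4].
      { split; (eapply Rle_trans; [exact h1|]); [apply Rmin_l|apply Rmin_r]. }
      set (s := (1 - h)%R).
      assert (Hs : (T <= s < 1)%R) by (unfold s; lra).
      assert (ENs : N T = N s) by (apply cder_zero_const; [lra|]; intros u Hu; apply DN; lra).
      assert (Hss : (0 < 1 - s * s <= y)%R).
      { replace (1 - s * s)%R with (h * (2 - h))%R by (unfold s; ring); split; [apply Rmult_lt_0_compat; lra|nra]. }
      assert (Bd : (Cmod (N s) <= Cmod (N T) / (2 * B) * B)%R).
      { unfold N; rewrite (Cmod_mult (RtoC s)), (Cmod_mult (phi s)), Cmod_R, Rabs_pos_eq by lra.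
        unfold phi; rewrite Cmod_Cexp.
        replace (Re (c * RtoC (ln (1 - s * s)))) with (Re c * ln (1 - s * s))%R by (simpl; unfold Re; ring).
        assert (Ex : (exp (Re c * ln (1 - s * s)) <= Cmod (N T) / (2 * B))%R).
        { rewrite <- (exp_ln (Cmod (N T) / (2 * B))) by (apply Rdiv_lt_0_compat; unfold B; lra).
          apply exp_mono; apply Rle_trans with (Re c * ln y)%R.
          - apply Rmult_le_compat_l; [lra|apply ln_le; lra].
          - unfold y; rewrite ln_exp; right; field; lra. }
        pose proof (exp_pos (Re c * ln (1 - s * s))).
        assert (Cmod (W s) <= B)%R by (apply BW; unfold s; lra).
        pose proof (Cmod_ge_0 (W s)).
        assert (0 <= exp (Re c * ln (1 - s * s)) * Cmod (W s))%R by (apply Rmult_le_pos; lra).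
        apply Rle_trans with (1 * (exp (Re c * ln (1 - s * s)) * Cmod (W s)))%R; [apply Rmult_le_compat_r; lra|rewrite Rmult_1_l].
        apply Rmult_le_compat; trivial; lra. }
      rewrite <- ENs in Bd; unfold B in Bd.
      replace (Cmod (N T) / (2 * (Cmod (W 1%R) + 1)) * (Cmod (W 1%R) + 1))%R with (Cmod (N T) / 2)%R in Bd by (field; lra).
      lra. }
    unfold N in NT; apply Cmult_zero in NT; destruct NT as [NT|NT]; [exfalso; revert NT; apply RtoC_nz; lra|].
    apply Cmult_zero in NT; destruct NT as [NT|NT]; trivial; exfalso; revert NT; apply Cexp_neq_0. }
  assert (W1 : W 1%R = 0).
  { apply (ccont_left_zero W 0 1); trivial; [lra|]; eapply cder_ccont, DW; lra. }
  assert (Y11 : Y 1%R = 1).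
  { unfold Y, v; replace (1 - 1 * 1)%R with 0%R by ring; now apply hyp2F1_0. }
  assert (CY : ccont Y 1) by (eapply cder_ccont, DY; lra).
  destruct (ccont_eps Y 1 (1 / 2) CY ltac:(lra)) as [d [Pd Qd]].
  set (T0 := (1 - Rmin (d / 2) (1 / 2))%R).
  assert (Hm : (0 < Rmin (d / 2) (1 / 2) /\ Rmin (d / 2) (1 / 2) <= d / 2 /\ Rmin (d / 2) (1 / 2) <= 1 / 2)%R).
  { split; [apply Rmin_glb_lt; lra|split; [apply Rmin_l|apply Rmin_r]]. }
  assert (PY : forall T, (T0 <= T <= 1)%R -> (0 < Re (Y T))%R).
  { intros T HT; specialize (Qd (T - 1)%R ltac:(rewrite Rabs_left1; unfold T0 in HT; lra)).
    replace (1 + (T - 1))%R with T in Qd by ring; rewrite Y11 in Qd.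
    pose proof (re_le_Cmod (Y T - 1)) as K; apply Rabs_le_between in K.
    replace (Re (Y T - 1)) with (Re (Y T) - 1)%R in K by (unfold Re; simpl; ring); lra. }
  exists T0; split; [unfold T0; lra|]; intros T HT.
  (* pw (- (1)) is the inverse on the right half-plane, in a form that hol_pw differentiates *)
  pose (R := fun T => M0 mu T * pw (- (1)) (Y T)).
  assert (ER : R T = R 1%R).
  { apply cder_zero_const; [lra|]; intros s Hs.
    assert (Hs' : (T0 <= s <= 1)%R) by lra.
    assert (Hs1 : (0 < s <= 1)%R) by (unfold T0 in Hs'; lra).
    assert (Ws : W s = 0) by (destruct (Req_dec s 1) as [->|]; [exact W1|apply W0; lra]).
    destruct (M_derivatives mu s Hmu ltac:(lra)) as [DM _].
    eapply cder_eq.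
    - apply cder_mult; [exact DM|].
      apply (hol_pw (- (1)) (Y s) (PY s Hs') Y s (Y1 s)); [reflexivity|now apply DY].
    - cbv beta; rewrite <- (pw_pred (- (1)) (Y s)) by now apply PY.
      transitivity (pw (- (1) - 1) (Y s) * W s); [unfold W; ring|rewrite Ws; ring]. }
  assert (Inv : forall s, (T0 <= s <= 1)%R -> pw (- (1)) (Y s) * Y s = 1).
  { intros s Hs; rewrite <- (pw_1 (Y s)) at 2 by now apply PY.
    rewrite <- pw_add; unfold pw; replace ((- (1) + 1) * Clr (Y s)) with (RtoC 0) by ring; apply Cexp_0. }
  transitivity (R T * Y T); [unfold R; rewrite <- Cmult_assoc, Inv by lra; ring|].
  assert (E1 : pw (- (1)) (Y 1%R) = 1).
  { pose proof (Inv 1%R ltac:(unfold T0 in *; lra)) as I; rewrite Y11, Cmult_1_r in I; rewrite Y11; exact I. }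
  rewrite ER; unfold R; rewrite E1; unfold Y, v; ring.
Qed.

Lemma cosh_pos s : (0 < cosh s)%R.
Proof. pose proof (cosh_ge_1 s); lra. Qed.

Lemma Qc_real mu s : (Re mu < 0)%R -> (0 < s)%R ->
  Qc mu (RtoC s) = pw mu (RtoC (2 * cosh s)) * M0 mu (sinh s / cosh s).
Proof.
  intros Hmu Hs; pose proof (cosh_pos s) as Hc; pose proof (sinh_pos s Hs) as Hsh.
  assert (HT : (0 < sinh s / cosh s)%R) by now apply Rdiv_lt_0_compat.
  assert (HR : Reg (RtoC s)).
  { repeat split; simpl; try lra; [rewrite Rabs_R0; pose proof PI_RGT_0; lra|apply RtoC_nz; lra]. }
  destruct (tkernels_dfam mu _ Hmu HT) as (D0 & _ & _).
  apply (dfam_hgood _ _ _ (sinh s / cosh s)) in D0; [|rewrite Rminus_eq_0, Rabs_R0; lra].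
  unfold Qc, M0; rewrite <- HInt_scal by trivial; apply HInt_ext.
  - intros t _; unfold k0, m0.
    assert (E : kA (RtoC s) t = RtoC (2 * cosh s) * tB (sinh s / cosh s) t).
    { unfold kA, tB; rewrite Ccosh_eq, Csinh_eq; simpl; rewrite cos_0, sin_0.
      apply C_ext; simpl; field; lra. }
    rewrite E; apply pw_mult; [simpl; lra|apply tB_pos; lra|rewrite <- E; now apply kA_pos].
  - now apply kernels_good.
  - now apply hgood_scal.
Qed.

(** * Integrals over the whole line *)

(** Integral over the whole line, folded onto the half-line. *)
Definition WI (g : R -> C) : C := HInt (fun t => g t + g (- t)%R).

Definition wgood (g : R -> C) : Prop :=
  (forall t, ccont g t) /\
  exists M d, (0 < d)%R /\ forall t, (Cmod (g t) <= M * exp (- d * Rabs t))%R.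

Lemma ccont_reflect g t : (forall t, ccont g t) -> ccont (fun t => g (- t)%R) t.
Proof.
  intros H; destruct (H (- t)%R) as [H1 H2]; split.
  - apply (continuity_pt_comp (fun t => - t)%R (fun t => Re (g t))); trivial.
    apply derivable_continuous_pt; apply derivable_pt_opp, derivable_pt_id.
  - apply (continuity_pt_comp (fun t => - t)%R (fun t => Im (g t))); trivial.
    apply derivable_continuous_pt; apply derivable_pt_opp, derivable_pt_id.
Qed.

Lemma wgood_right g : wgood g -> hgood g.
Proof.
  intros [H [M [d [H1 H2]]]]; split; trivial; exists M, d; split; trivial; intros t Ht.
  specialize (H2 t); now rewrite Rabs_pos_eq in H2.
Qed.

Lemma wgood_reflect g : wgood g -> wgood (fun t => g (- t)%R).
Proof.
  intros [H [M [d [H1 H2]]]]; split; [intros; now apply ccont_reflect|].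
  exists M, d; split; trivial; intros t; specialize (H2 (- t)%R); now rewrite Rabs_Ropp in H2.
Qed.

Lemma wgood_hgood g : wgood g -> hgood (fun t => g t + g (- t)%R).
Proof.
  intros H; apply hgood_plus; [now apply wgood_right|].
  apply (wgood_right (fun t => g (- t)%R)); now apply wgood_reflect.
Qed.

Lemma WI_split g : wgood g -> WI g = HInt g + HInt (fun t => g (- t)%R).
Proof.
  intros H; apply (HInt_plus g (fun t => g (- t)%R)); [now apply wgood_right|].
  apply (wgood_right (fun t => g (- t)%R)); now apply wgood_reflect.
Qed.

Lemma WI_derive G g l1 l2 : (forall v, cder G v (g v)) -> wgood g ->
  clim G l1 -> clim (fun T => G (- T)%R) l2 -> WI g = l1 - l2.
Proof.
  intros HG Hg H1 H2; unfold WI.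
  rewrite (HInt_derive (fun t => G t + - G (- t)%R) _ (l1 + - l2)).
  - rewrite Ropp_0; ring.
  - intros t; eapply cder_eq.
    + apply cder_plus; [apply HG|apply cder_opp].
      apply (cder_comp G (fun t => - t)%R t (g (- t)%R) (-1)); [apply HG|auto_derive; trivial].
    + apply C_ext; simpl; unfold Re, Im; ring.
  - now apply wgood_hgood.
  - apply clim_plus; trivial; now apply clim_opp.
Qed.

Lemma primitive g v : (forall t, ccont g t) -> cder (fun v => CRInt g 0 v) v (g v).
Proof.
  intros H; split; simpl.
  - apply (is_derive_RInt (fun t => Re (g t)) (fun v => RInt (fun t => Re (g t)) 0 v) 0 v).
    + apply filter_forall; intros x; apply (RInt_correct (V := R_CompleteNormedModule)); apply ex_RInt_cont; intros; apply H.
    + apply continuity_pt_filterlim, H.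
  - apply (is_derive_RInt (fun t => Im (g t)) (fun v => RInt (fun t => Im (g t)) 0 v) 0 v).
    + apply filter_forall; intros x; apply (RInt_correct (V := R_CompleteNormedModule)); apply ex_RInt_cont; intros; apply H.
    + apply continuity_pt_filterlim, H.
Qed.

Lemma primitive_reflect g T : (forall t, ccont g t) ->
  CRInt g 0 (- T) = - CRInt (fun t => g (- t)%R) 0 T.
Proof.
  intros H.
  rewrite (CRInt_derive (fun t => - CRInt g 0 (- t)) (fun t => g (- t)%R) 0 T).
  - rewrite Ropp_0.
    replace (CRInt g 0 0) with (RtoC 0); [ring|].
    apply C_ext; simpl; rewrite RInt_point; reflexivity.
  - intros t _; split; [|now apply ccont_reflect].
    eapply cder_eq; [apply cder_opp, (cder_comp (fun v => CRInt g 0 v) (fun t => - t)%R t (g (- t)%R) (-1))|].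
    + now apply primitive.
    + auto_derive; trivial.
    + apply C_ext; simpl; unfold Re, Im; ring.
Qed.

Lemma primitive_limits g : wgood g ->
  clim (fun T => CRInt g 0 T) (HInt g) /\
  clim (fun T => CRInt g 0 (- T)) (- HInt (fun t => g (- t)%R)).
Proof.
  intros H; split; [now apply HInt_lim, wgood_right|].
  apply (clim_ext (fun T => - CRInt (fun t => g (- t)%R) 0 T)).
  - intros; symmetry; apply primitive_reflect, H.
  - apply clim_opp, HInt_lim; apply (wgood_right (fun t => g (- t)%R)); now apply wgood_reflect.
Qed.

Lemma clim_shift F h l : clim F l -> clim (fun T => F (T + h)%R) l.
Proof.
  assert (K : forall (u : R -> R) (x : R), is_lim u p_infty x -> is_lim (fun T => u (T + h)%R) p_infty x).
  { intros u x Hu; apply (is_lim_ext (fun T => u (1 * T + h)%R)); [intros; f_equal; ring|].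
    apply is_lim_comp_lin; [|lra].
    replace (Rbar_plus (Rbar_mult 1%R p_infty) h) with p_infty; trivial.
    simpl; destruct (Rle_dec 0 1); [|lra]; destruct (Rle_lt_or_eq_dec 0 1 r); [trivial|lra]. }
  intros [H1 H2]; split; [now apply (K (fun T => Re (F T)))|now apply (K (fun T => Im (F T)))].
Qed.

Lemma WI_shift g h : wgood g -> wgood (fun v => g (v + h)%R) -> WI (fun v => g (v + h)%R) = WI g.
Proof.
  intros H H'; destruct (primitive_limits g H) as [L1 L2].
  rewrite (WI_derive (fun v => CRInt g 0 (v + h)) _ (HInt g) (- HInt (fun t => g (- t)%R))); trivial.
  - rewrite WI_split by trivial; ring.
  - intros v; eapply cder_eq; [apply (cder_comp (fun v => CRInt g 0 v) (fun v => v + h)%R v (g (v + h)%R) 1)|].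
    + apply primitive, H.
    + auto_derive; trivial.
    + ring.
  - now apply (clim_shift (fun T => CRInt g 0 T)).
  - apply (clim_ext (fun T => CRInt g 0 (- (T + - h)))); [intros; f_equal; ring|].
    now apply (clim_shift (fun T => CRInt g 0 (- T))).
Qed.

Lemma wgood_scal c g : wgood g -> wgood (fun v => c * g v).
Proof.
  intros [H [M [d [H1 H2]]]]; split.
  - intros; apply ccont_mult; trivial; apply ccont_const.
  - exists (Cmod c * M)%R, d; split; trivial; intros; rewrite Cmod_mult, Rmult_assoc.
    apply Rmult_le_compat_l; [apply Cmod_ge_0|auto].
Qed.

Lemma WI_scal c g : wgood g -> WI (fun v => c * g v) = c * WI g.
Proof.
  intros H; unfold WI; rewrite <- HInt_scal by now apply wgood_hgood.
  apply HInt_ext; [intros; ring| |now apply hgood_scal, wgood_hgood].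
  apply wgood_hgood; now apply wgood_scal.
Qed.

Lemma wgood_plus f g : wgood f -> wgood g -> wgood (fun t => f t + g t).
Proof.
  intros [H [M [d [H1 H2]]]] [H' [M' [d' [H1' H2']]]]; split.
  - intros; now apply ccont_plus.
  - exists (M + M')%R, (Rmin d d'); split; [now apply Rmin_glb_lt|].
    intros t; eapply Rle_trans; [apply Cmod_triangle|].
    rewrite Rmult_plus_distr_r.
    assert (Mp : forall (k : R -> C) m e, (forall t, (Cmod (k t) <= m * exp (- e * Rabs t))%R) -> (0 <= m)%R).
    { intros k m e Hk; apply (bound_nonneg k m e); intros u Hu; specialize (Hk u); now rewrite Rabs_pos_eq in Hk. }
    pose proof (exp_weaken M d (Rmin d d') (Rabs t) (Mp _ _ _ H2) (Rmin_l _ _) (Rabs_pos t)).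
    pose proof (exp_weaken M' d' (Rmin d d') (Rabs t) (Mp _ _ _ H2') (Rmin_r _ _) (Rabs_pos t)).
    specialize (H2 t); specialize (H2' t); lra.
Qed.

Lemma WI_plus f g : wgood f -> wgood g -> WI (fun v => f v + g v) = WI f + WI g.
Proof.
  intros Hf Hg; rewrite !WI_split; trivial; [|now apply wgood_plus].
  rewrite (HInt_plus f g), (HInt_plus (fun t => f (- t)%R) (fun t => g (- t)%R)).
  - ring.
  - apply (wgood_right (fun t => f (- t)%R)); now apply wgood_reflect.
  - apply (wgood_right (fun t => g (- t)%R)); now apply wgood_reflect.
  - now apply wgood_right.
  - now apply wgood_right.
Qed.

Lemma WI_ext f g : (forall v, f v = g v) -> WI f = WI g.
Proof. intros E; unfold WI; f_equal; apply functional_extensionality; intros; now rewrite !E. Qed.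

Lemma HInt_norm_le f (h : R -> R) : hgood f -> hgood (fun t => RtoC (h t)) ->
  (forall t, (0 <= t)%R -> (Cmod (f t) <= h t)%R) -> (Cmod (HInt f) <= 2 * Re (HInt (fun t => RtoC (h t))))%R.
Proof.
  intros Hf Hh H.
  destruct (HInt_lim f Hf) as [F1 F2]; destruct (HInt_lim _ Hh) as [L _]; simpl in L.
  assert (K : forall (u : R -> R) (l : R), (forall t, continuity_pt u t) ->
     (forall t, (0 <= t)%R -> (Rabs (u t) <= h t)%R) -> is_lim (fun T => RInt u 0 T) p_infty l ->
     (Rabs l <= Re (HInt (fun t => RtoC (h t))))%R).
  { intros u l Hu Hb Hl.
    assert (Hc : forall t, continuity_pt h t) by (intros t; apply (proj1 (proj1 Hh t))).
    assert (A : forall T, (0 < T)%R -> (Rabs (RInt u 0 T) <= RInt h 0 T)%R).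
    { intros T HT; eapply Rle_trans; [apply (abs_RInt_le u 0 T); [lra|now apply ex_RInt_cont]|].
      apply RInt_le; [lra| |now apply ex_RInt_cont|intros; apply Hb; lra].
      apply ex_RInt_cont; intros; apply (continuity_pt_comp u Rabs); trivial; apply Rcontinuity_abs. }
    apply Rabs_le; split.
    - apply Ropp_le_cancel; rewrite Ropp_involutive.
      apply (is_lim_le_loc (fun T => - RInt u 0 T)%R (fun T => RInt h 0 T) p_infty (- l)%R (Re (HInt (fun t => RtoC (h t))))); trivial.
      + exists 0%R; intros T HT; specialize (A T HT); apply Rabs_le_between in A; lra.
      + apply (is_lim_opp _ _ (Finite _)); trivial.
    - apply (is_lim_le_loc (fun T => RInt u 0 T)%R (fun T => RInt h 0 T) p_infty l (Re (HInt (fun t => RtoC (h t))))); trivial.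
      exists 0%R; intros T HT; specialize (A T HT); apply Rabs_le_between in A; lra. }
  eapply Rle_trans; [apply Cmod_le_ReIm|].
  assert (K1 := K _ _ (fun t => proj1 (proj1 Hf t)) (fun t Ht => Rle_trans _ _ _ (re_le_Cmod (f t)) (H t Ht)) F1).
  assert (K2 := K _ _ (fun t => proj2 (proj1 Hf t)) (fun t Ht => Rle_trans _ _ _ (im_le_Cmod (f t)) (H t Ht)) F2).
  lra.
Qed.

Lemma WI_norm_le f (h : R -> R) : wgood f -> wgood (fun t => RtoC (h t)) ->
  (forall t, (Cmod (f t) <= h t)%R) -> (Cmod (WI f) <= 2 * Re (WI (fun t => RtoC (h t))))%R.
Proof.
  intros Hf Hh H; unfold WI.
  replace (HInt (fun t => RtoC (h t) + RtoC (h (- t)%R))) with (HInt (fun t => RtoC (h t + h (- t)%R))).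
  - apply HInt_norm_le; [now apply wgood_hgood| |].
    + apply wgood_hgood in Hh; destruct Hh as [H1 [M [d [H2 H3]]]].
      replace (fun t => RtoC (h t + h (- t)%R)) with (fun t => RtoC (h t) + RtoC (h (- t)%R)).
      * split; trivial; now exists M, d.
      * apply functional_extensionality; intros; now rewrite RtoC_plus.
    + intros t _; eapply Rle_trans; [apply Cmod_triangle|]; apply Rplus_le_compat; apply H.
  - f_equal; apply functional_extensionality; intros; now rewrite RtoC_plus.
Qed.

(** ** Improper integrals over (0, oo) by the substitution t = exp v *)

Lemma CRInt_is_RInt f a b : ex_RInt (fun t => Re (f t)) a b -> ex_RInt (fun t => Im (f t)) a b ->
  is_RInt (V := C_R_NormedModule) f a b (CRInt f a b).
Proof.
  intros H1 H2; apply (is_RInt_fct_extend_pair (U := R_NormedModule) (V := R_NormedModule));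
    apply (RInt_correct (V := R_CompleteNormedModule)); trivial.
Qed.

(** After [t = exp v] both improper ends become ends at infinity of an exponentially decaying
    function. *)
Lemma exp_substitution (f g : R -> C) : wgood g -> (forall v, f (exp v) * RtoC (exp v) = g v) ->
  is_RInt_gen (V := C_R_NormedModule) f (at_right 0) (Rbar_locally p_infty) (WI g).
Proof.
  intros Hg E.
  assert (Ef : forall t, (0 < t)%R -> f t = RtoC (/ t) * g (ln t)).
  { intros t Ht; rewrite <- E, exp_ln, RtoC_inv by (trivial; lra); field; apply RtoC_nz; lra. }
  assert (I : forall a b, (0 < a)%R -> (0 < b)%R ->
    is_RInt (V := C_R_NormedModule) f a b (CRInt g 0 (ln b) - CRInt g 0 (ln a))).
  { intros a b Ha Hb.
    assert (Hpos : forall t, (Rmin a b <= t <= Rmax a b)%R -> (0 < t)%R).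
    { intros t Ht; assert (0 < Rmin a b)%R by now apply Rmin_glb_lt. lra. }
    pose (k := fun t => RtoC (/ t) * g (ln t)).
    assert (Dk : forall t, (0 < t)%R -> cder (fun t => CRInt g 0 (ln t)) t (k t)).
    { intros t Ht; apply (cder_comp (fun v => CRInt g 0 v) ln t (g (ln t)) (/ t)%R); [apply primitive, Hg|].
      apply is_derive_Reals; now apply derivable_pt_lim_ln. }
    assert (Ck : forall t, (0 < t)%R -> ccont k t).
    { intros t Ht; apply ccont_mult.
      - apply ccont_RtoC; apply (continuity_pt_inv (fun t => t)); [apply derivable_continuous_pt, derivable_pt_id|lra].
      - destruct (proj1 Hg (ln t)) as [C1 C2].
        assert (Cl : continuity_pt ln t) by (apply derivable_continuous_pt; exists (/ t)%R; now apply derivable_pt_lim_ln).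
        split; [now apply (continuity_pt_comp ln (fun v => Re (g v)))|now apply (continuity_pt_comp ln (fun v => Im (g v)))]. }
    rewrite <- (CRInt_derive (fun t => CRInt g 0 (ln t)) k a b) by (intros t Ht; split; [apply Dk|apply Ck]; now apply Hpos).
    apply (is_RInt_ext k).
    - intros t Ht; symmetry; apply Ef, Hpos; lra.
    - apply CRInt_is_RInt; apply @ex_RInt_continuous; intros t Ht; apply continuity_pt_filterlim; apply Ck, Hpos, Ht. }
  destruct (primitive_limits g Hg) as [[L1 L2] [L3 L4]].
  intros P [e HP].
  apply is_lim_spec in L1, L2, L3, L4.
  assert (He : (0 < e / 2)%R) by (pose proof (cond_pos e); lra).
  destruct (L1 (mkposreal _ He)) as [B1 HB1], (L2 (mkposreal _ He)) as [B2 HB2],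
    (L3 (mkposreal _ He)) as [B3 HB3], (L4 (mkposreal _ He)) as [B4 HB4]; simpl in *.
  set (B := (Rabs B1 + Rabs B2 + Rabs B3 + Rabs B4)%R).
  assert (HB : (B1 <= B /\ B2 <= B /\ B3 <= B /\ B4 <= B)%R).
  { unfold B; pose proof (Rle_abs B1); pose proof (Rle_abs B2); pose proof (Rle_abs B3); pose proof (Rle_abs B4);
    pose proof (Rabs_pos B1); pose proof (Rabs_pos B2); pose proof (Rabs_pos B3); pose proof (Rabs_pos B4); lra. }
  unfold filtermapi.
  exists (fun a => (0 < a < exp (- B))%R) (fun b => (exp B < b)%R).
  - exists (mkposreal _ (exp_pos (- B))); intros y Hy Hy0; split; trivial.
    assert (Hy' : (Rabs (y - 0) < exp (- B))%R) by exact Hy; rewrite Rminus_0_r, Rabs_pos_eq in Hy'; lra.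
  - now exists (exp B).
  - intros a b Ha Hb; simpl.
    pose proof (exp_pos B) as EB.
    exists (CRInt g 0 (ln b) - CRInt g 0 (ln a)); split; [apply I; lra|].
    assert (Hlb : (B < ln b)%R) by (rewrite <- (ln_exp B); apply ln_increasing; lra).
    assert (Hla : (B < - ln a)%R).
    { assert (ln a < - B)%R; [|lra]. rewrite <- (ln_exp (- B)); apply ln_increasing; lra. }
    specialize (HB1 (ln b) ltac:(lra)); specialize (HB2 (ln b) ltac:(lra)).
    specialize (HB3 (- ln a)%R ltac:(lra)); specialize (HB4 (- ln a)%R ltac:(lra)).
    rewrite Ropp_involutive in HB3, HB4.
    apply HP; rewrite WI_split by trivial.
    apply Rabs_def2 in HB1, HB2, HB3, HB4.
    split; apply Rabs_def1; unfold minus, plus, opp, HInt; simpl; lra.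
Qed.

Lemma CInt_exp (f g : R -> C) : wgood g -> (forall v, f (exp v) * RtoC (exp v) = g v) ->
  ex_CInt_0_infty f /\ CInt_0_infty f = WI g.
Proof.
  intros Hg E; pose proof (exp_substitution f g Hg E) as I; split; [now exists (WI g)|].
  unfold CInt_0_infty; apply (is_RInt_gen_unique (V := C_R_CompleteNormedModule)); exact I.
Qed.

(** * The Gamma function *)

(** Euler's integrand after the substitution [t = exp v]. *)
Definition gk (a : C) (v : R) : C := Cexp (a * RtoC v - RtoC (exp v)).

Lemma Cmod_gk a v : Cmod (gk a v) = exp (Re a * v - exp v).
Proof. unfold gk; rewrite Cmod_Cexp; f_equal; simpl; unfold Re; ring. Qed.

Lemma exp_quad v : (0 <= v)%R -> (1 + v + v * v / 2 <= exp v)%R.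
Proof.
  intros Hv.
  assert (K : forall u, (0 <= u)%R -> (1 + u <= exp u)%R) by (intros; apply exp_ineq1_le).
  assert (L : (0 - (exp v - (1 + v + v * v / 2)) <= 0 - (exp 0 - (1 + 0 + 0 * 0 / 2)))%R).
  { apply (is_derive_mono (fun u => 0 - (exp u - (1 + u + u * u / 2)))%R (fun u => - (exp u - (1 + u)))%R); trivial.
    - intros u Hu; auto_derive; trivial; field.
    - intros u Hu; specialize (K u ltac:(lra)); lra. }
  rewrite exp_0 in L; lra.
Qed.

(** For [v >= 0] the double exponential beats every exponential, quantitatively by [exp_quad]. *)
Lemma gk_bound a v : (0 < Re a)%R ->
  (Cmod (gk a v) <= exp ((Re a + 1) * (Re a + 1) / 2) * exp (- Rmin (Re a) 1 * Rabs v))%R.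
Proof.
  intros Ha; rewrite Cmod_gk, <- exp_plus; apply exp_mono.
  pose proof (Rmin_l (Re a) 1); pose proof (Rmin_r (Re a) 1).
  assert (0 < Rmin (Re a) 1)%R by (apply Rmin_glb_lt; lra).
  destruct (Rle_or_lt 0 v) as [Hv|Hv].
  - rewrite Rabs_pos_eq by trivial; pose proof (exp_quad v Hv).
    pose proof (pow2_ge_0 (Re a + 1 - v)); nra.
  - rewrite Rabs_left by trivial; pose proof (exp_pos v); nra.
Qed.

Lemma ccont_gk a v : ccont (gk a) v.
Proof.
  apply ccont_of_c2, ccont2_Cexp, (ccont2_1 (fun v => a * RtoC v - RtoC (exp v))).
  eapply cder_ccont, cder_minus; [apply cder_scal, cder_id|apply cder_RtoC, is_derive_exp].
Qed.

Lemma gk_wgood a : (0 < Re a)%R -> wgood (gk a).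
Proof.
  intros Ha; split; [apply ccont_gk|].
  exists (exp ((Re a + 1) * (Re a + 1) / 2)), (Rmin (Re a) 1); split; [apply Rmin_glb_lt; lra|].
  intros; now apply gk_bound.
Qed.

Lemma Clr_exp v : Clr (RtoC (exp v)) = RtoC v.
Proof. rewrite Clr_RtoC by apply exp_pos; now rewrite ln_exp. Qed.

Lemma CGamma_WI a : (0 < Re a)%R -> CGamma a = WI (gk a).
Proof.
  intros Ha; apply (CInt_exp _ (gk a)); [now apply gk_wgood|].
  intros v; rewrite Cpower_pw by (simpl; apply exp_pos); unfold pw; rewrite Clr_exp.
  rewrite <- (Cexp_RtoC v) at 2; rewrite <- !Cexp_add; unfold gk; f_equal; ring.
Qed.

Lemma gk_limits a : (0 < Re a)%R -> clim (gk a) 0 /\ clim (fun T => gk a (- T)%R) 0.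
Proof.
  intros Ha; assert (P : (0 < Rmin (Re a) 1)%R) by (apply Rmin_glb_lt; lra).
  split; eapply (clim_exp_dominated _ _ _ _ P); intros T HT.
  - replace (gk a T - 0) with (gk a T) by ring; pose proof (gk_bound a T Ha) as B.
    rewrite Rabs_pos_eq in B by lra; exact B.
  - replace (gk a (- T)%R - 0) with (gk a (- T)%R) by ring; pose proof (gk_bound a (- T) Ha) as B.
    rewrite Rabs_Ropp, Rabs_pos_eq in B by lra; exact B.
Qed.

Lemma cder_gk a v : cder (gk a) v (a * gk a v + (- (1)) * gk (a + 1) v).
Proof.
  eapply cder_eq.
  - apply (hol_Cexp (a * RtoC v - RtoC (exp v)) (fun v => a * RtoC v - RtoC (exp v)) v (a - RtoC (exp v))); [reflexivity|].
    eapply cder_eq; [apply cder_minus; [apply cder_scal, cder_id|apply cder_RtoC, is_derive_exp]|ring].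
  - replace (gk (a + 1) v) with (gk a v * RtoC (exp v)); [unfold gk; ring|].
    rewrite <- (Cexp_RtoC v); unfold gk; rewrite <- Cexp_add; f_equal; ring.
Qed.

(** Integration by parts: [cder_gk] writes the difference of the two sides as a total derivative. *)
Lemma CGamma_succ a : (0 < Re a)%R -> CGamma (a + 1) = a * CGamma a.
Proof.
  intros Ha; assert (Ha1 : (0 < Re (a + 1))%R) by (simpl; unfold Re in *; lra).
  destruct (gk_limits a Ha) as [L1 L2].
  pose proof (gk_wgood a Ha) as G0; pose proof (gk_wgood _ Ha1) as G1.
  assert (E := WI_derive (gk a) _ 0 0 (cder_gk a) ltac:(apply wgood_plus; now apply wgood_scal) L1 L2).
  rewrite WI_plus, !WI_scal in E; trivial; try now apply wgood_scal.
  rewrite !CGamma_WI by trivial.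
  transitivity (a * WI (gk a) - (a * WI (gk a) + (- (1)) * WI (gk (a + 1)))); [ring|rewrite E; ring].
Qed.

Lemma gk_real x v : gk (RtoC x) v = RtoC (exp (x * v - exp v)).
Proof. unfold gk; rewrite <- RtoC_mult, <- RtoC_minus; apply Cexp_RtoC. Qed.

Lemma RHint_pos (h : R -> R) M d : (forall t, continuity_pt h t) -> (0 < d)%R ->
  (forall t, (0 <= t)%R -> (Rabs (h t) <= M * exp (- d * t))%R) -> (forall t, (0 < h t)%R) -> (0 < RHint h)%R.
Proof.
  intros Hc Hd Hb Hp; destruct (RHint_spec h M d Hc Hd Hb) as [L _].
  assert (I : (0 < RInt h 0 1)%R).
  { apply RInt_gt_0; [lra|intros; apply Hp|intros; apply continuity_pt_filterlim; apply Hc]. }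
  apply Rlt_le_trans with (1 := I).
  apply (is_lim_le_loc (fun _ => RInt h 0 1) (fun T => RInt h 0 T) p_infty (RInt h 0 1) (RHint h)); trivial.
  - exists 1%R; intros T HT.
    rewrite <- (RInt_Chasles h 0 1 T) by now apply ex_RInt_cont.
    assert (0 <= RInt h 1 T)%R.
    { apply RInt_ge_0; [lra|now apply ex_RInt_cont|intros; left; apply Hp]. }
    unfold plus; simpl; lra.
  - apply is_lim_const.
Qed.

Lemma CGamma_real_pos x : (0 < x)%R -> exists r, (0 < r)%R /\ CGamma (RtoC x) = RtoC r.
Proof.
  intros Hx; rewrite CGamma_WI by exact Hx.
  pose proof (gk_wgood (RtoC x) Hx) as G; pose proof (wgood_hgood _ G) as GH.
  exists (Re (WI (gk (RtoC x)))); split.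
  - destruct (hgood_re _ GH) as (M & d & H1 & H2 & H3).
    apply (RHint_pos _ M d); trivial; intros t; rewrite !gk_real; simpl.
    pose proof (exp_pos (x * t - exp t)); pose proof (exp_pos (x * - t - exp (- t))); lra.
  - apply C_ext; trivial.
    assert (E0 : RHint (fun t => Im (gk (RtoC x) t + gk (RtoC x) (- t))) = 0%R); [|exact E0].
    unfold RHint; rewrite (is_lim_unique _ p_infty 0%R); trivial.
    apply (is_lim_ext (fun _ => 0%R)); [|apply is_lim_const].
    intros T; symmetry; transitivity (RInt (fun _ => 0%R) 0 T).
    + apply RInt_ext; intros t _; rewrite !gk_real; simpl; ring.
    + rewrite RInt_const; unfold scal; simpl; unfold mult; simpl; ring.
Qed.

(** For large [x] the mass of [exp (x * v - exp v)] concentrates near [v = ln x], so that Gamma at [x + i y] is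
    close to [x ^ (i y)] times Gamma at [x]. The deviation of the phases is at most [Rabs y * Rabs D] with
    [D = v - ln x], and [Rabs D <= k / 2 + D ^ 2 / (2 * k)] with [D ^ 2 <= exp D + exp (- D) - 2] bounds it by
    integrands of Gamma at [x], [x + 1] and [x - 1]. *)
Lemma gk_phase x y v k : (0 < k)%R -> (0 < x)%R ->
  (Cmod (gk (x, y) v - Cexp (Ci * RtoC (y * ln x)) * gk (RtoC x) v) <=
   Rabs y * ((k / 2 - / k) * exp (x * v - exp v) + / (2 * k) * (/ x * exp ((x + 1) * v - exp v) + x * exp ((x - 1) * v - exp v))))%R.
Proof.
  intros Hk Hx.
  assert (E : gk (x, y) v - Cexp (Ci * RtoC (y * ln x)) * gk (RtoC x) v =
     gk (RtoC x) v * (Cexp (Ci * RtoC (y * v)) - Cexp (Ci * RtoC (y * ln x)))).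
  { replace (gk (x, y) v) with (gk (RtoC x) v * Cexp (Ci * RtoC (y * v))); [ring|].
    unfold gk; rewrite <- Cexp_add; f_equal; apply C_ext; simpl; ring. }
  rewrite E, Cmod_mult, gk_real, Cmod_R, Rabs_pos_eq by (left; apply exp_pos).
  assert (Lip : forall p q, (Cmod (Cexp (Ci * RtoC p) - Cexp (Ci * RtoC q)) <= Rabs (p - q))%R).
  { assert (Lip0 : forall p, (Cmod (Cexp (Ci * RtoC p) - 1) <= Rabs p)%R).
    { intros p; rewrite Cexp_i.
      assert (Hs : forall u, (0 <= u)%R -> (1 - u * u / 2 <= cos u)%R).
      { assert (Hsin : forall u, (0 <= u)%R -> (sin u <= u)%R).
        { intros u Hu; assert (L : (sin u - u <= sin 0 - 0)%R); [|rewrite sin_0 in L; lra].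
          apply (is_derive_mono (fun u => sin u - u)%R (fun u => cos u - 1)%R); trivial.
          - intros; auto_derive; trivial; ring.
          - intros w _; pose proof (COS_bound w); lra. }
        intros u Hu; assert (L : (1 - u * u / 2 - cos u <= 1 - 0 * 0 / 2 - cos 0)%R); [|rewrite cos_0 in L; lra].
        apply (is_derive_mono (fun u => 1 - u * u / 2 - cos u)%R (fun u => sin u - u)%R); trivial.
        - intros; auto_derive; trivial; field.
        - intros w Hw; specialize (Hsin w ltac:(lra)); lra. }
      assert (Hc : (1 - p * p / 2 <= cos p)%R).
      { destruct (Rle_or_lt 0 p) as [H|H]; [now apply Hs|].
        rewrite <- cos_neg; replace (p * p)%R with (- p * - p)%R by ring; apply Hs; lra. }
      apply Rsqr_incr_0_var; [|apply Rabs_pos]; rewrite <- Rsqr_abs; unfold Rsqr.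
      rewrite Cmod_sqr; simpl.
      pose proof (sin2_cos2 p) as S2; unfold Rsqr in S2; nra. }
    intros p q.
    replace (Cexp (Ci * RtoC p) - Cexp (Ci * RtoC q)) with (Cexp (Ci * RtoC q) * (Cexp (Ci * RtoC (p - q)) - 1)).
    - rewrite Cmod_mult, Cmod_Cexp; replace (Re (Ci * RtoC q)) with 0%R by (simpl; ring).
      rewrite exp_0, Rmult_1_l; apply Lip0.
    - replace (Ci * RtoC p) with (Ci * RtoC q + Ci * RtoC (p - q)) by (rewrite RtoC_minus; ring).
      rewrite Cexp_add; ring. }
  set (e := exp (x * v - exp v)).
  assert (He : (0 < e)%R) by apply exp_pos.
  set (D := (v - ln x)%R).
  assert (E1 : (/ x * exp ((x + 1) * v - exp v) = e * exp D)%R).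
  { unfold e, D; rewrite <- exp_plus.
    replace (x * v - exp v + (v - ln x))%R with ((x + 1) * v - exp v + - ln x)%R by ring.
    rewrite exp_plus, exp_Ropp, exp_ln by trivial; ring. }
  assert (E2 : (x * exp ((x - 1) * v - exp v) = e * exp (- D))%R).
  { unfold e, D; rewrite <- exp_plus.
    replace (x * v - exp v + - (v - ln x))%R with ((x - 1) * v - exp v + ln x)%R by ring.
    rewrite exp_plus, exp_ln by trivial; ring. }
  rewrite E1, E2.
  assert (Q : (D * D <= exp D + exp (- D) - 2)%R).
  { assert (Q0 : forall u, (0 <= u)%R -> (u * u <= exp u + exp (- u) - 2)%R).
    { intros u Hu.
      assert (B : forall w, (0 <= w)%R -> (2 * w <= exp w - exp (- w))%R).
      { intros w Hw; assert (L : (2 * w - (exp w - exp (- w)) <= 2 * 0 - (exp 0 - exp (- 0)))%R); [|rewrite Ropp_0 in L; lra].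
        apply (is_derive_mono (fun w => 2 * w - (exp w - exp (- w)))%R (fun w => 2 - (exp w + exp (- w)))%R); trivial.
        - intros; auto_derive; trivial; ring.
        - intros z _; pose proof (cosh_ge_1 z) as C1; unfold cosh in C1; lra. }
      assert (L : (u * u - (exp u + exp (- u) - 2) <= 0 * 0 - (exp 0 + exp (- 0) - 2))%R); [|rewrite Ropp_0, exp_0 in L; lra].
      apply (is_derive_mono (fun w => w * w - (exp w + exp (- w) - 2))%R (fun w => 2 * w - (exp w - exp (- w)))%R); trivial.
      - intros; auto_derive; trivial; ring.
      - intros z Hz; specialize (B z ltac:(lra)); lra. }
    destruct (Rle_or_lt 0 D) as [H|H]; [now apply Q0|].
    specialize (Q0 (- D)%R ltac:(lra)); rewrite Ropp_involutive in Q0; nra. }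
  assert (B : (Cmod (Cexp (Ci * RtoC (y * v)) - Cexp (Ci * RtoC (y * ln x))) <= Rabs y * Rabs D)%R).
  { eapply Rle_trans; [apply Lip|]; rewrite <- Rabs_mult; right; f_equal; unfold D; ring. }
  assert (B2 : (Rabs D <= k / 2 + D * D / (2 * k))%R).
  { replace (D * D)%R with (Rabs D * Rabs D)%R by (rewrite <- Rabs_mult; apply Rabs_pos_eq; nra).
    assert (0 <= (Rabs D - k) * (Rabs D - k) / (2 * k))%R.
    { apply Rmult_le_pos; [apply (Rle_0_sqr (Rabs D - k))|left; apply Rinv_0_lt_compat; lra]. }
    replace ((Rabs D - k) * (Rabs D - k) / (2 * k))%R with (k / 2 + Rabs D * Rabs D / (2 * k) - Rabs D)%R in H by (field; lra).
    lra. }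
  assert (Hik : (0 < / (2 * k))%R) by (apply Rinv_0_lt_compat; lra).
  assert (B3 : (Rabs D <= k / 2 + / (2 * k) * (exp D + exp (- D) - 2))%R).
  { eapply Rle_trans; [exact B2|]; apply Rplus_le_compat_l; unfold Rdiv; rewrite Rmult_comm.
    apply Rmult_le_compat_l; lra. }
  replace (Rabs y * ((k / 2 - / k) * e + / (2 * k) * (e * exp D + e * exp (- D))))%R with
    (e * (Rabs y * (k / 2 + / (2 * k) * (exp D + exp (- D) - 2))))%R by (field; lra).
  apply Rmult_le_compat_l; [lra|]; eapply Rle_trans; [exact B|].
  apply Rmult_le_compat_l; [apply Rabs_pos|exact B3].
Qed.

Lemma CGamma_large_nz y : exists X, forall x, (X <= x)%R -> CGamma (x, y) <> 0.
Proof.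
  pose proof (Rabs_pos y) as Y0.
  (* the relative error 2 |y| (k / 2 + 1 / (2 k (x - 1))) is then at most 1/2 *)
  set (k := (/ (4 * (Rabs y + 1)))%R).
  assert (Hk : (0 < k)%R) by (apply Rinv_0_lt_compat; lra).
  exists (1 + 16 * ((Rabs y + 1) * (Rabs y + 1)))%R; intros x Hx.
  assert (Hx1 : (16 <= x - 1)%R) by nra.
  assert (G : wgood (gk (RtoC x))) by (apply gk_wgood; simpl; lra).
  assert (Gp : wgood (gk (RtoC (x + 1)))) by (apply gk_wgood; simpl; lra).
  assert (Gm : wgood (gk (RtoC (x - 1)))) by (apply gk_wgood; simpl; lra).
  assert (Gxy : wgood (gk (x, y))) by (apply gk_wgood; simpl; lra).
  pose (h := fun v => (Rabs y * ((k / 2 - / k) * exp (x * v - exp v) + / (2 * k) * (/ x * exp ((x + 1) * v - exp v) + x * exp ((x - 1) * v - exp v))))%R).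
  pose (hc := fun v => RtoC (Rabs y) * (RtoC (k / 2 - / k) * gk (RtoC x) v
      + RtoC (/ (2 * k)) * (RtoC (/ x) * gk (RtoC (x + 1)) v + RtoC x * gk (RtoC (x - 1)) v))).
  assert (Eh : (fun v => RtoC (h v)) = hc).
  { apply functional_extensionality; intros v; unfold h, hc; rewrite !gk_real, !RtoC_mult, !RtoC_plus, !RtoC_mult, !RtoC_plus, !RtoC_mult; reflexivity. }
  pose proof (wgood_scal (RtoC (k / 2 - / k)) _ G) as G1; pose proof (wgood_scal (RtoC (/ x)) _ Gp) as G2; pose proof (wgood_scal (RtoC x) _ Gm) as G3.
  pose proof (wgood_plus _ _ G2 G3) as G4; pose proof (wgood_scal (RtoC (/ (2 * k))) _ G4) as G5; pose proof (wgood_plus _ _ G1 G5) as G6.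
  assert (Gh : wgood hc) by exact (wgood_scal (RtoC (Rabs y)) _ G6).
  set (u := Cexp (Ci * RtoC (y * ln x))).
  assert (B := WI_norm_le (fun v => gk (x, y) v + (- u) * gk (RtoC x) v) h
    ltac:(apply wgood_plus; trivial; now apply wgood_scal) ltac:(rewrite Eh; exact Gh)).
  rewrite Eh in B; unfold hc in B.
  rewrite (WI_plus _ _ Gxy (wgood_scal (- u) _ G)), (WI_scal (- u) _ G) in B.
  rewrite (WI_scal _ _ G6), (WI_plus _ _ G1 G5), (WI_scal _ _ G), (WI_scal _ _ G4), (WI_plus _ _ G2 G3), (WI_scal _ _ Gp), (WI_scal _ _ Gm) in B.
  rewrite <- !CGamma_WI in B by (simpl; lra).
  destruct (CGamma_real_pos x ltac:(lra)) as [r [Hr gauss_int]].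
  destruct (CGamma_real_pos (x - 1) ltac:(lra)) as [r1 [Hr1 Er1]].
  assert (Ep : CGamma (RtoC (x + 1)) = RtoC x * CGamma (RtoC x)).
  { rewrite RtoC_plus; apply CGamma_succ; simpl; lra. }
  assert (Em : RtoC r = RtoC (x - 1) * RtoC r1).
  { rewrite <- gauss_int, <- Er1; rewrite <- (CGamma_succ (RtoC (x - 1))) by (simpl; lra).
    f_equal; rewrite <- RtoC_plus; f_equal; ring. }
  rewrite <- RtoC_mult in Em; apply RtoC_inj in Em.
  rewrite Ep, Er1, gauss_int in B.
  intros Z; rewrite Z in B.
  assert (Bd : (Cmod (0 + - u * RtoC r) <= 2 * (Rabs y * ((k / 2 - / k) * r + / (2 * k) * (r + x * r1))))%R).
  { eapply Rle_trans; [apply B; intros v; unfold h|].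
    - replace (gk (x, y) v + - u * gk (RtoC x) v) with (gk (x, y) v - u * gk (RtoC x) v) by ring.
      apply gk_phase; lra.
    - right; f_equal; simpl; field; lra. }
  replace (0 + - u * RtoC r) with (- (u * RtoC r)) in Bd by ring.
  rewrite Cmod_opp, Cmod_mult, Cmod_R, (Rabs_pos_eq r) in Bd by lra.
  unfold u in Bd; rewrite Cmod_Cexp in Bd; replace (Re (Ci * RtoC (y * ln x))) with 0%R in Bd by (simpl; ring).
  rewrite exp_0, Rmult_1_l in Bd.
  assert (Er1' : (r1 = r / (x - 1))%R) by (rewrite Em; field; lra).
  replace (2 * (Rabs y * ((k / 2 - / k) * r + / (2 * k) * (r + x * r1))))%R with
    (r * (Rabs y * k + Rabs y / (k * (x - 1))))%R in Bd by (rewrite Er1'; field; lra).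
  assert (B1 : (Rabs y * k <= 1 / 4)%R).
  { unfold k; apply Rmult_le_reg_r with (4 * (Rabs y + 1))%R; [lra|].
    rewrite Rmult_assoc, Rinv_l by lra; lra. }
  assert (B2 : (Rabs y / (k * (x - 1)) <= 1 / 4)%R).
  { unfold k; replace (Rabs y / (/ (4 * (Rabs y + 1)) * (x - 1)))%R with (4 * (Rabs y * (Rabs y + 1)) / (x - 1))%R by (field; lra).
    apply Rmult_le_reg_r with (x - 1)%R; [lra|].
    unfold Rdiv; rewrite Rmult_assoc, Rinv_l by lra; nra. }
  nra.
Qed.

(** The functional equation carries a zero to the right, where [CGamma_large_nz] excludes it. *)
Lemma CGamma_nz s : (0 < Re s)%R -> CGamma s <> 0.
Proof.
  intros Hs Z.
  assert (A : forall n, CGamma (s + RtoC (INR n)) = 0).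
  { induction n as [|n IH]; [replace (s + RtoC (INR 0)) with s by (simpl; ring); exact Z|].
    rewrite S_INR, RtoC_plus, Cplus_assoc, CGamma_succ, IH; [ring|].
    simpl; pose proof (pos_INR n); unfold Re in *; lra. }
  destruct (CGamma_large_nz (Im s)) as [X HX].
  destruct (INR_unbounded X) as [n Hn].
  apply (HX (Re s + INR n)%R); [lra|].
  rewrite <- (A n); f_equal; apply C_ext; simpl; unfold Re, Im; ring.
Qed.

(** * The quotient of Gamma functions as an integral *)

(** The primitive of the Gaussian; [gauss_total] is its limit at infinity, found to be half the square root of
    pi in [gauss_total_value]. *)
Definition gauss_int (x : R) : R := RInt (fun u => exp (- (u * u))) 0 x.
Definition gauss_total : R := RHint (fun u => exp (- (u * u))).

Lemma ex_derive_cont (f : R -> R) t : ex_derive f t -> continuity_pt f t.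
Proof. intros H; apply continuity_pt_filterlim; exact (ex_derive_continuous f t H). Qed.

Lemma gauss_cont t : continuity_pt (fun u => exp (- (u * u))) t.
Proof. apply ex_derive_cont; auto_derive; trivial. Qed.

Lemma gauss_bound t : (0 <= t)%R -> (Rabs (exp (- (t * t))) <= exp (/ 4) * exp (- 1 * t))%R.
Proof.
  intros _; rewrite Rabs_pos_eq by (left; apply exp_pos); rewrite <- exp_plus; apply exp_mono.
  pose proof (pow2_ge_0 (t - / 2)); nra.
Qed.

Lemma gauss_int_derive x : is_derive gauss_int x (exp (- (x * x))).
Proof.
  apply (is_derive_RInt (fun u => exp (- (u * u))) gauss_int 0 x).
  - apply filter_forall; intros; apply (RInt_correct (V := R_CompleteNormedModule)), ex_RInt_cont, gauss_cont.
  - apply continuity_pt_filterlim, gauss_cont.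
Qed.

Lemma gauss_int_0 : gauss_int 0 = 0%R.
Proof. unfold gauss_int; rewrite RInt_point; reflexivity. Qed.

Lemma gauss_int_tail x : (0 <= x)%R -> (Rabs (gauss_int x - gauss_total) <= exp (/ 4) * exp (- x))%R.
Proof.
  intros Hx; destruct (RHint_spec _ _ 1 gauss_cont Rlt_0_1 gauss_bound) as [_ H].
  specialize (H x Hx); rewrite Rabs_minus_sym; fold gauss_total (gauss_int x) in H.
  replace (exp (/ 4) * exp (- x))%R with (exp (/ 4) / 1 * exp (- (1) * x))%R; [exact H|].
  replace (- (1) * x)%R with (- x)%R by ring; field.
Qed.

Lemma gauss_total_pos : (0 < gauss_total)%R.
Proof. apply (RHint_pos _ _ 1 gauss_cont Rlt_0_1 gauss_bound); intros; apply exp_pos. Qed.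

(** The Gaussian is at most [1 / (1 + u * u)], so its primitive is dominated by [atan]. *)
Lemma gauss_int_bound x : (Rabs (gauss_int x) <= PI / 2)%R.
Proof.
  assert (D : forall y, is_derive (fun y => gauss_int y - atan y)%R y (exp (- (y * y)) - / (1 + y * y))%R).
  { intros y; apply is_derive_Rminus; [apply gauss_int_derive|].
    eapply is_derive_eq; [apply is_derive_atan|reflexivity]. }
  assert (Dn : forall y, (exp (- (y * y)) - / (1 + y * y) <= 0)%R).
  { intros y; rewrite exp_Ropp; pose proof (Rle_0_sqr y) as S; unfold Rsqr in S.
    assert (/ exp (y * y) <= / (1 + y * y))%R; [|lra].
    apply Rinv_le_contravar; [lra|apply exp_ineq1_le]. }
  assert (Dm : forall y, is_derive (fun y => - gauss_int y)%R y (- exp (- (y * y)))%R).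
  { intros y; apply (is_derive_opp gauss_int), gauss_int_derive. }
  pose proof (atan_bound x) as A.
  destruct (Rle_or_lt 0 x) as [Hx|Hx].
  - pose proof (is_derive_mono _ _ 0 x Hx (fun y _ => D y) (fun y _ => Dn y)) as K1.
    pose proof (is_derive_mono _ _ 0 x Hx (fun y _ => Dm y) (fun y _ => ltac:(pose proof (exp_pos (- (y * y))); lra))) as K2.
    cbv beta in *; rewrite gauss_int_0 in *; rewrite atan_0 in K1; rewrite Rabs_pos_eq; lra.
  - pose proof (is_derive_mono _ _ x 0 ltac:(lra) (fun y _ => D y) (fun y _ => Dn y)) as K1.
    pose proof (is_derive_mono _ _ x 0 ltac:(lra) (fun y _ => Dm y) (fun y _ => ltac:(pose proof (exp_pos (- (y * y))); lra))) as K2.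
    cbv beta in *; rewrite gauss_int_0 in *; rewrite atan_0 in K1; rewrite Rabs_left1; lra.
Qed.

Lemma continuity_2d_reflect f x t : continuity_2d_pt f x (- t) -> continuity_2d_pt (fun x t => f x (- t)%R) x t.
Proof.
  intros H eps; destruct (H eps) as [d Hd]; exists d; intros u v Hu Hv; apply Hd; trivial.
  replace (- v - - t)%R with (- (v - t))%R by ring; now rewrite Rabs_Ropp.
Qed.

(** The analogue of [dfam] on the whole line. *)
Definition wfam (f : R -> R -> C) (s r : R) : Prop :=
  (forall x t, (Rabs (x - s) < r)%R -> ccont2 f x t) /\
  exists M d, (0 < d)%R /\ forall x t, (Rabs (x - s) < r)%R -> (Cmod (f x t) <= M * exp (- d * Rabs t))%R.

Lemma wfam_dfam f s r : wfam f s r -> dfam (fun x t => f x t + f x (- t)%R) s r.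
Proof.
  intros [H [M [d [H1 H2]]]]; split.
  - intros x t Hx; apply ccont2_plus; [now apply H|].
    destruct (H x (- t)%R Hx) as [C1 C2]; split.
    + apply (continuity_2d_reflect (fun x t => Re (f x t))); exact C1.
    + apply (continuity_2d_reflect (fun x t => Im (f x t))); exact C2.
  - exists (M + M)%R, d; split; trivial; intros x t Hx Ht.
    eapply Rle_trans; [apply Cmod_triangle|]; rewrite Rmult_plus_distr_r.
    pose proof (H2 x t Hx) as B1; pose proof (H2 x (- t)%R Hx) as B2.
    rewrite Rabs_Ropp in B2; rewrite Rabs_pos_eq in B1, B2 by trivial; lra.
Qed.

Lemma wfam_wgood f s r x : wfam f s r -> (Rabs (x - s) < r)%R -> wgood (f x).
Proof.
  intros [H [M [d [H1 H2]]]] Hx; split; [intros t; now apply ccont2_slice, H|].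
  exists M, d; split; auto.
Qed.

Lemma WI_param_derive f f' s r : (0 < r)%R -> wfam f s r -> wfam f' s r ->
  (forall x t, (Rabs (x - s) < r)%R -> cder (fun u => f u t) x (f' x t)) ->
  cder (fun x => WI (f x)) s (WI (f' s)).
Proof.
  intros Hr H H' Hd; unfold WI.
  apply (HInt_der_at (fun x t => f x t + f x (- t)%R) (fun x t => f' x t + f' x (- t)%R) s r); trivial.
  - now apply wfam_dfam.
  - now apply wfam_dfam.
  - intros x t Hx; apply cder_plus; now apply Hd.
Qed.

Lemma wgood_shift g h : wgood g -> wgood (fun v => g (v + h)%R).
Proof.
  intros [H [M [d [H1 H2]]]]; split.
  - intros t; destruct (H (t + h)%R) as [C1 C2].
    assert (Cl : continuity_pt (fun t => t + h)%R t).
    { apply derivable_continuous_pt; apply derivable_pt_plus; [apply derivable_pt_id|apply derivable_pt_const]. }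
    split; [now apply (continuity_pt_comp (fun t => t + h)%R (fun t => Re (g t)))|
      now apply (continuity_pt_comp (fun t => t + h)%R (fun t => Im (g t)))].
  - assert (HM : (0 <= M)%R).
    { apply (bound_nonneg g M d); intros u Hu; specialize (H2 u); now rewrite Rabs_pos_eq in H2. }
    exists (M * exp (d * Rabs h))%R, d; split; trivial; intros t; eapply Rle_trans; [apply H2|].
    rewrite Rmult_assoc, <- exp_plus; apply Rmult_le_compat_l; trivial; apply exp_mono.
    assert (Rabs t <= Rabs (t + h) + Rabs h)%R; [|nra].
    replace t with ((t + h) + - h)%R at 1 by ring; eapply Rle_trans; [apply Rabs_triang|]; rewrite Rabs_Ropp; lra.
Qed.

Lemma cosh_half t : ((1 + 1 * cosh t) / 2 = cosh (t / 2) * cosh (t / 2))%R.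
Proof.
  unfold cosh; replace t with (t / 2 + t / 2)%R at 1 2 by field.
  assert (E : (exp (t / 2) * exp (- (t / 2)) = 1)%R) by (rewrite <- exp_plus, Rplus_opp_r; apply exp_0).
  replace (- (t / 2 + t / 2))%R with (- (t / 2) + - (t / 2))%R by ring; rewrite !exp_plus; nra.
Qed.

Lemma m0_one mu t : m0 mu 1 t = Cexp (mu * RtoC (2 * ln (cosh (t / 2)))).
Proof.
  pose proof (cosh_pos (t / 2)) as P.
  unfold m0, tB, pw; rewrite cosh_half, Clr_RtoC by (apply Rmult_lt_0_compat; trivial).
  rewrite ln_mult by trivial; do 3 f_equal; ring.
Qed.

Lemma scaled_gk b l v : Cexp (b * RtoC v - RtoC (exp l * exp v)) = Cexp (- (b * RtoC l)) * gk b (v + l).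
Proof.
  unfold gk; rewrite <- Cexp_add; f_equal; rewrite exp_plus, RtoC_plus, (Rmult_comm (exp v)); ring.
Qed.

Lemma WI_scaled_gk b l : (0 < Re b)%R ->
  WI (fun v => Cexp (b * RtoC v - RtoC (exp l * exp v))) = Cexp (- (b * RtoC l)) * CGamma b.
Proof.
  intros Hb; pose proof (gk_wgood b Hb) as G; pose proof (wgood_shift _ l G) as Gs.
  rewrite (WI_ext _ _ (scaled_gk b l)), (WI_scal _ (fun v => gk b (v + l))), WI_shift, CGamma_WI; trivial.
Qed.

(** Integrated over [v], this interpolates between 0 at [t = 0] and [gauss_total * CGamma a] at infinity, while its
    derivative in [t] integrates to a multiple of [CGamma (a + 1 / 2)] times the kernel of [M0]. It stands
    for the interchange of the integrations over [t] and [v] in a proof by double integrals. *)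
Definition quot_kernel (a : C) (t v : R) : C := gk a v * RtoC (gauss_int (sinh (t / 2) * exp (v / 2))).
Definition quot_kernel' (a : C) (t v : R) : C :=
  RtoC (cosh (t / 2) / 2) * Cexp ((a + 1 / 2) * RtoC v - RtoC (exp (2 * ln (cosh (t / 2))) * exp v)).

Lemma Re_half a : Re (a + 1 / 2) = (Re a + / 2)%R.
Proof. destruct a; simpl; field. Qed.

Lemma exp_2ln c : (0 < c)%R -> exp (2 * ln c) = (c * c)%R.
Proof. intros H; replace (2 * ln c)%R with (ln c + ln c)%R by ring; now rewrite exp_plus, exp_ln. Qed.

Lemma half_Re (v : R) : Cexp (1 / 2 * RtoC v) = RtoC (exp (v / 2)).
Proof. rewrite <- Cexp_RtoC; f_equal; apply C_ext; simpl; field. Qed.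

Lemma cder_quot_kernel a t v : cder (fun t => quot_kernel a t v) t (quot_kernel' a t v).
Proof.
  assert (E : quot_kernel' a t v = gk a v * RtoC (exp (- (sinh (t / 2) * exp (v / 2) * (sinh (t / 2) * exp (v / 2)))) * (cosh (t / 2) / 2 * exp (v / 2)))).
  { unfold quot_kernel', gk; rewrite exp_2ln, cosh_sinh_sqr by apply cosh_pos.
    set (p := sinh (t / 2)); set (q := exp (v / 2)).
    assert (X : Cexp ((a + 1 / 2) * RtoC v - RtoC ((1 + p * p) * exp v)) =
      Cexp (a * RtoC v - RtoC (exp v)) * RtoC (exp (- (p * q * (p * q)))) * RtoC q).
    { unfold q at 3; rewrite <- half_Re, <- (Cexp_RtoC (- (p * q * (p * q)))), <- !Cexp_add; f_equal.
      replace (exp v) with (q * q)%R by (unfold q; rewrite <- exp_plus; f_equal; field).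
      rewrite !RtoC_opp, !RtoC_mult, !RtoC_plus, !RtoC_mult; ring. }
    rewrite X, !RtoC_mult; ring. }
  rewrite E; unfold quot_kernel; apply cder_scal, cder_RtoC.
  eapply is_derive_eq; [apply (is_derive_Rcomp gauss_int (fun t => sinh (t / 2) * exp (v / 2))%R); [apply gauss_int_derive|]|].
  - apply (is_derive_Rmult (fun t => sinh (t / 2)) (fun _ => exp (v / 2))); [|apply @is_derive_const].
    apply (is_derive_Rcomp sinh (fun t => t / 2)%R); [apply is_derive_Reals, derivable_pt_lim_sinh|].
    instantiate (1 := (/ 2)%R); auto_derive; trivial; field.
  - unfold zero; simpl; field.
Qed.

Lemma sinh_half_cont t : continuity_pt (fun t => sinh (t / 2)) t.
Proof.
  apply ex_derive_cont; exists (/ 2 * cosh (t / 2))%R.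
  apply (is_derive_Rcomp sinh (fun t => t / 2)%R); [apply is_derive_Reals, derivable_pt_lim_sinh|auto_derive; trivial; field].
Qed.

Lemma cosh_half_cont t : continuity_pt (fun t => cosh (t / 2)) t.
Proof.
  apply ex_derive_cont; exists (/ 2 * sinh (t / 2))%R.
  apply (is_derive_Rcomp cosh (fun t => t / 2)%R); [apply is_derive_Reals, derivable_pt_lim_cosh|auto_derive; trivial; field].
Qed.

Lemma continuity_2d_of_1 (f : R -> R) x t : continuity_pt f x -> continuity_2d_pt (fun u _ => f u) x t.
Proof. intros H; apply (continuity_1d_2d_pt_comp f (fun u _ => u)); trivial; apply continuity_2d_pt_id1. Qed.

Lemma continuity_2d_of_2 (f : R -> R) x t : continuity_pt f t -> continuity_2d_pt (fun _ u => f u) x t.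
Proof. intros H; apply (continuity_1d_2d_pt_comp f (fun _ u => u)); trivial; apply continuity_2d_pt_id2. Qed.

Lemma ccont2_RtoC (f : R -> R -> R) x t : continuity_2d_pt f x t -> ccont2 (fun u v => RtoC (f u v)) x t.
Proof. intros H; split; simpl; trivial; apply continuity_2d_pt_const. Qed.

Lemma exp_half_cont k t : continuity_pt (fun v => exp (v / k)) t.
Proof. apply ex_derive_cont; auto_derive; trivial. Qed.

Lemma quot_kernel_wfam a s r : (0 < Re a)%R -> wfam (quot_kernel a) s r.
Proof.
  intros Ha; split.
  - intros x t _; apply ccont2_mult; [apply (ccont2_2 (gk a)), ccont_gk|].
    apply ccont2_RtoC, (continuity_1d_2d_pt_comp gauss_int).
    + apply ex_derive_cont; eexists; apply gauss_int_derive.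
    + apply continuity_2d_pt_mult; [apply (continuity_2d_of_1 (fun u => sinh (u / 2))), sinh_half_cont|].
      apply (continuity_2d_of_2 (fun v => exp (v / 2))), exp_half_cont.
  - destruct (gk_wgood a Ha) as [_ [M [d [H1 H2]]]].
    exists (M * (PI / 2))%R, d; split; trivial; intros x t _; unfold quot_kernel; rewrite Cmod_mult, Cmod_R.
    replace (M * (PI / 2) * exp (- d * Rabs t))%R with (M * exp (- d * Rabs t) * (PI / 2))%R by ring.
    apply Rmult_le_compat; [apply Cmod_ge_0|apply Rabs_pos|apply H2|apply gauss_int_bound].
Qed.

Lemma quot_kernel'_wfam a s : (0 < Re a)%R -> wfam (quot_kernel' a) s 1.
Proof.
  intros Ha; assert (Hb : (0 < Re (a + 1 / 2))%R) by (rewrite Re_half; lra).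
  split.
  - intros x t _; apply ccont2_mult.
    + apply ccont2_RtoC, (continuity_2d_of_1 (fun u => cosh (u / 2) / 2)%R).
      apply (continuity_pt_mult (fun u => cosh (u / 2)) (fun _ => / 2)%R); [apply cosh_half_cont|apply continuity_pt_const; now intros ? ?].
    + apply ccont2_Cexp, ccont2_minus.
      * apply ccont2_mult; [apply ccont2_const|]; apply (ccont2_2 (fun v => RtoC v)); eapply cder_ccont, cder_id.
      * apply (ccont2_ext (fun x t => RtoC (cosh (x / 2) * cosh (x / 2)) * RtoC (exp t))).
        -- intros; rewrite exp_2ln by apply cosh_pos; symmetry; apply RtoC_mult.
        -- apply ccont2_mult; apply ccont2_RtoC.
           ++ apply (continuity_2d_of_1 (fun u => cosh (u / 2) * cosh (u / 2))%R).
              apply (continuity_pt_mult (fun u => cosh (u / 2)) (fun u => cosh (u / 2))); apply cosh_half_cont.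
           ++ apply (continuity_2d_of_2 exp), derivable_continuous, derivable_exp.
  - destruct (gk_wgood _ Hb) as [_ [M [d [H1 H2]]]].
    assert (HM : (0 <= M)%R).
    { apply (bound_nonneg (gk (a + 1 / 2)) M d); intros u Hu; specialize (H2 u); now rewrite Rabs_pos_eq in H2. }
    exists (exp ((Rabs s + 1) / 2) * M)%R, d; split; trivial; intros x t Hx; unfold quot_kernel'.
    rewrite Cmod_mult, Cmod_R, Rmult_assoc; pose proof (cosh_ge_1 (x / 2)) as C1.
    apply Rmult_le_compat; [apply Rabs_pos|apply Cmod_ge_0| |].
    + rewrite Rabs_pos_eq by lra.
      assert (cosh (x / 2) <= exp (Rabs (x / 2)))%R.
      { unfold cosh; pose proof (exp_mono (x / 2) (Rabs (x / 2)) (Rle_abs _)).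
        pose proof (exp_mono (- (x / 2)) (Rabs (x / 2)) ltac:(rewrite <- Rabs_Ropp; apply Rle_abs)); lra. }
      assert (exp (Rabs (x / 2)) <= exp ((Rabs s + 1) / 2))%R; [|pose proof (exp_pos ((Rabs s + 1) / 2)); lra].
      apply exp_mono; unfold Rdiv at 1; rewrite Rabs_mult, (Rabs_pos_eq (/ 2)) by lra.
      assert (Rabs x <= Rabs (x - s) + Rabs s)%R by (replace x with ((x - s) + s)%R at 1 by ring; apply Rabs_triang).
      lra.
    + eapply Rle_trans; [|apply H2]; rewrite Cmod_Cexp, Cmod_gk; apply exp_mono.
      rewrite exp_2ln by apply cosh_pos.
      replace (Re _) with (Re (a + 1 / 2) * t - cosh (x / 2) * cosh (x / 2) * exp t)%R by (simpl; unfold Re; ring).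
      pose proof (exp_pos t); assert (1 <= cosh (x / 2) * cosh (x / 2))%R by nra; nra.
Qed.

(** Completing [1 + sinh ^ 2] to [cosh ^ 2] in the exponent leaves a Gamma integral with scaled variable. *)
Lemma quot_kernel_total a : (0 < Re a)%R -> forall t, cder (fun t => WI (quot_kernel a t)) t (1 / 2 * CGamma (a + 1 / 2) * m0 (- a) 1 t).
Proof.
  intros Ha t; eapply cder_eq.
  - apply (WI_param_derive (quot_kernel a) (quot_kernel' a) t 1); [lra|now apply quot_kernel_wfam|now apply quot_kernel'_wfam|].
    intros; apply cder_quot_kernel.
  - assert (Hb : (0 < Re (a + 1 / 2))%R) by (rewrite Re_half; lra).
    unfold quot_kernel'; rewrite WI_scal; [rewrite WI_scaled_gk by trivial|].
    + rewrite m0_one.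
      assert (E : Cexp (- ((a + 1 / 2) * RtoC (2 * ln (cosh (t / 2))))) * RtoC (cosh (t / 2)) = Cexp (- a * RtoC (2 * ln (cosh (t / 2))))).
      { rewrite <- (exp_ln (cosh (t / 2))) at 2 by apply cosh_pos.
        rewrite <- Cexp_RtoC, <- Cexp_add; f_equal; rewrite RtoC_mult; field; apply two_nz. }
      rewrite <- E, RtoC_div by lra; field; apply two_nz.
    + pose proof (wfam_wgood _ _ _ t (quot_kernel'_wfam a t Ha)) as G; rewrite Rminus_eq_0, Rabs_R0 in G; specialize (G ltac:(lra)).
      apply (wgood_scal (RtoC (/ (cosh (t / 2) / 2)))) in G.
      pose proof (cosh_pos (t / 2)).
      replace (fun v => Cexp ((a + 1 / 2) * RtoC v - RtoC (exp (2 * ln (cosh (t / 2))) * exp v)))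
        with (fun v => RtoC (/ (cosh (t / 2) / 2)) * quot_kernel' a t v); trivial.
      apply functional_extensionality; intros v; unfold quot_kernel'.
      rewrite Cmult_assoc, <- RtoC_mult, Rinv_l by lra; ring.
Qed.

Lemma sinh_half_lower T : (2 < T)%R -> (exp (T / 2) / 4 <= sinh (T / 2))%R.
Proof.
  intros HT; unfold sinh.
  assert (exp (- (T / 2)) <= 1)%R by (rewrite <- exp_0; apply exp_mono; lra).
  pose proof (exp_ineq1_le (T / 2)); lra.
Qed.

Lemma ln_lt_id x : (0 < x)%R -> (ln x <= x)%R.
Proof.
  intros H; rewrite <- (ln_exp x) at 2; apply ln_le; trivial; pose proof (exp_ineq1_le x); lra.
Qed.

Lemma quot_kernel_limit a : (0 < Re a)%R -> clim (fun t => WI (quot_kernel a t)) (RtoC gauss_total * CGamma a).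
Proof.
  intros Ha; set (e := Rmin (Re a) 1).
  assert (He : (0 < e)%R) by (apply Rmin_glb_lt; lra).
  assert (He1 : (e <= Re a /\ e <= 1)%R) by (split; [apply Rmin_l|apply Rmin_r]).
  pose proof (gk_wgood a Ha) as G.
  set (b := (Re a - e / 2)%R).
  assert (Gb : wgood (gk (RtoC b))) by (apply gk_wgood; simpl; unfold b; lra).
  set (R0 := Re (WI (gk (RtoC b)))).
  set (K := (exp (/ 4) * exp (e * ln 4))%R).
  apply (clim_exp_eventually _ _ (2 * (K * R0)) (e / 2) 2); [lra|].
  intros T HT.
  assert (Gf : wgood (quot_kernel a T)).
  { apply (wfam_wgood _ T 1); [now apply quot_kernel_wfam|rewrite Rminus_eq_0, Rabs_R0; lra]. }
  rewrite CGamma_WI, <- WI_scal by trivial.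
  replace (WI (quot_kernel a T) - WI (fun v => RtoC gauss_total * gk a v)) with (WI (fun v => quot_kernel a T v + RtoC (- gauss_total) * gk a v)).
  2:{ rewrite WI_plus, !WI_scal, RtoC_opp by (trivial; now apply wgood_scal); ring. }
  pose (h := fun v => (K * exp (- (e / 2) * T) * exp (b * v - exp v))%R).
  assert (Eh : (fun v => RtoC (h v)) = (fun v => RtoC (K * exp (- (e / 2) * T)) * gk (RtoC b) v)).
  { apply functional_extensionality; intros v; unfold h; now rewrite gk_real, <- RtoC_mult. }
  eapply Rle_trans.
  - apply (WI_norm_le _ h).
    + apply wgood_plus; trivial; now apply wgood_scal.
    + rewrite Eh; now apply wgood_scal.
    + intros v; unfold quot_kernel.
      replace (gk a v * RtoC (gauss_int (sinh (T / 2) * exp (v / 2))) + RtoC (- gauss_total) * gk a v) with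
        (gk a v * RtoC (gauss_int (sinh (T / 2) * exp (v / 2)) - gauss_total)) by (rewrite RtoC_minus, RtoC_opp; ring).
      pose proof (sinh_half_lower T HT) as SL; pose proof (exp_pos (T / 2)) as ET; pose proof (exp_pos (v / 2)) as EV.
      rewrite Cmod_mult, Cmod_R, Cmod_gk.
      set (x := (sinh (T / 2) * exp (v / 2))%R).
      assert (Hx : (exp (T / 2) / 4 * exp (v / 2) <= x)%R) by (apply Rmult_le_compat_r; lra).
      assert (Hx0 : (0 < exp (T / 2) / 4 * exp (v / 2))%R) by (apply Rmult_lt_0_compat; lra).
      assert (Hlx : (T / 2 - ln 4 + v / 2 <= ln x)%R).
      { replace (T / 2 - ln 4 + v / 2)%R with (ln (exp (T / 2) / 4 * exp (v / 2))).
        - apply ln_le; trivial.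
        - rewrite ln_mult, ln_div, !ln_exp by lra; reflexivity. }
      assert (Hex : (exp (- x) <= exp (- (e * (T / 2 - ln 4 + v / 2))))%R).
      { apply exp_mono; pose proof (ln_lt_id x ltac:(lra)).
        destruct (Rle_or_lt 0 (T / 2 - ln 4 + v / 2)); nra. }
      unfold h, K; apply Rle_trans with (exp (Re a * v - exp v) * (exp (/ 4) * exp (- (e * (T / 2 - ln 4 + v / 2)))))%R.
      * apply Rmult_le_compat_l; [left; apply exp_pos|].
        eapply Rle_trans; [apply gauss_int_tail; lra|apply Rmult_le_compat_l; trivial; left; apply exp_pos].
      * right; rewrite <- !exp_plus; f_equal; unfold b; field.
  - rewrite Eh, WI_scal by trivial; unfold R0.
    replace (Re (RtoC (K * exp (- (e / 2) * T)) * WI (gk (RtoC b)))) with (K * exp (- (e / 2) * T) * Re (WI (gk (RtoC b))))%R.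
    + right; ring.
    + destruct (WI (gk (RtoC b))); simpl; ring.
Qed.

(** Both sides are the total increase over the half-line of the function of [t] in [quot_kernel_total]. *)
Lemma gamma_half_gauss_total a : (0 < Re a)%R -> 1 / 2 * CGamma (a + 1 / 2) * M0 (- a) 1 = RtoC gauss_total * CGamma a.
Proof.
  intros Ha.
  assert (Hmu : (Re (- a) < 0)%R) by (simpl; unfold Re in *; lra).
  destruct (tkernels_dfam (- a) 1 Hmu Rlt_0_1) as [D _].
  apply (dfam_hgood _ _ _ 1) in D; [|rewrite Rminus_eq_0, Rabs_R0; lra].
  unfold M0; rewrite <- HInt_scal by trivial.
  rewrite (HInt_derive (fun t => WI (quot_kernel a t)) _ (RtoC gauss_total * CGamma a)).
  - replace (WI (quot_kernel a 0)) with (RtoC 0); [ring|].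
    rewrite (WI_ext (quot_kernel a 0) (fun v => 0 * gk a v)).
    + rewrite WI_scal by now apply gk_wgood. ring.
    + intros v; unfold quot_kernel; replace (0 / 2)%R with 0%R by field.
      unfold sinh; rewrite Ropp_0, Rminus_eq_0; replace (0 / 2 * exp (v / 2))%R with 0%R by field; rewrite gauss_int_0; ring.
  - now apply quot_kernel_total.
  - now apply hgood_scal.
  - now apply quot_kernel_limit.
Qed.

Lemma CGamma_1 : CGamma 1 = 1.
Proof.
  rewrite CGamma_WI by (simpl; lra).
  rewrite (WI_derive (fun v => RtoC (- exp (- exp v))) (gk 1) 0 (RtoC (- 1))).
  - apply C_ext; simpl; ring.
  - intros v; rewrite gk_real; apply cder_RtoC; auto_derive; trivial.
    replace (1 * v - exp v)%R with (v + - exp v)%R by ring; rewrite exp_plus; ring.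
  - apply gk_wgood; simpl; lra.
  - apply (clim_exp_dominated _ _ 1 1); [lra|]; intros T HT.
    replace (RtoC (- exp (- exp T)) - 0) with (RtoC (- exp (- exp T))) by ring.
    rewrite Cmod_R, Rabs_Ropp, Rabs_pos_eq by (left; apply exp_pos); rewrite Rmult_1_l; apply exp_mono.
    pose proof (exp_ineq1_le T); lra.
  - apply (clim_exp_dominated _ _ 1 1); [lra|]; intros T HT.
    rewrite <- RtoC_minus, Cmod_R.
    pose proof (exp_ineq1_le (- exp (- T))) as K.
    assert (exp (- exp (- T)) <= 1)%R by (rewrite <- exp_0; apply exp_mono; pose proof (exp_pos (- T)); lra).
    replace (- (1) * T)%R with (- T)%R by ring; rewrite Rabs_pos_eq; lra.
Qed.

Lemma CGamma_half : CGamma (1 / 2) = RtoC (2 * gauss_total).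
Proof.
  assert (E12 : 1 / 2 = RtoC (/ 2)) by (apply C_ext; simpl; field).
  rewrite E12, CGamma_WI by (simpl; lra).
  rewrite (WI_derive (fun v => RtoC (2 * gauss_int (exp (v / 2)))) (gk (RtoC (/ 2))) (RtoC (2 * gauss_total)) 0).
  - ring.
  - intros v; rewrite gk_real; apply cder_RtoC; eapply is_derive_eq.
    + apply @is_derive_scal; apply (is_derive_Rcomp gauss_int (fun v => exp (v / 2))); [apply gauss_int_derive|auto_derive; trivial].
    + cbv beta; rewrite <- !exp_plus; replace (v / 2 + v / 2)%R with v by field.
      replace (/ 2 * v - exp v)%R with (v / 2 + - exp v)%R by field; rewrite exp_plus; unfold Rdiv; field.
  - apply gk_wgood; simpl; lra.
  - apply (clim_exp_dominated _ _ (2 * exp (/ 4)) (/ 2)); [lra|]; intros T HT.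
    rewrite <- RtoC_minus, Cmod_R, <- Rmult_minus_distr_l, Rabs_mult, (Rabs_pos_eq 2), Rmult_assoc by lra.
    apply Rmult_le_compat_l; [lra|]; pose proof (exp_pos (T / 2)).
    eapply Rle_trans; [apply gauss_int_tail; lra|].
    apply Rmult_le_compat_l; [left; apply exp_pos|apply exp_mono].
    pose proof (exp_ineq1_le (T / 2)); lra.
  - apply (clim_exp_dominated _ _ 2 (/ 2)); [lra|]; intros T HT.
    rewrite <- RtoC_minus, Cmod_R, Rminus_0_r, Rabs_mult, (Rabs_pos_eq 2) by lra.
    apply Rmult_le_compat_l; [lra|]; replace (- / 2 * T)%R with (- T / 2)%R by field.
    set (x := exp (- T / 2)); assert (Hx : (0 < x)%R) by apply exp_pos.
    assert (K1 : (gauss_int x - x <= gauss_int 0 - 0)%R).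
    { apply (is_derive_mono (fun y => gauss_int y - y)%R (fun y => exp (- (y * y)) - 1)%R); [lra| |].
      - intros; apply is_derive_Rminus; [apply gauss_int_derive|apply @is_derive_id].
      - intros y _; assert (exp (- (y * y)) <= 1)%R; [|lra].
        rewrite <- exp_0; apply exp_mono; pose proof (Rle_0_sqr y); unfold Rsqr in *; lra. }
    assert (K2 : (- gauss_int x <= - gauss_int 0)%R).
    { apply (is_derive_mono (fun y => - gauss_int y)%R (fun y => - exp (- (y * y)))%R); [lra| |].
      - intros; apply (is_derive_opp gauss_int), gauss_int_derive.
      - intros y _; pose proof (exp_pos (- (y * y))); lra. }
    rewrite gauss_int_0 in K1, K2; rewrite Rabs_pos_eq; lra.
Qed.

Lemma atan_le_id x : (0 <= x)%R -> (atan x <= x)%R.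
Proof.
  intros Hx; assert (L : (atan x - x <= atan 0 - 0)%R); [|rewrite atan_0 in L; lra].
  apply (is_derive_mono (fun x => atan x - x)%R (fun x => / (1 + x²) - 1)%R); trivial.
  - intros; apply is_derive_Rminus; [apply is_derive_atan|apply @is_derive_id].
  - intros y _; pose proof (Rle_0_sqr y).
    assert (/ (1 + y²) <= / 1)%R by (apply Rinv_le_contravar; lra); lra.
Qed.

(** Here the kernel is [/ cosh (t / 2)], with primitive [2 * atan (sinh (t / 2))]. *)
Lemma M0_half : M0 (- (1 / 2)) 1 = RtoC PI.
Proof.
  assert (E12 : - (1 / 2) = RtoC (- / 2)) by (apply C_ext; simpl; field).
  rewrite E12.
  destruct (tkernels_dfam (RtoC (- / 2)) 1 ltac:(simpl; lra) Rlt_0_1) as [D _].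
  apply (dfam_hgood _ _ _ 1) in D; [|rewrite Rminus_eq_0, Rabs_R0; lra].
  unfold M0; rewrite (HInt_derive (fun t => RtoC (2 * atan (sinh (t / 2)))) _ (RtoC PI)); trivial.
  - replace (0 / 2)%R with 0%R by field; unfold sinh at 1; rewrite Ropp_0, Rminus_eq_0; replace (0 / 2)%R with 0%R by field.
    rewrite atan_0, Rmult_0_r; ring.
  - intros t; pose proof (cosh_pos (t / 2)) as P.
    rewrite m0_one, <- RtoC_mult, Cexp_RtoC.
    replace (- / 2 * (2 * ln (cosh (t / 2))))%R with (- ln (cosh (t / 2)))%R by field.
    rewrite exp_Ropp, exp_ln by trivial.
    apply cder_RtoC; eapply is_derive_eq.
    + apply @is_derive_scal, (is_derive_Rcomp atan (fun t => sinh (t / 2))); [apply is_derive_atan|].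
      apply (is_derive_Rcomp sinh (fun t => t / 2)%R); [apply is_derive_Reals, derivable_pt_lim_sinh|].
      instantiate (1 := (/ 2)%R); auto_derive; trivial; field.
    + unfold Rsqr; rewrite <- cosh_sinh_sqr; field; lra.
  - apply (clim_exp_eventually _ _ 8 (/ 2) 2); [lra|]; intros T HT.
    pose proof (sinh_half_lower T HT) as SL; pose proof (exp_pos (T / 2)) as ET.
    assert (Ps : (0 < sinh (T / 2))%R) by lra.
    pose proof (atan_inv (sinh (T / 2)) Ps) as AI.
    assert (HI : (/ sinh (T / 2) <= 4 * exp (- / 2 * T))%R).
    { replace (4 * exp (- / 2 * T))%R with (/ (exp (T / 2) / 4))%R.
      - apply Rinv_le_contravar; lra.
      - replace (- / 2 * T)%R with (- (T / 2))%R by field; rewrite exp_Ropp; field; lra. }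
    pose proof (Rinv_0_lt_compat _ Ps) as IP.
    pose proof (atan_le_id _ (Rlt_le _ _ IP)) as AL.
    assert (AP : (0 < atan (/ sinh (T / 2)))%R) by (rewrite <- atan_0; now apply atan_increasing).
    rewrite <- RtoC_minus, Cmod_R, Rabs_left1; lra.
Qed.

(** The case [a = 1 / 2] of [gamma_half_gauss_total] reads [PI / 2 = 2 * gauss_total ^ 2]. *)
Lemma gauss_total_value : (2 * gauss_total = sqrt PI)%R.
Proof.
  pose proof (gamma_half_gauss_total (1 / 2) ltac:(simpl; lra)) as E.
  replace (1 / 2 + 1 / 2) with (RtoC 1) in E by (apply C_ext; simpl; field).
  rewrite CGamma_1, CGamma_half, M0_half in E.
  assert (E' : (PI = 4 * (gauss_total * gauss_total))%R).
  { assert (E1 : RtoC (PI / 2) = RtoC (gauss_total * (2 * gauss_total))).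
    { rewrite RtoC_mult, <- E, RtoC_div by lra; field; apply two_nz. }
    apply RtoC_inj in E1; lra. }
  pose proof gauss_total_pos; pose proof PI_RGT_0; symmetry; apply sqrt_lem_1; lra.
Qed.

Lemma gamma_quotient a : (0 < Re a)%R -> M0 (- a) 1 = RtoC (sqrt PI) * (CGamma a / CGamma (a + 1 / 2)).
Proof.
  intros Ha; pose proof (gamma_half_gauss_total a Ha) as E.
  assert (Hb : (0 < Re (a + 1 / 2))%R) by (rewrite Re_half; lra).
  pose proof (CGamma_nz _ Hb) as Nz; rewrite <- gauss_total_value, RtoC_mult.
  transitivity (2 * (1 / 2 * CGamma (a + 1 / 2) * M0 (- a) 1) / CGamma (a + 1 / 2)).
  - field; exact Nz.
  - rewrite E; field; exact Nz.
Qed.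

(** * Legendre's equation for analytic functions *)

(** Legendre's operator in the variable z. *)
Definition Lop (lam : C) (f : C -> C) (z : C) : C :=
  (1 - z * z) * Cder (Cder f) z - 2 * z * Cder f z + lam * f z.

Lemma an_Lop lam f z : an f z -> an (Lop lam f) z.
Proof.
  intros H; pose proof (an_der _ _ H) as H1; pose proof (an_der _ _ H1) as H2.
  apply (an_ext_loc (fun z => Cder (Cder f) z + (- (1)) * (z * (z * Cder (Cder f) z)) + (- 2) * (z * Cder f z) + lam * f z) _ z 1); [lra| |].
  - intros w _; unfold Lop; ring.
  - repeat first [apply (an_plus (fun z => _ + _ + _))|apply (an_plus (fun z => _ + _))|apply an_plus]; trivial;
      repeat first [assumption|apply an_scal|apply an_mulX].
Qed.

Lemma hol_Ccosh_line p d s : cder (fun x => Ccosh (p + RtoC x * d)) s (Csinh (p + RtoC s * d) * d).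
Proof. apply (hol_Ccosh (p + RtoC s * d) (fun x => p + RtoC x * d)); [reflexivity|apply cder_line]. Qed.

Lemma hol_Csinh_line p d s : cder (fun x => Csinh (p + RtoC x * d)) s (Ccosh (p + RtoC s * d) * d).
Proof. apply (hol_Csinh (p + RtoC s * d) (fun x => p + RtoC x * d)); [reflexivity|apply cder_line]. Qed.

(** Chain rule for [z = Ccosh w] along a line in the [w]-plane. *)
Lemma Legendre_along_line lam f p d s :
  let w := p + RtoC s * d in
  an f (Ccosh w) ->
  cder (fun x => f (Ccosh (p + RtoC x * d))) s (d * (Csinh w * Cder f (Ccosh w))) /\
  exists y2, cder (fun x => Csinh (p + RtoC x * d) * Cder f (Ccosh (p + RtoC x * d))) s (d * y2) /\
    Csinh w * y2 + Ccosh w * (Csinh w * Cder f (Ccosh w)) - lam * Csinh w * f (Ccosh w)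
      = - Csinh w * Lop lam f (Ccosh w).
Proof.
  intros w H; pose proof (an_hol _ _ H) as D0; pose proof (an_hol _ _ (an_der _ _ H)) as D1.
  split.
  - eapply cder_eq; [apply (D0 (fun x => Ccosh (p + RtoC x * d)) s _ eq_refl (hol_Ccosh_line p d s))|fold w; ring].
  - exists (Ccosh w * Cder f (Ccosh w) + Csinh w * Csinh w * Cder (Cder f) (Ccosh w)); split.
    + eapply cder_eq.
      * apply cder_mult; [apply hol_Csinh_line|].
        apply (D1 (fun x => Ccosh (p + RtoC x * d)) s _ eq_refl (hol_Ccosh_line p d s)).
      * cbv beta; fold w; ring.
    + clearbody w; unfold Lop; generalize (Cder (Cder f) (Ccosh w)), (Cder f (Ccosh w)), (f (Ccosh w)); intros f2 f1 f0.
      rewrite Ccosh_sqr; ring.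
Qed.

(** After division by [Csinh], the difference of two solutions satisfies the hypotheses of
    [linear_ode_unique]. *)
Lemma Legendre_unique_on_segment lam p d (u u1 v v1 : C -> C) (a b : R) : (a <= b)%R ->
  (forall s, (a <= s <= b)%R -> Csinh (p + RtoC s * d) <> 0) ->
  (forall s, (a <= s <= b)%R -> cder (fun x => u (p + RtoC x * d)) s (d * u1 (p + RtoC s * d)) /\
     exists y2, cder (fun x => u1 (p + RtoC x * d)) s (d * y2) /\
       Csinh (p + RtoC s * d) * y2 + Ccosh (p + RtoC s * d) * u1 (p + RtoC s * d) - lam * Csinh (p + RtoC s * d) * u (p + RtoC s * d) = 0) ->
  (forall s, (a <= s <= b)%R -> cder (fun x => v (p + RtoC x * d)) s (d * v1 (p + RtoC s * d)) /\
     exists y2, cder (fun x => v1 (p + RtoC x * d)) s (d * y2) /\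
       Csinh (p + RtoC s * d) * y2 + Ccosh (p + RtoC s * d) * v1 (p + RtoC s * d) - lam * Csinh (p + RtoC s * d) * v (p + RtoC s * d) = 0) ->
  u (p + RtoC a * d) = v (p + RtoC a * d) -> u1 (p + RtoC a * d) = v1 (p + RtoC a * d) ->
  u (p + RtoC b * d) = v (p + RtoC b * d).
Proof.
  intros Hab Hs Hu Hv E0 E1.
  set (g := fun s => p + RtoC s * d) in *.
  assert (CS : forall s, ccont (fun x => Csinh (g x)) s) by (intros; eapply cder_ccont, hol_Csinh_line).
  assert (CC : forall s, ccont (fun x => Ccosh (g x)) s) by (intros; eapply cder_ccont, hol_Ccosh_line).
  pose (A := fun s => - d * (Ccosh (g s) * / Csinh (g s))).
  assert (Z : u (g b) - v (g b) = 0).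
  { apply (linear_ode_unique A (fun _ => d * d * lam) (fun s => u (g s) - v (g s)) (fun s => d * (u1 (g s) - v1 (g s))) a b); trivial.
    - intros s Hs'; apply ccont_mult; [apply ccont_const|]; apply ccont_mult; [apply CC|].
      specialize (Hs s Hs'); apply Cmod_gt_0 in Hs.
      destruct (CS s) as [C1 C2].
      assert (Pn : (fst (Csinh (g s)) ^ 2 + snd (Csinh (g s)) ^ 2 <> 0)%R).
      { pose proof (Cmod_sqr (Csinh (g s))) as Q; unfold Re, Im in Q; pose proof (Rmult_lt_0_compat _ _ Hs Hs); fold (g s) in H; apply Rgt_not_eq; lra. }
      assert (Cn : continuity_pt (fun x => fst (Csinh (g x)) ^ 2 + snd (Csinh (g x)) ^ 2)%R s).
      { apply (continuity_pt_plus (fun x => fst (Csinh (g x)) ^ 2)%R (fun x => snd (Csinh (g x)) ^ 2)%R).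
        - apply (continuity_pt_comp (fun x => Re (Csinh (g x))) (fun y => y ^ 2)%R); trivial; apply derivable_continuous, derivable_pow.
        - apply (continuity_pt_comp (fun x => Im (Csinh (g x))) (fun y => y ^ 2)%R); trivial; apply derivable_continuous, derivable_pow. }
      split.
      + apply (continuity_pt_div (fun x => Re (Csinh (g x))) (fun x => fst (Csinh (g x)) ^ 2 + snd (Csinh (g x)) ^ 2)%R); trivial.
      + apply (continuity_pt_div (fun x => - Im (Csinh (g x)))%R (fun x => fst (Csinh (g x)) ^ 2 + snd (Csinh (g x)) ^ 2)%R); trivial.
        apply (continuity_pt_opp (fun x => Im (Csinh (g x)))); trivial.
    - intros; apply ccont_const.
    - intros s Hs'; destruct (Hu s Hs') as [U _], (Hv s Hs') as [V _].
      eapply cder_eq; [apply cder_minus; [exact U|exact V]|unfold g; ring].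
    - intros s Hs'; destruct (Hu s Hs') as [_ [yu [U Eu]]], (Hv s Hs') as [_ [yv [V Ev]]].
      eapply cder_eq; [apply cder_scal, cder_minus; [exact U|exact V]|].
      specialize (Hs s Hs'); change (p + RtoC s * d) with (g s) in Hs, Eu, Ev.
      assert (Eyu : yu = - Ccosh (g s) * / Csinh (g s) * u1 (g s) + lam * u (g s)).
      { transitivity ((Csinh (g s) * yu + Ccosh (g s) * u1 (g s) - lam * Csinh (g s) * u (g s)) * / Csinh (g s)
          - Ccosh (g s) * / Csinh (g s) * u1 (g s) + lam * u (g s)); [field; trivial|rewrite Eu; ring]. }
      assert (Eyv : yv = - Ccosh (g s) * / Csinh (g s) * v1 (g s) + lam * v (g s)).
      { transitivity ((Csinh (g s) * yv + Ccosh (g s) * v1 (g s) - lam * Csinh (g s) * v (g s)) * / Csinh (g s)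
          - Ccosh (g s) * / Csinh (g s) * v1 (g s) + lam * v (g s)); [field; trivial|rewrite Ev; ring]. }
      rewrite Eyu, Eyv; unfold A; ring.
    - unfold g; rewrite E0; ring.
    - unfold g; rewrite E1; ring. }
  transitivity ((u (g b) - v (g b)) + v (g b)); [unfold g; ring|rewrite Z; unfold g; ring].
Qed.

Lemma Qc_solution mu p d s r : (Re mu < 0)%R -> (0 < r)%R ->
  (forall x, (Rabs (x - s) < r)%R -> Reg (p + RtoC x * d)) ->
  cder (fun x => Qc mu (p + RtoC x * d)) s (d * Qc1 mu (p + RtoC s * d)) /\
  exists y2, cder (fun x => Qc1 mu (p + RtoC x * d)) s (d * y2) /\
    Csinh (p + RtoC s * d) * y2 + Ccosh (p + RtoC s * d) * Qc1 mu (p + RtoC s * d)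
      - mu * (mu + 1) * Csinh (p + RtoC s * d) * Qc mu (p + RtoC s * d) = 0.
Proof.
  intros Hmu Hr HR; destruct (Qc_line mu p d s r Hmu Hr HR) as [D0 D1]; split; trivial.
  exists (Qc2 mu (p + RtoC s * d)); split; trivial; apply Qc_equation; trivial.
  apply HR; rewrite Rminus_eq_0, Rabs_R0; lra.
Qed.

(** * The function of the second kind off the cut *)

(** The hypergeometric series of the definition has argument [/ z ^ 2 = 1 - T * T] with [T = tanh s], so that
    [M_proportional] applies as soon as [T] is close to 1. *)
Lemma Q_on_real_axis nu Q : (-1 < Re nu)%R -> is_LegendreQ nu Q ->
  exists S0, (0 < S0)%R /\ forall s, (S0 <= s)%R -> Q (Ccosh (RtoC s)) = Qc (- nu - 1) (RtoC s).
Proof.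
  intros Hnu [_ HQ].
  assert (Hmu : (Re (- nu - 1) < 0)%R) by (simpl; unfold Re in *; lra).
  assert (Eab : nu / 2 + 1 + (nu / 2 + 1 / 2) = nu + 3 / 2) by (apply C_ext; simpl; field).
  destruct (M_proportional (- nu - 1) (nu / 2 + 1) (nu / 2 + 1 / 2) (nu + 3 / 2) Hmu) as (T0 & HT0 & HM); trivial.
  { field; apply two_nz. }
  { field; apply two_nz. }
  (* s large enough for tanh s to exceed T0 *)
  exists (Rmax 1 (/ (1 - T0))); split; [apply Rlt_le_trans with 1%R; [lra|apply Rmax_l]|].
  intros s Hs.
  assert (Hs1 : (1 <= s)%R) by (eapply Rle_trans; [apply Rmax_l|exact Hs]).
  assert (Hs2 : (/ (1 - T0) <= s)%R) by (eapply Rle_trans; [apply Rmax_r|exact Hs]).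
  pose proof (cosh_pos s) as Cp; pose proof (sinh_pos s ltac:(lra)) as Sp.
  pose proof (cosh_sinh_sqr s) as CS.
  assert (C1 : (1 < cosh s)%R) by nra.
  set (T := (sinh s / cosh s)%R).
  assert (ET : (1 - T * T = / (cosh s * cosh s))%R).
  { unfold T; replace (sinh s / cosh s * (sinh s / cosh s))%R with ((cosh s * cosh s - 1) / (cosh s * cosh s))%R; [field; lra|].
    replace (cosh s * cosh s - 1)%R with (sinh s * sinh s)%R by lra; field; lra. }
  assert (HT : (T0 <= T <= 1)%R).
  { assert (Ex : (1 - T = exp (- s) / cosh s)%R).
    { unfold T; replace (exp (- s)) with (cosh s - sinh s)%R by (unfold cosh, sinh; field); field; lra. }
    assert (0 < exp (- s) / cosh s)%R by (apply Rdiv_lt_0_compat; [apply exp_pos|lra]).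
    assert (exp (- s) / cosh s <= 1 - T0)%R; [|lra].
    apply Rle_trans with (/ s)%R.
    - pose proof (exp_ineq1_le s); rewrite exp_Ropp.
      unfold Rdiv; rewrite <- Rinv_mult; apply Rinv_le_contravar; [lra|]; nra.
    - rewrite <- (Rinv_inv (1 - T0)); apply Rinv_le_contravar; trivial; apply Rinv_0_lt_compat; lra. }
  assert (Ez : Ccosh (RtoC s) = RtoC (cosh s)).
  { rewrite Ccosh_eq; simpl; rewrite cos_0, sin_0; apply C_ext; simpl; ring. }
  rewrite Ez, HQ.
  2:{ intros [_ K]; simpl in K; lra. }
  2:{ rewrite Cmod_R, Rabs_pos_eq; lra. }
  rewrite Qc_real by (trivial; lra); fold T; rewrite HM by trivial.
  replace (1 / (RtoC (cosh s) * RtoC (cosh s))) with (RtoC (1 - T * T)).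
  2:{ rewrite ET, RtoC_inv, RtoC_mult by nra; field; apply RtoC_nz; lra. }
  rewrite <- RtoC_mult, Cpower_pw by (simpl; lra).
  replace (- nu - 1) with (- (nu + 1)) by ring; rewrite gamma_quotient by (simpl; unfold Re in *; lra).
  replace (nu + 1 + 1 / 2) with (nu + 3 / 2) by (apply C_ext; simpl; field).
  ring.
Qed.

Definition Omega (w : C) : Prop := (0 < Re w)%R /\ (Rabs (Im w) < PI / 2)%R.

Lemma Omega_Reg w : Omega w -> Reg w.
Proof.
  intros [H1 H2]; split; [split; lra|]; intros E; rewrite E in H1; simpl in H1; lra.
Qed.

(** The image of the half-strip lies in the right half-plane off the segment from 0 to 1. *)
Lemma Omega_cut w : Omega w -> cut_plane 1 (Ccosh w).
Proof.
  intros [H1 H2]; rewrite Ccosh_eq; unfold cut_plane; simpl; intros [E1 E2].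
  pose proof (sinh_pos _ H1) as Sp; pose proof (cosh_sinh_sqr (Re w)) as CS; pose proof (cosh_pos (Re w)) as Cp.
  assert (S0 : sin (Im w) = 0%R) by nra.
  pose proof (sin2_cos2 (Im w)) as SC; unfold Rsqr in SC.
  apply Rabs_def2 in H2; assert (0 < cos (Im w))%R by (apply cos_gt_0; lra).
  assert (cos (Im w) = 1%R) by nra; nra.
Qed.

Lemma Omega_convex p w s : Omega p -> Omega w -> (0 <= s <= 1)%R -> Omega (p + RtoC s * (w - p)).
Proof.
  intros [P1 P2] [W1 W2] Hs.
  replace (p + RtoC s * (w - p)) with (RtoC (1 - s) * p + RtoC s * w) by (rewrite RtoC_minus; ring).
  split; simpl; fold (Re p) (Im p) (Re w) (Im w).
  - replace ((1 - s) * Re p - 0 * Im p + (s * Re w - 0 * Im w))%R with ((1 - s) * Re p + s * Re w)%R by ring.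
    destruct (Req_dec s 0) as [->|]; [lra|]; assert (0 < s * Re w)%R by (apply Rmult_lt_0_compat; lra).
    assert (0 <= (1 - s) * Re p)%R by (apply Rmult_le_pos; lra); lra.
  - replace ((1 - s) * Im p + 0 * Re p + (s * Im w + 0 * Re w))%R with ((1 - s) * Im p + s * Im w)%R by ring.
    apply Rabs_def2 in P2, W2; apply Rabs_def1; destruct (Req_dec s 0) as [->|]; try lra.
    + assert (s * Im w < s * (PI / 2))%R by (apply Rmult_lt_compat_l; lra).
      assert ((1 - s) * Im p <= (1 - s) * (PI / 2))%R by (apply Rmult_le_compat_l; lra); lra.
    + assert (s * - (PI / 2) < s * Im w)%R by (apply Rmult_lt_compat_l; lra).
      assert ((1 - s) * - (PI / 2) <= (1 - s) * Im p)%R by (apply Rmult_le_compat_l; lra); lra.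
Qed.

Lemma Omega_open p d s : Omega (p + RtoC s * d) ->
  exists r, (0 < r)%R /\ forall x, (Rabs (x - s) < r)%R -> Omega (p + RtoC x * d).
Proof.
  intros [H1 H2]; set (m := Rmin (Re (p + RtoC s * d)) (PI / 2 - Rabs (Im (p + RtoC s * d)))).
  assert (Hm : (0 < m)%R) by (apply Rmin_glb_lt; lra).
  destruct (ccont_eps _ s m (ccont_line p d s) Hm) as [r [Hr Hr']].
  exists r; split; trivial; intros x Hx; specialize (Hr' (x - s)%R Hx).
  replace (s + (x - s))%R with x in Hr' by ring.
  set (w := p + RtoC s * d) in *; set (w' := p + RtoC x * d) in *.
  pose proof (re_le_Cmod (w' - w)) as R1; pose proof (im_le_Cmod (w' - w)) as R2.
  assert (m <= Re w /\ m <= PI / 2 - Rabs (Im w))%R as [M1 M2] by (split; [apply Rmin_l|apply Rmin_r]).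
  replace (Re (w' - w)) with (Re w' - Re w)%R in R1 by (simpl; unfold Re; ring).
  replace (Im (w' - w)) with (Im w' - Im w)%R in R2 by (simpl; unfold Im; ring).
  split.
  - apply Rabs_le_between in R1; lra.
  - replace (Im w') with ((Im w' - Im w) + Im w)%R by ring; eapply Rle_lt_trans; [apply Rabs_triang|lra].
Qed.

(** On the real axis near infinity Q satisfies Legendre's equation because [Qc] does. The operator applied
    to Q is analytic, so it vanishes along the image of every segment in [Omega] that starts there
    ([zero_propagation]); then Q and [Qc] solve the same equation on that segment with the same initial
    values. *)
Lemma Q_off_cut nu Q w : (-1 < Re nu)%R -> is_LegendreQ nu Q -> Omega w ->
  Q (Ccosh w) = Qc (- nu - 1) w.
Proof.
  intros Hnu HQ Hw; destruct (Q_on_real_axis nu Q Hnu HQ) as (S0 & HS0 & HR).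
  set (mu := - nu - 1) in *; set (lam := mu * (mu + 1)).
  assert (Hmu : (Re mu < 0)%R) by (unfold mu; simpl; unfold Re in *; lra).
  destruct HQ as [Han _].
  assert (An : forall v, Omega v -> an Q (Ccosh v)).
  { intros v Hv; apply analytic_at_an, Han; now apply Omega_cut. }
  assert (OR : forall s, (0 < s)%R -> Omega (RtoC s)).
  { intros s Hs; split; simpl; [lra|]; rewrite Rabs_R0; pose proof PI_RGT_0; lra. }
  assert (RL : forall x, 0 + RtoC x * 1 = RtoC x) by (intros; ring).
  assert (Sol : forall s, (S0 < s)%R -> Csinh (RtoC s) * Cder Q (Ccosh (RtoC s)) = Qc1 mu (RtoC s)).
  { intros s Hs; destruct (Legendre_along_line lam Q 0 1 s) as [D _]; [rewrite RL; apply An, OR; lra|].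
    destruct (Qc_line mu 0 1 s s Hmu ltac:(lra)) as [D' _].
    { intros x Hx; rewrite RL; apply Omega_Reg, OR; apply Rabs_def2 in Hx; lra. }
    assert (D2 : cder (fun x => Qc mu (0 + RtoC x * 1)) s (1 * (Csinh (0 + RtoC s * 1) * Cder Q (Ccosh (0 + RtoC s * 1))))).
    { apply (cder_ext_loc (fun x => Q (Ccosh (0 + RtoC x * 1)))); trivial.
      exists (mkposreal (s - S0) ltac:(lra)); intros x Hx; assert (Hx' : (Rabs (x - s) < s - S0)%R) by exact Hx.
      apply Rabs_def2 in Hx'; rewrite RL; apply HR; lra. }
    pose proof (cder_unique _ _ _ _ D2 D') as E; rewrite RL, !Cmult_1_l in E; exact E. }
  assert (Lz : forall s, (S0 < s)%R -> Lop lam Q (Ccosh (RtoC s)) = 0).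
  { intros s Hs; destruct (Legendre_along_line lam Q 0 1 s) as [_ [y2 [D E]]]; [rewrite RL; apply An, OR; lra|].
    destruct (Qc_line mu 0 1 s s Hmu ltac:(lra)) as [_ D'].
    { intros x Hx; rewrite RL; apply Omega_Reg, OR; apply Rabs_def2 in Hx; lra. }
    assert (D2 : cder (fun x => Qc1 mu (0 + RtoC x * 1)) s (1 * y2)).
    { apply (cder_ext_loc (fun x => Csinh (0 + RtoC x * 1) * Cder Q (Ccosh (0 + RtoC x * 1)))); trivial.
      exists (mkposreal (s - S0) ltac:(lra)); intros x Hx; assert (Hx' : (Rabs (x - s) < s - S0)%R) by exact Hx.
      apply Rabs_def2 in Hx'; rewrite RL; apply Sol; lra. }
    pose proof (cder_unique _ _ _ _ D2 D') as E2; rewrite RL, !Cmult_1_l in E2.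
    rewrite RL, E2, Sol, HR in E by lra; unfold lam in E.
    rewrite Qc_equation in E by (trivial; apply Omega_Reg, OR; lra).
    symmetry in E; fold lam in E.
    assert (Nz : - Csinh (RtoC s) <> 0).
    { intros Z; apply (Reg_Csinh_nz (RtoC s)); [apply Omega_Reg, OR; lra|].
      replace (Csinh (RtoC s)) with (- - Csinh (RtoC s)) by ring; rewrite Z; ring. }
    apply Cmult_zero in E; tauto. }
  set (s1 := (S0 + 1)%R).
  assert (V1 : vanishes_near (Lop lam Q) (Ccosh (RtoC s1))).
  { apply an_zero; [apply an_Lop, An, OR; unfold s1; lra|].
    intros eps He.
    assert (Nz : Csinh (0 + RtoC s1 * 1) * 1 <> 0).
    { rewrite RL, Cmult_1_r; apply Reg_Csinh_nz, Omega_Reg, OR; unfold s1; lra. }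
    destruct (cder_moves _ _ _ eps (hol_Ccosh_line 0 1 s1) Nz He) as [d [Pd Qd]].
    specialize (Qd (d / 2)%R ltac:(rewrite Rabs_pos_eq; lra)); rewrite !RL in Qd.
    exists (Ccosh (RtoC (s1 + d / 2))); split; trivial; apply Lz; unfold s1; lra. }
  destruct (Ceq_dec w (RtoC s1)) as [->|Hne]; [apply HR; unfold s1; lra|].
  set (p := RtoC s1) in *; set (d := w - p).
  assert (Hd : d <> 0).
  { intros Z; apply Hne; replace w with (d + p) by (unfold d; ring); rewrite Z; ring. }
  assert (Op : Omega p) by (apply OR; unfold s1; lra).
  assert (Os : forall s, (0 <= s <= 1)%R -> Omega (p + RtoC s * d)) by (intros; now apply Omega_convex).
  assert (Vs : forall s, (0 <= s <= 1)%R -> vanishes_near (Lop lam Q) (Ccosh (p + RtoC s * d))).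
  { apply (zero_propagation (Lop lam Q) (fun s => Ccosh (p + RtoC s * d)) 0 1).
    - intros s Hs; split; [apply an_Lop, An, Os; trivial|].
      exists (Csinh (p + RtoC s * d) * d); split; [|apply hol_Ccosh_line].
      intros Z; apply Cmult_zero in Z; destruct Z as [Z|Z]; [|now apply Hd].
      revert Z; apply Reg_Csinh_nz, Omega_Reg, Os; trivial.
    - replace (p + RtoC 0 * d) with p by ring; exact V1. }
  replace w with (p + RtoC 1 * d) by (unfold d; ring).
  apply (Legendre_unique_on_segment lam p d (fun v => Q (Ccosh v)) (fun v => Csinh v * Cder Q (Ccosh v)) (Qc mu) (Qc1 mu) 0 1); try lra.
  - intros s Hs; apply Reg_Csinh_nz, Omega_Reg, Os; trivial.
  - intros s Hs; destruct (Legendre_along_line lam Q p d s) as [D [y2 [D2 E]]]; [apply An, Os; trivial|].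
    split; trivial; exists y2; split; trivial; rewrite E.
    destruct (Vs s Hs) as [r [Hr Hr']]; rewrite Hr'; [ring|].
    replace (_ - _) with (RtoC 0) by ring; now rewrite Cmod_0.
  - intros s Hs; destruct (Omega_open p d s (Os s Hs)) as [r [Hr Hr']].
    apply (Qc_solution mu p d s r); trivial; intros; now apply Omega_Reg, Hr'.
  - replace (p + RtoC 0 * d) with p by ring; apply HR; unfold s1; lra.
  - replace (p + RtoC 0 * d) with p by ring; apply Sol; unfold s1; lra.
Qed.

(** * Boundary values on the cut *)

Section Boundary.

Let focal_left (x y : R) : R := sqrt ((x + 1) * (x + 1) + y * y).
Let focal_right (x y : R) : R := sqrt ((x - 1) * (x - 1) + y * y).
Let focal_sum (x y : R) : R := ((focal_left x y + focal_right x y) / 2)%R.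
Let focal_diff (x y : R) : R := ((focal_left x y - focal_right x y) / 2)%R.

(** The elliptic coordinates of [x + i y], which stay regular down to the cut. *)
Let tau (x y : R) : R := ln (focal_sum x y + sqrt (focal_sum x y * focal_sum x y - 1)).
Let eta (x y : R) : R := acos (focal_diff x y).

(** The sum and difference of the distances to the foci are twice [cosh tau] and twice [cos eta]. *)
Lemma elliptic_facts x y : (0 < x < 1)%R ->
  (1 <= focal_sum x y)%R /\ (focal_sum x y * focal_diff x y = x)%R /\ (0 < focal_diff x y < 1)%R /\
  ((focal_sum x y * focal_sum x y - 1) * (1 - focal_diff x y * focal_diff x y) = y * y)%R /\ (y <> 0%R -> 1 < focal_sum x y)%R.
Proof.
  intros Hx.
  assert (U0 : (0 <= (x + 1) * (x + 1) + y * y)%R) by nra.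
  assert (V0 : (0 <= (x - 1) * (x - 1) + y * y)%R) by nra.
  pose proof (sqrt_sqrt _ U0) as U2; pose proof (sqrt_sqrt _ V0) as V2.
  pose proof (sqrt_pos ((x + 1) * (x + 1) + y * y)) as U; pose proof (sqrt_pos ((x - 1) * (x - 1) + y * y)) as V.
  fold (focal_left x y) in U2, U; fold (focal_right x y) in V2, V.
  assert (Ug : (x + 1 <= focal_left x y)%R) by nra.
  assert (Vg : (1 - x <= focal_right x y)%R) by nra.
  assert (A1 : (1 <= focal_sum x y)%R) by (unfold focal_sum; lra).
  assert (AB : (focal_sum x y * focal_diff x y = x)%R).
  { unfold focal_sum, focal_diff; replace ((focal_left x y + focal_right x y) / 2 * ((focal_left x y - focal_right x y) / 2))%R with ((focal_left x y * focal_left x y - focal_right x y * focal_right x y) / 4)%R by field.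
    rewrite U2, V2; field. }
  assert (AB2 : (focal_sum x y * focal_sum x y + focal_diff x y * focal_diff x y = x * x + 1 + y * y)%R).
  { unfold focal_sum, focal_diff; replace ((focal_left x y + focal_right x y) / 2 * ((focal_left x y + focal_right x y) / 2) + (focal_left x y - focal_right x y) / 2 * ((focal_left x y - focal_right x y) / 2))%R
      with ((focal_left x y * focal_left x y + focal_right x y * focal_right x y) / 2)%R by field.
    rewrite U2, V2; field. }
  split; [exact A1|split; [exact AB|split; [nra|split]]].
  - replace ((focal_sum x y * focal_sum x y - 1) * (1 - focal_diff x y * focal_diff x y))%R with
      ((focal_sum x y * focal_sum x y + focal_diff x y * focal_diff x y) - 1 - (focal_sum x y * focal_diff x y) * (focal_sum x y * focal_diff x y))%R by ring.
    rewrite AB2, AB; ring.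
  - intros Hy; assert (0 < y * y)%R by nra.
    assert (x + 1 < focal_left x y)%R by nra; unfold focal_sum; lra.
Qed.

Lemma elliptic_point x y s : (0 < x < 1)%R -> (0 <= y)%R -> (s = 1 \/ s = -1)%R ->
  Ccosh (tau x y, (s * eta x y)%R) = (x, (s * y)%R).
Proof.
  intros Hx Hy Hs; destruct (elliptic_facts x y Hx) as (A1 & AB & B & E & _).
  assert (S0 : (0 <= focal_sum x y * focal_sum x y - 1)%R) by nra.
  set (q := sqrt (focal_sum x y * focal_sum x y - 1)).
  assert (Q0 : (0 <= q)%R) by apply sqrt_pos.
  assert (Q2 : (q * q = focal_sum x y * focal_sum x y - 1)%R) by now apply sqrt_sqrt.
  assert (P : (0 < focal_sum x y + q)%R) by lra.
  assert (I : (/ (focal_sum x y + q) = focal_sum x y - q)%R).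
  { apply Rmult_eq_reg_l with (focal_sum x y + q)%R; [|lra]; rewrite Rinv_r by lra; nra. }
  assert (Ch : cosh (tau x y) = focal_sum x y).
  { unfold cosh, tau; fold q; rewrite exp_Ropp, exp_ln, I by trivial; field. }
  assert (Sh : sinh (tau x y) = q).
  { unfold sinh, tau; fold q; rewrite exp_Ropp, exp_ln, I by trivial; field. }
  assert (Co : cos (eta x y) = focal_diff x y) by (apply cos_acos; lra).
  assert (Si : sin (eta x y) = sqrt (1 - (focal_diff x y)²)) by (apply sin_acos; lra).
  assert (Pr : (q * sin (eta x y) = y)%R).
  { rewrite Si; unfold q; rewrite <- sqrt_mult_alt by trivial; unfold Rsqr; rewrite E; now apply sqrt_square. }
  rewrite Ccosh_eq; simpl; rewrite Ch, Sh.
  destruct Hs as [-> | ->].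
  - rewrite Rmult_1_l, Co, AB, Pr; f_equal; ring.
  - replace (-1 * eta x y)%R with (- eta x y)%R by ring; rewrite cos_neg, sin_neg, Co, AB.
    f_equal; rewrite <- Pr at 2; ring.
Qed.

Lemma elliptic_cont x y s : (0 < x < 1)%R -> ccont (fun y => (tau x y, (s * eta x y)%R)) y.
Proof.
  intros Hx.
  destruct (elliptic_facts x y Hx) as (A1 & AB & B & E & _).
  assert (Cq : forall k, continuity_pt (fun y => sqrt (k * k + y * y)) y).
  { intros k; apply (continuity_pt_comp (fun y => k * k + y * y)%R sqrt).
    - apply ex_derive_cont; auto_derive; trivial.
    - apply continuity_pt_sqrt; nra. }
  assert (CA : continuity_pt (focal_sum x) y).
  { apply (continuity_pt_mult (fun y => focal_left x y + focal_right x y)%R (fun _ => / 2)%R); [|apply continuity_pt_const; now intros ? ?].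
    apply (continuity_pt_plus (focal_left x) (focal_right x)); apply Cq. }
  assert (CB : continuity_pt (focal_diff x) y).
  { apply (continuity_pt_mult (fun y => focal_left x y - focal_right x y)%R (fun _ => / 2)%R); [|apply continuity_pt_const; now intros ? ?].
    apply (continuity_pt_minus (focal_left x) (focal_right x)); apply Cq. }
  split; simpl.
  - apply (continuity_pt_comp (fun y => focal_sum x y + sqrt (focal_sum x y * focal_sum x y - 1))%R ln).
    + apply (continuity_pt_plus (focal_sum x) (fun y => sqrt (focal_sum x y * focal_sum x y - 1))); trivial.
      apply (continuity_pt_comp (fun y => focal_sum x y * focal_sum x y - 1)%R sqrt); [|apply continuity_pt_sqrt; nra].
      apply (continuity_pt_minus (fun y => focal_sum x y * focal_sum x y)%R (fun _ => 1%R)); [|apply continuity_pt_const; now intros ? ?].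
      now apply (continuity_pt_mult (focal_sum x) (focal_sum x)).
    + apply derivable_continuous_pt; exists (/ (focal_sum x y + sqrt (focal_sum x y * focal_sum x y - 1)))%R; apply derivable_pt_lim_ln.
      pose proof (sqrt_pos (focal_sum x y * focal_sum x y - 1)); lra.
  - apply (continuity_pt_mult (fun _ => s) (eta x)); [apply continuity_pt_const; now intros ? ?|].
    apply (continuity_pt_comp (focal_diff x) acos); trivial.
    apply derivable_continuous_pt, derivable_pt_acos; lra.
Qed.

Lemma elliptic_region x y s : (0 < x < 1)%R -> (s = 1 \/ s = -1)%R ->
  Reg (tau x y, (s * eta x y)%R) /\ (y <> 0%R -> Omega (tau x y, (s * eta x y)%R)).
Proof.
  intros Hx Hs; destruct (elliptic_facts x y Hx) as (A1 & AB & B & E & A2).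
  pose proof (sqrt_pos (focal_sum x y * focal_sum x y - 1)) as Q0.
  assert (T0 : (0 <= tau x y)%R).
  { unfold tau; rewrite <- ln_1; apply ln_le; lra. }
  assert (E1 : (0 < eta x y < PI / 2)%R).
  { pose proof (acos_bound (focal_diff x y)) as Ab; pose proof (cos_acos (focal_diff x y) ltac:(lra)) as Co.
    fold (eta x y) in Ab, Co; split.
    - destruct (proj1 Ab) as [|Z]; trivial; rewrite <- Z, cos_0 in Co; lra.
    - destruct (Rlt_or_le (eta x y) (PI / 2)) as [|L]; trivial.
      pose proof (cos_le_0 (eta x y) L ltac:(lra)); lra. }
  assert (Eb : (Rabs (s * eta x y) < PI / 2)%R).
  { rewrite Rabs_mult; replace (Rabs s) with 1%R; [rewrite Rabs_pos_eq; lra|].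
    destruct Hs as [-> | ->]; [now rewrite Rabs_R1|rewrite Rabs_left; lra]. }
  split.
  - split; [split; trivial|]; intros Z; apply (f_equal Im) in Z; simpl in Z; destruct Hs as [-> | ->]; lra.
  - intros Hy; split; trivial; simpl; specialize (A2 Hy).
    unfold tau; rewrite <- ln_1; apply ln_increasing; lra.
Qed.

Lemma elliptic_base theta s : (0 < theta < PI / 2)%R -> (tau (cos theta) 0, (s * eta (cos theta) 0)%R) = (0, (s * theta)%R).
Proof.
  intros Ht.
  assert (Hc : (0 < cos theta)%R) by (apply cos_gt_0; lra).
  assert (Hc1 : (cos theta < 1)%R) by (rewrite <- cos_0; apply cos_decreasing_1; lra).
  assert (U : focal_left (cos theta) 0 = (cos theta + 1)%R) by (unfold focal_left; rewrite Rmult_0_l, Rplus_0_r; apply sqrt_square; lra).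
  assert (V : focal_right (cos theta) 0 = (1 - cos theta)%R).
  { unfold focal_right; rewrite Rmult_0_l, Rplus_0_r; replace ((cos theta - 1) * (cos theta - 1))%R with ((1 - cos theta) * (1 - cos theta))%R by ring.
    apply sqrt_square; lra. }
  assert (A : focal_sum (cos theta) 0 = 1%R) by (unfold focal_sum; rewrite U, V; field).
  assert (B : focal_diff (cos theta) 0 = cos theta) by (unfold focal_diff; rewrite U, V; field).
  unfold tau, eta; rewrite A, B, acos_cos by lra.
  replace (1 * 1 - 1)%R with 0%R by ring; rewrite sqrt_0, Rplus_0_r, ln_1; reflexivity.
Qed.

(** The two points x + i y and x - i y are the images of points of [Omega] that tend to i theta and
    - i theta, where [Qc] is continuous. *)
Lemma LegendreQ_cut_value nu Q theta : (-1 < Re nu)%R -> is_LegendreQ nu Q -> (0 < theta < PI / 2)%R ->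
  LegendreQ_cut Q (cos theta) = (Qc (- nu - 1) (0, theta)%R + Qc (- nu - 1) (0, - theta)%R) / 2.
Proof.
  intros Hnu HQ Ht; set (mu := - nu - 1).
  assert (Hmu : (Re mu < 0)%R) by (unfold mu; simpl; unfold Re in *; lra).
  assert (Hc : (0 < cos theta)%R) by (apply cos_gt_0; lra).
  assert (Hc1 : (cos theta < 1)%R) by (rewrite <- cos_0; apply cos_decreasing_1; lra).
  set (x := cos theta) in *.
  pose (w := fun (s y : R) => (tau x y, (s * eta x y)%R) : C).
  assert (W0 : forall s, w s 0%R = (0, (s * theta)%R)) by (intros; now apply elliptic_base).
  assert (Cw : forall s, (s = 1 \/ s = -1)%R -> ccont (fun y => Qc mu (w s y)) 0).
  { intros s Hs; apply (Qc_cont mu (w s) 0 1); trivial; [lra|]; intros y _; split.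
    - apply elliptic_cont; lra.
    - apply elliptic_region; trivial; lra. }
  assert (Cs : ccont (fun y => (Qc mu (w 1%R y) + Qc mu (w (-1)%R y)) * / 2) 0).
  { apply ccont_mult; [|apply ccont_const]; apply ccont_plus; apply Cw; [now left|now right]. }
  unfold LegendreQ_cut; apply Clim_unique; [apply at_right_proper_filter|].
  assert (Hl : (Qc mu (0, theta)%R + Qc mu (0, - theta)%R) / 2 = (Qc mu (w 1%R 0%R) + Qc mu (w (-1)%R 0%R)) * / 2).
  { rewrite !W0, Rmult_1_l; replace (-1 * theta)%R with (- theta)%R by ring; reflexivity. }
  rewrite Hl.
  apply (filterlim_ext_loc (fun y => (Qc mu (w 1%R y) + Qc mu (w (-1)%R y)) * / 2)).
  - exists (mkposreal 1 Rlt_0_1); intros y _ Hy.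
    replace (RtoC x + Ci * RtoC y) with (Ccosh (w 1%R y)).
    2:{ unfold w; rewrite elliptic_point by (try lra; now left); apply C_ext; simpl; ring. }
    replace (RtoC x - Ci * RtoC y) with (Ccosh (w (-1)%R y)).
    2:{ unfold w; rewrite elliptic_point by (try lra; now right); apply C_ext; simpl; ring. }
    assert (Hx : (0 < x < 1)%R) by lra; assert (Hy0 : (y <> 0)%R) by lra.
    assert (Om : forall s, (s = 1 \/ s = -1)%R -> Omega (w s y)) by (intros s Hs; exact (proj2 (elliptic_region x y s Hx Hs) Hy0)).
    rewrite (Q_off_cut nu Q _ Hnu HQ (Om 1%R (or_introl eq_refl))), (Q_off_cut nu Q _ Hnu HQ (Om (-1)%R (or_intror eq_refl))).
    reflexivity.
  - destruct Cs as [C1 C2]; apply filterlim_C; [apply at_right_proper_filter| |].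
    + eapply filterlim_filter_le_1; [|apply continuity_pt_filterlim in C1; exact C1].
      intros P [e He]; exists e; intros y Hy _; now apply He.
    + eapply filterlim_filter_le_1; [|apply continuity_pt_filterlim in C2; exact C2].
      intros P [e He]; exists e; intros y Hy _; now apply He.
Qed.

End Boundary.

(** * The connection formula *)

(** Laplace's integrand, for the base [cos a - i * sin a * cos phi]. *)
Definition lapk (mu : C) (a phi : R) : C := pw mu (cos a, (- (sin a * cos phi))%R).
Definition Lap (mu : C) (a : R) : C := CRInt (lapk mu a) 0 PI.

Lemma CRInt_bound f a b B : (a <= b)%R -> (forall t, (a <= t <= b)%R -> ccont f t) ->
  (forall t, (a <= t <= b)%R -> (Cmod (f t) <= B)%R) -> (Cmod (CRInt f a b) <= 2 * ((b - a) * B))%R.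
Proof.
  intros Hab Hc HB; eapply Rle_trans; [apply Cmod_le_ReIm|].
  assert (K : forall u : R -> R, (forall t, (a <= t <= b)%R -> continuity_pt u t) -> (forall t, (a <= t <= b)%R -> (Rabs (u t) <= B)%R) ->
    (Rabs (RInt u a b) <= (b - a) * B)%R).
  { intros u Hu Hub; apply abs_RInt_le_const; trivial; apply @ex_RInt_continuous; intros z; rewrite Rmin_left, Rmax_right by trivial.
    intros Hz; apply continuity_pt_filterlim; now apply Hu. }
  pose proof (K (fun t => Re (f t)) (fun t Ht => proj1 (Hc t Ht)) (fun t Ht => Rle_trans _ _ _ (re_le_Cmod _) (HB t Ht))).
  pose proof (K (fun t => Im (f t)) (fun t Ht => proj2 (Hc t Ht)) (fun t Ht => Rle_trans _ _ _ (im_le_Cmod _) (HB t Ht))).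
  simpl; lra.
Qed.

Lemma ccont2_pair_id y t : ccont2 (fun y t => (t, y)) y t.
Proof. split; simpl; [apply continuity_2d_pt_id2|apply continuity_2d_pt_id1]. Qed.

(** On the line [Im t = PI] the sign of [cosh t] changes, which exchanges the bases for theta and - theta.
    The real part of the common base is positive on the half-strip, and the far side of the rectangle
    contributes a quantity that decays exponentially. *)
Lemma connection mu theta : (Re mu < 0)%R -> (0 < theta < PI / 2)%R ->
  Qc mu (0, - theta)%R - Qc mu (0, theta)%R = Ci * Lap mu theta.
Proof.
  intros Hmu Ht; pose proof PI_RGT_0 as PP.
  assert (Hc : (0 < cos theta)%R) by (apply cos_gt_0; lra).
  assert (Hs : (0 < sin theta)%R) by (apply sin_gt_0; lra).
  pose (Az := fun z => RtoC (cos theta) + (- (Ci * RtoC (sin theta))) * Ccosh z).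
  assert (HA : forall t y, Az (t, y) = ((cos theta + sin theta * (sinh t * sin y))%R, (- (sin theta * (cosh t * cos y)))%R)).
  { intros; unfold Az; rewrite Ccosh_eq; apply C_ext; simpl; ring. }
  pose (F := fun z => pw mu (Az z)).
  pose (F' := fun z => mu * pw (mu - 1) (Az z) * ((- (Ci * RtoC (sin theta))) * Csinh z)).
  pose (g := fun y t => (cos theta + sin theta * (sinh t * sin y))%R).
  assert (Gc : forall y t, continuity_2d_pt g y t).
  { intros y t; unfold g; apply continuity_2d_pt_plus; [apply continuity_2d_pt_const|].
    apply continuity_2d_pt_mult; [apply continuity_2d_pt_const|]; apply continuity_2d_pt_mult.
    - apply (continuity_2d_of_2 sinh), derivable_continuous, derivable_sinh.
    - apply (continuity_2d_of_1 sin), continuity_sin. }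
  assert (Gp : forall y t, (0 <= y <= PI)%R -> (0 <= t)%R -> (0 < g y t)%R).
  { intros y t Hy Htt; unfold g; pose proof (sinh_nonneg t Htt); pose proof (sin_ge_0 y ltac:(lra) ltac:(lra)).
    assert (0 <= sin theta * (sinh t * sin y))%R by (apply Rmult_le_pos; [lra|now apply Rmult_le_pos]); lra. }
  assert (Gr : forall y t, (0 < g y t)%R -> (0 < Re (Az (t, y)))%R) by (intros; rewrite HA; trivial).
  assert (CA : forall y t, ccont2 (fun y t => Az (t, y)) y t).
  { intros; unfold Az; apply ccont2_plus; [apply ccont2_const|]; apply ccont2_mult; [apply ccont2_const|]; apply (ccont2_Ccosh (fun y t => (t, y))), ccont2_pair_id. }
  assert (CF : forall y t, (0 < g y t)%R -> ccont2 (fun y t => F (t, y)) y t).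
  { intros y t H; apply ccont2_pw; [apply CA|now apply Gr]. }
  assert (Rect : forall T, (0 <= T)%R -> CRInt (fun t => F (t, PI)) 0 T - CRInt (fun t => F (t, 0%R)) 0 T =
     Ci * (CRInt (fun y => F (T, y)) 0 PI - CRInt (fun y => F (0%R, y)) 0 PI)).
  { intros T HT; apply (rectangle g F F' 0 T 0 PI); trivial; try lra.
    - intros; apply Gp; trivial; lra.
    - intros y t H; eapply hol_eq.
      + apply (hol_comp (pw mu) Az); [apply hol_pw, Gr, H|].
        apply hol_plus; [apply hol_const|apply hol_scal, hol_Ccosh].
      + unfold F'; ring.
    - intros y t H; unfold F'; apply ccont2_mult.
      + apply ccont2_mult; [apply ccont2_const|apply ccont2_pw; [apply CA|now apply Gr]].
      + apply ccont2_mult; [apply ccont2_const|]; apply (ccont2_Csinh (fun y t => (t, y))), ccont2_pair_id. }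
  assert (Rm : forall s, (s = theta \/ s = - theta)%R -> Reg (0, s)%R).
  { intros s Hs'; split; [split; simpl; [lra|]|].
    - destruct Hs' as [-> | ->]; [rewrite Rabs_pos_eq; lra|rewrite Rabs_Ropp, Rabs_pos_eq; lra].
    - intros Z; apply (f_equal Im) in Z; simpl in Z; destruct Hs'; lra. }
  assert (Km : forall t, k0 mu (0, - theta)%R t = F (t, 0%R)).
  { intros t; unfold k0, F; f_equal; rewrite HA; unfold kA; rewrite Ccosh_eq, Csinh_eq; simpl.
    rewrite cosh_0, cos_neg, sin_neg, sin_0, cos_0; unfold sinh at 1 2; rewrite Ropp_0, Rminus_eq_0.
    apply C_ext; simpl; field. }
  assert (Kp : forall t, k0 mu (0, theta)%R t = F (t, PI)).
  { intros t; unfold k0, F; f_equal; rewrite HA; unfold kA; rewrite Ccosh_eq, Csinh_eq; simpl.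
    rewrite cosh_0, sin_PI, cos_PI; unfold sinh at 1 2; rewrite Ropp_0, Rminus_eq_0.
    apply C_ext; simpl; field. }
  assert (EL : CRInt (fun y => F (0%R, y)) 0 PI = Lap mu theta).
  { unfold Lap; f_equal; apply functional_extensionality; intros y; unfold F, lapk; f_equal; rewrite HA.
    rewrite cosh_0; unfold sinh; rewrite Ropp_0, Rminus_eq_0; apply C_ext; simpl; field. }
  destruct (kernels_good mu (0, - theta)%R Hmu (Rm _ (or_intror eq_refl))) as [Gm _].
  destruct (kernels_good mu (0, theta)%R Hmu (Rm _ (or_introl eq_refl))) as [Gpl _].
  apply HInt_lim in Gm, Gpl.
  assert (L : clim (fun T => CRInt (k0 mu (0, theta)%R) 0 T + - CRInt (k0 mu (0, - theta)%R) 0 T) (Ci * (0 + - Lap mu theta))).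
  { apply (clim_ext (fun T => Ci * (CRInt (fun y => F (T, y)) 0 PI + - Lap mu theta))).
    - intros T HT; rewrite <- EL.
      replace (k0 mu (0, theta)%R) with (fun t => F (t, PI)) by (apply functional_extensionality; intros; now rewrite Kp).
      replace (k0 mu (0, - theta)%R) with (fun t => F (t, 0%R)) by (apply functional_extensionality; intros; now rewrite Km).
      symmetry; apply Rect; lra.
    - apply clim_scal, clim_plus; [|apply clim_const].
      pose (D := (exp (Rabs (Im mu) * PI) * exp (Re mu * ln (sin theta / 4)))%R).
      apply (clim_exp_eventually _ _ (2 * (PI * D)) (- Re mu) 2); [lra|]; intros T HT.
      replace (_ - 0) with (CRInt (fun y => F (T, y)) 0 PI) by ring; rewrite Ropp_involutive.
      eapply Rle_trans; [apply CRInt_bound with (B := (D * exp (Re mu * T))%R); [lra| |]|right; ring].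
      + intros y Hy; apply (ccont2_slice1 (fun y t => F (t, y))), CF, Gp; lra.
      + intros y Hy; apply pw_decay; try lra; [apply Gr, Gp; lra|].
        pose proof (sinh_half_lower (2 * T) ltac:(lra)) as SL; replace (2 * T / 2)%R with T in SL by field.
        pose proof (exp_pos T) as ET; pose proof (sin_ge_0 y ltac:(lra) ltac:(lra)) as SY.
        apply Rle_trans with (sin theta * sinh T)%R; [nra|].
        apply Rsqr_incr_0_var; [|apply Cmod_ge_0]; unfold Rsqr; rewrite Cmod_sqr, HA; simpl.
        pose proof (cosh_sinh_sqr T) as CS; pose proof (sin2_cos2 y) as SC; unfold Rsqr in SC.
        assert (X : (0 <= 2 * cos theta * (sin theta * (sinh T * sin y)))%R).
        { apply Rmult_le_pos; [lra|]; apply Rmult_le_pos; [lra|]; apply Rmult_le_pos; lra. }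
        replace ((cos theta + sin theta * (sinh T * sin y)) * (cos theta + sin theta * (sinh T * sin y)) +
          - (sin theta * (cosh T * cos y)) * - (sin theta * (cosh T * cos y)))%R with
          (cos theta * cos theta + 2 * cos theta * (sin theta * (sinh T * sin y))
           + sin theta * sin theta * (sinh T * sinh T * (sin y * sin y) + (cosh T * cosh T) * (cos y * cos y)))%R by ring.
        rewrite CS.
        replace (sinh T * sinh T * (sin y * sin y) + (1 + sinh T * sinh T) * (cos y * cos y))%R with
          (sinh T * sinh T * (sin y * sin y + cos y * cos y) + cos y * cos y)%R by ring.
        rewrite SC.
        assert (0 <= sin theta * sin theta * (cos y * cos y))%R by (apply Rmult_le_pos; apply Rle_0_sqr).
        pose proof (Rle_0_sqr (cos theta)) as Q; unfold Rsqr in Q; nra. }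
  pose proof (clim_plus _ _ _ _ Gpl (clim_opp _ _ Gm)) as L'.
  pose proof (clim_unique _ _ _ L L') as E; fold (Qc mu (0, theta)%R) (Qc mu (0, - theta)%R) in E.
  transitivity (- (Qc mu (0, theta)%R + - Qc mu (0, - theta)%R)); [ring|rewrite <- E; ring].
Qed.

(** * The function of the first kind *)

Lemma hol_ext_loc F G z l r : (0 < r)%R ->
  (forall w, (Cmod (w - z) < r)%R -> F w = G w) -> hol F z l -> hol G z l.
Proof.
  intros Hr E H g s g' e Hg.
  destruct (ccont_eps g s r (cder_ccont _ _ _ Hg) Hr) as [d [Hd Hd']].
  apply (cder_ext_loc (fun x => F (g x))); [|now apply H].
  exists (mkposreal _ Hd); intros x Hx; apply E; rewrite <- e.
  specialize (Hd' (x - s)%R Hx); rewrite Rplus_minus in Hd'; exact Hd'.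
Qed.

Lemma hol_reflect F z l : hol F ((1 - z) / 2) l -> hol (fun z => F ((1 - z) / 2)) z (- (l / 2)).
Proof.
  intros H; eapply hol_eq.
  - apply (hol_comp F (fun z => (1 - z) / 2)); [exact H|].
    apply (hol_ext (fun z => / 2 * (1 - z))); [intros; unfold Cdiv; ring|].
    apply hol_scal, hol_minus; [apply hol_const|apply hol_id].
  - unfold Cdiv; ring.
Qed.

Lemma locally_Cmod (z0 : C) (Pr : C -> Prop) : locally (T := C_UniformSpace) z0 Pr ->
  exists r, (0 < r)%R /\ forall z, (Cmod (z - z0) < r)%R -> Pr z.
Proof.
  intros [e He]; exists (pos e); split; [apply cond_pos|]; intros z Hz; apply He, ball_Cmod, Hz.
Qed.

(** Near z = 1 this is Gauss' equation for the parameters [- nu], [nu + 1] and 1 in the variable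
    [(1 - z) / 2]. *)
Lemma P_equation_at_1 nu P : is_LegendreP nu P -> vanishes_near (Lop (nu * (nu + 1)) P) 1.
Proof.
  intros [_ HP]; destruct (locally_Cmod _ _ HP) as (r & Hr & HE).
  assert (Np : nonpole 1) by (apply Re_pos_nonpole; simpl; lra).
  set (r' := Rmin r 1); assert (Hr' : (0 < r')%R) by (apply Rmin_glb_lt; lra).
  assert (Hrr : (r' <= r /\ r' <= 1)%R) by (split; [apply Rmin_l|apply Rmin_r]).
  exists r'; split; trivial; intros z Hz.
  assert (Vz : forall w, (Cmod (w - 1) < r')%R -> (Cmod ((1 - w) / 2) < 1)%R).
  { intros w Hw; replace ((1 - w) / 2) with ((- / 2) * (w - 1)) by (unfold Cdiv; ring).
    rewrite Cmod_mult, Cmod_opp, Cmod_inv, Cmod_R, Rabs_pos_eq by (try apply two_nz; lra).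
    pose proof (Cmod_ge_0 (w - 1)); lra. }
  destruct (gauss_equation (- nu) (nu + 1) 1 ((1 - z) / 2) Np (Vz z Hz)) as (G1 & G2 & HG & GE).
  assert (In : forall w u, (Cmod (w - 1) < r')%R -> (Cmod (u - w) < r' - Cmod (w - 1))%R -> (Cmod (u - 1) < r')%R).
  { intros w u Hw Hu; replace (u - 1) with ((u - w) + (w - 1)) by ring; eapply Rle_lt_trans; [apply Cmod_triangle|lra]. }
  assert (D1 : forall w, (Cmod (w - 1) < r')%R -> Cder P w = - (G1 ((1 - w) / 2) / 2)).
  { intros w Hw; apply hol_Cder, (hol_ext_loc (fun z => hyp2F1 (- nu) (nu + 1) 1 ((1 - z) / 2)) _ w _ (r' - Cmod (w - 1))); [lra| |].
    - intros u Hu; symmetry; apply HE; specialize (In w u Hw Hu); lra.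
    - apply (hol_reflect (hyp2F1 (- nu) (nu + 1) 1)), Cdiff_hol, HG, Vz, Hw. }
  assert (D2 : Cder (Cder P) z = G2 ((1 - z) / 2) / 4).
  { apply hol_Cder, (hol_ext_loc (fun z => (- / 2) * G1 ((1 - z) / 2)) _ z _ (r' - Cmod (z - 1))); [lra| |].
    - intros u Hu; rewrite D1 by (now apply (In z u)); unfold Cdiv; ring.
    - eapply hol_eq; [apply hol_scal, (hol_reflect G1), Cdiff_hol, HG, Vz, Hz|].
      replace (RtoC 4) with (RtoC 2 * RtoC 2) by (rewrite <- RtoC_mult; f_equal; ring); field; apply two_nz. }
  unfold Lop; rewrite D2, D1, HE by (trivial; lra).
  set (v := (1 - z) / 2) in *.
  replace z with (1 - 2 * v) by (unfold v; field; apply two_nz).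
  rewrite <- GE; replace (RtoC 4) with (RtoC 2 * RtoC 2) by (rewrite <- RtoC_mult; f_equal; ring).
  field; apply two_nz.
Qed.

Lemma an_P nu P z : is_LegendreP nu P -> cut_plane (-1) z -> an P z.
Proof. intros [H _] Hz; apply analytic_at_an, H, Hz. Qed.

Lemma cut_plane_real x : (-1 < x)%R -> cut_plane (-1) (RtoC x).
Proof. intros H [_ K]; simpl in K; lra. Qed.

(** Identity theorem along the segment from 1 to x. *)
Lemma P_equation nu P x : is_LegendreP nu P -> (-1 < x <= 1)%R -> Lop (nu * (nu + 1)) P (RtoC x) = 0.
Proof.
  intros HP Hx.
  assert (G : forall s, RtoC 1 + RtoC s * - (1) = RtoC (1 - s)) by (intros; rewrite RtoC_minus; ring).
  destruct (zero_propagation (Lop (nu * (nu + 1)) P) (fun s => RtoC 1 + RtoC s * - (1)) 0 (1 - x)) with (s := (1 - x)%R) as [r [Hr Hr']].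
  - intros s Hs; split.
    + rewrite G; apply an_Lop, (an_P nu); trivial; apply cut_plane_real; lra.
    + exists (- (1)); split; [|apply cder_line].
      intros Z; apply (f_equal Re) in Z; simpl in Z; lra.
  - rewrite G, Rminus_0_r; now apply P_equation_at_1.
  - lra.
  - apply Hr'; rewrite G; replace (1 - (1 - x))%R with x by ring.
    replace (_ - _) with (RtoC 0) by ring; now rewrite Cmod_0.
Qed.

Definition lapk1 (mu : C) (a phi : R) : C :=
  mu * pw (mu - 1) (cos a, (- (sin a * cos phi))%R) * ((- sin a)%R, (- (cos a * cos phi))%R).
Definition Lap1 (mu : C) (a : R) : C := CRInt (lapk1 mu a) 0 PI.

Lemma ccont2_lap a phi : ccont2 (fun a phi => (cos a, (- (sin a * cos phi))%R)) a phi.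
Proof.
  split; simpl.
  - apply (continuity_2d_of_1 cos), continuity_cos.
  - apply continuity_2d_pt_opp, continuity_2d_pt_mult.
    + apply (continuity_2d_of_1 sin), continuity_sin.
    + apply (continuity_2d_of_2 cos), continuity_cos.
Qed.

Lemma ccont2_lap1 a phi : ccont2 (fun a phi => ((- sin a)%R, (- (cos a * cos phi))%R)) a phi.
Proof.
  split; simpl.
  - apply continuity_2d_pt_opp, (continuity_2d_of_1 sin), continuity_sin.
  - apply continuity_2d_pt_opp, continuity_2d_pt_mult.
    + apply (continuity_2d_of_1 cos), continuity_cos.
    + apply (continuity_2d_of_2 cos), continuity_cos.
Qed.

Lemma ccont2_lapk1 mu a phi : (0 < cos a)%R -> ccont2 (lapk1 mu) a phi.
Proof.
  intros H; apply ccont2_mult; [|apply ccont2_lap1]; apply ccont2_mult; [apply ccont2_const|].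
  apply ccont2_pw; [apply ccont2_lap|exact H].
Qed.

Lemma Lap_derive mu a : (0 < cos a)%R -> cder (Lap mu) a (Lap1 mu a).
Proof.
  intros H; apply (CRInt_param_derive (fun a _ => cos a) (lapk mu) (lapk1 mu)); trivial.
  - pose proof PI_RGT_0; lra.
  - intros; apply (continuity_2d_of_1 cos), continuity_cos.
  - intros x t Hx; eapply cder_eq.
    + apply (hol_pw mu (cos x, (- (sin x * cos t))%R) Hx (fun x => (cos x, (- (sin x * cos t))%R)) x ((- sin x)%R, (- (cos x * cos t))%R)); trivial.
      split; simpl; auto_derive; trivial; ring.
    + unfold lapk1; ring.
  - intros; now apply ccont2_lapk1.
  - intros x t Hx; apply (ccont2_slice (lapk mu)), ccont2_pw; [apply ccont2_lap|exact Hx].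
Qed.

Lemma Lap1_cont mu : ccont (Lap1 mu) 0.
Proof.
  pose proof PI_RGT_0 as PP.
  assert (H0 : (0 < cos 0)%R) by (rewrite cos_0; lra).
  assert (Lc : locally 0%R (fun x => 0 < cos x)%R).
  { pose proof (continuity_cos 0) as K; apply continuity_pt_filterlim in K.
    apply (K (fun y => 0 < y)%R); now apply (open_gt 0). }
  split.
  - change (continuity_pt (fun a => RInt (fun t => Re (lapk1 mu a t)) 0 PI) 0).
    apply (RInt_param_cont (fun a t => Re (lapk1 mu a t))); [lra|intros t; exact (proj1 (ccont2_lapk1 mu 0 t H0))|].
    revert Lc; apply filter_imp; intros x Hx; apply ex_RInt_cont; intros t.
    exact (proj1 (ccont2_slice (lapk1 mu) x t (ccont2_lapk1 mu x t Hx))).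
  - change (continuity_pt (fun a => RInt (fun t => Im (lapk1 mu a t)) 0 PI) 0).
    apply (RInt_param_cont (fun a t => Im (lapk1 mu a t))); [lra|intros t; exact (proj2 (ccont2_lapk1 mu 0 t H0))|].
    revert Lc; apply filter_imp; intros x Hx; apply ex_RInt_cont; intros t.
    exact (proj2 (ccont2_slice (lapk1 mu) x t (ccont2_lapk1 mu x t Hx))).
Qed.

Lemma Lap_0 mu : Lap mu 0 = RtoC PI.
Proof.
  assert (E : lapk mu 0 = fun _ => RtoC 1).
  { apply functional_extensionality; intros t; unfold lapk; rewrite cos_0, sin_0.
    replace (1%R, (- (0 * cos t))%R) with (RtoC 1) by (apply C_ext; simpl; ring).
    unfold pw; rewrite Clr_RtoC, ln_1, Cmult_0_r by lra; apply Cexp_0. }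
  unfold Lap; rewrite E; apply C_ext; simpl; rewrite RInt_const; unfold scal; simpl; unfold mult; simpl; ring.
Qed.

Lemma Ci_nz : Ci <> 0.
Proof. intros Z; apply (f_equal Im) in Z; simpl in Z; lra. Qed.

Lemma PI_nz : RtoC PI <> 0.
Proof. apply RtoC_nz, PI_neq0. Qed.

Lemma imaginary_axis s : 0 + RtoC s * Ci = (0, s).
Proof. apply C_ext; simpl; ring. Qed.

Lemma Ccosh_i s : Ccosh (0, s) = RtoC (cos s).
Proof.
  rewrite Ccosh_eq; simpl; rewrite cosh_0; unfold sinh; rewrite Ropp_0, Rminus_eq_0; apply C_ext; simpl; field.
Qed.

Lemma Csinh_i s : Csinh (0, s) = Ci * RtoC (sin s).
Proof.
  rewrite Csinh_eq; simpl; rewrite cosh_0; unfold sinh; rewrite Ropp_0, Rminus_eq_0; apply C_ext; simpl; field.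
Qed.

Lemma Reg_i s : (0 < Rabs s < PI / 2)%R -> Reg (0, s).
Proof.
  intros H; split; [split; simpl; lra|]; intros Z; apply (f_equal Im) in Z; simpl in Z; rewrite Z, Rabs_R0 in H; lra.
Qed.

(** Laplace's integral for the function of the first kind, as a difference of boundary values; in
    this form it inherits Legendre's equation from the kernel of the second kind. *)
Definition LQ (mu w : C) : C := (Qc mu (- w) - Qc mu w) / (Ci * RtoC PI).
Definition LQ1 (mu w : C) : C := - (Qc1 mu (- w) + Qc1 mu w) / (Ci * RtoC PI).

Lemma LQ_Lap mu a : (Re mu < 0)%R -> (0 < a < PI / 2)%R -> LQ mu (0, a) = Lap mu a / RtoC PI.
Proof.
  intros Hmu Ha; unfold LQ.
  replace (- (0, a)%R : C) with ((0, - a)%R : C) by (apply C_ext; simpl; ring).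
  rewrite connection by trivial; field; split; [apply PI_nz|apply Ci_nz].
Qed.

Lemma LQ_solution mu s : (Re mu < 0)%R -> (0 < s < PI / 2)%R ->
  cder (fun x => LQ mu (0 + RtoC x * Ci)) s (Ci * LQ1 mu (0 + RtoC s * Ci)) /\
  exists y2, cder (fun x => LQ1 mu (0 + RtoC x * Ci)) s (Ci * y2) /\
    Csinh (0 + RtoC s * Ci) * y2 + Ccosh (0 + RtoC s * Ci) * LQ1 mu (0 + RtoC s * Ci)
      - mu * (mu + 1) * Csinh (0 + RtoC s * Ci) * LQ mu (0 + RtoC s * Ci) = 0.
Proof.
  intros Hmu Hs.
  set (r := Rmin s (PI / 2 - s)); assert (Hr : (0 < r)%R) by (apply Rmin_glb_lt; lra).
  assert (Hrr : (r <= s /\ r <= PI / 2 - s)%R) by (split; [apply Rmin_l|apply Rmin_r]).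
  assert (K : forall x, (Rabs (x - s) < r)%R -> (0 < x < PI / 2)%R) by (intros x Hx; apply Rabs_def2 in Hx; lra).
  destruct (Qc_solution mu 0 Ci s r Hmu Hr) as [D [y2 [D2 E]]].
  { intros x Hx; rewrite imaginary_axis; apply Reg_i; specialize (K x Hx); rewrite Rabs_pos_eq; lra. }
  assert (Ng : forall x, 0 + RtoC x * - Ci = - (0 + RtoC x * Ci)) by (intros; ring).
  destruct (Qc_solution mu 0 (- Ci) s r Hmu Hr) as [D' [y2' [D2' E']]].
  { intros x Hx; replace (0 + RtoC x * - Ci) with ((0, - x)%R : C) by (apply C_ext; simpl; ring).
    apply Reg_i; specialize (K x Hx); rewrite Rabs_Ropp, Rabs_pos_eq; lra. }
  rewrite Ng in D', E'.
  apply (cder_ext _ (fun x => Qc mu (- (0 + RtoC x * Ci)))) in D'; [|intros; now rewrite Ng].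
  apply (cder_ext _ (fun x => Qc1 mu (- (0 + RtoC x * Ci)))) in D2'; [|intros; now rewrite Ng].
  set (w := 0 + RtoC s * Ci) in *.
  assert (Sn : Csinh (- w) = - Csinh w).
  { unfold Csinh; replace (- - w) with w by ring; unfold Cdiv; ring. }
  assert (Cn : Ccosh (- w) = Ccosh w).
  { unfold Ccosh; replace (- - w) with w by ring; unfold Cdiv; ring. }
  rewrite Sn, Cn in E'.
  split.
  - unfold LQ; apply (cder_ext (fun x => / (Ci * RtoC PI) * (Qc mu (- (0 + RtoC x * Ci)) - Qc mu (0 + RtoC x * Ci)))).
    + intros; unfold Cdiv; ring.
    + eapply cder_eq; [apply cder_scal, cder_minus; [exact D'|exact D]|unfold LQ1; fold w; unfold Cdiv; ring].
  - exists ((y2' - y2) / (Ci * RtoC PI)); split.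
    + unfold LQ1; apply (cder_ext (fun x => - / (Ci * RtoC PI) * (Qc1 mu (- (0 + RtoC x * Ci)) + Qc1 mu (0 + RtoC x * Ci)))).
      * intros; unfold Cdiv; ring.
      * eapply cder_eq; [apply cder_scal, cder_plus; [exact D2'|exact D2]|unfold Cdiv; ring].
    + unfold LQ1, LQ.
      transitivity (- / (Ci * RtoC PI) * (- Csinh w * y2' + Ccosh w * Qc1 mu (- w) - mu * (mu + 1) * - Csinh w * Qc mu (- w))
        - / (Ci * RtoC PI) * (Csinh w * y2 + Ccosh w * Qc1 mu w - mu * (mu + 1) * Csinh w * Qc mu w)).
      * unfold Cdiv; ring.
      * rewrite E, E'; ring.
Qed.

(** Near [theta = 0] both functions are regular while the second solution of the equation is not, so their
    Wronskian vanishes and they are proportional, with factor 1 by their values at 0. The equality is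
    continued to the given angle by uniqueness for the differential equation, whose coefficients are regular
    away from 0. *)
Lemma P_Laplace nu P theta : (-1 < Re nu)%R -> is_LegendreP nu P -> (0 < theta < PI / 2)%R ->
  P (RtoC (cos theta)) = Lap (- nu - 1) theta / RtoC PI.
Proof.
  intros Hnu HP Ht; pose proof PI_RGT_0 as PP.
  set (mu := - nu - 1).
  assert (Hmu : (Re mu < 0)%R) by (unfold mu; simpl; unfold Re in *; lra).
  assert (El : nu * (nu + 1) = mu * (mu + 1)) by (unfold mu; ring).
  set (u := fun w => P (Ccosh w)).
  set (u1 := fun w => Csinh w * Cder P (Ccosh w)).
  assert (Pa : forall a, (0 <= a < PI / 2)%R -> an P (Ccosh (0, a))).
  { intros a Ha; rewrite Ccosh_i; apply (an_P nu); trivial; apply cut_plane_real.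
    assert (0 < cos a)%R by (apply cos_gt_0; lra); lra. }
  assert (Su : forall s, (0 <= s < PI / 2)%R ->
    cder (fun x => u (0 + RtoC x * Ci)) s (Ci * u1 (0 + RtoC s * Ci)) /\
    exists y2, cder (fun x => u1 (0 + RtoC x * Ci)) s (Ci * y2) /\
    Csinh (0 + RtoC s * Ci) * y2 + Ccosh (0 + RtoC s * Ci) * u1 (0 + RtoC s * Ci)
      - mu * (mu + 1) * Csinh (0 + RtoC s * Ci) * u (0 + RtoC s * Ci) = 0).
  { intros s Hs; destruct (Legendre_along_line (mu * (mu + 1)) P 0 Ci s) as [D [y2 [D2 E]]].
    - rewrite imaginary_axis; now apply Pa.
    - split; [exact D|exists y2; split; [exact D2|]]; unfold u, u1; rewrite E.
      rewrite imaginary_axis, Ccosh_i, <- El, (P_equation nu P); trivial; [ring|].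
      assert (0 < cos s)%R by (apply cos_gt_0; lra); pose proof (COS_bound s); lra. }
  (* the Wronskian times sinh w, written so as to be continuous at the end a = 0 of the interval *)
  pose (N := fun a => Csinh (0 + RtoC a * Ci) * (u (0 + RtoC a * Ci) * (- Ci * (Lap1 mu a / RtoC PI))
     - u1 (0 + RtoC a * Ci) * (Lap mu a / RtoC PI))).
  assert (LL : forall a, (0 < a < PI / 2)%R -> - Ci * (Lap1 mu a / RtoC PI) = LQ1 mu (0 + RtoC a * Ci)).
  { intros a Ha.
    destruct (LQ_solution mu a Hmu Ha) as [D _].
    assert (D' : cder (fun x => LQ mu (0 + RtoC x * Ci)) a (/ RtoC PI * Lap1 mu a)).
    { apply (cder_ext_loc (fun x => / RtoC PI * Lap mu x)).
      - set (r := Rmin a (PI / 2 - a)); assert (Hr : (0 < r)%R) by (apply Rmin_glb_lt; lra).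
        exists (mkposreal _ Hr); intros x Hx; assert (Hx' : (Rabs (x - a) < r)%R) by exact Hx.
        assert (Hrr : (r <= a /\ r <= PI / 2 - a)%R) by (split; [apply Rmin_l|apply Rmin_r]).
        apply Rabs_def2 in Hx'; rewrite imaginary_axis, LQ_Lap by (trivial; lra); unfold Cdiv; ring.
      - apply cder_scal, Lap_derive, cos_gt_0; lra. }
    pose proof (cder_unique _ _ _ _ D D') as E.
    transitivity (- Ci * (Ci * LQ1 mu (0 + RtoC a * Ci))); [rewrite E; unfold Cdiv; ring|].
    assert (I2 : Ci * Ci = - (1)) by (apply C_ext; simpl; ring).
    transitivity (- (Ci * Ci) * LQ1 mu (0 + RtoC a * Ci)); [ring|rewrite I2; ring]. }
  assert (DN : forall a, (0 < a < PI / 2)%R -> cder N a 0).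
  { intros a Ha.
    apply (cder_ext_loc (fun a => Csinh (0 + RtoC a * Ci) * (u (0 + RtoC a * Ci) * LQ1 mu (0 + RtoC a * Ci)
      - u1 (0 + RtoC a * Ci) * LQ mu (0 + RtoC a * Ci)))).
    - set (r := Rmin a (PI / 2 - a)); assert (Hr : (0 < r)%R) by (apply Rmin_glb_lt; lra).
      exists (mkposreal _ Hr); intros x Hx; assert (Hx' : (Rabs (x - a) < r)%R) by exact Hx.
      assert (Hrr : (r <= a /\ r <= PI / 2 - a)%R) by (split; [apply Rmin_l|apply Rmin_r]).
      apply Rabs_def2 in Hx'; unfold N; rewrite LL by lra.
      do 2 f_equal; f_equal; rewrite imaginary_axis, LQ_Lap by (trivial; lra); reflexivity.
    - destruct (Su a ltac:(lra)) as [D [y2 [D2 E]]], (LQ_solution mu a Hmu Ha) as [V [v2 [V2 F]]].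
      eapply cder_eq.
      + apply cder_mult; [apply hol_Csinh_line|]; apply cder_minus; apply cder_mult; eassumption.
      + cbv beta; set (w := 0 + RtoC a * Ci) in *.
        transitivity (Ci * (u w * (Csinh w * v2 + Ccosh w * LQ1 mu w - mu * (mu + 1) * Csinh w * LQ mu w)
          - LQ mu w * (Csinh w * y2 + Ccosh w * u1 w - mu * (mu + 1) * Csinh w * u w))); [ring|rewrite E, F; ring]. }
  assert (cos00 : (0 < cos 0)%R) by (rewrite cos_0; lra).
  assert (CN : ccont N 0).
  { destruct (Su 0%R ltac:(lra)) as [D [y2 [D2 _]]].
    apply ccont_mult; [eapply cder_ccont, hol_Csinh_line|].
    apply ccont_plus.
    - apply ccont_mult; [eapply cder_ccont, D|]; apply ccont_mult; [apply ccont_const|].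
      apply ccont_mult; [apply Lap1_cont|apply ccont_const].
    - assert (X : ccont (fun a => (- (1)) * (u1 (0 + RtoC a * Ci) * (Lap mu a * / RtoC PI))) 0).
      { apply ccont_mult; [apply ccont_const|]; apply ccont_mult; [eapply cder_ccont, D2|].
        apply ccont_mult; [eapply cder_ccont, Lap_derive, cos00|apply ccont_const]. }
      replace (fun x => - (u1 (0 + RtoC x * Ci) * (Lap mu x / RtoC PI))) with
        (fun a => (- (1)) * (u1 (0 + RtoC a * Ci) * (Lap mu a * / RtoC PI))); trivial.
      apply functional_extensionality; intros; unfold Cdiv; ring. }
  assert (N0 : N 0%R = 0).
  { unfold N; rewrite imaginary_axis, Csinh_i, sin_0; ring. }
  assert (NZ : forall a, (0 < a < PI / 2)%R -> N a = 0).
  { intros a Ha.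
    destruct (Ceq_dec (N a) 0) as [Na|Hne]; [exact Na|exfalso]; apply Cmod_gt_0 in Hne.
    destruct (ccont_eps N 0 _ CN Hne) as [d [Pd Qd]].
    set (h := Rmin (d / 2) a); assert (Hh : (0 < h)%R) by (apply Rmin_glb_lt; lra).
    assert (Hhh : (h <= d / 2 /\ h <= a)%R) by (split; [apply Rmin_l|apply Rmin_r]).
    assert (E : N h = N a) by (apply cder_zero_const; [lra|]; intros; apply DN; lra).
    specialize (Qd h ltac:(rewrite Rabs_pos_eq; lra)); rewrite Rplus_0_l, E, N0 in Qd.
    replace (N a - 0) with (N a) in Qd by ring; lra. }
  assert (u0 : P (RtoC (cos 0)) = 1).
  { rewrite cos_0; destruct HP as [_ HP]; apply locally_singleton in HP; rewrite HP.
    replace ((1 - 1) / 2) with (RtoC 0) by (unfold Cdiv; ring); apply hyp2F1_0, Re_pos_nonpole; simpl; lra. }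
  pose (L := fun a => / RtoC PI * Lap mu a).
  assert (DL : forall a, (0 <= a < PI / 2)%R -> cder L a (/ RtoC PI * Lap1 mu a)).
  { intros a Ha; apply cder_scal, Lap_derive, cos_gt_0; lra. }
  assert (L0 : L 0%R = 1) by (unfold L; rewrite Lap_0; field; apply PI_nz).
  assert (CL : ccont L 0) by (eapply cder_ccont, DL; lra).
  destruct (ccont_eps L 0 (1 / 2) CL ltac:(lra)) as [d [Pd Qd]].
  set (h := Rmin (d / 2) theta); assert (Hh : (0 < h)%R) by (apply Rmin_glb_lt; lra).
  assert (Hhh : (h <= d / 2 /\ h <= theta)%R) by (split; [apply Rmin_l|apply Rmin_r]).
  assert (PL : forall a, (0 <= a <= h)%R -> (0 < Re (L a))%R).
  { intros a Ha; specialize (Qd a ltac:(rewrite Rabs_pos_eq; lra)); rewrite Rplus_0_l, L0 in Qd.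
    pose proof (re_le_Cmod (L a - 1)) as K; apply Rabs_le_between in K.
    replace (Re (L a - 1)) with (Re (L a) - 1)%R in K by (unfold Re; simpl; ring); lra. }
  (* the quotient of the two functions, for angles at which L has positive real part *)
  pose (Rq := fun a => u (0 + RtoC a * Ci) * pw (- (1)) (L a)).
  assert (DR : forall a, (0 <= a <= h)%R -> cder Rq a 0).
  { intros a Ha; destruct (Su a ltac:(lra)) as [D _].
    eapply cder_eq.
    - apply cder_mult; [exact D|].
      apply (hol_pw (- (1)) (L a) (PL a Ha) L a _ eq_refl (DL a ltac:(lra))).
    - cbv beta; rewrite <- (pw_pred (- (1)) (L a)) by now apply PL.
      destruct (Req_dec a 0) as [->|Ha0].
      + assert (E : Lap1 mu 0 = 0).
        { unfold Lap1; replace (lapk1 mu 0) with (fun phi : R => mu * Ci * RtoC (- cos phi)).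
          - rewrite (CRInt_derive (fun phi => mu * Ci * RtoC (- sin phi))).
            + rewrite sin_PI, sin_0; ring.
            + intros t _; split.
              * apply cder_scal, cder_RtoC; auto_derive; trivial; ring.
              * apply ccont_mult; [apply ccont_const|apply ccont_RtoC]; apply ex_derive_cont; auto_derive; trivial.
          - apply functional_extensionality; intros phi; unfold lapk1; rewrite cos_0, sin_0.
            replace (1%R, (- (0 * cos phi))%R) with (RtoC 1) by (apply C_ext; simpl; ring).
            unfold pw; rewrite Clr_RtoC, ln_1, Cmult_0_r, Cexp_0 by lra; apply C_ext; simpl; ring. }
        rewrite E, imaginary_axis; unfold u1; rewrite Csinh_i, sin_0; ring.
      + assert (Z : N a = 0) by (apply NZ; lra); unfold N in Z; apply Cmult_zero in Z; destruct Z as [Z|Z].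
        * exfalso; revert Z; rewrite imaginary_axis; apply Reg_Csinh_nz, Reg_i; rewrite Rabs_pos_eq; lra.
        * fold (L a); assert (I2 : Ci * Ci = - (1)) by (apply C_ext; simpl; ring).
          transitivity (- Ci * pw (- (1) - 1) (L a) * (u (0 + RtoC a * Ci) * (- Ci * (Lap1 mu a / RtoC PI)) - u1 (0 + RtoC a * Ci) * (Lap mu a / RtoC PI))
            + (- (1) - Ci * Ci) * pw (- (1) - 1) (L a) * u (0 + RtoC a * Ci) * (Lap1 mu a / RtoC PI)).
          -- unfold L at 2; unfold Cdiv; ring.
          -- rewrite Z, I2; ring. }
  assert (Eq : forall a, (0 <= a <= h)%R -> u (0, a) = L a).
  { intros a Ha; assert (ER : Rq 0%R = Rq a) by (apply cder_zero_const; [lra|]; intros; apply DR; lra).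
    assert (Inv : forall s, (0 <= s <= h)%R -> pw (- (1)) (L s) * L s = 1).
    { intros s Hs; rewrite <- (pw_1 (L s)) at 2 by now apply PL.
      rewrite <- pw_add; unfold pw; replace ((- (1) + 1) * Clr (L s)) with (RtoC 0) by ring; apply Cexp_0. }
    assert (R1 : Rq 0%R = 1).
    { unfold Rq; rewrite imaginary_axis; unfold u; rewrite Ccosh_i, u0, Cmult_1_l.
      pose proof (Inv 0%R ltac:(lra)) as I; rewrite L0, Cmult_1_r in I; rewrite L0; exact I. }
    rewrite R1 in ER; unfold Rq in ER; rewrite imaginary_axis in ER.
    transitivity (u (0, a) * (pw (- (1)) (L a) * L a)); [rewrite Inv by trivial; ring|].
    transitivity ((u (0, a) * pw (- (1)) (L a)) * L a); [ring|rewrite <- ER; ring]. }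
  assert (Fin : u (0 + RtoC theta * Ci) = LQ mu (0 + RtoC theta * Ci)).
  { apply (Legendre_unique_on_segment (mu * (mu + 1)) 0 Ci u u1 (LQ mu) (LQ1 mu) (h / 2) theta); [lra| | | | |].
    - intros s Hs; rewrite imaginary_axis; apply Reg_Csinh_nz, Reg_i; rewrite Rabs_pos_eq; lra.
    - intros s Hs; apply Su; lra.
    - intros s Hs; apply LQ_solution; trivial; lra.
    - rewrite imaginary_axis, LQ_Lap, Eq by (trivial; lra); unfold L, Cdiv; ring.
    - destruct (Su (h / 2)%R ltac:(lra)) as [D _].
      assert (D' : cder (fun x => u (0 + RtoC x * Ci)) (h / 2) (/ RtoC PI * Lap1 mu (h / 2))).
      { apply (cder_ext_loc L); [|apply DL; lra].
        assert (Hh2 : (0 < h / 2)%R) by lra.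
        exists (mkposreal _ Hh2); intros x Hx; assert (Hx' : (Rabs (x - h / 2) < h / 2)%R) by exact Hx.
        apply Rabs_def2 in Hx'; rewrite imaginary_axis; symmetry; apply Eq; lra. }
      rewrite <- LL by lra.
      pose proof (cder_unique _ _ _ _ D D') as E.
      assert (I2 : Ci * Ci = - (1)) by (apply C_ext; simpl; ring).
      transitivity (- (Ci * Ci) * u1 (0 + RtoC (h / 2) * Ci)); [rewrite I2; ring|].
      transitivity (- Ci * (Ci * u1 (0 + RtoC (h / 2) * Ci))); [ring|rewrite E; unfold Cdiv; ring]. }
  rewrite imaginary_axis, LQ_Lap in Fin by trivial; unfold u in Fin; rewrite Ccosh_i in Fin; exact Fin.
Qed.

(** * Rotation of the path of integration *)

(** In the variable [w], with [u = exp w] and [cosh t = 1 + u], the measure [dt = du / sqrt (u * (u + 2))] becomes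
    [exp (w / 2) * (2 + u) ^ (- 1 / 2) dw], and [rB] is the base of the kernel of [Qc] at - i theta. Rotating
    [u] by a right angle is the shift of [w] by i pi/2. *)
Definition rA (w : C) : C := 2 + Cexp w.
Definition rB (theta : R) (w : C) : C := Cexp (- (Ci * RtoC theta)) + (- (Ci * RtoC (sin theta))) * Cexp w.
Definition rF (mu : C) (theta : R) (w : C) : C := Cexp (/ 2 * w) * (pw (- / 2) (rA w) * pw mu (rB theta w)).

Lemma sin_theta_pos theta : (0 < theta < PI / 2)%R -> (0 < sin theta)%R.
Proof. intros; apply sin_gt_0; lra. Qed.

Lemma cos_theta_pos theta : (0 < theta < PI / 2)%R -> (0 < cos theta)%R.
Proof. intros; apply cos_gt_0; lra. Qed.

Lemma rA_eq v y : rA (v, y) = ((2 + exp v * cos y)%R, (exp v * sin y)%R).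
Proof. unfold rA, Cexp; apply C_ext; simpl; ring. Qed.

Lemma Cexp_mi x : Cexp (- (Ci * RtoC x)) = (cos x, (- sin x)%R).
Proof.
  replace (- (Ci * RtoC x)) with (Ci * RtoC (- x)) by (rewrite RtoC_opp; ring).
  rewrite Cexp_i, cos_neg, sin_neg; reflexivity.
Qed.

Lemma rB_eq theta v y : rB theta (v, y) = ((cos theta + sin theta * (exp v * sin y))%R, (- sin theta - sin theta * (exp v * cos y))%R).
Proof. unfold rB; rewrite Cexp_mi; unfold Cexp; apply C_ext; simpl; ring. Qed.

Lemma rA_pos v y : (0 <= y <= PI / 2)%R -> (0 < Re (rA (v, y)))%R.
Proof.
  intros Hy; rewrite rA_eq; simpl; pose proof (exp_pos v); pose proof (cos_ge_0 y ltac:(lra) ltac:(lra)).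
  assert (0 <= exp v * cos y)%R by (apply Rmult_le_pos; lra); lra.
Qed.

Lemma rB_pos theta v y : (0 < theta < PI / 2)%R -> (0 <= y <= PI / 2)%R -> (0 < Re (rB theta (v, y)))%R.
Proof.
  intros Ht Hy; rewrite rB_eq; simpl; pose proof (exp_pos v); pose proof (sin_ge_0 y ltac:(lra) ltac:(lra)).
  pose proof (sin_theta_pos theta Ht); pose proof (cos_theta_pos theta Ht).
  assert (0 <= sin theta * (exp v * sin y))%R by (apply Rmult_le_pos; [lra|apply Rmult_le_pos; lra]); lra.
Qed.

Lemma rA_lower v y : (0 <= y <= PI / 2)%R -> (1 <= Cmod (rA (v, y)) /\ exp v <= Cmod (rA (v, y)))%R.
Proof.
  intros Hy; pose proof (exp_pos v); pose proof (cos_ge_0 y ltac:(lra) ltac:(lra)) as C0.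
  pose proof (sin2_cos2 y) as S; unfold Rsqr in S.
  assert (E : (Cmod (rA (v, y)) * Cmod (rA (v, y)) = 4 + 4 * (exp v * cos y) + exp v * exp v)%R).
  { rewrite Cmod_sqr, rA_eq; simpl.
    transitivity (4 + 4 * (exp v * cos y) + exp v * exp v * (sin y * sin y + cos y * cos y))%R; [ring|rewrite S; ring]. }
  assert (0 <= exp v * cos y)%R by (apply Rmult_le_pos; lra).
  split; (apply Rsqr_incr_0_var; [|apply Cmod_ge_0]); unfold Rsqr; rewrite E; nra.
Qed.

Lemma rB_lower theta v y : (0 < theta < PI / 2)%R -> (0 <= y <= PI / 2)%R -> (1 <= Cmod (rB theta (v, y)) /\ sin theta * exp v <= Cmod (rB theta (v, y)))%R.
Proof.
  intros Ht Hy; pose proof (exp_pos v); pose proof (cos_ge_0 y ltac:(lra) ltac:(lra)) as C0.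
  pose proof (sin_ge_0 y ltac:(lra) ltac:(lra)) as S0; pose proof (sin_theta_pos theta Ht) as St; pose proof (cos_theta_pos theta Ht) as Ct.
  pose proof (sin2_cos2 y) as S; unfold Rsqr in S; pose proof (sin2_cos2 theta) as S'; unfold Rsqr in S'.
  assert (E : (Cmod (rB theta (v, y)) * Cmod (rB theta (v, y)) = 1 + 2 * (exp v * (sin theta * (cos theta * sin y + sin theta * cos y))) + (sin theta * exp v) * (sin theta * exp v))%R).
  { rewrite Cmod_sqr, rB_eq; simpl.
    transitivity ((sin theta * sin theta + cos theta * cos theta) + 2 * (exp v * (sin theta * (cos theta * sin y + sin theta * cos y)))
      + (sin theta * exp v) * (sin theta * exp v) * (sin y * sin y + cos y * cos y))%R; [ring|rewrite S, S'; ring]. }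
  assert (0 <= exp v * (sin theta * (cos theta * sin y + sin theta * cos y)))%R.
  { apply Rmult_le_pos; [lra|]; apply Rmult_le_pos; [lra|]; apply Rplus_le_le_0_compat; apply Rmult_le_pos; lra. }
  assert (0 <= (sin theta * exp v) * (sin theta * exp v))%R by apply Rle_0_sqr.
  split; (apply Rsqr_incr_0_var; [|apply Cmod_ge_0]); unfold Rsqr; rewrite E; lra.
Qed.

(** At the left end the factor [exp (w / 2)] decays; at the right end it is cancelled by the power of [rA],
    and the power of [rB] decays. Both bounds are uniform on the strip. *)
Lemma rF_bound mu theta : (Re mu < 0)%R -> (0 < theta < PI / 2)%R ->
  exists K d, (0 < d)%R /\ forall v y, (0 <= y <= PI / 2)%R -> (Cmod (rF mu theta (v, y)) <= K * exp (- d * Rabs v))%R.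
Proof.
  intros Hmu Ht; pose proof (sin_theta_pos theta Ht) as St.
  set (a := - / 2 : C).
  assert (Ra : Re a = (- / 2)%R) by (unfold a; simpl; field).
  set (KA := (exp (Rabs (Im a) * PI) * exp (Re a * ln 1))%R).
  set (K1 := (exp (Rabs (Im mu) * PI) * exp (Re mu * ln 1))%R).
  set (K2 := (exp (Rabs (Im mu) * PI) * exp (Re mu * ln (sin theta)))%R).
  assert (PA : (0 < KA)%R) by (apply Rmult_lt_0_compat; apply exp_pos).
  assert (P1 : (0 < K1)%R) by (apply Rmult_lt_0_compat; apply exp_pos).
  assert (P2 : (0 < K2)%R) by (apply Rmult_lt_0_compat; apply exp_pos).
  set (d := Rmin (/ 2) (- Re mu)).
  assert (Hd : (0 < d)%R) by (apply Rmin_glb_lt; lra).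
  assert (Hd' : (d <= / 2 /\ d <= - Re mu)%R) by (split; [apply Rmin_l|apply Rmin_r]).
  exists (KA * (K1 + K2))%R, d; split; trivial; intros v y Hy.
  destruct (rA_lower v y Hy) as [A1 A2], (rB_lower theta v y Ht Hy) as [B1 B2].
  unfold rF; rewrite (Cmod_mult (Cexp _)), (Cmod_mult (pw _ _)), Cmod_Cexp.
  replace (Re (/ 2 * (v, y))) with (/ 2 * v)%R by (simpl; field).
  fold a; pose proof (rA_pos v y Hy) as PA'; pose proof (rB_pos theta v y Ht Hy) as PB'.
  pose proof (exp_pos (/ 2 * v)) as Ev.
  destruct (Rle_or_lt 0 v) as [Hv|Hv].
  - rewrite Rabs_pos_eq by trivial.
    pose proof (pw_decay a (rA (v, y)) 1 v PA' Rlt_0_1 ltac:(lra) ltac:(lra)) as DA; fold KA in DA.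
    pose proof (pw_decay mu (rB theta (v, y)) (sin theta) v PB' St B2 ltac:(lra)) as DB; fold K2 in DB.
    rewrite Ra in DA.
    apply Rle_trans with (exp (/ 2 * v) * ((KA * exp (- / 2 * v)) * (K2 * exp (Re mu * v))))%R.
    + apply Rmult_le_compat_l; [lra|]; apply Rmult_le_compat; trivial; apply Cmod_ge_0.
    + replace (exp (/ 2 * v) * ((KA * exp (- / 2 * v)) * (K2 * exp (Re mu * v))))%R with
        (KA * (K2 * ((exp (/ 2 * v) * exp (- / 2 * v)) * exp (Re mu * v))))%R by ring.
      rewrite <- (exp_plus (/ 2 * v)); replace (/ 2 * v + - / 2 * v)%R with 0%R by ring; rewrite exp_0, Rmult_1_l.
      rewrite Rmult_assoc; apply Rmult_le_compat_l; [lra|].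
      assert (exp (Re mu * v) <= exp (- d * v))%R by (apply exp_mono; nra).
      pose proof (exp_pos (Re mu * v)); nra.
  - rewrite Rabs_left by trivial.
    pose proof (pw_decay a (rA (v, y)) 1 0 PA' Rlt_0_1 ltac:(rewrite exp_0; lra) ltac:(lra)) as DA; fold KA in DA.
    pose proof (pw_decay mu (rB theta (v, y)) 1 0 PB' Rlt_0_1 ltac:(rewrite exp_0; lra) ltac:(lra)) as DB; fold K1 in DB.
    rewrite Rmult_0_r, exp_0, Rmult_1_r in DA, DB.
    apply Rle_trans with (exp (/ 2 * v) * (KA * K1))%R.
    + apply Rmult_le_compat_l; [lra|]; apply Rmult_le_compat; trivial; apply Cmod_ge_0.
    + assert (exp (/ 2 * v) <= exp (- d * - v))%R by (apply exp_mono; nra).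
      rewrite Rmult_comm; apply Rmult_le_compat; try lra; [apply Rmult_le_pos; lra|].
      apply Rmult_le_compat_l; lra.
Qed.

(** The minimum of the real parts of the two bases, written as a continuous expression. *)
Definition rg (theta y v : R) : R :=
  let a := (2 + exp v * cos y)%R in let b := (cos theta + sin theta * (exp v * sin y))%R in
  ((a + b - Rabs (a - b)) / 2)%R.

Lemma rg_min theta y v : (0 < rg theta y v)%R <-> (0 < Re (rA (v, y)) /\ 0 < Re (rB theta (v, y)))%R.
Proof.
  rewrite rA_eq, rB_eq; unfold rg; simpl.
  set (a := (2 + exp v * cos y)%R); set (b := (cos theta + sin theta * (exp v * sin y))%R).
  split.
  - intros H; pose proof (Rle_abs (a - b)); pose proof (Rle_abs (b - a)) as H1; rewrite Rabs_minus_sym in H1; lra.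
  - intros [Ha Hb]; assert (Rabs (a - b) < a + b)%R by (apply Rabs_def1; lra); lra.
Qed.

Lemma rg_cont theta y v : continuity_2d_pt (rg theta) y v.
Proof.
  assert (C1 : forall f, continuity f -> continuity_2d_pt (fun y v => (exp v * f y)%R) y v).
  { intros f Hf; apply continuity_2d_pt_mult.
    - apply (continuity_2d_of_2 exp), derivable_continuous, derivable_exp.
    - apply (continuity_2d_of_1 f), Hf. }
  assert (Ca : continuity_2d_pt (fun y v => (2 + exp v * cos y)%R) y v).
  { apply continuity_2d_pt_plus; [apply continuity_2d_pt_const|apply C1, continuity_cos]. }
  assert (Cb : continuity_2d_pt (fun y v => (cos theta + sin theta * (exp v * sin y))%R) y v).
  { apply continuity_2d_pt_plus; [apply continuity_2d_pt_const|].
    apply continuity_2d_pt_mult; [apply continuity_2d_pt_const|apply C1, continuity_sin]. }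
  apply (continuity_2d_pt_mult (fun y v => (2 + exp v * cos y + (cos theta + sin theta * (exp v * sin y)) -
    Rabs (2 + exp v * cos y - (cos theta + sin theta * (exp v * sin y))))%R) (fun _ _ => / 2)%R); [|apply continuity_2d_pt_const].
  apply continuity_2d_pt_minus; [now apply continuity_2d_pt_plus|].
  apply (continuity_1d_2d_pt_comp Rabs); [apply Rcontinuity_abs|now apply continuity_2d_pt_minus].
Qed.

Lemma ccont2_rA y v : ccont2 (fun y v => rA (v, y)) y v.
Proof. apply ccont2_plus; [apply ccont2_const|apply (ccont2_Cexp (fun y v => (v, y))), ccont2_pair_id]. Qed.

Lemma ccont2_rB theta y v : ccont2 (fun y v => rB theta (v, y)) y v.
Proof.
  apply ccont2_plus; [apply ccont2_const|]; apply ccont2_mult; [apply ccont2_const|apply (ccont2_Cexp (fun y v => (v, y))), ccont2_pair_id].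
Qed.

Lemma ccont2_rE y v : ccont2 (fun y v => Cexp (/ 2 * (v, y))) y v.
Proof. apply ccont2_Cexp, ccont2_mult; [apply ccont2_const|apply ccont2_pair_id]. Qed.

Lemma ccont2_rF mu theta y v : (0 < rg theta y v)%R -> ccont2 (fun y v => rF mu theta (v, y)) y v.
Proof.
  intros H; apply rg_min in H; apply ccont2_mult; [apply ccont2_rE|].
  apply ccont2_mult; apply ccont2_pw; try apply ccont2_rA; try apply ccont2_rB; apply H.
Qed.

Lemma rg_strip theta y v : (0 < theta < PI / 2)%R -> (0 <= y <= PI / 2)%R -> (0 < rg theta y v)%R.
Proof. intros Ht Hy; apply rg_min; split; [now apply rA_pos|now apply rB_pos]. Qed.

Lemma rF_wgood mu theta y : (Re mu < 0)%R -> (0 < theta < PI / 2)%R ->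
  (0 <= y <= PI / 2)%R -> wgood (fun v => rF mu theta (v, y)).
Proof.
  intros Hmu Ht Hy; split.
  - intros v; apply (ccont2_slice (fun y v => rF mu theta (v, y))), ccont2_rF, rg_strip; trivial.
  - destruct (rF_bound mu theta Hmu Ht) as [K [d [Hd B]]]; exists K, d; split; trivial; intros; now apply B.
Qed.

Lemma symmetric_limit g : wgood g -> clim (fun T => CRInt g (- T) T) (WI g).
Proof.
  intros H; destruct (primitive_limits g H) as [L1 L2].
  replace (WI g) with (HInt g + - - HInt (fun t => g (- t)%R)) by (rewrite WI_split by trivial; ring).
  apply (clim_ext (fun T => CRInt g 0 T + - CRInt g 0 (- T))).
  - intros T HT; symmetry; apply (CRInt_derive (fun v => CRInt g 0 v)); intros; split; [apply primitive|]; apply H.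
  - apply clim_plus; trivial; now apply clim_opp.
Qed.

(** Cauchy's theorem on the rectangles from [- T] to [T], whose vertical sides contribute nothing in the limit. *)
Lemma rotation mu theta : (Re mu < 0)%R -> (0 < theta < PI / 2)%R ->
  WI (fun v => rF mu theta (v, (PI / 2)%R)) = WI (fun v => rF mu theta (v, 0%R)).
Proof.
  intros Hmu Ht; pose proof PI_RGT_0 as PP.
  pose (E' := fun w : C => / 2 * Cexp (/ 2 * w)).
  pose (A' := fun w : C => - / 2 * pw (- / 2 - 1) (rA w) * Cexp w).
  pose (B' := fun w : C => mu * pw (mu - 1) (rB theta w) * (- (Ci * RtoC (sin theta)) * Cexp w)).
  pose (F' := fun w => E' w * (pw (- / 2) (rA w) * pw mu (rB theta w)) + Cexp (/ 2 * w) * (A' w * pw mu (rB theta w) + pw (- / 2) (rA w) * B' w)).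
  assert (Rect : forall T, (0 < T)%R -> CRInt (fun v => rF mu theta (v, (PI / 2)%R)) (- T) T - CRInt (fun v => rF mu theta (v, 0%R)) (- T) T =
    Ci * (CRInt (fun y => rF mu theta (T, y)) 0 (PI / 2) - CRInt (fun y => rF mu theta ((- T)%R, y)) 0 (PI / 2))).
  { intros T HT; apply (rectangle (rg theta) (rF mu theta) F'); try lra.
    - apply rg_cont.
    - intros; now apply rg_strip.
    - intros y v H; apply rg_min in H; destruct H as [HA HB].
      apply (hol_mult (fun w => Cexp (/ 2 * w)) (fun w => pw (- / 2) (rA w) * pw mu (rB theta w))); [|apply (hol_mult (fun w => pw (- / 2) (rA w)) (fun w => pw mu (rB theta w)))].
      + eapply hol_eq; [apply (hol_comp Cexp (fun w => / 2 * w)); [apply hol_Cexp|apply hol_scal, hol_id]|unfold E'; ring].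
      + eapply hol_eq; [apply (hol_comp (pw (- / 2)) rA); [now apply hol_pw|apply hol_plus; [apply hol_const|apply hol_Cexp]]|unfold A'; ring].
      + eapply hol_eq; [apply (hol_comp (pw mu) (rB theta)); [now apply hol_pw|apply hol_plus; [apply hol_const|apply hol_scal, hol_Cexp]]|unfold B'; ring].
    - intros y v H; apply rg_min in H; destruct H as [HA HB].
      assert (PA : forall a, ccont2 (fun y v => pw a (rA (v, y))) y v) by (intros; apply ccont2_pw; [apply ccont2_rA|exact HA]).
      assert (PB : forall a, ccont2 (fun y v => pw a (rB theta (v, y))) y v) by (intros; apply ccont2_pw; [apply ccont2_rB|exact HB]).
      assert (CE : ccont2 (fun y v => Cexp (v, y)) y v) by (apply (ccont2_Cexp (fun y v => (v, y))), ccont2_pair_id).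
      unfold F', E', A', B'; apply ccont2_plus; apply ccont2_mult.
      + apply ccont2_mult; [apply ccont2_const|apply ccont2_rE].
      + apply ccont2_mult; [apply PA|apply PB].
      + apply ccont2_rE.
      + apply ccont2_plus; apply ccont2_mult.
        * apply ccont2_mult; [|exact CE]; apply ccont2_mult; [apply ccont2_const|apply PA].
        * apply PB.
        * apply PA.
        * apply ccont2_mult; [apply ccont2_mult; [apply ccont2_const|apply PB]|].
          apply ccont2_mult; [apply ccont2_const|exact CE]. }
  assert (S1 := symmetric_limit _ (rF_wgood mu theta (PI / 2) Hmu Ht ltac:(lra))).
  assert (S0 := symmetric_limit _ (rF_wgood mu theta 0 Hmu Ht ltac:(lra))).
  destruct (rF_bound mu theta Hmu Ht) as [K [d [Hd B]]].
  assert (Side : forall s, (s = 1 \/ s = -1)%R -> clim (fun T => CRInt (fun y => rF mu theta ((s * T)%R, y)) 0 (PI / 2)) 0).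
  { intros s Hs; apply (clim_exp_dominated _ _ (2 * (PI / 2 * K)) d Hd); intros T HT.
    replace (_ - 0) with (CRInt (fun y => rF mu theta ((s * T)%R, y)) 0 (PI / 2)) by ring.
    eapply Rle_trans; [apply CRInt_bound with (B := (K * exp (- d * T))%R); [lra| |]|right; ring].
    - intros y Hy; apply (ccont2_slice1 (fun y v => rF mu theta (v, y))), ccont2_rF, rg_strip; trivial.
    - intros y Hy; eapply Rle_trans; [apply B, Hy|].
      replace (Rabs (s * T)) with T; [lra|]; rewrite Rabs_mult, (Rabs_pos_eq T) by lra.
      destruct Hs as [-> | ->]; [rewrite Rabs_R1; ring|rewrite Rabs_left by lra; ring]. }
  assert (L1 := clim_plus _ _ _ _ S1 (clim_opp _ _ S0)).
  assert (L2 : clim (fun T => CRInt (fun v => rF mu theta (v, (PI / 2)%R)) (- T) T + - CRInt (fun v => rF mu theta (v, 0%R)) (- T) T) (Ci * (0 + - 0))).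
  { apply (clim_ext (fun T => Ci * (CRInt (fun y => rF mu theta ((1 * T)%R, y)) 0 (PI / 2) + - CRInt (fun y => rF mu theta ((-1 * T)%R, y)) 0 (PI / 2)))).
    - intros T HT; rewrite Rmult_1_l; replace (-1 * T)%R with (- T)%R by ring; symmetry; now apply Rect.
    - apply clim_scal, clim_plus; [|apply clim_opp]; apply Side; [now left|now right]. }
  pose proof (clim_unique _ _ _ L1 L2) as E.
  transitivity ((WI (fun v => rF mu theta (v, (PI / 2)%R)) + - WI (fun v => rF mu theta (v, 0%R))) + WI (fun v => rF mu theta (v, 0%R))); [ring|rewrite E; ring].
Qed.

(** The substitution [cosh t = 1 + exp v]. *)
Definition ct (v : R) : R := (2 * arcsinh (exp (v / 2) / sqrt 2))%R.

Lemma ct_cosh v : cosh (ct v) = (1 + exp v)%R.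
Proof.
  unfold ct; set (x := (exp (v / 2) / sqrt 2)%R).
  assert (S2 : (sqrt 2 * sqrt 2 = 2)%R) by (apply sqrt_sqrt; lra).
  assert (P2 : (0 < sqrt 2)%R) by (apply sqrt_lt_R0; lra).
  assert (X2 : (x * x = exp v / 2)%R).
  { unfold x; replace (exp v) with (exp (v / 2) * exp (v / 2))%R by (rewrite <- exp_plus; f_equal; field).
    apply Rmult_eq_reg_r with 2%R; [|lra].
    transitivity (exp (v / 2) * exp (v / 2) * 2 / (sqrt 2 * sqrt 2))%R; [field; lra|rewrite S2; field]. }
  pose proof (cosh_half (2 * arcsinh x)) as H; replace (2 * arcsinh x / 2)%R with (arcsinh x) in H by field.
  pose proof (cosh_sinh_sqr (arcsinh x)) as H'; rewrite sinh_arcsinh, X2 in H'; lra.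
Qed.

Lemma ct_derive v : is_derive ct v (exp (v / 2) * exp (- / 2 * ln (2 + exp v)))%R.
Proof.
  unfold ct.
  assert (S2 : (sqrt 2 * sqrt 2 = 2)%R) by (apply sqrt_sqrt; lra).
  assert (P2 : (0 < sqrt 2)%R) by (apply sqrt_lt_R0; lra).
  pose proof (exp_pos v) as Ev.
  eapply is_derive_eq.
  - apply @is_derive_scal, (is_derive_Rcomp arcsinh (fun v => exp (v / 2) / sqrt 2)%R).
    + apply is_derive_Reals, derivable_pt_lim_arcsinh.
    + instantiate (1 := (exp (v / 2) / (2 * sqrt 2))%R); auto_derive; trivial.
      replace (v * / 2)%R with (v / 2)%R by reflexivity; field; lra.
  - replace ((exp (v / 2) / sqrt 2) ^ 2 + 1)%R with ((2 + exp v) * / 2)%R.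
    2:{ replace (exp v) with (exp (v / 2) * exp (v / 2))%R by (rewrite <- exp_plus; f_equal; field).
        transitivity (exp (v / 2) * exp (v / 2) / (sqrt 2 * sqrt 2) + 1)%R; [rewrite S2; field|field; lra]. }
    rewrite sqrt_mult_alt, sqrt_inv by lra.
    replace (- / 2 * ln (2 + exp v))%R with (- (/ 2 * ln (2 + exp v)))%R by ring; rewrite exp_Ropp.
    fold (Rpower (2 + exp v) (/ 2)); rewrite Rpower_sqrt by lra.
    assert (0 < sqrt (2 + exp v))%R by (apply sqrt_lt_R0; lra).
    replace (2 * (exp (v / 2) / (2 * sqrt 2) * / (sqrt (2 + exp v) * / sqrt 2)))%R with (exp (v / 2) / sqrt (2 + exp v))%R; [reflexivity|].
    field; lra.
Qed.

Lemma ct_lower v : (v - ln 2 <= ct v)%R.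
Proof.
  unfold ct; set (x := (exp (v / 2) / sqrt 2)%R).
  assert (P2 : (0 < sqrt 2)%R) by (apply sqrt_lt_R0; lra).
  assert (X0 : (0 < x)%R) by (apply Rdiv_lt_0_compat; [apply exp_pos|trivial]).
  assert (H : (ln x <= arcsinh x)%R).
  { unfold arcsinh; apply ln_le; trivial; pose proof (sqrt_pos (x ^ 2 + 1)); lra. }
  assert (E : (2 * ln x = v - ln 2)%R); [|lra].
  unfold x; rewrite ln_div, ln_exp by (trivial; apply exp_pos).
  assert (L2 : (ln 2 = ln (sqrt 2) + ln (sqrt 2))%R) by (rewrite <- ln_mult, sqrt_sqrt; trivial; lra).
  rewrite L2; field.
Qed.

Lemma ct_upper v : (0 < ct v <= 2 * exp (v / 2))%R.
Proof.
  unfold ct; set (x := (exp (v / 2) / sqrt 2)%R).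
  assert (P2 : (1 < sqrt 2)%R) by (rewrite <- sqrt_1; apply sqrt_lt_1_alt; lra).
  pose proof (exp_pos (v / 2)) as Ev.
  assert (X0 : (0 < x)%R) by (apply Rdiv_lt_0_compat; lra).
  assert (X1 : (x <= exp (v / 2))%R).
  { unfold x; apply Rmult_le_reg_r with (sqrt 2); [lra|]; unfold Rdiv; rewrite Rmult_assoc, Rinv_l by lra; nra. }
  assert (H0 : (0 < arcsinh x)%R) by (rewrite <- arcsinh_0; now apply arcsinh_lt).
  assert (H : (arcsinh x <= x)%R); [|lra].
  unfold arcsinh; rewrite <- (ln_exp x) at 3; apply ln_le.
  - pose proof (sqrt_pos (x ^ 2 + 1)); lra.
  - pose proof (exp_quad x ltac:(lra)).
    assert (sqrt (x ^ 2 + 1) <= 1 + x * x / 2)%R; [|lra].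
    rewrite <- (sqrt_square (1 + x * x / 2)) by nra; apply sqrt_le_1_alt; nra.
Qed.

(** The substitution [t = ct v]; at the lower end [ct v] tends to 0 by [ct_upper]. *)
Lemma Qc_rotated mu theta : (Re mu < 0)%R -> (0 < theta < PI / 2)%R ->
  Qc mu (0, - theta)%R = WI (fun v => rF mu theta (v, 0%R)).
Proof.
  intros Hmu Ht; assert (HR : Reg (0, - theta)%R) by (apply Reg_i; rewrite Rabs_Ropp, Rabs_pos_eq; lra).
  destruct (kernels_good mu _ Hmu HR) as [G _].
  set (k := k0 mu (0, - theta)%R) in *.
  rewrite (WI_derive (fun v => CRInt k 0 (ct v)) _ (Qc mu (0, - theta)%R) 0).
  - ring.
  - intros v; eapply cder_eq.
    + apply (cder_comp (fun t => CRInt k 0 t) ct v (k (ct v)) (exp (v / 2) * exp (- / 2 * ln (2 + exp v)))%R).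
      * apply primitive, G.
      * apply ct_derive.
    + unfold rF, k, k0; rewrite RtoC_mult, Cmult_assoc; f_equal; [f_equal|f_equal].
      * rewrite <- Cexp_RtoC; f_equal; apply C_ext; simpl; field.
      * unfold pw; replace (rA (v, 0%R)) with (RtoC (2 + exp v)).
        -- rewrite Clr_RtoC by (pose proof (exp_pos v); lra); rewrite <- Cexp_RtoC; f_equal; apply C_ext; simpl; field.
        -- rewrite rA_eq, cos_0, sin_0; apply C_ext; simpl; ring.
      * rewrite rB_eq, cos_0, sin_0; unfold kA; rewrite ct_cosh, Ccosh_i, Csinh_i, cos_neg, sin_neg; apply C_ext; simpl; ring.
  - apply rF_wgood; trivial; pose proof PI_RGT_0; lra.
  - destruct (HInt_lim k G) as [L1 L2].
    assert (Lc : is_lim ct p_infty p_infty).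
    { apply (is_lim_le_p_loc (fun v => v - ln 2)%R).
      - exists 0%R; intros; apply ct_lower.
      - apply (is_lim_minus (fun v => v) (fun _ => ln 2) p_infty p_infty (ln 2) p_infty); [apply is_lim_id|apply is_lim_const|reflexivity]. }
    split; simpl.
    + apply (is_lim_comp (fun T => RInt (fun t => Re (k t)) 0 T) ct p_infty _ p_infty); trivial.
      exists 0%R; intros; discriminate.
    + apply (is_lim_comp (fun T => RInt (fun t => Im (k t)) 0 T) ct p_infty _ p_infty); trivial.
      exists 0%R; intros; discriminate.
  - destruct G as [Gc [M [d [Hd B]]]].
    pose proof (bound_nonneg _ _ _ B) as HM.
    apply (clim_exp_dominated _ _ (4 * M) (/ 2)); [lra|]; intros T HT.
    replace (CRInt k 0 (ct (- T)) - 0) with (CRInt k 0 (ct (- T))) by ring.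
    destruct (ct_upper (- T)) as [C1 C2].
    eapply Rle_trans; [apply CRInt_bound with (B := M)|].
    + lra.
    + intros; apply Gc.
    + intros t Htt; eapply Rle_trans; [apply B; lra|].
      rewrite <- (Rmult_1_r M) at 2; apply Rmult_le_compat_l; trivial; rewrite <- exp_0; apply exp_mono; nra.
    + rewrite Rminus_0_r; replace (- / 2 * T)%R with (- T / 2)%R by field.
      assert (ct (- T) * M <= 2 * exp (- T / 2) * M)%R by (apply Rmult_le_compat_r; trivial); lra.
Qed.

(** Two branches have to be matched: the argument of [x ^ 2 - 2 i x] is the sum - pi/2 plus that of [2 + i x],
    which lies in (- pi/2, 0), and the base of the power is [exp (- i theta)] times [1 + beta x], all three numbers being in
    the right half-plane. *)
Lemma psi_integrand_rotated mu theta nu v : (0 < theta < PI / 2)%R -> mu = - nu - 1 ->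
  psi_integrand nu theta (exp v) * RtoC (exp v) =
  Cexp (- (Ci * (nu + 1) * RtoC theta)) * rF mu theta (v, (PI / 2)%R).
Proof.
  intros Ht Em; pose proof (exp_pos v) as Ev; set (x := exp v) in *.
  pose proof PI_RGT_0 as PP; pose proof (sin_theta_pos theta Ht) as St; pose proof (cos_theta_pos theta Ht) as Ct.
  assert (A : rA (v, (PI / 2)%R) = (2, x)%R) by (rewrite rA_eq, cos_PI2, sin_PI2; fold x; apply C_ext; simpl; ring).
  (* L is the principal logarithm of x^2 - 2 i x = x (- i) (2 + i x) *)
  set (L := RtoC v - Ci * RtoC (PI / 2) + Clr (2, x)%R).
  assert (EL : Cexp L = RtoC x * RtoC x - 2 * Ci * RtoC x).
  { unfold L; rewrite Cexp_add, Cexp_Clr by (simpl; lra); unfold Cminus at 1; rewrite Cexp_add, Cexp_mi, cos_PI2, sin_PI2, Cexp_RtoC.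
    fold x; apply C_ext; simpl; ring. }
  assert (HL : (Rabs (Im L) < PI)%R).
  { pose proof (Clr_Im (2, x)%R) as B; apply Rabs_def2 in B.
    replace (Im L) with (- (PI / 2) + Im (Clr (2, x)%R))%R by (unfold L; simpl; field).
    assert (0 < Im (Clr (2, x)%R))%R.
    { simpl; rewrite <- atan_0; apply atan_increasing, Rdiv_lt_0_compat; lra. }
    apply Rabs_def1; lra. }
  assert (Sq : Csqrt (RtoC x * RtoC x - 2 * Ci * RtoC x) = Cexp (L / 2)).
  { rewrite <- EL; unfold Csqrt; pose proof (Clog_Cexp L HL) as CL.
    apply (f_equal Im) in CL; simpl in CL; rewrite CL, Cmod_Cexp.
    replace (sqrt (exp (Re L))) with (exp (Re L / 2)).
    - rewrite <- Cexp_RtoC, <- Cexp_add; f_equal; apply C_ext; simpl; unfold Re, Im; field.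
    - replace (exp (Re L)) with (exp (Re L / 2) * exp (Re L / 2))%R by (rewrite <- exp_plus; f_equal; field).
      symmetry; apply sqrt_square; left; apply exp_pos. }
  assert (B1 : legendre_beta theta = ((sin theta * cos theta)%R, (sin theta * sin theta)%R)).
  { unfold legendre_beta; rewrite Cexp_i; apply C_ext; simpl; ring. }
  set (z := 1 + legendre_beta theta * RtoC x).
  assert (Hz : (0 < Re z)%R).
  { unfold z; rewrite B1; simpl.
    assert (0 < sin theta * cos theta * x)%R by (repeat apply Rmult_lt_0_compat; lra); lra. }
  assert (EB : rB theta (v, (PI / 2)%R) = Cexp (- (Ci * RtoC theta)) * z).
  { rewrite rB_eq, cos_PI2, sin_PI2, Cexp_mi; unfold z; rewrite B1; fold x.
    pose proof (sin2_cos2 theta) as S; unfold Rsqr in S; apply C_ext; simpl.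
    - transitivity (cos theta + sin theta * x * (sin theta * sin theta + cos theta * cos theta))%R; [rewrite S; ring|ring].
    - ring. }
  assert (EBp : pw mu (rB theta (v, (PI / 2)%R)) = Cexp (mu * - (Ci * RtoC theta)) * pw mu z).
  { rewrite EB, pw_mult; trivial.
    - rewrite pw_Cexp; trivial; simpl.
      replace (- (0 * 0 + 1 * theta))%R with (- theta)%R by ring; rewrite Rabs_Ropp, Rabs_pos_eq; lra.
    - rewrite Cexp_mi; exact Ct.
    - rewrite <- EB; apply rB_pos; trivial; lra. }
  assert (Ip : 1 / (Cexp (L / 2) * pw (nu + 1) z) * Cexp (RtoC v) = Cexp (RtoC v - L / 2) * pw mu z).
  { assert (I1 : Cexp (L / 2) * Cexp (- (L / 2)) = 1) by apply Cexp_opp_r.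
    assert (I2 : pw (nu + 1) z * pw mu z = 1).
    { rewrite <- pw_add, Em; unfold pw; replace ((nu + 1 + (- nu - 1)) * Clr z) with (RtoC 0) by ring; apply Cexp_0. }
    unfold Cminus at 1; rewrite Cexp_add.
    pose proof (Cexp_neq_0 (L / 2)) as N1.
    assert (N2 : pw (nu + 1) z <> 0) by apply Cexp_neq_0.
    transitivity (Cexp (RtoC v) * (Cexp (L / 2) * Cexp (- (L / 2))) * (pw (nu + 1) z * pw mu z) / (Cexp (L / 2) * pw (nu + 1) z)).
    - rewrite I1, I2; field; split; trivial.
    - field; split; trivial. }
  unfold psi_integrand; fold z; rewrite Sq, Cpower_pw by trivial.
  unfold x at 1; rewrite <- Cexp_RtoC, Ip; unfold rF; rewrite EBp, A.
  transitivity (Cexp (- (Ci * (nu + 1) * RtoC theta)) * Cexp (mu * - (Ci * RtoC theta)) * (Cexp (/ 2 * (v, (PI / 2)%R)) * pw (- / 2) (2, x)%R) * pw mu z); [|ring].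
  change (pw (- / 2) (2, x)%R) with (Cexp (- / 2 * Clr (2, x)%R)); rewrite <- !Cexp_add; f_equal; f_equal; rewrite Em; unfold L.
  replace ((v, (PI / 2)%R) : C) with (RtoC v + Ci * RtoC (PI / 2)) by (apply C_ext; simpl; ring).
  field; apply two_nz.
Qed.

Lemma psi_integral mu theta nu : (Re mu < 0)%R -> (0 < theta < PI / 2)%R -> mu = - nu - 1 ->
  ex_CInt_0_infty (psi_integrand nu theta) /\
  CInt_0_infty (psi_integrand nu theta) = Cexp (- (Ci * (nu + 1) * RtoC theta)) * Qc mu (0, - theta)%R.
Proof.
  intros Hmu Ht Em; pose proof PI_RGT_0.
  assert (G : wgood (fun v => rF mu theta (v, (PI / 2)%R))) by (apply rF_wgood; trivial; lra).
  destruct (CInt_exp (psi_integrand nu theta) (fun v => Cexp (- (Ci * (nu + 1) * RtoC theta)) * rF mu theta (v, (PI / 2)%R))) as [E V].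
  - now apply wgood_scal.
  - intros v; now apply psi_integrand_rotated.
  - split; trivial; rewrite V, WI_scal, Qc_rotated, rotation by trivial; reflexivity.
Qed.

Theorem mainTheorem1 (nu : C) (theta : R) (P Q : C -> C)
    (hnu : (-1 < Re nu)%R) (htheta : (0 < theta < PI / 2)%R)
    (hP : is_LegendreP nu P) (hQ : is_LegendreQ nu Q) :
  ex_CInt_0_infty (psi_integrand nu theta) /\
  legendre_psi P Q theta =
    - RtoC (2 / PI) * Ci * Cexp (Ci * (nu + 1) * RtoC theta)
      * CInt_0_infty (psi_integrand nu theta).
Proof.
  set (mu := - nu - 1).
  assert (Hmu : (Re mu < 0)%R) by (unfold mu; simpl; unfold Re in *; lra).
  destruct (psi_integral mu theta nu Hmu htheta eq_refl) as [E V].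
  split; [exact E|].
  rewrite V; unfold legendre_psi.
  rewrite (P_Laplace nu P theta), (LegendreQ_cut_value nu Q theta) by trivial; fold mu.
  pose proof (connection mu theta Hmu htheta) as C0.
  set (Qp := Qc mu (0, theta)%R) in *; set (Qm := Qc mu (0, - theta)%R) in *.
  assert (I2 : Ci * Ci = - (1)) by (apply C_ext; simpl; ring).
  assert (EL : Lap mu theta = - Ci * (Qm - Qp)).
  { rewrite C0; transitivity (- (Ci * Ci) * Lap mu theta); [rewrite I2; ring|ring]. }
  pose proof (Cexp_opp_r (Ci * (nu + 1) * RtoC theta)) as X.
  transitivity (- RtoC (2 / PI) * Ci * (Cexp (Ci * (nu + 1) * RtoC theta) * Cexp (- (Ci * (nu + 1) * RtoC theta))) * Qm); [|ring].
  rewrite X, EL, RtoC_div by apply PI_neq0.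
  field; apply PI_nz.
Qed.
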